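(* Let $N\ge 2$ and assume that $f$ satisfies either assumptions $(A1)$ or assumptions $(A2)$. Then there exists $k_0\in\mathbb N\cup\{0\}$ such that for every integer $k\ge k_0$ there exist at least $2M+1$ solutions with positive initial value $u(0)$, and at least $2|\bar M|-1$ solutions with negative initial value $u(0)$, of the problem $$u''+\frac{N-1}{r}u'+f(u)=0,\quad r>0,\qquad u'(0)=0,\quad \lim_{r\to\infty}u(r)=0,$$ having exactly $k$ sign changes in $(0,\infty)$.
   Context: Throughout, $N\ge 2$ is an integer, $'$ denotes $d/dr$, $F(s)=\int_0^s f(t)\,dt$, and a solution is a $C^1$ function $u$ of $r\ge 0$ such that $u'$ is also $C^1$. In case $(A2)$, $\gamma_*=\infty$. Assumptions $(A1)$ (finite case, $\gamma_*<\infty$): $(f_1)$ $f$ is a continuous function defined in $(\gamma_*^-,\gamma_*]$, $-\infty\le\gamma_*^-<0<\gamma_*$, $f(0)=0$, $f(\gamma_* )=0$, and $f$ is locally Lipschitz in $(\gamma_*^-,\gamma_*]\setminus\{0\}$. $(f_2)$ There exists $\delta>0$ such that $F(s)<0$ for all $0<|s|<\delta$; moreover $\lim_{s\to\gamma_*^-}F(s)=F(\gamma_* )$ and $F(s)<F(\gamma_* )$ for all $s\in(\gamma_*^-,\gamma_* )$. $(f_3)$ $F$ has a local maximum at some $\gamma\in(\delta,\gamma_* )$ with $F(\gamma)>0$. $(f_4)$ $f$ has a finite number of zeros in $(\gamma_*^-,-\delta)\cup(\delta,\gamma_* )$ and $f$ changes sign at these points. Assumptions $(A2)$ (infinite case,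 $\gamma_*=\infty$): $(f_1)$ $f$ is a continuous function defined in $(\gamma_*^-,\infty)$, $-\infty\le\gamma_*^-<0$, $f(0)=0$, and $f$ is locally Lipschitz in $(\gamma_*^-,\infty)\setminus\{0\}$. $(f_2)$ There exists $\delta>0$ such that $F(s)<0$ for all $0<|s|<\delta$, and $F(s)<\lim_{s\to\infty}F(s)=\lim_{s\to\gamma_*^-}F(s)$ for all $s$. $(f_3)$ $F$ has a local maximum at some $\gamma\in(\delta,\infty)$ with $F(\gamma)>0$. $(f_4)$ $f$ has a finite number of zeros in $(\gamma_*^-,-\delta)\cup(\delta,\infty)$ and $f$ changes sign at these points. $(f_5)$ With $Q(s):=2NF(s)-(N-2)sf(s)$: there exists $s_0\in(\gamma_*^-,0)$ such that $Q(s)>0$ for all $s\in(\gamma_*^-,s_0)$, and there exists $\theta\in(0,1)$ such that $$\lim_{s\to\infty}\Bigl(\inf_{s_1,s_2\in[\theta s,s]}Q(s_2)\Bigl(\frac{s}{f(s_1)}\Bigr)^{N/2}\Bigr)=\infty.$$ The integers $M\ge1$ and $\bar M\le 0$: $\gamma_0=0$; $\gamma_1$ is the first positive local maximum point of $F$ with $F(\gamma_1)>0$; for $i\in\mathbb N$, $\gamma_{i+1}$ is the first local maximum point of $F$ in $(\gamma_i,\gamma_* )$ such that $F(\gamma_i)<F(\gamma_{i+1})$; the last one is $\gamma_M$. Similarly, $\gamma_{-1}$ is the first (closest to $0$) negative local maximum point of $F$ (if any) with $F(\gamma_{-1})>0$; for $i\le-1$, $\gamma_{i-1}$ is the first local maximum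 point of $F$ to the left of $\gamma_i$ such that $F(\gamma_i)<F(\gamma_{i-1})$; the last one is $\gamma_{\bar M}$. If $F$ has no negative local maximum point with $F>0$, then $\bar M=0$. *)

(* Defs.v *)
From Stdlib Require Export Reals ZArith List.
From Coquelicot Require Export Coquelicot.
Open Scope R_scope.

(* The nonlinearity is a total function [f : R -> R] of which only the values on
   its domain (gm, gp] matter.  When [gp = p_infty] this set is (gm, oo). *)
Definition dom (gm gp : Rbar) (s : R) : Prop := Rbar_lt gm s /\ Rbar_le s gp.

Definition primitive (f : R -> R) (s : R) : R := RInt f 0 s.

Definition locally_lipschitz_on (D : R -> Prop) (f : R -> R) : Prop :=
  forall x, D x -> exists L eps : R, 0 < eps /\
    forall y z, D y -> D z -> Rabs (y - x) < eps -> Rabs (z - x) < eps ->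
      Rabs (f y - f z) <= L * Rabs (y - z).

(* Only used at interior points of the domain of [F]. *)
Definition local_max (F : R -> R) (x : R) : Prop :=
  locally x (fun y => F y <= F x).

Definition changes_sign_at (g : R -> R) (x : R) : Prop :=
  (at_left x (fun y => g y < 0) /\ at_right x (fun y => 0 < g y)) \/
  (at_left x (fun y => 0 < g y) /\ at_right x (fun y => g y < 0)).

(* The filter "s -> gm with s > gm": the right-hand neighbourhoods of a finite
   [gm], the neighbourhoods of -oo when [gm = m_infty]. *)
Definition from_above (gm : Rbar) : (R -> Prop) -> Prop :=
  within (fun s : R => Rbar_lt gm s) (Rbar_locally gm).

Definition outer (gm gp : Rbar) (delta s : R) : Prop :=
  (Rbar_lt gm s /\ s < - delta) \/ (delta < s /\ Rbar_lt s gp).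

Definition cond_f3 (gp : Rbar) (f : R -> R) (delta : R) : Prop :=
  exists g : R, delta < g /\ Rbar_lt g gp /\
    local_max (primitive f) g /\ 0 < primitive f g.

Definition cond_f4 (gm gp : Rbar) (f : R -> R) (delta : R) : Prop :=
  (exists l : list R, forall s, outer gm gp delta s -> f s = 0 -> In s l) /\
  (forall s, outer gm gp delta s -> f s = 0 -> changes_sign_at f s).

Definition assumptionsA1 (gm : Rbar) (gs : R) (f : R -> R) : Prop :=
  let F := primitive f in
  (Rbar_lt gm 0 /\ 0 < gs /\
   continuous_on (dom gm gs) f /\ f 0 = 0 /\ f gs = 0 /\
   locally_lipschitz_on (fun s => dom gm gs s /\ s <> 0) f) /\
  exists delta : R,
    (0 < delta /\ (forall s, 0 < Rabs s < delta -> F s < 0) /\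
     filterlim F (from_above gm) (locally (F gs)) /\
     (forall s : R, Rbar_lt gm s -> s < gs -> F s < F gs)) /\
    cond_f3 gs f delta /\
    cond_f4 gm gs f delta.

Definition Qfun (N : nat) (f : R -> R) (s : R) : R :=
  2 * INR N * primitive f s - (INR N - 2) * s * f s.

(* Under the other conditions of [assumptionsA2], [f] is positive near +oo, so
   that the base of [Rpower] is positive and the infimum is that of a continuous
   function on a nonempty compact set, as soon as [s] is large. *)
Definition cond_f5 (N : nat) (gm : Rbar) (f : R -> R) : Prop :=
  let Q := Qfun N f in
  (exists s0 : R, Rbar_lt gm s0 /\ s0 < 0 /\
     forall s : R, Rbar_lt gm s -> s < s0 -> 0 < Q s) /\
  (exists theta : R, 0 < theta < 1 /\
     is_lim
       (fun s => real (Glb_Rbar (fun y => exists s1 s2 : R,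
          theta * s <= s1 <= s /\ theta * s <= s2 <= s /\
          y = Q s2 * Rpower (s / f s1) (INR N / 2))))
       p_infty p_infty).

Definition assumptionsA2 (N : nat) (gm : Rbar) (f : R -> R) : Prop :=
  let F := primitive f in
  (Rbar_lt gm 0 /\
   continuous_on (dom gm p_infty) f /\ f 0 = 0 /\
   locally_lipschitz_on (fun s => dom gm p_infty s /\ s <> 0) f) /\
  (exists delta : R,
    (* The common limit [L] may be +oo. *)
    (0 < delta /\ (forall s, 0 < Rabs s < delta -> F s < 0) /\
     exists L : Rbar,
       is_lim F p_infty L /\
       filterlim F (from_above gm) (Rbar_locally L) /\
       (forall s : R, Rbar_lt gm s -> Rbar_lt (F s) L)) /\
    cond_f3 p_infty f delta /\
    cond_f4 gm p_infty f delta) /\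
  cond_f5 N gm f.

(* [b] is the first local maximum point of [F] in (a, gp) with F a < F b. *)
Definition next_right (F : R -> R) (gp : Rbar) (a b : R) : Prop :=
  a < b /\ Rbar_lt b gp /\ local_max F b /\ F a < F b /\
  (forall c, a < c < b -> local_max F c -> ~ F a < F c).

(* Mirror image: [b] is the closest such point to the left of [a]. *)
Definition next_left (F : R -> R) (gm : Rbar) (a b : R) : Prop :=
  b < a /\ Rbar_lt gm b /\ local_max F b /\ F a < F b /\
  (forall c, b < c < a -> local_max F c -> ~ F a < F c).

(* [gamma i] for Mbar <= i <= M are the points gamma_i, and [M], [Mbar] are the
   last indices.  As F 0 = 0 and gamma 0 = 0, the case i = 0 of the recursion says
   that gamma 1 (resp. gamma (-1)) is the first positive (resp. negative) local
   maximum point at which F is positive.  Values of [gamma] outside of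
   [Mbar, M] are irrelevant. *)
Definition gamma_points (gm gp : Rbar) (f : R -> R)
    (gamma : Z -> R) (M Mbar : Z) : Prop :=
  let F := primitive f in
  gamma 0%Z = 0 /\
  (1 <= M)%Z /\
  (forall i : Z, (0 <= i < M)%Z ->
     next_right F gp (gamma i) (gamma (i + 1)%Z)) /\
  (forall b, ~ next_right F gp (gamma M) b) /\
  (Mbar <= 0)%Z /\
  (forall i : Z, (Mbar < i <= 0)%Z ->
     next_left F gm (gamma i) (gamma (i - 1)%Z)) /\
  (forall b, ~ next_left F gm (gamma Mbar) b).

(* [u] is C^1 on [0, oo) with derivative [v]; the derivative at 0 is one-sided
   ([is_derive] with the neighbourhood filter restricted to [0, oo)). *)
Definition C1_halfline (u v : R -> R) : Prop :=
  (forall r, 0 <= r ->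
     filterdiff u (within (Rle 0) (locally r)) (fun h => scal h (v r))) /\
  continuous_on (Rle 0) v.

(* Only the values u r for r >= 0 matter; they must lie where [f] is defined. *)
Definition is_solution (N : nat) (gm gp : Rbar) (f u : R -> R) : Prop :=
  (forall r, 0 <= r -> dom gm gp (u r)) /\
  (exists u' u'' : R -> R,
     C1_halfline u u' /\ C1_halfline u' u'' /\
     (forall r, 0 < r -> u'' r + (INR N - 1) / r * u' r + f (u r) = 0) /\
     u' 0 = 0) /\
  is_lim u p_infty 0.

Definition exactly_sign_changes (k : nat) (u : R -> R) : Prop :=
  exists l : list R, NoDup l /\ length l = k /\
    forall r, In r l <-> 0 < r /\ changes_sign_at u r.

(* At least [n] functions satisfy [P], distinct as functions on [0, oo); no
   content when n <= 0. *)
Definition at_least (n : Z) (P : (R -> R) -> Prop) : Prop :=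
  exists U : nat -> R -> R,
    (forall i, (Z.of_nat i < n)%Z -> P (U i)) /\
    (forall i j, (Z.of_nat i < n)%Z -> (Z.of_nat j < n)%Z -> i <> j ->
       exists r, 0 <= r /\ U i r <> U j r).

(* Main.v *)
Require Import Defs.
From Corelib Require Import ssreflect.
From Stdlib Require Import Lra Lia Psatz Classical ClassicalEpsilon Cantor FunctionalExtensionality.
From Stdlib Require FinFun.
Unset SsrRewrite. Open Scope general_if_scope.

(** A radial solution is the motion [u'' + (n/r) u' + f(u) = 0], [n = N - 1], of
    a particle in the potential [F], the primitive of [f]. Friction lowers the
    energy [u'^2/2 + F(u)] and fades as [r] grows. Made to stay at [(0,0)] once it
    gets there ([normal_sol]), the solution is determined by its initial height.

    Let [I] be [(0, gamma_1)], or an interval between consecutive maxima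
    [gamma_i], [gamma_(i+1)], or the interval above the last one. Two facts give,
    for each large [k], a height in [I] whose solution tends to [0] with [k] zeros.

    - From heights near the ends of [I] other than [0] solutions keep, until late
      times, an energy above a level [mu > 0]: near a [gamma_i], because it is a rest point
      ([critical_end]); near a finite upper end, because [f] vanishes and is
      Lipschitz there ([A1_upper_end]); near infinity, by Pohozaev's identity
      ([A2_upper_end]). With little friction left they oscillate many times in
      the well of [F] around [0] before they settle ([energetic_zeros]).

    - Some height in [I] has a solution with finitely many zeros. In
      [(0, gamma_1)] small heights will do, as they have negative energy. In the
      other intervals consider also solutions that start from rest at a time
      [rho > 0]. If [rho] is large the flow nearly preserves areas, backwards in
      time it even expands them ([area_escape]), so some solution comes from [I]
      with large [rho] and reaches negative energy ([late_start]). The earliest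
      arrival at the state that it reaches comes from time [0]: as long as
      [rho > 0], the start can be moved to an earlier one ([first_arrival]).

    Move the height from the second kind towards an end of [I]. At the last
    height [be] with at most [k] zeros ([sweep]) the solution is a bound state
    with exactly [k] zeros ([edge_bound_state]). Its energy stays nonnegative: a
    negative one would be shared by the neighbours and forbid their further zero.
    Hence, unless it reaches [(0,0)], it tends to a zero of [F] and of [f]
    ([settle]). The neighbours leave this limit for their further zero. If it were
    not [0], they would on their way cross a region where [F < 0], which costs a
    fixed amount of [r E(r)] ([crossing_cost]); between [0] and the wall of the
    well this amount is no longer there, and at the wall the neighbours would move
    too slowly ([no_limit_at_wall]). Near [0] so little of [r E(r)] is left that
    the neighbours have a single further zero ([few_zeros]).

    This makes one bound state in [(0, gamma_1)] and two, one on each side of the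
    height with few zeros, in each of the other intervals: [1 + 2 (M - 1) + 2] for
    positive heights. Negative heights are reflected, and there the last interval
    is not used: [1 + 2 (|Mbar| - 1)]. *)

Notation by_lra := ltac:(lra) (only parsing).

(** * Real-variable tools *)

Lemma real_induction (P : R -> Prop) (a : R) :
  (forall x, a <= x -> (forall y, a <= y < x -> P y) -> P x) ->
  (forall x, a <= x -> (forall y, a <= y <= x -> P y) ->
     exists e, 0 < e /\ forall y, x < y < x + e -> P y) ->
  forall x, a <= x -> P x.
Proof.
 intros Hl Hr x Hx. apply NNPP; intro Hn. set (E := fun t => a <= t /\ forall y, a <= y <= t -> P y). have Ha : E a.
 { split; [lra|]. intros y Hy. apply Hl; [lra|]. intros; lra. } have HEx : forall t, E t -> t < x.
 { intros t [Ht HP]. case: (Rlt_le_dec t x) => H; auto. exfalso; apply Hn, HP; lra. }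
 destruct (completeness E) as [s [Hs1 Hs2]]. { exists x. intros t Ht. apply Rlt_le; auto. } { exists a; auto. }
 have Has : a <= s by auto. have Hlt : forall y, a <= y < s -> P y.
 { intros y Hy. apply NNPP; intro HnP. assert (s <= y); [|lra]. apply Hs2. intros t [Ht HP].
  case: (Rle_lt_dec t y) => H; auto. exfalso; apply HnP, HP; lra. }
 have HPs : forall y, a <= y <= s -> P y.
 { intros y Hy. destruct (Rlt_le_dec y s); [apply Hlt; lra|]. replace y with s by lra. auto. }
 have [e [He HPe]] := Hr s Has HPs. assert (E (s + e / 2)).
 { split; [lra|]. intros y Hy. destruct (Rle_lt_dec y s); [apply HPs; lra|]. apply HPe; lra. }
 assert (s + e / 2 <= s) by auto. lra.
Qed.

Lemma continuous_continuity_pt (g : R -> R) x : continuous g x <-> continuity_pt g x.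
Proof. symmetry. apply continuity_pt_filterlim. Qed.

Lemma mean_value (g g' : R -> R) (a b : R) : a < b ->
  (forall x, a <= x <= b -> continuous g x) ->
  (forall x, a < x < b -> is_derive g x (g' x)) ->
  exists c, a < c < b /\ g b - g a = g' c * (b - a).
Proof.
 intros Hab Hc Hd. have pr1 : forall c, a < c < b -> derivable_pt g c.
 { intros c Hx. exists (g' c). apply is_derive_Reals; auto. } have pr2 : forall c, a < c < b -> derivable_pt id c.
 { intros; apply derivable_pt_id. } destruct (MVT g id a b pr1 pr2 Hab) as [c [Hx He]].
 { intros x Hx; apply continuous_continuity_pt; auto. } { intros x Hx; apply derivable_continuous_pt, derivable_pt_id. }
 exists c; split; auto.
 replace (derive_pt id c (pr2 c Hx)) with 1 in He by (symmetry; apply derive_pt_eq_0, derivable_pt_lim_id).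
 replace (derive_pt g c (pr1 c Hx)) with (g' c) in He by (symmetry; apply derive_pt_eq_0, is_derive_Reals; auto).
 unfold id in He. lra.
Qed.

Lemma deriv_ge_le (g g' : R -> R) (m a b : R) : a <= b ->
  (forall x, a <= x <= b -> continuous g x) ->
  (forall x, a < x < b -> is_derive g x (g' x) /\ m <= g' x) ->
  g a + m * (b - a) <= g b.
Proof.
 intros [Hab| ->] Hc Hd; [|lra]. destruct (mean_value g g' a b) as [c [Hx He]]; auto. { intros; apply Hd; auto. }
 assert (m <= g' c) by (apply Hd; auto). nra.
Qed.

Lemma nondecr_deriv (g g' : R -> R) (a b : R) : a <= b ->
  (forall x, a <= x <= b -> continuous g x) ->
  (forall x, a < x < b -> is_derive g x (g' x) /\ 0 <= g' x) ->
  g a <= g b.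
Proof. intros. have H2 := deriv_ge_le g g' 0 a b H H0 H1. lra. Qed.

Lemma nonincr_deriv (g g' : R -> R) (a b : R) : a <= b ->
  (forall x, a <= x <= b -> continuous g x) ->
  (forall x, a < x < b -> is_derive g x (g' x) /\ g' x <= 0) ->
  g b <= g a.
Proof.
 intros Hab Hc Hd. assert (- g a <= - g b); [|lra]. apply (nondecr_deriv (fun x => - g x) (fun x => - g' x)); auto.
 - intros x Hx. apply (continuous_opp g); auto.
 - intros x Hx. destruct (Hd x Hx). split; [|lra]. apply (is_derive_opp g); auto.
Qed.

Lemma gronwall (g g' : R -> R) (C a b : R) : a <= b ->
  (forall x, a <= x <= b -> continuous g x) ->
  (forall x, a < x < b -> is_derive g x (g' x) /\ g' x <= C * g x) ->
  g b <= g a * exp (C * (b - a)).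
Proof.
 intros Hab Hc Hd. have H : g b * exp (- C * b) <= g a * exp (- C * a).
 { apply (nonincr_deriv (fun x => g x * exp (- C * x)) (fun x => g' x * exp (- C * x) + g x * (- C * exp (- C * x)))); auto.
  - intros x Hx. apply (continuous_mult g); auto. apply (ex_derive_continuous (fun x => exp (- C * x))). auto_derive; auto.
  - intros x Hx. have [H1 H2] := Hd x Hx. split.
   + have H3 : is_derive (fun x => exp (- C * x)) x (- C * exp (- C * x)) by (auto_derive; auto; ring).
    apply (is_derive_mult g (fun x => exp (- C * x))); auto. intros; apply Rmult_comm.
   + assert (0 < exp (- C * x)) by apply exp_pos. nra. }
 replace (C * (b - a)) with (C * b + - C * a) by ring.
 rewrite exp_plus. have E : exp (- C * b) * exp (C * b) = 1.
 { rewrite <- exp_plus. replace (- C * b + C * b) with 0 by ring. apply exp_0. } assert (0 < exp (C * b)) by apply exp_pos.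
 replace (g b) with (g b * exp (- C * b) * exp (C * b)) by (rewrite Rmult_assoc, E; ring). nra.
Qed.

Lemma first_hit (g : R -> R) (a b y : R) : a <= b ->
  (forall x, a <= x <= b -> continuous g x) -> g a < y -> y <= g b ->
  exists t, a < t <= b /\ g t = y /\ forall s, a <= s < t -> g s < y.
Proof.
 intros Hab Hc Ha Hb. apply NNPP; intro Hn. have H : forall x, a <= x -> x <= b -> g x < y.
 { intros x Hx. pattern x. apply (real_induction _ a); auto; clear x Hx.
  - intros x Hx IH Hxb. destruct (total_order_T (g x) y) as [[H|H]|H]; auto.
   + exfalso; apply Hn; exists x. repeat split; auto.
    * destruct (Rle_lt_or_eq_dec a x Hx); auto. subst; lra.
    * intros s Hs; apply IH; lra.
   + have Hax : a < x by (destruct Hx; subst; lra). have Hcx := Hc x by_lra. destruct (Hcx (fun z => y < z)) as [e He].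
    { apply open_gt; auto. } assert (y < g (Rmax a (x - e / 2))).
    { apply He. unfold ball; simpl; unfold AbsRing_ball, minus, plus, opp; simpl. assert (0 < e) by apply cond_pos.
     unfold Rmax; destruct Rle_dec; apply Rabs_def1; lra. }
    assert (g (Rmax a (x - e / 2)) < y); [|lra].
    assert (0 < e) by apply cond_pos. apply IH; unfold Rmax; destruct Rle_dec; lra.
  - intros x Hx IH. have [Hxb|Hxb] := Rlt_le_dec x b.
   + have Hgx : g x < y by (apply IH; lra). have Hcx := Hc x by_lra. destruct (Hcx (fun z => z < y)) as [e He].
    { apply open_lt; auto. } exists e; split; [apply cond_pos|]. intros z Hz _. apply He.
    unfold ball; simpl; unfold AbsRing_ball, minus, plus, opp; simpl. apply Rabs_def1; lra.
   + exists 1; split; [lra|]. intros; lra. }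
 assert (g b < y) by (apply H; lra). lra.
Qed.

Lemma continuous_opp_arg (g : R -> R) x : continuous g (- x) -> continuous (fun t => g (- t)) x.
Proof. apply continuous_comp. apply (continuous_opp (fun t : R => t)), continuous_id. Qed.

Lemma last_hit (g : R -> R) (a b y : R) : a <= b ->
  (forall x, a <= x <= b -> continuous g x) -> g b < y -> y <= g a ->
  exists t, a <= t < b /\ g t = y /\ forall s, t < s <= b -> g s < y.
Proof.
 intros Hab Hc Hb Ha. destruct (first_hit (fun t => g (- t)) (- b) (- a) y) as [t [H1 [H2 H3]]]; try lra.
 - intros x Hx. apply continuous_opp_arg, Hc; lra.
 - rewrite Ropp_involutive; auto.
 - rewrite Ropp_involutive; auto.
 - exists (- t). repeat split; try lra. intros s Hs. rewrite <- (Ropp_involutive s). apply H3; lra.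
Qed.

Lemma ivt (g : R -> R) (a b y : R) : a <= b ->
  (forall x, a <= x <= b -> continuous g x) -> g a <= y <= g b ->
  exists c, a <= c <= b /\ g c = y.
Proof.
 intros Hab Hc [[H1|H1] H2].
 - destruct (first_hit g a b y) as [t [Ht [He _]]]; auto. exists t; split; lra.
 - exists a; split; lra.
Qed.

Lemma ivt_decr (g : R -> R) (a b y : R) : a <= b ->
  (forall x, a <= x <= b -> continuous g x) -> g b <= y <= g a ->
  exists c, a <= c <= b /\ g c = y.
Proof.
 intros Hab Hc H. destruct (ivt (fun x => - g x) a b (- y)) as [c [H1 H2]]; auto.
 - intros x Hx; apply (continuous_opp g); auto.
 - lra.
 - exists c; split; lra.
Qed.

Lemma continuous_eps (g : R -> R) (x e : R) : continuous g x -> 0 < e ->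
  exists d, 0 < d /\ forall y, Rabs (y - x) < d -> Rabs (g y - g x) < e.
Proof.
 intros Hc He. destruct (Hc (ball (g x) (mkposreal e He))) as [d Hd]. { apply locally_ball. }
 exists d; split; [apply cond_pos|]. auto.
Qed.

Lemma eps_continuous (g : R -> R) (x : R) :
  (forall e, 0 < e -> exists d, 0 < d /\ forall y, Rabs (y - x) < d -> Rabs (g y - g x) < e) ->
  continuous g x.
Proof. intros H P [e He]. have [d [Hd H1]] := H e (cond_pos e). exists (mkposreal d Hd). intros y Hy. apply He, H1; auto. Qed.

Lemma is_derive_eps (g : R -> R) (x l : R) :
  (forall e, 0 < e -> exists d, 0 < d /\ forall y, Rabs (y - x) < d ->
     Rabs (g y - g x - l * (y - x)) <= e * Rabs (y - x)) ->
  is_derive g x l.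
Proof.
 intros H. apply is_derive_Reals. intros e He. destruct (H (e / 2)) as [d [Hd H1]]; [lra|]. exists (mkposreal d Hd).
 intros h Hh Hhd. specialize (H1 (x + h)). replace (x + h - x) with h in H1 by ring. specialize (H1 Hhd).
 replace ((g (x + h) - g x) / h - l) with ((g (x + h) - g x - l * h) / h) by (field; auto). unfold Rdiv at 1.
 rewrite Rabs_mult, Rabs_inv. assert (0 < Rabs h) by (apply Rabs_pos_lt; auto). apply (Rmult_lt_reg_r (Rabs h)); auto.
 rewrite Rmult_assoc, Rinv_l by lra. nra.
Qed.

(** * Extraction of convergent subsequences *)

Definition increasing_map (phi : nat -> nat) : Prop := forall n, (phi n < phi (S n))%nat.

Lemma increasing_map_le phi : increasing_map phi -> forall n, (n <= phi n)%nat.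
Proof. intros H n; induction n; [lia|]. specialize (H n); lia. Qed.

Lemma increasing_map_mono phi : increasing_map phi ->
  forall m n, (m < n)%nat -> (phi m < phi n)%nat.
Proof. intros H m n Hmn. induction Hmn; auto. specialize (H m0); lia. Qed.

Lemma increasing_map_comp phi psi : increasing_map phi -> increasing_map psi ->
  increasing_map (fun n => phi (psi n)).
Proof. intros H1 H2 n. apply increasing_map_mono; auto. Qed.

Lemma bounded_subsequence (x : nat -> R) (B : R) : (forall n, Rabs (x n) <= B) ->
  exists phi, increasing_map phi /\ ex_finite_lim_seq (fun n => x (phi n)).
Proof.
 intros HB. destruct (Bolzano_Weierstrass x (fun c => - B <= c <= B)) as [l Hl]. { apply compact_P3. }
 { intro n. apply Rabs_le_between. auto. } have Hstep : forall k N, exists p, (N <= p)%nat /\ Rabs (x p - l) < / INR (S k).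
 { intros k N. have Hk : 0 < / INR (S k) by (apply Rinv_0_lt_compat, lt_0_INR; lia).
  destruct (Hl (fun y => Rabs (y - l) < / INR (S k)) N) as [p [Hp1 Hp2]].
  - exists (mkposreal _ Hk). easy.
  - exists p; auto. }
 set (step := fun k N => proj1_sig (constructive_indefinite_description _ (Hstep k N))).
 have Hs : forall k N, (N <= step k N)%nat /\ Rabs (x (step k N) - l) < / INR (S k). { intros k N. apply proj2_sig. }
 set (phi := fix phi k := match k with O => step O O | S k' => step k (S (phi k')) end). exists phi. split.
 - intros n. simpl. destruct (Hs (S n) (S (phi n))). lia.
 - exists l. apply is_lim_seq_Reals. intros e He. have [N [HN1 HN2]] := archimed_cor1 e He. exists N. intros n Hn.
  apply Rlt_trans with (/ INR N); auto. apply Rlt_le_trans with (/ INR (S n)).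
  + destruct n; simpl phi; apply Hs.
  + apply Rinv_le_contravar; [apply lt_0_INR; auto|]. apply le_INR. lia.
Qed.

(** The n-th term of the diagonal sequence is taken from the n-th of the nested
    subsequences; beyond rank k it runs inside the k-th one. *)
Lemma diagonal_subsequence (x : nat -> nat -> R) (B : nat -> R) :
  (forall k n, Rabs (x k n) <= B k) ->
  exists phi, increasing_map phi /\ forall k, ex_finite_lim_seq (fun n => x k (phi n)).
Proof.
 intros HB. have Hex : forall k psi, exists phi, increasing_map phi /\ ex_finite_lim_seq (fun n => x k (psi (phi n))).
 { intros k psi. apply (bounded_subsequence (fun n => x k (psi n)) (B k)); auto. }
 set (ext := fun k psi => proj1_sig (constructive_indefinite_description _ (Hex k psi))).
 have He : forall k psi, increasing_map (ext k psi) /\ ex_finite_lim_seq (fun n => x k (psi (ext k psi n))).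
 { intros k psi. apply proj2_sig. }
 set (nest := fix nest k := match k with O => ext O (fun n => n) | S k' => fun n => nest k' (ext k (nest k') n) end).
 have Hn : forall k, increasing_map (nest k) /\ ex_finite_lim_seq (fun n => x k (nest k n)).
 { induction k; simpl.
  - auto.
  - have [I1 I2] := IHk. have [E1 E2] := He (S k) (nest k). split; auto. apply increasing_map_comp; auto. }
 have Htail : forall j k, exists psi, increasing_map psi /\ forall n, nest (k + j)%nat n = nest k (psi n).
 { induction j; intros k.
  - exists (fun n => n). split; [intro; lia|]. rewrite Nat.add_0_r; auto.
  - have [psi [P1 P2]] := IHj k. exists (fun n => psi (ext (S (k + j)) (nest (k + j)%nat) n)). split.
   + apply increasing_map_comp; auto. apply He.
   + rewrite Nat.add_succ_r. simpl. auto. }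
 exists (fun n => nest n n). split.
 - intros n. have [E1 _] := He (S n) (nest n). apply Nat.lt_le_trans with (nest n (S n)); [apply Hn|]. simpl.
  have [E|E] := Nat.eq_dec (S n) (ext (S n) (nest n) (S n)).
  + rewrite <- E. lia.
  + apply Nat.lt_le_incl, increasing_map_mono; [apply Hn|]. have H := increasing_map_le _ E1 (S n). lia.
 - intros k. have [l Hl] := proj2 (Hn k). exists l. apply is_lim_seq_Reals. apply is_lim_seq_Reals in Hl. intros e Hepos.
  have [N HN] := Hl e Hepos. exists (max N k). intros n Hnn. have [psi [P1 P2]] := Htail (n - k)%nat k.
  replace (k + (n - k))%nat with n in P2 by lia. rewrite P2. apply HN. have H := increasing_map_le _ P1 n. lia.
Qed.

(** A countable dense subset of the line. *)
Definition dense_point (k : nat) : R :=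
  let (i, jl) := Cantor.of_nat k in let (j, l) := Cantor.of_nat jl in
  (INR i - INR j) / INR (S l).

Lemma dense_point_near (t e : R) : 0 < e -> exists k, Rabs (dense_point k - t) < e.
Proof.
 intros He. have [l [Hl1 Hl2]] := archimed_cor1 e He. destruct l as [|l]; [lia|].
 have HL : 0 < INR (S l) by (apply lt_0_INR; lia). have [A1 A2] := archimed (t * INR (S l)).
 set (z := up (t * INR (S l))) in *. have Hz : exists i j : nat, IZR z = INR i - INR j.
 { destruct (Z_le_gt_dec 0 z).
  - exists (Z.to_nat z), O. rewrite INR_IZR_INZ, Z2Nat.id by auto. simpl; ring.
  - exists O, (Z.to_nat (- z)). rewrite (INR_IZR_INZ (Z.to_nat (- z))), Z2Nat.id by lia. rewrite opp_IZR. simpl; ring. }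
 destruct Hz as [i [j Hz]]. exists (Cantor.to_nat (i, Cantor.to_nat (j, l))). unfold dense_point.
 rewrite Cantor.cancel_of_to, Cantor.cancel_of_to, <- Hz.
 replace (IZR z / INR (S l) - t) with ((IZR z - t * INR (S l)) * / INR (S l)) by (field; lra).
 rewrite Rabs_mult, (Rabs_right (/ INR (S l))).
 - assert (0 < / INR (S l)) by (apply Rinv_0_lt_compat; auto).
  assert (Rabs (IZR z - t * INR (S l)) <= 1) by (apply Rabs_le; lra). nra.
 - apply Rle_ge, Rlt_le, Rinv_0_lt_compat; auto.
Qed.

(** Lipschitz up to an error that tends to 0, uniformly in n and locally in
    time: this covers step functions that come from a discretization. *)
Definition almost_lipschitz (K h : R -> R) (hn : nat -> R) (x : nat -> R -> R) : Prop :=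
  forall n T s t, Rabs s <= T -> Rabs t <= T ->
    Rabs (x n t - x n s) <= K T * Rabs (t - s) + h T * hn n.

(** Along a dense sequence of times a diagonal subsequence converges; by
    equicontinuity it then converges at all times. *)
Lemma ascoli (K h : R -> R) (hn : nat -> R) (x : nat -> R -> R) (B : R) :
  (forall T, 0 <= K T) -> is_lim_seq hn 0 -> almost_lipschitz K h hn x ->
  (forall n, Rabs (x n 0) <= B) ->
  exists phi y, increasing_map phi /\ forall t, is_lim_seq (fun n => x (phi n) t) (y t : R).
Proof.
 intros HK Hh Hx HB. have Hhb : exists H, forall n, Rabs (hn n) <= H.
 { have Hbd := filterlim_bounded hn. destruct Hbd as [M HM].
  - exists 0. auto.
  - exists M. auto. }
 have [H HH] := Hhb.
 set (bd := fun k => B + K (Rabs (dense_point k)) * Rabs (dense_point k) + Rabs (h (Rabs (dense_point k))) * H).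
 destruct (diagonal_subsequence (fun k n => x n (dense_point k)) bd) as [phi [P1 P2]].
 { intros k n. unfold bd. set (q := dense_point k). have E := Hx n (Rabs q) 0 q. rewrite Rabs_R0 in E.
  specialize (E (Rabs_pos _) (Rle_refl _)). rewrite Rminus_0_r in E. assert (h (Rabs q) * hn n <= Rabs (h (Rabs q)) * H).
  { apply Rle_trans with (Rabs (h (Rabs q)) * Rabs (hn n)).
   - rewrite <- Rabs_mult. apply Rle_abs.
   - apply Rmult_le_compat_l; [apply Rabs_pos|auto]. }
  assert (Rabs (x n q) <= Rabs (x n q - x n 0) + Rabs (x n 0)).
  { replace (x n q) with ((x n q - x n 0) + x n 0) at 1 by ring. apply Rabs_triang. } specialize (HB n). lra. }
 have Hphi : forall t, ex_finite_lim_seq (fun n => x (phi n) t).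
 { intro t. apply ex_lim_seq_cauchy_corr. intros e. set (T := Rabs t + 1). have Hd : 0 < e / (4 * (K T + 1)).
  { apply Rdiv_lt_0_compat; [apply cond_pos|]. specialize (HK T). lra. }
  destruct (dense_point_near t (Rmin 1 (e / (4 * (K T + 1))))) as [k Hk]. { apply Rmin_glb_lt; lra. } have [l Hl] := P2 k.
  apply is_lim_seq_Reals in Hl. have He8 : 0 < e / 8 by (assert (0 < e) by apply cond_pos; lra). have [N1 HN1] := Hl _ He8.
  have Hh0 : is_lim_seq (fun n => h T * hn (phi n)) (h T * 0).
  { apply is_lim_seq_scal_l with (lu := 0). apply is_lim_seq_subseq with (phi := phi) in Hh; auto.
   apply eventually_subseq; auto. }
  apply is_lim_seq_Reals in Hh0. have [N2 HN2] := Hh0 _ He8. exists (max N1 N2).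
  intros n m Hn Hm. have Q : forall p, (max N1 N2 <= p)%nat -> Rabs (x (phi p) t - l) < e / 2.
  { intros p Hp. specialize (HN1 p ltac:(lia)). specialize (HN2 p ltac:(lia)). unfold Rdist in HN1, HN2.
   have E := Hx (phi p) T (dense_point k) t. have Hq1 := Rmin_l 1 (e / (4 * (K T + 1))).
   have Hq2 := Rmin_r 1 (e / (4 * (K T + 1))). assert (Rabs (dense_point k) <= T).
   { unfold T. replace (dense_point k) with ((dense_point k - t) + t) by ring. eapply Rle_trans; [apply Rabs_triang|]. lra. }
   specialize (E H0 ltac:(unfold T; lra)). assert (K T * Rabs (t - dense_point k) <= e / 4).
   { rewrite Rabs_minus_sym. apply Rle_trans with (K T * (e / (4 * (K T + 1)))).
    - apply Rmult_le_compat_l; auto. lra.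
    - specialize (HK T). apply Rle_trans with ((K T + 1) * (e / (4 * (K T + 1)))); [nra|]. apply Req_le. field. lra. }
   assert (h T * hn (phi p) <= e / 8) by (apply Rabs_lt_between in HN2; lra).
   replace (x (phi p) t - l) with ((x (phi p) t - x (phi p) (dense_point k)) + (x (phi p) (dense_point k) - l)) by ring.
   eapply Rle_lt_trans; [apply Rabs_triang|]. lra. }
  replace (x (phi n) t - x (phi m) t) with ((x (phi n) t - l) - (x (phi m) t - l)) by ring.
  eapply Rle_lt_trans; [apply Rabs_triang|]. rewrite Rabs_Ropp. have Q1 := Q n Hn. have Q2 := Q m Hm. lra. }
 exists phi, (fun t => real (Lim_seq (fun n => x (phi n) t))). split; auto. intro t. apply Lim_seq_correct'. auto.
Qed.

Lemma lim_seq_bounded (x : nat -> R) (l : R) : is_lim_seq x l ->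
  exists B, 0 <= B /\ forall n, Rabs (x n) <= B.
Proof.
 intros H. destruct (filterlim_bounded x) as [M HM]; [exists l; exact H|]. exists M. split; auto.
 eapply Rle_trans; [apply Rabs_pos|apply (HM O)].
Qed.

Lemma almost_lipschitz_limit (K h : R -> R) (hn : nat -> R) (x : nat -> R -> R)
    (phi : nat -> nat) (y : R -> R) :
  is_lim_seq hn 0 -> almost_lipschitz K h hn x -> increasing_map phi ->
  (forall t, is_lim_seq (fun n => x (phi n) t) (y t)) ->
  forall T s t, Rabs s <= T -> Rabs t <= T -> Rabs (y t - y s) <= K T * Rabs (t - s).
Proof.
 intros Hh Hx Hphi Hy T s t Hs Ht. have L1 : is_lim_seq (fun n => Rabs (x (phi n) t - x (phi n) s)) (Rabs (y t - y s)).
 { apply (is_lim_seq_abs _ (Finite (y t - y s))). apply is_lim_seq_minus'; auto. }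
 have L2 : is_lim_seq (fun n => K T * Rabs (t - s) + h T * hn (phi n)) (K T * Rabs (t - s) + h T * 0).
 { apply is_lim_seq_plus'; [apply is_lim_seq_const|]. apply is_lim_seq_mult'; [apply is_lim_seq_const|].
  apply is_lim_seq_subseq with (phi := phi) in Hh; auto. apply eventually_subseq; auto. }
 rewrite Rmult_0_r, Rplus_0_r in L2. apply is_lim_seq_le with (2 := L1) (3 := L2). auto.
Qed.

Lemma lipschitz_continuous (K : R -> R) (y : R -> R) :
  (forall T s t, Rabs s <= T -> Rabs t <= T -> Rabs (y t - y s) <= K T * Rabs (t - s)) ->
  forall t, continuous y t.
Proof.
 intros H t. apply eps_continuous. intros e He. set (T := Rabs t + 1). set (k := Rabs (K T) + 1).
 have Hk : 0 < k by (unfold k; assert (H1 := Rabs_pos (K T)); lra). exists (Rmin 1 (e / k)). split.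
 - apply Rmin_glb_lt; [lra|]. apply Rdiv_lt_0_compat; auto.
 - intros s Hs. apply Rmin_Rgt_l in Hs as [Hs1 Hs2]. assert (Rabs s <= T).
  { unfold T. replace s with ((s - t) + t) by ring. eapply Rle_trans; [apply Rabs_triang|]. lra. }
  eapply Rle_lt_trans; [apply (H T); auto; unfold T; lra|]. apply Rle_lt_trans with (k * Rabs (s - t)).
  + apply Rmult_le_compat_r; [apply Rabs_pos|]. unfold k. have H1 := Rle_abs (K T). lra.
  + apply Rlt_le_trans with (k * (e / k)); [apply Rmult_lt_compat_l; auto|]. apply Req_le. field. lra.
Qed.

Lemma subseq_lim (x : nat -> R) (l : Rbar) (phi : nat -> nat) : increasing_map phi ->
  is_lim_seq x l -> is_lim_seq (fun n => x (phi n)) l.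
Proof. intros H1 H2. apply is_lim_seq_subseq; auto. apply eventually_subseq; auto. Qed.

Lemma lim_seq_eps (x : nat -> R) (l : R) : is_lim_seq x l <->
  forall e, 0 < e -> exists N, forall n, (N <= n)%nat -> Rabs (x n - l) < e.
Proof. rewrite is_lim_seq_Reals. split; auto. Qed.

Lemma lim_seq_inj (x : nat -> R) (l m : R) : is_lim_seq x l -> is_lim_seq x m -> l = m.
Proof. intros H1 H2. apply is_lim_seq_unique in H1. apply is_lim_seq_unique in H2. congruence. Qed.

Lemma ascoli_pair (K : R -> R) (x y : nat -> R -> R) (B : R) : (forall T, 0 <= K T) ->
  (forall k T s t, Rabs s <= T -> Rabs t <= T ->
     Rabs (x k t - x k s) <= K T * Rabs (t - s) /\ Rabs (y k t - y k s) <= K T * Rabs (t - s)) ->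
  (forall k, Rabs (x k 0) <= B /\ Rabs (y k 0) <= B) ->
  exists phi u v, increasing_map phi /\ (forall t, is_lim_seq (fun k => x (phi k) t) (u t : R)) /\
    (forall t, is_lim_seq (fun k => y (phi k) t) (v t : R)) /\ forall t, continuous u t /\ continuous v t.
Proof.
 intros HK HL HB. have L0 : is_lim_seq (fun _ : nat => 0) 0 by apply is_lim_seq_const.
 have Al : forall z : nat -> R -> R, (forall k T s t, Rabs s <= T -> Rabs t <= T -> Rabs (z k t - z k s) <= K T * Rabs (t -
  s)) -> almost_lipschitz K (fun _ => 0) (fun _ => 0) z. { intros z Hz k T s t Hs Ht. rewrite Rmult_0_l, Rplus_0_r. auto. }
 have Ax : almost_lipschitz K (fun _ => 0) (fun _ => 0) x by (apply Al; intros; apply HL).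
 have Ay : almost_lipschitz K (fun _ => 0) (fun _ => 0) y by (apply Al; intros; apply HL).
 destruct (ascoli K (fun _ => 0) (fun _ => 0) x B HK L0 Ax) as [phi1 [u [P1 Hu]]]. { apply HB. }
 destruct (ascoli K (fun _ => 0) (fun _ => 0) (fun k => y (phi1 k)) B HK L0) as [phi2 [v [P2 Hv]]]. { intro k. auto. }
 { intro k. apply HB. } exists (fun k => phi1 (phi2 k)), u, v. have P := increasing_map_comp phi1 phi2 P1 P2. split; auto.
 have Hu' : forall t, is_lim_seq (fun k => x (phi1 (phi2 k)) t) (u t).
 { intro t. apply (subseq_lim (fun k => x (phi1 k) t)); auto. } split; auto. split; auto.
 intro t; split; apply (lipschitz_continuous K).
 - apply (almost_lipschitz_limit K (fun _ => 0) (fun _ => 0) x (fun k => phi1 (phi2 k))); auto.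
 - apply (almost_lipschitz_limit K (fun _ => 0) (fun _ => 0) y (fun k => phi1 (phi2 k))); auto.
Qed.

Ltac by_cases := intros; unfold Rmin, Rmax, Rabs in *;
  repeat match goal with
  | H : context [Rle_dec ?a ?b] |- _ => destruct (Rle_dec a b)
  | |- context [Rle_dec ?a ?b] => destruct (Rle_dec a b)
  | H : context [Rcase_abs ?a] |- _ => destruct (Rcase_abs a)
  | |- context [Rcase_abs ?a] => destruct (Rcase_abs a)
  end; try split; lra.

Ltac positive := intros; repeat first [apply Rmult_lt_0_compat | apply Rmult_le_pos | apply Rdiv_lt_0_compat
  | apply Rdiv_le_0_compat | apply Rinv_0_lt_compat | apply pow_lt | apply pow_le | apply Rabs_pos | apply exp_pos | apply pos_INR]; auto; lra.

Ltac abs_bounds := intros; repeat match goal with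
  | H : Rabs _ < _ |- _ => apply Rabs_lt_between in H
  | H : Rabs _ <= _ |- _ => apply Rabs_le_between in H
  | H : _ < Rmin _ _ |- _ => apply Rmin_Rgt_l in H
  | H : _ /\ _ |- _ => destruct H
  | |- Rabs _ < _ => apply Rabs_def1
  | |- Rabs _ <= _ => apply Rabs_le
  | |- _ < Rmin _ _ => apply Rmin_glb_lt
  | |- _ <= Rmin _ _ => apply Rmin_glb
  | |- _ /\ _ => split
  end; auto; lra.

(** * Existence of solutions by a symplectic Euler scheme *)

Definition unif_cont (f : R -> R) : Prop :=
  forall e, 0 < e -> exists d, 0 < d /\ forall x y, Rabs (x - y) < d -> Rabs (f x - f y) < e.

Lemma unif_cont_continuous f x : unif_cont f -> continuous f x.
Proof. intros H. apply eps_continuous. intros e He. have [d [Hd H1]] := H e He. exists d; split; auto. Qed.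

(** The damped oscillator [u'' + q u' + f(u) = 0] as a first order system. *)
Definition ode_at (q f u v : R -> R) (t : R) : Prop :=
  is_derive u t (v t) /\ is_derive v t (- q t * v t - f (u t)).

Lemma limit_derive (x : nat -> R -> R) (g hn : nat -> R) (y : R -> R) (l t0 : R) :
  (forall t, is_lim_seq (fun n => x n t) (y t)) ->
  is_lim_seq g l -> is_lim_seq hn 0 ->
  (forall e, 0 < e -> exists d n0, 0 < d /\ forall n s, (n0 <= n)%nat -> Rabs (s - t0) < d ->
     Rabs (x n s - x n t0 - (s - t0) * g n) <= e * Rabs (s - t0) + hn n) ->
  is_derive y t0 l.
Proof.
 intros Hx Hg Hh H. apply is_derive_eps. intros e He. have [d [n0 [Hd H1]]] := H e He. exists d; split; auto. intros s Hs.
 have L1 : is_lim_seq (fun n => Rabs (x n s - x n t0 - (s - t0) * g n)) (Rabs (y s - y t0 - l * (s - t0))).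
 { replace (l * (s - t0)) with ((s - t0) * l) by ring. apply (is_lim_seq_abs _ (Finite (y s - y t0 - (s - t0) * l))).
  apply is_lim_seq_minus'; [apply is_lim_seq_minus'; auto|]. apply is_lim_seq_mult'; auto. apply is_lim_seq_const. }
 have L2 : is_lim_seq (fun n => e * Rabs (s - t0) + hn n) (e * Rabs (s - t0) + 0).
 { apply is_lim_seq_plus'; auto. apply is_lim_seq_const. } rewrite Rplus_0_r in L2.
 apply is_lim_seq_le_loc with (2 := L1) (3 := L2). exists n0. auto.
Qed.

Lemma telescope_bound (X : nat -> R) (h g e : R) (i j : nat) : (i <= j)%nat ->
  (forall k, (i <= k < j)%nat -> Rabs (X (S k) - X k - h * g) <= h * e) ->
  Rabs (X j - X i - (INR j - INR i) * h * g) <= (INR j - INR i) * h * e.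
Proof.
 intros Hij. induction Hij; intros H.
 - by_cases.
 - rewrite S_INR.
  replace (X (S m) - X i - (INR m + 1 - INR i) * h * g) with ((X m - X i - (INR m - INR i) * h * g) + (X (S m) - X m - h *
   g)) by ring. eapply Rle_trans; [apply Rabs_triang|]. have H1 := IHHij ltac:(intros; apply H; lia).
  have H2 := H m ltac:(lia). lra.
Qed.

Definition grid_index (h t : R) : nat := Z.to_nat (Int_part (t / h)).

Lemma grid_index_spec h t : 0 < h -> 0 <= t ->
  INR (grid_index h t) * h <= t < (INR (grid_index h t) + 1) * h.
Proof.
 intros Hh Ht. unfold grid_index. have Hq : 0 <= t / h by (apply Rdiv_le_0_compat). have [H1 H2] := base_Int_part (t / h).
 have Hz : (0 <= Int_part (t / h))%Z.
 { apply le_IZR. assert (-1 < Int_part (t / h))%Z; [|apply IZR_le; lia]. apply lt_IZR. lra. }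
 rewrite INR_IZR_INZ, Z2Nat.id by auto. have E : t = t / h * h by (field; lra). nra.
Qed.

Lemma grid_index_mult h k : 0 < h -> grid_index h (INR k * h) = k.
Proof.
 intros Hh. have Hk := pos_INR k. destruct (grid_index_spec h (INR k * h)) as [H1 H2]; auto; [nra|].
 have A : INR (grid_index h (INR k * h)) <= INR k by nra. have B : INR k < INR (grid_index h (INR k * h)) + 1 by nra.
 apply INR_le in A. rewrite <- S_INR in B. apply INR_lt in B. lia.
Qed.

Lemma grid_index_neg h t : 0 < h -> t <= 0 -> grid_index h t = O.
Proof.
 intros Hh Ht. unfold grid_index. have [H1 H2] := base_Int_part (t / h). assert (t / h <= 0).
 { apply Rmult_le_reg_r with h; auto. unfold Rdiv. rewrite Rmult_assoc, Rinv_l by lra. lra. }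
 assert (Int_part (t / h) <= 0)%Z by (apply le_IZR; lra). lia.
Qed.

Lemma grid_index_mono h s t : 0 < h -> s <= t -> (grid_index h s <= grid_index h t)%nat.
Proof.
 intros Hh Hst. destruct (Rle_lt_dec s 0); [rewrite grid_index_neg by auto; lia|].
 destruct (grid_index_spec h s) as [H1 H2]; try lra. destruct (grid_index_spec h t) as [H3 H4]; try lra.
 assert (INR (grid_index h s) < INR (grid_index h t) + 1) by nra. rewrite <- S_INR in H. apply INR_lt in H. lia.
Qed.

(** A sequence whose steps on a stretch of time all have about the slope [g]
    follows the line of slope [g], up to the size of the grid. *)
Lemma grid_tangent (h g e : R) (X : nat -> R) s t : 0 < h -> 0 <= e -> 0 <= s -> 0 <= t ->
  (forall k, Rmin s t - h < INR k * h -> (INR k + 1) * h <= Rmax s t -> Rabs (X (S k) - X k - h * g) <= h * e) ->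
  Rabs (X (grid_index h s) - X (grid_index h t) - (s - t) * g) <= e * Rabs (s - t) + h * (e + Rabs g).
Proof.
 intros Hh He Hs Ht HX.
 have Main : forall lo hi, 0 <= lo <= hi -> (forall k, lo - h < INR k * h -> (INR k + 1) * h <= hi -> Rabs (X (S k) - X k - h
  * g) <= h * e) -> Rabs (X (grid_index h hi) - X (grid_index h lo) - (hi - lo) * g) <= e * (hi - lo) + h * (e + Rabs g).
 { intros lo hi Hlh H. have Hm := grid_index_mono h lo hi Hh by_lra.
  destruct (grid_index_spec h lo) as [L1 L2]; auto; [lra|]. destruct (grid_index_spec h hi) as [M1 M2]; auto; [lra|].
  set (i := grid_index h lo) in *. set (j := grid_index h hi) in *. set (m := (INR j - INR i) * h).
  have E : Rabs (X j - X i - m * g) <= m * e.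
  { apply telescope_bound; auto. intros k Hk. have K1 : INR i <= INR k by (apply le_INR; lia).
   have K2 : INR k + 1 <= INR j by (rewrite <- S_INR; apply le_INR; lia). apply H; nra. }
  have B : Rabs (m - (hi - lo)) <= h by (apply Rabs_le; unfold m; lra).
  replace (X j - X i - (hi - lo) * g) with ((X j - X i - m * g) + (m - (hi - lo)) * g) by ring.
  eapply Rle_trans; [apply Rabs_triang|]. rewrite Rabs_mult. have P := Rabs_pos g. have P2 := Rle_abs (m - (hi - lo)). nra. }
 unfold Rmin, Rmax in HX. destruct (Rle_dec s t) as [Hst|Hst].
 - rewrite <- Rabs_Ropp, Rabs_minus_sym, (Rabs_right (t - s)) by lra.
  replace (- _) with (X (grid_index h t) - X (grid_index h s) - (t - s) * g) by ring. auto.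
 - rewrite (Rabs_right (s - t)) by lra. apply Main; auto; lra.
Qed.

(** The vector field [-q v - f(u)] is continuous, uniformly in [u]. *)
Lemma field_near (q f : R -> R) t0 W e : continuous q t0 -> unif_cont f -> 0 <= W -> 0 < e ->
  exists d, 0 < d /\ forall t a b a0 b0, Rabs (t - t0) < d -> Rabs b <= W -> Rabs (b - b0) < d -> Rabs (a - a0) < d ->
    Rabs (- q t * b - f a - (- q t0 * b0 - f a0)) <= e.
Proof.
 intros Hq Hf HW He. destruct (Hf (e / 3)) as [d1 [Hd1 F1]]; [lra|].
 destruct (continuous_eps q t0 (e / 3 / (W + 1))) as [d2 [Hd2 F2]]; auto. { positive. } set (k := Rabs (q t0) + 1).
 have Hk : Rabs (q t0) < k /\ 0 < k by (have P := Rabs_pos (q t0); unfold k; lra). exists (Rmin d1 (Rmin d2 (e / 3 / k))).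
 split. { repeat apply Rmin_glb_lt; auto. positive. } intros t a b a0 b0 Ht Hb Hbb Ha.
 apply Rmin_Rgt_l in Ht as [_ Ht], Hbb as [_ Hbb], Ha as [Ha _]. apply Rmin_Rgt_l in Ht as [Ht _], Hbb as [_ Hbb].
 specialize (F1 _ _ Ha). specialize (F2 _ Ht).
 replace (- q t * b - f a - (- q t0 * b0 - f a0)) with (- ((q t - q t0) * b) + (- (q t0 * (b - b0)) + - (f a - f a0))) by
  ring. eapply Rle_trans; [apply Rabs_triang|]. eapply Rle_trans; [apply Rplus_le_compat_l, Rabs_triang|].
 rewrite !Rabs_Ropp, !Rabs_mult. have R1 : Rabs (q t - q t0) * Rabs b <= e / 3 / (W + 1) * (W + 1).
 { apply Rmult_le_compat; try apply Rabs_pos; lra. }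
 have R2 : Rabs (q t0) * Rabs (b - b0) <= k * (e / 3 / k) by (apply Rmult_le_compat; try apply Rabs_pos; lra).
 replace (e / 3 / (W + 1) * (W + 1)) with (e / 3) in R1 by (field; lra).
 replace (k * (e / 3 / k)) with (e / 3) in R2 by (field; lra). lra.
Qed.

Section Scheme.

Variables (q f : R -> R) (Q M : R).
Hypothesis q_bound : forall t, Rabs (q t) <= Q.
Hypothesis q_cont : forall t, continuous q t.
Hypothesis f_bound : forall x, Rabs (f x) <= M.
Hypothesis f_unif : unif_cont f.

(** The velocity is updated first, with implicit friction, then the position with
    the new velocity. Each step then changes areas by an exactly known factor. *)
Fixpoint orbit (h u0 v0 : R) (i : nat) : R * R :=
  match i with
  | O => (u0, v0)
  | S i' => let p := orbit h u0 v0 i' in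
      let v' := (snd p - h * f (fst p)) / (1 + h * q (INR i' * h)) in
      (fst p + h * v', v')
  end.

Definition orbit_u h u0 v0 t := fst (orbit h u0 v0 (grid_index h t)).
Definition orbit_v h u0 v0 t := snd (orbit h u0 v0 (grid_index h t)).

Lemma Q_nonneg : 0 <= Q.
Proof. specialize (q_bound 0). by_cases. Qed.

Lemma M_nonneg : 0 <= M.
Proof. specialize (f_bound 0). by_cases. Qed.

Lemma damping_pos h t : 0 < h -> h * Q <= 1 / 2 -> 1 / 2 <= 1 + h * q t.
Proof. specialize (q_bound t). apply Rabs_le_between in q_bound. nra. Qed.

Lemma orbit_step_v h u0 v0 i : 0 < h -> h * Q <= 1 / 2 ->
  snd (orbit h u0 v0 (S i)) - snd (orbit h u0 v0 i) =
  h * (- q (INR i * h) * snd (orbit h u0 v0 (S i)) - f (fst (orbit h u0 v0 i))).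
Proof. intros Hh HQ. simpl. have H := damping_pos h (INR i * h) Hh HQ. field. lra. Qed.

Lemma orbit_step_u h u0 v0 i :
  fst (orbit h u0 v0 (S i)) - fst (orbit h u0 v0 i) = h * snd (orbit h u0 v0 (S i)).
Proof. simpl. ring. Qed.

Definition speed_bound (V T : R) : R := (V + M * Rabs T) * exp (2 * Q * Rabs T).

Lemma speed_bound_mono V S T : 0 <= V -> Rabs S <= Rabs T -> speed_bound V S <= speed_bound V T.
Proof.
 intros HV H. have HM := M_nonneg. have HQ := Q_nonneg. assert (0 <= Rabs S) by by_cases.
 apply Rmult_le_compat; [nra|apply Rlt_le, exp_pos|nra|].
 destruct (Rle_lt_or_eq_dec (2 * Q * Rabs S) (2 * Q * Rabs T)) as [H1|H1]; [nra| |].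
 - apply Rlt_le, exp_increasing; auto.
 - rewrite H1; lra.
Qed.

Lemma orbit_speed h u0 v0 V i T : 0 < h -> h * Q <= 1 / 2 -> Rabs v0 <= V ->
  INR i * h <= T -> Rabs (snd (orbit h u0 v0 i)) <= speed_bound V T.
Proof.
 intros Hh HQ HV HT. have HM := M_nonneg. have HQ0 := Q_nonneg. have Hi : 0 <= INR i by positive.
 have HVp : 0 <= V by by_cases. have Hih : 0 <= INR i * h by nra. apply Rle_trans with (speed_bound V (INR i * h)).
 2: { apply speed_bound_mono; auto. by_cases. } unfold speed_bound. rewrite (Rabs_right (INR i * h)) by lra. clear HT Hi Hih.
 induction i.
 - simpl. rewrite Rmult_0_l, !Rmult_0_r, exp_0. lra.
 - set (p := orbit h u0 v0 i) in *.
  have E : snd (orbit h u0 v0 (S i)) = (snd p - h * f (fst p)) / (1 + h * q (INR i * h)) by auto. rewrite E, S_INR.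
  set (w := snd p - h * f (fst p)). set (l := 1 + h * q (INR i * h)). have Hl : 1 / 2 <= l by (apply damping_pos).
  have Hl2 : / l <= exp (2 * Q * h).
  { apply Rle_trans with (1 + 2 * Q * h); [|apply exp_ineq1_le]. apply Rmult_le_reg_r with l; [lra|]. rewrite Rinv_l by lra.
   unfold l in *. have Hqi := q_bound (INR i * h). apply Rabs_le_between in Hqi. have B : 0 <= h * Q by nra. nra. }
  have Hw : Rabs w <= Rabs (snd p) + h * M.
  { eapply Rle_trans; [apply Rabs_triang|]. rewrite Rabs_Ropp, Rabs_mult. rewrite (Rabs_right h) by lra.
   specialize (f_bound (fst p)). nra. }
  unfold Rdiv. rewrite Rabs_mult, (Rabs_right (/ l)).
  2: { apply Rle_ge, Rlt_le, Rinv_0_lt_compat; lra. }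
  replace (2 * Q * ((INR i + 1) * h)) with (2 * Q * (INR i * h) + 2 * Q * h) by ring. rewrite exp_plus, <- Rmult_assoc.
  apply Rmult_le_compat; auto; [positive|apply Rlt_le, Rinv_0_lt_compat; lra|]. assert (1 <= exp (2 * Q * (INR i * h))).
  { have H := exp_ineq1_le (2 * Q * (INR i * h)). assert (0 <= 2 * Q * (INR i * h)) by positive. lra. }
  assert (0 <= h * M) by nra. nra.
Qed.

Definition slope_bound (V T : R) : R := speed_bound V T + (M + Q * speed_bound V T).

Lemma speed_bound_pos V T : 0 <= V -> 0 <= speed_bound V T.
Proof. intros HV. have HM := M_nonneg. have H := Rabs_pos T. apply Rmult_le_pos; [nra|apply Rlt_le, exp_pos]. Qed.

(** Both components of the scheme move with a speed bounded by [slope_bound]. *)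
Lemma orbit_slope h u0 v0 V T k : 0 < h -> h * Q <= 1 / 2 -> Rabs v0 <= V -> (INR k + 1) * h <= T ->
  Rabs (snd (orbit h u0 v0 (S k))) <= slope_bound V T /\
  forall t a, Rabs (- q t * snd (orbit h u0 v0 (S k)) - f a) <= slope_bound V T.
Proof.
 intros Hh HQ Hv HT. have HV : 0 <= V by by_cases. have HM := M_nonneg. have HQ0 := Q_nonneg.
 have P := speed_bound_pos V T HV.
 have Hs : Rabs (snd (orbit h u0 v0 (S k))) <= speed_bound V T by (apply orbit_speed; auto; rewrite S_INR).
 unfold slope_bound. split; [nra|]. intros t a. eapply Rle_trans; [apply Rabs_triang|].
 rewrite Rabs_Ropp, Rabs_mult, Rabs_Ropp. specialize (f_bound a).
 have H : Rabs (q t) * Rabs (snd (orbit h u0 v0 (S k))) <= Q * speed_bound V T by (apply Rmult_le_compat; auto; apply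
  Rabs_pos). lra.
Qed.

Lemma orbit_increment h u0 v0 V T s t : 0 < h -> h * Q <= 1 / 2 -> Rabs v0 <= V -> 0 <= T -> s <= T -> t <= T ->
  Rabs (orbit_u h u0 v0 s - orbit_u h u0 v0 t) <= slope_bound V T * (Rabs (s - t) + h) /\
  Rabs (orbit_v h u0 v0 s - orbit_v h u0 v0 t) <= slope_bound V T * (Rabs (s - t) + h).
Proof.
 intros Hh HQ Hv HT Hs Ht. have HM := M_nonneg. have HQ0 := Q_nonneg. have P := speed_bound_pos V T ltac:(by_cases).
 have HK : 0 <= slope_bound V T by (unfold slope_bound; nra). have Z : forall x, grid_index h x = grid_index h (Rmax 0 x).
 { intro x. unfold Rmax. destruct Rle_dec; auto. rewrite !grid_index_neg; auto; lra. }
 have N : Rabs (Rmax 0 s - Rmax 0 t) <= Rabs (s - t) by by_cases. have Hmax : Rmax (Rmax 0 s) (Rmax 0 t) <= T by by_cases.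
 have Go : forall X, (forall k, (INR k + 1) * h <= T -> Rabs (X (S k) - X k - h * 0) <= h * slope_bound V T) -> Rabs (X
  (grid_index h s) - X (grid_index h t)) <= slope_bound V T * (Rabs (s - t) + h).
 { intros X HX. rewrite Z, (Z t).
  have G := grid_tangent h 0 (slope_bound V T) X (Rmax 0 s) (Rmax 0 t) Hh HK (Rmax_l _ _) (Rmax_l _ _) ltac:(intros; apply
   HX; lra). rewrite Rmult_0_r, Rminus_0_r, Rabs_R0 in G. nra. }
 split; [apply (Go (fun k => fst (orbit h u0 v0 k)))|apply (Go (fun k => snd (orbit h u0 v0 k)))]; intros k Hk; destruct
  (orbit_slope h u0 v0 V T k) as [A B]; auto; rewrite ?orbit_step_u, ?orbit_step_v, Rmult_0_r, Rminus_0_r, Rabs_mult,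
  Rabs_right by (auto; lra); apply Rmult_le_compat_l; auto; lra.
Qed.

Lemma orbit_tangent (V t0 : R) : 0 < t0 -> 0 <= V -> forall e, 0 < e ->
  exists d, 0 < d /\ forall h u0 v0 s, 0 < h < d -> h * Q <= 1 / 2 -> Rabs v0 <= V -> Rabs (s - t0) < d ->
    Rabs (orbit_u h u0 v0 s - orbit_u h u0 v0 t0 - (s - t0) * orbit_v h u0 v0 t0)
      <= e * Rabs (s - t0) + h * (e + slope_bound V (t0 + 1)) /\
    Rabs (orbit_v h u0 v0 s - orbit_v h u0 v0 t0 -
          (s - t0) * (- q t0 * orbit_v h u0 v0 t0 - f (orbit_u h u0 v0 t0)))
      <= e * Rabs (s - t0) + h * (e + 2 * slope_bound V (t0 + 1)).
Proof.
 intros Ht0 HV e He. have HM := M_nonneg. have HQ0 := Q_nonneg. have P := speed_bound_pos V (t0 + 1) HV.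
 set (K := slope_bound V (t0 + 1)). have HK : 0 <= K by (unfold K, slope_bound; nra).
 have [d0 [Hd0 H0]] := field_near q f t0 K e (q_cont t0) f_unif HK He. set (c := Rmin e d0 / (3 * (K + 1))).
 have Hm : 0 < Rmin e d0 by abs_bounds. have Hc : 0 < c by positive. exists (Rmin (Rmin (1 / 3) (t0 / 3)) (Rmin (d0 / 3) c)).
 split. { abs_bounds. } intros h u0 v0 s [Hh Hhd] HQ Hv Hs. apply Rmin_Rgt_l in Hhd as [Hh1 Hh2], Hs as [Hs1 Hs2].
 apply Rmin_Rgt_l in Hh1 as [A1 A2], Hh2 as [A3 A4], Hs1 as [B1 B2], Hs2 as [B3 B4].
 have Inc := fun x y => orbit_increment h u0 v0 V (t0 + 1) x y Hh HQ Hv by_lra. fold K in Inc.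
 have Small : forall x, Rabs (x - t0) <= Rabs (s - t0) + h -> x <= t0 + 1 -> Rabs (orbit_u h u0 v0 x - orbit_u h u0 v0 t0) <
  Rmin e d0 /\ Rabs (orbit_v h u0 v0 x - orbit_v h u0 v0 t0) < Rmin e d0.
 { intros x Hx Hx2. destruct (Inc x t0) as [I1 I2]; [lra|lra|].
  have E : c * (3 * (K + 1)) = Rmin e d0 by (unfold c; field; lra). nra. }
 have Range : forall k, Rmin s t0 - h < INR k * h -> (INR k + 1) * h <= Rmax s t0 -> Rabs (INR k * h - t0) <= Rabs (s - t0) +
  h /\ Rabs (INR (S k) * h - t0) <= Rabs (s - t0) + h /\ INR (S k) * h <= t0 + 1.
 { intros k K1 K2. rewrite S_INR. by_cases. }
 have Ou : forall k, orbit_u h u0 v0 (INR k * h) = fst (orbit h u0 v0 k) by (intro; unfold orbit_u; rewrite grid_index_mult;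
  auto).
 have Ov : forall k, orbit_v h u0 v0 (INR k * h) = snd (orbit h u0 v0 k) by (intro; unfold orbit_v; rewrite grid_index_mult;
  auto). have M1 := Rmin_l e d0. have M2 := Rmin_r e d0. have Hs0 : 0 <= s by by_cases.
 have Hv0 : Rabs (orbit_v h u0 v0 t0) <= speed_bound V (t0 + 1).
 { apply orbit_speed; auto. destruct (grid_index_spec h t0); lra. } have Hf0 := f_bound (orbit_u h u0 v0 t0).
 have Hq0 : Rabs (q t0) * Rabs (orbit_v h u0 v0 t0) <= Q * speed_bound V (t0 + 1) by (apply Rmult_le_compat; auto; apply
  Rabs_pos). have Hg : Rabs (- q t0 * orbit_v h u0 v0 t0 - f (orbit_u h u0 v0 t0)) <= K.
 { eapply Rle_trans; [apply Rabs_triang|]. rewrite Rabs_Ropp, Rabs_mult, Rabs_Ropp. unfold K, slope_bound. lra. } split.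
 - eapply Rle_trans; [apply (grid_tangent h _ e (fun k => fst (orbit h u0 v0 k))); auto; try lra|].
  + intros k K1 K2. have [_ [R2 R3]] := Range k K1 K2. have [_ S2] := Small _ R2 R3. rewrite Ov in S2.
   rewrite orbit_step_u, <- Rmult_minus_distr_l, Rabs_mult, (Rabs_right h) by lra. nra.
  + have HQs : 0 <= Q * speed_bound V (t0 + 1) by nra. apply Rplus_le_compat_l, Rmult_le_compat_l; [lra|].
   unfold K, slope_bound. lra.
 - eapply Rle_trans; [apply (grid_tangent h _ e (fun k => snd (orbit h u0 v0 k))); auto; try lra|].
  + intros k K1 K2. have [R1 [R2 R3]] := Range k K1 K2. have [_ S2] := Small _ R2 R3. rewrite Ov in S2.
   destruct (Small (INR k * h) R1) as [S3 _]; [rewrite S_INR in R3; lra|]. rewrite Ou in S3.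
   rewrite orbit_step_v, <- Rmult_minus_distr_l, Rabs_mult, (Rabs_right h) by (auto; lra). apply Rmult_le_compat_l; [lra|].
   rewrite S_INR in R2, R3. apply H0; try lra. apply (orbit_slope h u0 v0 V (t0 + 1) k); auto.
  nra.
Qed.

(** The initial data may vary with the step, which gives limits of orbits that
    are chosen one for each step size. *)
Theorem scheme_limit (hn an bn : nat -> R) (a b V : R) :
  (forall n, 0 < hn n /\ hn n * Q <= 1 / 2) ->
  is_lim_seq hn 0 -> is_lim_seq an a -> is_lim_seq bn b -> (forall n, Rabs (bn n) <= V) ->
  exists phi u v, increasing_map phi /\
    (forall t, is_lim_seq (fun n => orbit_u (hn (phi n)) (an (phi n)) (bn (phi n)) t) (u t : R)) /\
    (forall t, is_lim_seq (fun n => orbit_v (hn (phi n)) (an (phi n)) (bn (phi n)) t) (v t : R)) /\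
    u 0 = a /\ v 0 = b /\
    (forall T s t, Rabs s <= T -> Rabs t <= T -> Rabs (u t - u s) <= slope_bound V T * Rabs (t - s) /\
       Rabs (v t - v s) <= slope_bound V T * Rabs (t - s)) /\
    (almost_lipschitz (slope_bound V) (slope_bound V) hn (fun n => orbit_u (hn n) (an n) (bn n)) /\
       almost_lipschitz (slope_bound V) (slope_bound V) hn (fun n => orbit_v (hn n) (an n) (bn n))) /\
    forall t, 0 < t -> ode_at q f u v t.
Proof.
 intros Hhn Hh0 Ha Hb HV. have HM := M_nonneg. have HQ0 := Q_nonneg. have [A [HA1 HA]] := lim_seq_bounded an a Ha.
 have HV1 : 0 <= V by (specialize (HV O); by_cases). have HW : forall T, 0 <= speed_bound V T.
 { intro T. have H := Rabs_pos T. apply Rmult_le_pos; [nra|apply Rlt_le, exp_pos]. } set (K := slope_bound V).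
 have HK : forall T, 0 <= K T by (intro T; unfold K, slope_bound; specialize (HW T); nra).
 have AL : almost_lipschitz K K hn (fun n => orbit_u (hn n) (an n) (bn n)) /\ almost_lipschitz K K hn (fun n => orbit_v (hn
  n) (an n) (bn n)).
 { split; intros n T s t Hs Ht; destruct (Hhn n) as [H1 H2]; rewrite <- Rmult_plus_distr_l; apply (orbit_increment _ _ _ V T
   t s H1 H2 (HV n)); by_cases. }
 have [ALu ALv] := AL. have Hu0 : forall n, orbit_u (hn n) (an n) (bn n) 0 = an n.
 { intro n. unfold orbit_u. rewrite grid_index_neg; [auto|apply Hhn|lra]. }
 have Hv0 : forall n, orbit_v (hn n) (an n) (bn n) 0 = bn n.
 { intro n. unfold orbit_v. rewrite grid_index_neg; [auto|apply Hhn|lra]. }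
 destruct (ascoli K K hn _ A HK Hh0 ALu) as [phi1 [u [P1 Hu]]]. { intro n. rewrite Hu0. auto. }
 destruct (ascoli K K (fun n => hn (phi1 n)) (fun n => orbit_v (hn (phi1 n)) (an (phi1 n)) (bn (phi1 n))) V HK) as [phi2 [v
  [P2 Hv]]]. { apply subseq_lim; auto. } { intros n. auto. } { intro n. rewrite Hv0. auto. }
 set (phi := fun n => phi1 (phi2 n)). have Pphi : increasing_map phi by exact (increasing_map_comp phi1 phi2 P1 P2).
 have Hu' : forall t, is_lim_seq (fun n => orbit_u (hn (phi n)) (an (phi n)) (bn (phi n)) t) (u t).
 { intro t. apply (subseq_lim (fun n => orbit_u (hn (phi1 n)) (an (phi1 n)) (bn (phi1 n)) t)); auto. } exists phi, u, v.
 split; [|split; [|split; [|split; [|split; [|split; [|split]]]]]]; auto.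
 - apply (lim_seq_inj (fun n => an (phi n))); [|apply subseq_lim; auto].
  apply (is_lim_seq_ext _ _ _ (fun n => Hu0 (phi n))), Hu'.
 - apply (lim_seq_inj (fun n => bn (phi n))); [|apply subseq_lim; auto].
  apply (is_lim_seq_ext _ _ _ (fun n => Hv0 (phi n))), Hv.
 - split; [apply (almost_lipschitz_limit K K hn (fun n => orbit_u (hn n) (an n) (bn n)) phi)| apply (almost_lipschitz_limit K
   K hn (fun n => orbit_v (hn n) (an n) (bn n)) phi)]; auto.
 - intros t Ht. have Hhphi : forall c, is_lim_seq (fun n => hn (phi n) * c) 0.
  { intro c. replace 0 with (0 * c) by ring. apply is_lim_seq_mult'; [|apply is_lim_seq_const]. apply subseq_lim; auto. }
  have Hsmall : forall d, 0 < d -> exists N, forall n, (N <= n)%nat -> 0 < hn (phi n) < d.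
  { intros d Hd. have H0 := proj1 (lim_seq_eps _ _) (subseq_lim _ _ phi Pphi Hh0) d Hd. have [N HN] := H0. exists N.
   intros n Hn. specialize (HN n Hn). destruct (Hhn (phi n)). by_cases. }
  split.
  + apply (limit_derive (fun n => orbit_u (hn (phi n)) (an (phi n)) (bn (phi n))) (fun n => orbit_v (hn (phi n)) (an (phi
    n)) (bn (phi n)) t) (fun n => hn (phi n) * (1 + K (t + 1)))); auto. intros e He.
   destruct (orbit_tangent V t Ht HV1 (Rmin e 1)) as [d [Hd H]]. { by_cases. } have [N HN] := Hsmall d Hd. exists d, N.
   split; auto. intros n s Hn Hs. have [G1 G2] := Hhn (phi n). eapply Rle_trans; [apply H; auto|]. have R1 := Rmin_l e 1.
   have R2 := Rmin_r e 1. have R3 := Rabs_pos (s - t). fold K. nra.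
  + apply (limit_derive (fun n => orbit_v (hn (phi n)) (an (phi n)) (bn (phi n))) (fun n => - q t * orbit_v (hn (phi n)) (an
    (phi n)) (bn (phi n)) t - f (orbit_u (hn (phi n)) (an (phi n)) (bn (phi n)) t)) (fun n => hn (phi n) * (1 + 2 * K (t +
    1)))); auto.
   * apply is_lim_seq_minus'.
    -- apply is_lim_seq_mult'; [apply is_lim_seq_const|auto].
    -- apply is_lim_seq_continuous; auto. apply continuous_continuity_pt, unif_cont_continuous; auto.
   * intros e He. destruct (orbit_tangent V t Ht HV1 (Rmin e 1)) as [d [Hd H]]. { by_cases. } have [N HN] := Hsmall d Hd.
    exists d, N. split; auto. intros n s Hn Hs. have [G1 G2] := Hhn (phi n). eapply Rle_trans; [apply H; auto|].
    have R1 := Rmin_l e 1. have R2 := Rmin_r e 1. have R3 := Rabs_pos (s - t). fold K. nra.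
Qed.

Theorem ode_exists (a b : R) : exists u v, u 0 = a /\ v 0 = b /\
  (forall t, continuous u t /\ continuous v t) /\
  (forall T s t, Rabs s <= T -> Rabs t <= T -> Rabs (u t - u s) <= slope_bound (Rabs b) T * Rabs (t - s) /\
     Rabs (v t - v s) <= slope_bound (Rabs b) T * Rabs (t - s)) /\
  forall t, 0 < t -> ode_at q f u v t.
Proof.
 have HQ0 := Q_nonneg. set (hn := fun n => / INR (S n) * / (2 * (Q + 1))). have Hh : forall n, 0 < hn n /\ hn n * Q <= 1 / 2.
 { intro n. assert (0 < / INR (S n)) by (apply Rinv_0_lt_compat, lt_0_INR; lia). assert (/ INR (S n) <= 1).
  { rewrite <- Rinv_1. apply Rinv_le_contravar; [lra|]. apply (le_INR 1). lia. } assert (0 < / (2 * (Q + 1))) by positive.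
  split; [apply Rmult_lt_0_compat; auto|]. apply Rle_trans with (1 * / (2 * (Q + 1)) * Q).
  - apply Rmult_le_compat_r; auto. apply Rmult_le_compat_r; lra.
  - apply Rmult_le_reg_r with (2 * (Q + 1)); [lra|]. field_simplify; lra. }
 destruct (scheme_limit hn (fun _ => a) (fun _ => b) a b (Rabs b) Hh) as [phi [u [v [_ [_ [_ [Ha [Hb [HK [_ H]]]]]]]]]].
 - replace 0 with (0 * / (2 * (Q + 1))) by ring. apply is_lim_seq_mult'; [|apply is_lim_seq_const].
  apply (is_lim_seq_incr_1 (fun n => / INR n)). apply (is_lim_seq_inv INR p_infty); [apply is_lim_seq_INR|discriminate].
 - apply is_lim_seq_const.
 - apply is_lim_seq_const.
 - easy.
 - exists u, v. do 2 (split; auto). split; auto.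
  intro t; split; apply (lipschitz_continuous (slope_bound (Rabs b))); intros T s r Hs Hr; apply HK; auto.
Qed.

End Scheme.

(** The friction coefficient of the radial equation, cut off near the origin. *)
Lemma friction_cut d rho (g : R -> R) : 0 < rho -> 0 <= d -> (forall t, continuous g t) ->
  (forall t, Rabs (d / Rmax rho (g t)) <= d / rho) /\ forall t, continuous (fun t => d / Rmax rho (g t)) t.
Proof.
 have HR : forall t, rho <= Rmax rho (g t) by by_cases. split; intro t; specialize (HR t).
 - have P : 0 < / Rmax rho (g t) by positive. rewrite Rabs_right by nra. apply Rmult_le_compat_l; auto.
  apply Rinv_le_contravar; auto.
 - apply (continuous_mult (fun _ => d)); [apply continuous_const|]. apply continuous_comp; [|apply continuous_Rinv; lra].
  apply continuous_comp; auto. apply eps_continuous. intros e He. exists e. split; auto. by_cases.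
Qed.

Lemma continuous_backward z t : continuous (fun t => z - t) t.
Proof. apply (ex_derive_continuous (V := R_NormedModule)). auto_derive; auto. Qed.

Lemma slope_bound_pos Q M V T : 0 <= Q -> 0 <= M -> 0 <= V -> 0 <= slope_bound Q M V T.
Proof.
 intros HQ HM HV. have P := Rabs_pos T. unfold slope_bound.
 have H : 0 <= speed_bound Q M V T by (apply Rmult_le_pos; [nra|apply Rlt_le, exp_pos]). nra.
Qed.

(** * Expansion of areas under a negatively damped flow *)

Definition unif_cont2 (chi : R -> R -> R) : Prop :=
  forall e, 0 < e -> exists d, 0 < d /\ forall x x' y y',
    Rabs (x - x') < d -> Rabs (y - y') < d -> Rabs (chi x y - chi x' y') < e.

Lemma unif_cont2_l chi y : unif_cont2 chi -> forall x, continuous (fun x => chi x y) x.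
Proof.
 intros H x. apply eps_continuous. intros e He. have [d [Hd H1]] := H e He. exists d; split; auto. intros. apply H1; auto.
 by_cases.
Qed.

Lemma unif_cont2_r chi x : unif_cont2 chi -> forall y, continuous (fun y => chi x y) y.
Proof.
 intros H y. apply eps_continuous. intros e He. have [d [Hd H1]] := H e He. exists d; split; auto. intros. apply H1; auto.
 by_cases.
Qed.

Lemma ex_RInt_cont (g : R -> R) a b : (forall x, continuous g x) -> ex_RInt g a b.
Proof. intros H. apply (ex_RInt_continuous (V := R_CompleteNormedModule)). auto. Qed.

Lemma is_derive_RInt_cont (g : R -> R) a t : (forall x, continuous g x) ->
  is_derive (fun s => RInt g a s) t (g t).
Proof.
 intros H. apply (is_derive_RInt g _ a); auto. apply filter_forall. intro s.
 apply (RInt_correct (V := R_CompleteNormedModule)), ex_RInt_cont; auto.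
Qed.

Lemma continuous_RInt_le chi a b : a <= b -> unif_cont2 chi ->
  forall y, continuous (fun y => RInt (fun x => chi x y) a b) y.
Proof.
 intros Hab H y. apply eps_continuous. intros e He. destruct (H (e / (b - a + 1))) as [d [Hd H1]]. { positive. }
 exists d; split; auto. intros y' Hy.
 have E : RInt (fun x => chi x y') a b - RInt (fun x => chi x y) a b = RInt (fun x => chi x y' - chi x y) a b.
 { symmetry. apply (RInt_minus (V := R_CompleteNormedModule)); apply ex_RInt_cont; intro; apply unif_cont2_l; auto. }
 rewrite E. apply Rle_lt_trans with ((b - a) * (e / (b - a + 1))).
 - apply abs_RInt_le_const; auto.
  + apply ex_RInt_cont. intro x. apply (continuous_minus (fun x => chi x y')); apply unif_cont2_l; auto.
  + intros t Ht. apply Rlt_le, H1; auto. by_cases.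
 - apply Rlt_le_trans with ((b - a + 1) * (e / (b - a + 1))).
  + apply Rmult_lt_compat_r; [apply Rdiv_lt_0_compat|]; lra.
  + apply Req_le. field. lra.
Qed.

Lemma continuous_RInt_l chi a b : unif_cont2 chi ->
  forall y, continuous (fun y => RInt (fun x => chi x y) a b) y.
Proof.
 intros H y. destruct (Rle_lt_dec a b); [apply continuous_RInt_le; auto|].
 apply (continuous_ext (fun y => opp (RInt (fun x => chi x y) b a))).
 { intro z. apply opp_RInt_swap. apply ex_RInt_cont, unif_cont2_l; auto. } apply (continuous_opp (V := R_NormedModule)).
 apply continuous_RInt_le; auto. lra.
Qed.

Lemma unif_cont2_swap chi : unif_cont2 chi -> unif_cont2 (fun x y => chi y x).
Proof. intros H e He. have [d [Hd H1]] := H e He. exists d; split; auto. Qed.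

Lemma fubini chi a b c d : a <= b -> c <= d -> unif_cont2 chi ->
  RInt (fun x => RInt (fun y => chi x y) c d) a b =
  RInt (fun y => RInt (fun x => chi x y) a b) c d.
Proof.
 intros Hab Hcd H. set (G := fun t => RInt (fun x => RInt (fun y => chi x y) c d) a t).
 set (J := fun t => RInt (fun y => RInt (fun x => chi x y) a t) c d). set (g := fun t => RInt (fun y => chi t y) c d).
 have Hg : forall t, continuous g t. { apply continuous_RInt_l. apply unif_cont2_swap; auto. }
 have HG : forall t, is_derive G t (g t) by (intro t; apply is_derive_RInt_cont).
 have HD : forall y t, is_derive (fun u => RInt (fun x => chi x y) a u) t (chi t y).
 { intros y t. apply (is_derive_RInt_cont (fun x => chi x y)). apply unif_cont2_l; auto. }
 have HJ : forall t, is_derive J t (g t).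
 { intro t. have E : RInt (fun y => Derive (fun u => RInt (fun x => chi x y) a u) t) c d = g t.
  { apply RInt_ext. intros y _. apply is_derive_unique, HD. } rewrite <- E. apply is_derive_RInt_param.
  - apply filter_forall. intros u y _. exists (chi u y). auto.
  - intros y _. apply (continuity_2d_pt_ext chi). { symmetry. apply is_derive_unique, HD. } intros [e He].
   have [r [Hr H1]] := H e He. exists (mkposreal r Hr). auto.
  - apply filter_forall. intros u. apply ex_RInt_cont. apply continuous_RInt_l; auto. }
 have HGJ' : forall x, is_derive (fun t => G t - J t) x 0.
 { intros x. replace 0 with (minus (g x) (g x)) by (unfold minus, plus, opp; simpl; ring).
  apply (is_derive_minus (V := R_NormedModule)); auto. }
 have HGJ : forall x, continuous (fun t => G t - J t) x.
 { intros x. apply (ex_derive_continuous (V := R_NormedModule)). exists 0; auto. } have E : G b - J b = G a - J a.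
 { apply Rle_antisym.
  - apply (nonincr_deriv (fun t => G t - J t) (fun _ => 0)); auto. split; auto; lra.
  - apply (nondecr_deriv (fun t => G t - J t) (fun _ => 0)); auto. split; auto; lra. }
 have Ga : G a = 0 by apply (RInt_point (V := R_CompleteNormedModule)). have Ja : J a = 0.
 { unfold J. rewrite (RInt_ext _ (fun _ => 0)).
  - rewrite RInt_const. unfold scal; simpl; unfold mult; simpl. ring.
  - intros y _. apply (RInt_point (V := R_CompleteNormedModule)). }
 unfold J in *. lra.
Qed.

Lemma RInt_zero_ext (g : R -> R) a b : (forall x, Rmin a b < x < Rmax a b -> g x = 0) ->
  RInt g a b = 0.
Proof.
 intros H. rewrite (RInt_ext _ (fun _ => 0)); auto. rewrite RInt_const. unfold scal; simpl; unfold mult; simpl. ring.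
Qed.

Lemma RInt_support (g : R -> R) a b a' b' : (forall x, continuous g x) -> a <= b -> a' <= b' ->
  (forall x, x < a \/ b < x -> g x = 0) -> (forall x, x < a' \/ b' < x -> g x = 0) ->
  RInt g a b = RInt g a' b'.
Proof.
 intros Hc Hab Hab' H H'. have Ch : forall p q r, RInt g p q + RInt g q r = RInt g p r.
 { intros p q r. apply (RInt_Chasles (V := R_CompleteNormedModule)); apply ex_RInt_cont; auto. }
 have Q : forall p r c e, p <= r -> c <= p -> r <= e -> (forall x, x < p \/ r < x -> g x = 0) -> RInt g c e = RInt g p r.
 { intros p r c e Hpr Hcp Hre Hz. have E1 := Ch c p e. have E2 := Ch p r e.
  assert (Z1 : RInt g c p = 0 /\ RInt g r e = 0); [|lra].
  split; apply RInt_zero_ext; intros x Hx; apply Hz; revert Hx; unfold Rmin, Rmax; destruct Rle_dec; lra. }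
 rewrite <- (Q a b (Rmin a a') (Rmax b b')); auto; try apply Rmin_l; try apply Rmax_l.
 apply Q; auto; try apply Rmin_r; try apply Rmax_r.
Qed.

Lemma RInt_affine (g : R -> R) (l c a b : R) : (forall x, continuous g x) ->
  l * RInt (fun y => g (l * y + c)) a b = RInt g (l * a + c) (l * b + c).
Proof.
 intros Hc. rewrite <- RInt_comp_lin by (apply ex_RInt_cont; auto). symmetry. apply (RInt_scal (fun y => g (l * y + c))).
 apply ex_RInt_cont. intro x. apply continuous_comp; auto. apply (ex_derive_continuous (V := R_NormedModule)).
 auto_derive; auto.
Qed.

Definition box_integral (K : R) (chi : R -> R -> R) : R :=
  RInt (fun x => RInt (fun y => chi x y) (- K) K) (- K) K.

Definition supported_in (K : R) (chi : R -> R -> R) : Prop :=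
  forall x y, chi x y <> 0 -> Rabs x < K /\ Rabs y < K.

Definition sheared (h l : R) (f : R -> R) (chi : R -> R -> R) (x y : R) : R :=
  chi (x - h * y) (l * y + h * f (x - h * y)).

Lemma unif_cont2_sheared h l f chi : unif_cont f -> unif_cont2 chi ->
  unif_cont2 (sheared h l f chi).
Proof.
 intros Hf Hchi e He. have [d [Hd H1]] := Hchi e He. have Hh := Rabs_pos h. have Hl := Rabs_pos l.
 destruct (Hf (d / (2 * (Rabs h + 1)))) as [d1 [Hd1 H2]]; [positive|]. set (D := Rmin d d1).
 have HD : 0 < D by (apply Rmin_glb_lt). have HDd := Rmin_l d d1. have HDd1 := Rmin_r d d1. fold D in HDd, HDd1.
 exists (D / (2 * (Rabs h + Rabs l + 1))). split; [positive|]. intros x x' y y' Hx Hy.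
 set (t := D / (2 * (Rabs h + Rabs l + 1))) in *. have Ht : t * (2 * (Rabs h + Rabs l + 1)) = D by (unfold t; field; lra).
 have Py := Rabs_pos (y - y'). have A : Rabs (x - h * y - (x' - h * y')) < D.
 { replace (x - h * y - (x' - h * y')) with ((x - x') + - (h * (y - y'))) by ring. eapply Rle_lt_trans; [apply Rabs_triang|].
  rewrite Rabs_Ropp, Rabs_mult. nra. }
 apply H1; [lra|]. have B := H2 _ _ (Rlt_le_trans _ _ _ A HDd1).
 replace (l * y + h * f (x - h * y) - (l * y' + h * f (x' - h * y'))) with (l * (y - y') + h * (f (x - h * y) - f (x' - h *
  y'))) by ring. eapply Rle_lt_trans; [apply Rabs_triang|]. rewrite !Rabs_mult. set (w := d / (2 * (Rabs h + 1))) in *.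
 have Hw : w * (2 * (Rabs h + 1)) = d by (unfold w; field; lra). assert (Rabs l * Rabs (y - y') <= D / 2) by nra. nra.
Qed.

(** A step of the scheme is a shear in each of the two variables combined with a
    dilation by 1/l of the second one. *)
Lemma box_integral_sheared (K h l : R) (f : R -> R) (chi : R -> R -> R) :
  0 < K -> 0 < l -> unif_cont f -> unif_cont2 chi ->
  supported_in K chi -> supported_in K (sheared h l f chi) ->
  l * box_integral K (sheared h l f chi) = box_integral K chi.
Proof.
 intros HK Hl Hf Hchi S1 S2. unfold box_integral. assert (Z1 : forall x y, K <= Rabs x \/ K <= Rabs y -> chi x y = 0).
 { intros x y Hxy. apply NNPP; intro N. apply S1 in N. lra. }
 assert (Z2 : forall x y, K <= Rabs x \/ K <= Rabs y -> sheared h l f chi x y = 0).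
 { intros x y Hxy. apply NNPP; intro N. apply S2 in N. lra. } assert (AB : forall x, x < - K \/ K < x -> K <= Rabs x).
 { intros x [H|H]; [rewrite Rabs_left1|rewrite Rabs_right]; lra. }
 rewrite fubini by (try lra; apply unif_cont2_sheared; auto). set (psi := fun x y => chi x (l * y + h * f x)).
 assert (Hpsi : unif_cont2 psi).
 { intros e He. destruct (Hchi e He) as [d [Hd H1]]. assert (Hh := Rabs_pos h).
  destruct (Hf (d / (2 * (Rabs h + 1)))) as [d1 [Hd1 H2]]; [positive|]. set (w := d / (2 * (Rabs h + 1))) in *.
  assert (Hw : w * (2 * (Rabs h + 1)) = d) by (unfold w; field; lra). exists (Rmin (Rmin d d1) (d / (2 * l))). split.
  { repeat apply Rmin_glb_lt; auto. apply Rdiv_lt_0_compat; lra. } intros x x' y y' Hx Hy. apply Rmin_Rgt_l in Hx as [Hx _].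
  apply Rmin_Rgt_l in Hx as [Hx1 Hx2]. apply Rmin_Rgt_l in Hy as [_ Hy]. apply H1; auto.
  replace (l * y + h * f x - (l * y' + h * f x')) with (l * (y - y') + h * (f x - f x')) by ring.
  eapply Rle_lt_trans; [apply Rabs_triang|]. rewrite !Rabs_mult, Rabs_right by lra. assert (l * Rabs (y - y') < d / 2).
  { apply Rlt_le_trans with (l * (d / (2 * l))); [apply Rmult_lt_compat_l; auto|]. apply Req_le. field. lra. }
  specialize (H2 x x' Hx2). assert (P := Rabs_pos (f x - f x')). nra. }
 assert (E1 : forall y, RInt (fun x => sheared h l f chi x y) (- K) K = RInt (fun x => psi x y) (- K) K).
 { intros y. unfold sheared. assert (E := RInt_affine (fun x => psi x y) 1 (- (h * y)) (- K) K (unif_cont2_l psi y Hpsi)).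
  rewrite Rmult_1_l in E. rewrite (RInt_ext _ (fun x => psi (1 * x + - (h * y)) y)).
  2: { intros x _. unfold psi. replace (1 * x + - (h * y)) with (x - h * y) by ring. reflexivity. } rewrite E.
  apply RInt_support; try lra.
  - apply unif_cont2_l; auto.
  - intros x Hx. unfold psi. assert (Z := Z2 (x + h * y) y). unfold sheared in Z.
   replace (x + h * y - h * y) with x in Z by ring. apply Z. left. apply AB. lra.
  - intros x Hx. apply Z1. left. apply AB; auto. }
 rewrite (RInt_ext _ _) by (intros; apply E1).
 rewrite <- fubini by (auto; lra). etransitivity.
 { symmetry. apply (RInt_scal (V := R_CompleteNormedModule)). apply ex_RInt_cont. intro x.
  apply continuous_RInt_l, unif_cont2_swap; auto. }
 apply RInt_ext. intros x _.
 assert (E := RInt_affine (fun y => chi x y) l (h * f x) (- K) K (unif_cont2_r chi x Hchi)). unfold psi.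
 etransitivity; [exact E|]. apply RInt_support; try nra.
 - apply unif_cont2_r; auto.
 - intros y Hy. assert (Z := Z2 (x + h * ((y - h * f x) / l)) ((y - h * f x) / l)). unfold sheared in Z.
  replace (x + h * ((y - h * f x) / l) - h * ((y - h * f x) / l)) with x in Z by ring.
  replace (l * ((y - h * f x) / l) + h * f x) with y in Z by (field; lra). apply Z. right. apply AB.
  case: Hy => Hy; [left|right]; apply Rmult_lt_reg_l with l; replace (l * ((y - h * f x) / l)) with (y - h * f x) by
   (field; lra); lra.
 - intros y Hy. apply Z1. right. apply AB; auto.
Qed.

Lemma box_integral_le (K : R) (chi : R -> R -> R) : 0 < K -> unif_cont2 chi ->
  (forall x y, chi x y <= 1) -> box_integral K chi <= 4 * K * K.
Proof.
 intros HK Hc H. assert (E : forall c, RInt (fun _ : R => c) (- K) K = 2 * K * c).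
 { intro c. rewrite RInt_const. unfold scal; simpl; unfold mult; simpl. ring. }
 replace (4 * K * K) with (2 * K * (2 * K * 1)) by ring. rewrite <- E. apply RInt_le; [lra| | |].
 - apply ex_RInt_cont. apply (continuous_RInt_l (fun y x => chi x y)), unif_cont2_swap; auto.
 - apply ex_RInt_cont. intro; apply continuous_const.
 - intros x _. rewrite <- E. apply RInt_le; [lra| | |].
  + apply ex_RInt_cont, unif_cont2_r; auto.
  + apply ex_RInt_cont. intro; apply continuous_const.
  auto.
Qed.

Section Transport.

Variables (q f : R -> R) (Q M : R).
Hypothesis q_bound : forall t, Rabs (q t) <= Q.
Hypothesis f_bound : forall x, Rabs (f x) <= M.
Hypothesis f_unif : unif_cont f.

(** Indicator-like functions of initial states, carried along by the scheme. *)
Fixpoint transport (h : R) (chi : R -> R -> R) (i : nat) : R -> R -> R :=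
  match i with
  | O => chi
  | S i' => sheared h (1 + h * q (INR i' * h)) f (transport h chi i')
  end.

Fixpoint dilation (h : R) (i : nat) : R :=
  match i with O => 1 | S i' => dilation h i' * (1 + h * q (INR i' * h)) end.

Lemma unif_cont2_transport h chi i : unif_cont2 chi -> unif_cont2 (transport h chi i).
Proof. intros H. induction i; simpl; auto. apply unif_cont2_sheared; auto. Qed.

Lemma transport_support h chi i x y : 0 < h -> h * Q <= 1 / 2 -> transport h chi i x y <> 0 ->
  exists a b, chi a b <> 0 /\ orbit q f h a b i = (x, y).
Proof.
 intros Hh HQ. revert x y. induction i; intros x y H.
 - exists x, y. auto.
 - have [a [b [H1 H2]]] := IHi _ _ H. exists a, b. split; auto. simpl. rewrite H2. simpl.
  have Hl := damping_pos q Q q_bound h (INR i * h) Hh HQ.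
  have E : ((1 + h * q (INR i * h)) * y + h * f (x - h * y) - h * f (x - h * y)) / (1 + h * q (INR i * h)) = y by (field;
   lra). rewrite E. f_equal. ring.
Qed.

(** The area of the orbit of an open set is divided by the factor [1 + h q < 1]
    at each step; it cannot remain in a bounded region for too long. *)
Lemma area_bound h chi K n : 0 < h -> h * Q <= 1 / 2 -> 0 < K -> unif_cont2 chi ->
  (forall x y, chi x y <= 1) ->
  (forall a b i, (i <= n)%nat -> chi a b <> 0 ->
     Rabs (fst (orbit q f h a b i)) < K /\ Rabs (snd (orbit q f h a b i)) < K) ->
  box_integral K chi <= dilation h n * (4 * K * K).
Proof.
 intros Hh HQ HK Hchi H1 Hbox. have Hsup : forall i, (i <= n)%nat -> supported_in K (transport h chi i).
 { intros i Hi x y Hxy. have [a [b [A B]]] := transport_support h chi i x y Hh HQ Hxy. specialize (Hbox a b i Hi A).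
  rewrite B in Hbox. auto. }
 have Hdil : forall i, 0 < dilation h i.
 { induction i; simpl; [lra|]. apply Rmult_lt_0_compat; auto. have Hl := damping_pos q Q q_bound h (INR i * h) Hh HQ. lra. }
 have E : forall i, (i <= n)%nat -> dilation h i * box_integral K (transport h chi i) = box_integral K chi.
 { induction i; intros Hi; simpl; [ring|]. rewrite Rmult_assoc. have Hl := damping_pos q Q q_bound h (INR i * h) Hh HQ.
  rewrite box_integral_sheared; auto.
  - apply IHi; lia.
  - lra.
  - apply unif_cont2_transport; auto.
  - apply Hsup; lia.
  - apply (Hsup (S i)); auto. }
 rewrite <- (E n (le_n n)). apply Rmult_le_compat_l; [apply Rlt_le; auto|].
 apply box_integral_le; auto.
 - apply unif_cont2_transport; auto.
 - have G : forall i x y, transport h chi i x y <= 1. { induction i; simpl; auto. intros; apply IHi. } auto.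
Qed.

End Transport.

Definition tent (e t : R) : R := Rmax 0 (1 - Rabs t / e).

Lemma tent_range e t : 0 < e -> 0 <= tent e t <= 1.
Proof.
 split; [apply Rmax_l|]. apply Rmax_lub; [lra|]. assert (0 <= Rabs t / e) by (apply Rdiv_le_0_compat; auto; apply Rabs_pos).
 lra.
Qed.

Lemma tent_pos e t : 0 < e -> (0 < tent e t <-> Rabs t < e).
Proof.
 intros He. unfold tent, Rmax. have E : Rabs t / e * e = Rabs t by (field; lra). destruct Rle_dec; split; intros H; nra.
Qed.

Lemma tent_lipschitz e s t : 0 < e -> Rabs (tent e s - tent e t) <= Rabs (s - t) / e.
Proof.
 intros He. unfold tent. have E : Rabs (Rabs s / e - Rabs t / e) <= Rabs (s - t) / e.
 { unfold Rdiv. rewrite <- Rmult_minus_distr_r, Rabs_mult, (Rabs_right (/ e)).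
  - apply Rmult_le_compat_r; [apply Rlt_le, Rinv_0_lt_compat; auto|]. by_cases.
  - apply Rle_ge, Rlt_le, Rinv_0_lt_compat; auto. }
 by_cases.
Qed.

Lemma tent_product_unif e x0 y0 : 0 < e -> unif_cont2 (fun x y => tent e (x - x0) * tent e (y - y0)).
Proof.
 intros He eps Heps. exists (e * eps / 2). split; [nra|]. intros x x' y y' Hx Hy.
 have T1 := tent_lipschitz e (x - x0) (x' - x0) He. have T2 := tent_lipschitz e (y - y0) (y' - y0) He.
 replace (x - x0 - (x' - x0)) with (x - x') in T1 by ring. replace (y - y0 - (y' - y0)) with (y - y') in T2 by ring.
 have B1 := tent_range e (x - x0) He. have B2 := tent_range e (y' - y0) He.
 replace (tent e (x - x0) * tent e (y - y0) - tent e (x' - x0) * tent e (y' - y0)) with (tent e (x - x0) * (tent e (y - y0) -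
  tent e (y' - y0)) + (tent e (x - x0) - tent e (x' - x0)) * tent e (y' - y0)) by ring.
 have D : forall w, Rabs w < e * eps / 2 -> Rabs w / e < eps / 2.
 { intros w Hw. apply Rmult_lt_reg_r with e; auto. unfold Rdiv. rewrite Rmult_assoc, Rinv_l by lra. lra. } apply D in Hx.
 apply D in Hy. eapply Rle_lt_trans; [apply Rabs_triang|]. rewrite !Rabs_mult.
 rewrite Rabs_right, (Rabs_right (tent e (y' - y0))) by lra. have P2 := Rabs_pos (tent e (y - y0) - tent e (y' - y0)). nra.
Qed.

Lemma tent_continuous e x0 x : 0 < e -> continuous (fun x => tent e (x - x0)) x.
Proof.
 intros He. apply eps_continuous. intros eps Heps. exists (e * eps). split; [nra|]. intros y Hy.
 eapply Rle_lt_trans; [apply tent_lipschitz; auto|]. replace (y - x0 - (x - x0)) with (y - x) by ring.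
 apply Rmult_lt_reg_r with e; auto. unfold Rdiv. rewrite Rmult_assoc, Rinv_l by lra. lra.
Qed.

Lemma tent_integral e x0 K : 0 < e -> Rabs x0 + e < K -> 0 < RInt (fun x => tent e (x - x0)) (- K) K.
Proof.
 intros He HK. have Hc : forall x, continuous (fun x => tent e (x - x0)) x. { intro x. apply tent_continuous; auto. }
 have Z : forall x, x < x0 - e \/ x0 + e < x -> tent e (x - x0) = 0.
 { intros x Hx. apply NNPP; intro N. have B := tent_range e (x - x0) He. have P : 0 < tent e (x - x0) by lra.
  apply tent_pos in P; auto. by_cases. }
 have HK2 : - K < x0 - e /\ x0 + e < K by by_cases.
 rewrite (RInt_support _ _ K (x0 - e) (x0 + e)); auto; try lra.
 - apply RInt_gt_0; [lra| |]; intros; auto. apply tent_pos; auto. by_cases.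
 - intros x Hx. apply Z. lra.
Qed.

(** If all orbits that go back in time from a small square stayed in a box until
    [rho], friction would expand the square by [(z / rho) ^ d], which exceeds the
    area of the box when [z] is large. The escaping orbits of the scheme converge
    to an escaping trajectory. *)
Theorem area_escape (f : R -> R) (M d rho K x0 y0 e : R) :
  (forall x, Rabs (f x) <= M) -> unif_cont f -> 1 <= d -> 0 < rho -> 0 < e ->
  exists z u v, rho < z /\
    (forall r, rho <= r <= z -> continuous u r /\ continuous v r) /\
    (forall r, rho < r < z -> ode_at (fun r => d / r) f u v r) /\
    Rabs (u z - x0) <= e /\ Rabs (v z - y0) <= e /\
    exists r, rho <= r <= z /\ (K <= Rabs (u r) \/ K <= Rabs (v r)).
Proof.
 intros HM Hf Hd Hrho He. set (K1 := Rabs K + Rabs x0 + Rabs y0 + e + 1). have PK := Rabs_pos K. have Px := Rabs_pos x0.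
 have Py := Rabs_pos y0. have HK1 : 0 < K1 /\ K <= K1 /\ Rabs x0 + e < K1 /\ Rabs (- y0) + e < K1.
 { rewrite Rabs_Ropp. have P := Rle_abs K. unfold K1. lra. } case: HK1 => [HK1 [HK2 [HK3 HK4]]].
 set (chi := fun x y => tent e (x - x0) * tent e (y - - y0)). have Hchi : unif_cont2 chi by (apply tent_product_unif).
 have Hchi1 : forall x y, chi x y <= 1.
 { intros x y. unfold chi. have B1 := tent_range e (x - x0) He. have B2 := tent_range e (y - - y0) He. nra. }
 have Hchi0 : forall x y, chi x y <> 0 -> Rabs (x - x0) < e /\ Rabs (y - - y0) < e.
 { intros x y H. unfold chi in H. have B1 := tent_range e (x - x0) He. have B2 := tent_range e (y - - y0) He.
  split; apply tent_pos; nra. }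
 set (A := box_integral K1 chi). have HA : 0 < A.
 { unfold A, box_integral.
  have E : forall x, RInt (fun y => tent e (x - x0) * tent e (y - - y0)) (- K1) K1 = RInt (fun y => tent e (y - - y0)) (-
   K1) K1 * tent e (x - x0).
  { intro x. rewrite Rmult_comm. apply (RInt_scal (fun y => tent e (y - - y0))). apply ex_RInt_cont. intro y.
   apply tent_continuous; auto. }
  rewrite (RInt_ext _ _ _ _ (fun x _ => E x)).
  apply Rlt_le_trans with (RInt (fun y => tent e (y - - y0)) (- K1) K1 * RInt (fun x => tent e (x - x0)) (- K1) K1).
  - apply Rmult_lt_0_compat; apply tent_integral; auto.
  - apply Req_le. symmetry. apply (RInt_scal (fun x => tent e (x - x0))). apply ex_RInt_cont. intro y.
   apply tent_continuous; auto. }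
 set (z := rho * (4 * K1 * K1 / A + 2)). have Hc : 0 < 4 * K1 * K1 / A by positive.
 have Hz : rho < z by (unfold z; nra). set (q := fun t => - (d / Rmax rho (z - t))). set (Q := d / rho).
 destruct (friction_cut d rho (fun t => z - t) Hrho by_lra (continuous_backward z)) as [HQ1 HQ2].
 have HQ : forall t, Rabs (q t) <= Q by (intro; unfold q; rewrite Rabs_Ropp; apply HQ1).
 have HQ0 : 0 <= Q by (unfold Q; apply Rdiv_le_0_compat; lra).
 have Hqc : forall t, continuous q t by (intro; apply (continuous_opp (fun t => d / Rmax rho (z - t))), HQ2).
 set (m0 := Z.to_nat (up (2 * Q * (z - rho)))). have Hm0 : 2 * Q * (z - rho) <= INR m0.
 { unfold m0. have [A1 A2] := archimed (2 * Q * (z - rho)). assert (0 <= 2 * Q * (z - rho)) by nra.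
  rewrite INR_IZR_INZ, Z2Nat.id; [lra|]. apply le_IZR. lra. }
 set (N := fun m : nat => (S m + m0)%nat).
 set (hn := fun m => (z - rho) / INR (N m)). have HN : forall m, 0 < INR (N m) by (intro; apply lt_0_INR; unfold N; lia).
 have HNh : forall m, INR (N m) * hn m = z - rho. { intro m. unfold hn. field. specialize (HN m). lra. }
 have Hhn : forall m, 0 < hn m /\ hn m * Q <= 1 / 2.
 { intro m. specialize (HN m). split; [positive|]. unfold hn. apply Rmult_le_reg_r with (INR (N m)); auto. unfold Rdiv.
  replace ((z - rho) * / INR (N m) * Q * INR (N m)) with ((z - rho) * Q) by (field; lra).
  assert (INR m0 <= INR (N m)) by (apply le_INR; unfold N; lia). lra. }
 have Hh0 : is_lim_seq hn 0.
 { replace 0 with ((z - rho) * 0) by ring. apply is_lim_seq_mult'; [apply is_lim_seq_const|].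
  apply (is_lim_seq_ext (fun m => / INR (m + S m0))). { intro m. unfold N. do 2 f_equal. lia. }
  apply (is_lim_seq_incr_n (fun m => / INR m)). apply (is_lim_seq_inv INR p_infty); [apply is_lim_seq_INR|discriminate]. }
 have Hdil : forall m i, (i <= N m)%nat -> dilation q (hn m) i <= (z - INR i * hn m) / z /\ 0 <= dilation q (hn m) i.
 { intros m i. have [G1 G2] := Hhn m. induction i; intros Hi.
  - simpl. replace ((z - 0 * hn m) / z) with 1 by (field; lra). lra.
  - have [I1 I2] := IHi ltac:(lia). have D := damping_pos q Q HQ (hn m) (INR i * hn m) G1 G2.
   have B : INR (S i) * hn m <= z - rho. { rewrite <- (HNh m). apply Rmult_le_compat_r; [lra|]. apply le_INR; auto. }
   rewrite S_INR in *. simpl. split; [|positive].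
   apply Rle_trans with ((z - INR i * hn m) / z * ((z - (INR i + 1) * hn m) / (z - INR i * hn m))).
   + apply Rmult_le_compat; try lra. unfold q. rewrite Rmax_right by nra.
    replace ((z - (INR i + 1) * hn m) / (z - INR i * hn m)) with (1 - hn m / (z - INR i * hn m)) by (field; lra).
    assert (0 < hn m / (z - INR i * hn m)) by positive. nra.
   + apply Req_le. field. lra. }
 have Hesc : forall m, exists a b i, (i <= N m)%nat /\ chi a b <> 0 /\ (K1 <= Rabs (fst (orbit q f (hn m) a b i)) \/ K1 <=
  Rabs (snd (orbit q f (hn m) a b i))).
 { intro m. have [G1 G2] := Hhn m. apply NNPP; intro Hno. have AB : A <= dilation q (hn m) (N m) * (4 * K1 * K1).
  { apply (area_bound q f Q); auto. intros a b i Hi Hab. split; apply Rnot_le_lt; intro H; apply Hno; exists a, b, i; auto. }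
  have [D1 D2] := Hdil m (N m) (le_n _). rewrite HNh in D1. assert (rho / z * (4 * K1 * K1) < A).
  { have E2 : 4 * K1 * K1 / A * A = 4 * K1 * K1 by (field; lra). have E3 : rho / z * (4 * K1 * K1 / A + 2) = 1.
   { replace (4 * K1 * K1 / A + 2) with (z / rho) by (unfold z; field; lra). field. lra. } nra. }
  nra. }
 destruct (choice (fun m (p : R * R * nat) => (snd p <= N m)%nat /\ chi (fst (fst p)) (snd (fst p)) <> 0 /\ (K1 <= Rabs (fst
  (orbit q f (hn m) (fst (fst p)) (snd (fst p)) (snd p))) \/ K1 <= Rabs (snd (orbit q f (hn m) (fst (fst p)) (snd (fst p))
  (snd p)))))) as [p Hp]. { intro m. have [a [b [i H]]] := Hesc m. exists (a, b, i). auto. }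
 set (an := fun m => fst (fst (p m))). set (bn := fun m => snd (fst (p m))). set (tn := fun m => INR (snd (p m)) * hn m).
 have Ht : forall m, 0 <= tn m <= z - rho.
 { intro m. have [H1 _] := Hp m. destruct (Hhn m). split.
  - apply Rmult_le_pos; [positive|lra].
  - rewrite <- (HNh m). apply Rmult_le_compat_r; [lra|]. apply le_INR; auto. }
 destruct (diagonal_subsequence (fun k m => match k with O => an m | 1%nat => bn m | _ => tn m end) (fun k => match k with O
  => Rabs x0 + e | 1%nat => Rabs y0 + e | _ => z end)) as [psi [Ppsi Hpsi]].
 { intros k m. have [_ [H2 _]] := Hp m. apply Hchi0 in H2. case: H2 => [H2 H3]. fold (an m) in H2. fold (bn m) in H3.
  case: k => [|[|k]].
  - by_cases.
  - by_cases.
  - specialize (Ht m). by_cases. }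
 have [a Ha] := Hpsi O. have [b Hb] := Hpsi 1%nat. have [t Htl] := Hpsi 2%nat.
 destruct (scheme_limit q f Q M HQ Hqc HM Hf (fun m => hn (psi m)) (fun m => an (psi m)) (fun m => bn (psi m)) a b (Rabs y0 +
  e)) as [phi [u [v [Pphi [Hu [Hv [Hu0 [Hv0 [HKl [[HKu HKv] Hode]]]]]]]]]]; auto. { apply subseq_lim; auto. }
 { intro m. have [_ [H2 _]] := Hp (psi m). apply Hchi0 in H2. fold (bn (psi m)) in H2. by_cases. }
 set (Ka := slope_bound Q M (Rabs y0 + e)) in *. have Htr : 0 <= t <= z - rho.
 { split.
  - apply (is_lim_seq_le (fun _ => 0) (fun m => tn (psi m)) 0 t); auto.
   + intro; apply Ht.
   + apply is_lim_seq_const.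
  - apply (is_lim_seq_le (fun m => tn (psi m)) (fun _ => z - rho) t (z - rho)); auto.
   + intro; apply Ht.
   + apply is_lim_seq_const. }
 have Hab : Rabs (a - x0) <= e /\ Rabs (b - - y0) <= e.
 { have G : forall (x : nat -> R) (l c : R), is_lim_seq x l -> (forall m, Rabs (x m - c) < e) -> Rabs (l - c) <= e.
  { intros x l c Hx H. apply (is_lim_seq_le (fun m => Rabs (x m - c)) (fun _ => e) (Rabs (l - c)) e).
   - intro m. apply Rlt_le; auto.
   - apply (is_lim_seq_abs _ (Finite (l - c))). apply is_lim_seq_minus'; auto. apply is_lim_seq_const.
   - apply is_lim_seq_const. }
  split; [apply (G (fun m => an (psi m)))|apply (G (fun m => bn (psi m)))]; auto; intro m; destruct (Hp (psi m)) as [_ [H2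
   _]]; apply Hchi0 in H2; apply H2. }
 have Hcont : forall s, continuous u s /\ continuous v s.
 { split; apply (lipschitz_continuous Ka); intros T s1 s2 H1 H2; apply HKl; auto. }
 have Hrev : forall (g : R -> R) r, continuous g (z - r) -> continuous (fun r => g (z - r)) r.
 { intros g r Hg. apply continuous_comp; auto. apply (ex_derive_continuous (V := R_NormedModule)). auto_derive; auto. }
 exists z, (fun r => u (z - r)), (fun r => - v (z - r)). split; auto. split; [|split; [|split; [|split]]].
 - split.
  + apply Hrev. apply Hcont.
  + apply (continuous_opp (fun r => v (z - r))). apply Hrev. apply Hcont.
 - intros r Hr. destruct (Hode (z - r)) as [O1 O2]; [lra|]. split.
  + evar_last.
   * apply is_derive_comp; [exact O1|].
    evar_last; [apply (is_derive_minus (fun _ => z)); [apply is_derive_const|apply is_derive_id]|]. auto.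
   * unfold scal, minus, plus, opp, zero, one; simpl; unfold mult; simpl. ring.
  + evar_last.
   * apply (is_derive_opp (fun r => v (z - r))). apply is_derive_comp; [exact O2|].
    evar_last; [apply (is_derive_minus (fun _ => z)); [apply is_derive_const|apply is_derive_id]|]. auto.
   * unfold scal, minus, plus, opp, zero, one; simpl; unfold mult; simpl. unfold q. rewrite Rmax_right by lra. field. lra.
 - replace (z - z) with 0 by ring. abs_bounds.
 - replace (z - z) with 0 by ring. abs_bounds.
 - exists (z - t). replace (z - (z - t)) with t by ring. rewrite Rabs_Ropp. apply NNPP; intro Hno.
  set (s := Rmin (K1 - Rabs (u t)) (K1 - Rabs (v t))). have Hs : 0 < s by (apply Rmin_glb_lt; lra).
  have Hs1 := Rmin_l (K1 - Rabs (u t)) (K1 - Rabs (v t)). have Hs2 := Rmin_r (K1 - Rabs (u t)) (K1 - Rabs (v t)).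
  fold s in Hs1, Hs2. have Htz : forall x, 0 <= x <= z - rho -> Rabs x <= z by abs_bounds.
  have Hsm : is_lim_seq (fun m => Ka z * Rabs (tn (psi (phi m)) - t) + Ka z * hn (psi (phi m))) (Ka z * Rabs (t - t) + Ka z
   * 0).
  { apply is_lim_seq_plus'; apply is_lim_seq_mult'; try apply is_lim_seq_const.
   - apply (is_lim_seq_abs _ (Finite (t - t))). apply is_lim_seq_minus'; [|apply is_lim_seq_const].
    apply (subseq_lim (fun m => tn (psi m))); auto.
   - apply (subseq_lim (fun m => hn (psi m))); auto. apply subseq_lim; auto. }
  rewrite Rminus_diag, Rabs_R0 in Hsm.
  destruct (proj1 (lim_seq_eps _ _) Hsm (s / 2)) as [N1 HN1]; [lra|].
  destruct (proj1 (lim_seq_eps _ _) (Hu t) (s / 2)) as [N2 HN2]; [lra|].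
  destruct (proj1 (lim_seq_eps _ _) (Hv t) (s / 2)) as [N3 HN3]; [lra|]. set (m := max N1 (max N2 N3)).
  specialize (HN1 m ltac:(lia)). specialize (HN2 m ltac:(lia)). specialize (HN3 m ltac:(lia)). apply Rabs_lt_between in HN1.
  have HT := Ht (psi (phi m)). have Bu := HKu (phi m) z t (tn (psi (phi m))) (Htz _ Htr) (Htz _ HT).
  have Bv := HKv (phi m) z t (tn (psi (phi m))) (Htz _ Htr) (Htz _ HT). have [_ [_ Hout]] := Hp (psi (phi m)).
  have Eu : orbit_u q f (hn (psi (phi m))) (an (psi (phi m))) (bn (psi (phi m))) (tn (psi (phi m))) = fst (orbit q f (hn
   (psi (phi m))) (an (psi (phi m))) (bn (psi (phi m))) (snd (p (psi (phi m))))).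
  { unfold orbit_u, tn. rewrite grid_index_mult; auto. apply Hhn. }
  have Ev : orbit_v q f (hn (psi (phi m))) (an (psi (phi m))) (bn (psi (phi m))) (tn (psi (phi m))) = snd (orbit q f (hn
   (psi (phi m))) (an (psi (phi m))) (bn (psi (phi m))) (snd (p (psi (phi m))))).
  { unfold orbit_v, tn. rewrite grid_index_mult; auto. apply Hhn. } fold (an (psi (phi m))) in Hout.
  fold (bn (psi (phi m))) in Hout. rewrite <- Eu, <- Ev in Hout.
  have T3 : forall x y c : R, Rabs x <= Rabs (x - y) + Rabs (y - c) + Rabs c.
  { intros x y c. replace x with ((x - y) + ((y - c) + c)) at 1 by ring. eapply Rle_trans; [apply Rabs_triang|].
   have P := Rabs_triang (y - c) c. lra. }
  case: Hout => Hout; eapply Rle_not_lt; try exact Hout.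
  + eapply Rle_lt_trans; [apply (T3 _ (orbit_u q f (hn (psi (phi m))) (an (psi (phi m))) (bn (psi (phi m))) t) (u t))|].
   lra.
  + eapply Rle_lt_trans; [apply (T3 _ (orbit_v q f (hn (psi (phi m))) (an (psi (phi m))) (bn (psi (phi m))) t) (v t))|].
   lra.
Qed.

(** * Trajectories of the equation: energy, uniqueness, compactness *)

(** The common content of the two sets of assumptions, on the open interval [D]
    where solutions live.  By [nl_coercive] both ends of [D] are higher for [F]
    than any point of [D], so that an energy level confines. *)
Record nonlinearity (D : R -> Prop) (f : R -> R) (delta : R) : Prop := {
  nl_zero : D 0;
  nl_conv : forall a b x, D a -> D b -> a <= x <= b -> D x;
  nl_open : forall x, D x -> exists e, 0 < e /\ forall y, Rabs (y - x) < e -> D y;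
  nl_cont : forall x, D x -> continuous f x;
  nl_lip : forall x, D x -> x <> 0 -> exists L e, 0 < e /\ 0 <= L /\
    forall y z, Rabs (y - x) < e -> Rabs (z - x) < e -> Rabs (f y - f z) <= L * Rabs (y - z);
  nl_f0 : f 0 = 0;
  nl_coercive : forall x, D x -> exists A B, D A /\ D B /\ A < 0 < B /\ A < x < B /\
    primitive f x < primitive f A /\ primitive f x < primitive f B;
  nl_delta : 0 < delta;
  nl_neg : forall s, D s -> 0 < Rabs s < delta -> primitive f s < 0;
  nl_finite : exists l : list R, forall s, D s -> delta < Rabs s -> f s = 0 -> In s l
}.

Arguments nl_zero {D f delta}.
Arguments nl_conv {D f delta}.
Arguments nl_open {D f delta}.
Arguments nl_cont {D f delta}.
Arguments nl_lip {D f delta}.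
Arguments nl_f0 {D f delta}.
Arguments nl_coercive {D f delta}.
Arguments nl_delta {D f delta}.
Arguments nl_neg {D f delta}.
Arguments nl_finite {D f delta}.

Definition clamp (A B x : R) : R := Rmax A (Rmin B x).

Lemma clamp_range A B x : A <= B -> A <= clamp A B x <= B.
Proof. unfold clamp. by_cases. Qed.

Lemma clamp_id A B x : A <= x <= B -> clamp A B x = x.
Proof. unfold clamp. by_cases. Qed.

Lemma clamp_lipschitz A B x y : A <= B -> Rabs (clamp A B x - clamp A B y) <= Rabs (x - y).
Proof. unfold clamp. by_cases. Qed.

Lemma is_derive_reflect (g : R -> R) x l : is_derive g (- x) l -> is_derive (fun t => g (- t)) x (- l).
Proof.
 intros H. auto_derive; [exists l; auto|].
 match goal with |- context [Derive ?h ?y] => replace (Derive h y) with l end; [ring|].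
 symmetry; apply is_derive_unique; auto.
Qed.

Lemma two_sided_gronwall (g g' : R -> R) (C a b : R) : a <= b ->
  (forall x, a <= x <= b -> continuous g x) ->
  (forall x, a < x < b -> is_derive g x (g' x) /\ Rabs (g' x) <= C * g x) ->
  g b <= g a * exp (C * (b - a)) /\ g a <= g b * exp (C * (b - a)).
Proof.
 intros Hab Hc Hd. split.
 - apply (gronwall g g'); auto. intros x Hx. destruct (Hd x Hx) as [H1 H2]. split; auto. by_cases.
 - assert (E := gronwall (fun t => g (- t)) (fun t => - g' (- t)) C (- b) (- a)). cbv beta in E.
  rewrite !Ropp_involutive in E. replace (- a - - b) with (b - a) in E by ring. apply E; [lra| |].
  + intros x Hx. apply continuous_opp_arg, Hc; lra.
  + intros x Hx. destruct (Hd (- x)) as [H1 H2]; [lra|]. split.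
   * apply is_derive_reflect; auto.
   by_cases.
Qed.

Lemma lipschitz_of_deriv (g g' : R -> R) (K a b : R) : a <= b ->
  (forall x, a <= x <= b -> continuous g x) ->
  (forall x, a < x < b -> is_derive g x (g' x) /\ Rabs (g' x) <= K) ->
  Rabs (g b - g a) <= K * (b - a).
Proof.
 intros [Hab| ->] Hc Hd.
 - destruct (mean_value g g' a b) as [c [H1 H2]]; auto. { intros; apply Hd; auto. }
  rewrite H2, Rabs_mult, (Rabs_right (b - a)) by lra. apply Rmult_le_compat_r; [lra|]. apply Hd; auto.
 by_cases.
Qed.

Lemma is_derive_square (g : R -> R) x l : is_derive g x l -> is_derive (fun t => g t ^ 2) x (2 * g x * l).
Proof.
 intros H. auto_derive; [exists l; auto|].
 match goal with |- context [Derive ?h ?y] => replace (Derive h y) with l end; [ring|].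
 symmetry; apply is_derive_unique; auto.
Qed.

Lemma is_derive_sum (g h : R -> R) x l m : is_derive g x l -> is_derive h x m ->
  is_derive (fun t => g t + h t) x (l + m).
Proof. apply (is_derive_plus g). Qed.

Lemma is_derive_diff (g h : R -> R) x l m : is_derive g x l -> is_derive h x m ->
  is_derive (fun t => g t - h t) x (l - m).
Proof. apply (is_derive_minus g). Qed.

Lemma is_derive_prod (g h : R -> R) x l m : is_derive g x l -> is_derive h x m ->
  is_derive (fun t => g t * h t) x (l * h x + g x * m).
Proof. intros H1 H2. apply (is_derive_mult g); auto. intros; apply Rmult_comm. Qed.

Lemma is_derive_cmul (c : R) (g : R -> R) x l : is_derive g x l -> is_derive (fun t => c * g t) x (c * l).
Proof. apply is_derive_scal. Qed.

Lemma is_derive_value (g : R -> R) x l m : is_derive g x l -> l = m -> is_derive g x m.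
Proof. congruence. Qed.

Lemma is_derive_continuous (g : R -> R) x l : is_derive g x l -> continuous g x.
Proof. intros H. apply (ex_derive_continuous (V := R_NormedModule)). exists l; auto. Qed.

Lemma continuous_sum (g h : R -> R) x : continuous g x -> continuous h x -> continuous (fun t => g t + h t) x.
Proof. apply (continuous_plus g). Qed.

Lemma continuous_diff (g h : R -> R) x : continuous g x -> continuous h x -> continuous (fun t => g t - h t) x.
Proof. apply (continuous_minus g). Qed.

Lemma continuous_prod (g h : R -> R) x : continuous g x -> continuous h x -> continuous (fun t => g t * h t) x.
Proof. apply (continuous_mult g). Qed.

Lemma continuous_square (g : R -> R) x : continuous g x -> continuous (fun t => g t ^ 2) x.
Proof. intros H. apply (continuous_ext (fun t => g t * g t)); [by_cases|]. apply continuous_prod; auto. Qed.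

Lemma tangent_of_deriv (g g' : R -> R) r0 s e :
  (forall x, Rabs (x - r0) <= Rabs (s - r0) -> is_derive g x (g' x) /\ Rabs (g' x - g' r0) <= e) ->
  Rabs (g s - g r0 - (s - r0) * g' r0) <= e * Rabs (s - r0).
Proof.
 intros H. set (h := fun x => g x - g' r0 * x).
 have Hh : forall x, Rabs (x - r0) <= Rabs (s - r0) -> is_derive h x (g' x - g' r0).
 { intros x Hx. apply (is_derive_value _ _ (g' x - g' r0 * 1)); [|apply f_equal, Rmult_1_r].
  apply is_derive_diff; [apply H; auto|apply is_derive_cmul, (is_derive_id x)]. }
 replace (g s - g r0 - (s - r0) * g' r0) with (h s - h r0) by (unfold h; ring). have [Hs|Hs] := Rle_lt_dec r0 s.
 - rewrite (Rabs_right (s - r0)) by lra. apply (lipschitz_of_deriv h (fun x => g' x - g' r0)); auto.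
  + intros x Hx. apply (is_derive_continuous _ _ _ (Hh x ltac:(by_cases))).
  + split; [apply Hh|apply H]; by_cases.
 - rewrite Rabs_minus_sym, (Rabs_minus_sym s), (Rabs_right (r0 - s)) by lra.
  apply (lipschitz_of_deriv h (fun x => g' x - g' r0)); [lra| |].
  + intros x Hx. apply (is_derive_continuous _ _ _ (Hh x ltac:(by_cases))).
  + split; [apply Hh|apply H]; by_cases.
Qed.

Ltac smooth := intros; repeat first [apply continuous_sum | apply continuous_diff | apply continuous_prod | apply continuous_square
  | apply continuous_const | apply continuous_id | match goal with |- continuity_pt _ _ => apply continuous_continuity_pt end]; auto.

(** The limit of solutions is a solution: near [r0] the approximation by the
    tangent is uniform in the sequence, because speeds are equi-Lipschitz. *)
Lemma ode_limit (q f : R -> R) (un vn : nat -> R -> R) (u v : R -> R) (r0 e0 K W : R) (N : nat) :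
  0 < e0 -> continuous q r0 -> unif_cont f ->
  (forall t, is_lim_seq (fun n => un n t) (u t)) -> (forall t, is_lim_seq (fun n => vn n t) (v t)) ->
  (forall n r, (N <= n)%nat -> Rabs (r - r0) < e0 -> ode_at q f (un n) (vn n) r /\ Rabs (vn n r) <= W) ->
  (forall n s t, (N <= n)%nat -> Rabs (s - r0) < e0 -> Rabs (t - r0) < e0 ->
     Rabs (un n t - un n s) <= K * Rabs (t - s) /\ Rabs (vn n t - vn n s) <= K * Rabs (t - s)) ->
  ode_at q f u v r0.
Proof.
 intros He0 Hq Hf Hu Hv Hode Hlip. have Hself : Rabs (r0 - r0) < e0 by by_cases. have HW : 0 <= W.
 { have [_ H] := Hode N r0 (le_n _) Hself. by_cases. }
 have Tan : forall e, 0 < e -> exists d, 0 < d <= e0 /\ forall n x, (N <= n)%nat -> Rabs (x - r0) < d -> Rabs (vn n x - vn n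
  r0) <= e /\ Rabs (- q x * vn n x - f (un n x) - (- q r0 * vn n r0 - f (un n r0))) <= e.
 { intros e He. have [d [Hd H]] := field_near q f r0 W e Hq Hf HW He. have P := Rabs_pos K.
  have Hm : 0 < Rmin d e by abs_bounds. have M1 := Rmin_l d e. have M2 := Rmin_r d e. set (d1 := Rmin d e / (Rabs K + 1)).
  have Hd1 : 0 < d1 by positive. exists (Rmin e0 (Rmin d d1)). split. { by_cases. } intros n x Hn Hx.
  apply Rmin_Rgt_l in Hx as [X1 Hx]. apply Rmin_Rgt_l in Hx as [X2 X3]. have [L1 L2] := Hlip n r0 x Hn Hself X1.
  have P2 := Rabs_pos (x - r0). have P3 := Rle_abs K. have E : d1 * (Rabs K + 1) = Rmin d e by (unfold d1; field; lra).
  have G : K * Rabs (x - r0) < Rmin d e by nra. split; [lra|]. apply H; try lra. apply (Hode n x Hn X1). }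
 split.
 - apply (limit_derive (fun n => un n) (fun n => vn n r0) (fun _ => 0)); auto; [apply is_lim_seq_const|]. intros e He.
  have [d [Hd H]] := Tan e He. exists d, N. split; [lra|]. intros n s Hn Hs. rewrite Rplus_0_r. apply tangent_of_deriv.
  split; [apply (Hode n x Hn); lra|apply (H n x Hn); lra].
 - apply (limit_derive (fun n => vn n) (fun n => - q r0 * vn n r0 - f (un n r0)) (fun _ => 0)); auto; [|apply
   is_lim_seq_const|].
  + apply is_lim_seq_minus'; [apply is_lim_seq_mult'; [apply is_lim_seq_const|auto]|]. apply is_lim_seq_continuous; auto.
   apply continuous_continuity_pt, unif_cont_continuous; auto.
  + intros e He. have [d [Hd H]] := Tan e He. exists d, N. split; [lra|]. intros n s Hn Hs. rewrite Rplus_0_r.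
   apply (tangent_of_deriv _ (fun x => - q x * vn n x - f (un n x))).
   split; [apply (Hode n x Hn); lra|apply (H n x Hn); lra].
Qed.

Definition energy (f u v : R -> R) (r : R) : R := v r ^ 2 / 2 + primitive f (u r).

(** [u'' + (n/r) u' + f(u) = 0]. *)
Notation radial n f u v r := (ode_at (fun s : R => INR n / s) f u v r).

(** The solution that starts from rest at height [al] at time [rho], extended by
    a constant before [rho].  For [rho = 0] these are the radial solutions of
    the problem; starting times [rho > 0] provide a second parameter. *)
Record rest_sol (n : nat) (D : R -> Prop) (f : R -> R) (rho al : R) (u v : R -> R) : Prop := {
  rs_rho : 0 <= rho;
  rs_rest : forall r, r <= rho -> u r = al /\ v r = 0;
  rs_dom : forall r, D (u r);
  rs_cont : forall r, continuous u r /\ continuous v r;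
  rs_ode : forall r, rho < r -> radial n f u v r
}.

Arguments rs_rho {n D f rho al u v}.
Arguments rs_rest {n D f rho al u v}.
Arguments rs_dom {n D f rho al u v}.
Arguments rs_cont {n D f rho al u v}.
Arguments rs_ode {n D f rho al u v}.

Ltac smooth ::= intros; repeat first [apply continuous_sum | apply continuous_diff | apply continuous_prod | apply continuous_square
  | apply continuous_const | apply continuous_id | match goal with |- continuity_pt _ _ => apply continuous_continuity_pt end
  | match goal with RS : rest_sol _ _ _ _ _ _ _ |- continuous _ ?x => apply (rs_cont RS x) end]; auto.

Section Trajectories.

Context {n D f delta} (n_pos : (1 <= n)%nat) (NL : nonlinearity D f delta).

Let F := primitive f.
Let d := INR n.

Lemma F_derive x : D x -> is_derive F x (f x).
Proof.
 intros Hx. have [e [He H]] := nl_open NL x Hx. apply (is_derive_RInt f F 0).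
 - exists (mkposreal e He). intros y Hy. apply (RInt_correct (V := R_CompleteNormedModule)). apply ex_RInt_continuous.
  intros z Hz. apply (nl_cont NL). have D0 := nl_zero NL. unfold Rmin, Rmax in Hz.
  destruct Rle_dec; eapply (nl_conv NL); try exact Hz; auto.
 - apply (nl_cont NL); auto.
Qed.

Lemma F_cont x : D x -> continuous F x.
Proof. intros H. apply (is_derive_continuous _ _ _ (F_derive x H)). Qed.

Lemma F_zero : F 0 = 0.
Proof. apply (RInt_point (V := R_CompleteNormedModule)). Qed.

Lemma D_between A B x : D A -> D B -> A <= x <= B -> D x.
Proof. apply (nl_conv NL). Qed.

Lemma f_bounded A B : D A -> D B -> A <= B -> exists M, 0 < M /\ forall x, A <= x <= B -> Rabs (f x) <= M.
Proof.
 intros HA HB HAB. destruct (continuity_ab_maj (fun x => Rabs (f x)) A B HAB) as [m [Hm _]].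
 { intros c Hc. apply continuous_continuity_pt. apply continuous_comp.
  - apply (nl_cont NL). apply (D_between A B); auto.
  - apply continuous_Rabs. }
 exists (Rabs (f m) + 1). split; [by_cases|]. intros x Hx. specialize (Hm x Hx). lra.
Qed.

Lemma F_lipschitz A B M x y : D A -> D B -> (forall x, A <= x <= B -> Rabs (f x) <= M) ->
  A <= x <= B -> A <= y <= B -> Rabs (F x - F y) <= M * Rabs (x - y).
Proof.
 intros HA HB HM. have G : forall x y, A <= x <= B -> A <= y <= B -> x <= y -> Rabs (F y - F x) <= M * (y - x).
 { clear x y. intros x y Hx Hy Hxy. apply (lipschitz_of_deriv F f); auto.
  - intros z Hz. apply F_cont, (D_between A B); auto; lra.
  - split; [apply F_derive, (D_between A B); auto; lra|]. apply HM; lra. }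
 intros Hx Hy. destruct (Rle_lt_dec x y).
 - rewrite Rabs_minus_sym, (Rabs_minus_sym x), (Rabs_right (y - x)) by lra. auto.
 - rewrite (Rabs_right (x - y)) by lra. apply G; lra.
Qed.

Definition clamped A B (x : R) : R := f (clamp A B x).

Lemma clamped_unif A B : D A -> D B -> A <= B -> unif_cont (clamped A B).
Proof.
 intros HA HB HAB e He. have Hc : forall x, A <= x <= B -> continuity_pt f x.
 { intros x Hx. apply continuous_continuity_pt, (nl_cont NL), (D_between A B); auto. }
 have [r Hr] := Heine_cor2 Hc (mkposreal e He). exists r. split; [apply cond_pos|]. intros x y Hxy.
 apply Hr; try (apply clamp_range; auto). eapply Rle_lt_trans; [apply clamp_lipschitz; auto|auto].
Qed.

Lemma clamped_id A B x : A <= x <= B -> clamped A B x = f x.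
Proof. intros H. unfold clamped. rewrite clamp_id; auto. Qed.

(** ** Energy *)

Lemma energy_derive u v r : D (u r) -> radial n f u v r ->
  is_derive (energy f u v) r (- (d / r) * v r ^ 2).
Proof.
 intros HD [H1 H2]. eapply is_derive_value.
 - apply is_derive_sum.
  + apply (is_derive_ext (fun t => / 2 * v t ^ 2)); [positive|]. apply is_derive_cmul, is_derive_square. exact H2.
  + apply is_derive_comp; [apply F_derive; auto|exact H1].
 - unfold scal; simpl; unfold mult; simpl. unfold d. lra.
Qed.

Lemma energy_cont u v r : D (u r) -> continuous u r -> continuous v r -> continuous (energy f u v) r.
Proof.
 intros HD H1 H2. apply continuous_sum.
 - apply (continuous_ext (fun t => / 2 * v t ^ 2)); [positive|]. apply continuous_prod; [apply continuous_const|].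
  apply continuous_square; auto.
 - apply continuous_comp; auto. apply F_cont; auto.
Qed.

Lemma energy_decreasing u v a b : 0 <= a <= b ->
  (forall r, a <= r <= b -> D (u r) /\ continuous u r /\ continuous v r) ->
  (forall r, a < r < b -> radial n f u v r) ->
  energy f u v b <= energy f u v a.
Proof.
 intros Hab Hc Ho. apply (nonincr_deriv _ (fun r => - (d / r) * v r ^ 2)); try lra.
 - intros x Hx. have [H1 [H2 H3]] := Hc x Hx. apply energy_cont; auto.
 - split; [apply energy_derive; auto; apply Hc; lra|]. assert (0 <= d / x) by (apply Rdiv_le_0_compat; [apply pos_INR|lra]).
  nra.
Qed.

(** Two points higher than the initial energy enclose the trajectory. *)
Lemma confined A B u v a b : D A -> D B -> 0 <= a -> a <= b ->
  A < u a < B -> energy f u v a < F A -> energy f u v a < F B ->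
  (forall r, a <= r <= b -> continuous u r /\ continuous v r) ->
  (forall r, a < r < b -> A <= u r <= B -> radial n f u v r) ->
  forall r, a <= r <= b -> A < u r < B.
Proof.
 intros HA HB Ha Hab Hu0 HEA HEB Hc Ho r Hr. assert (G : forall r, a <= r -> r <= b -> A < u r < B); [|apply G; lra].
 clear r Hr. intros r Hr. pattern r. apply (real_induction _ a); auto; clear r Hr.
 - intros r Hr IH Hrb. have Hcl : A <= u r <= B.
  { have [Hcu _] := Hc r by_lra. split; apply Rnot_lt_le; intro Hlt.
   - destruct (continuous_eps u r (A - u r) Hcu) as [e [He H]]; [lra|]. have B1 := IH (Rmax a (r - e / 2)).
    have B2 := H (Rmax a (r - e / 2)). by_cases.
   - destruct (continuous_eps u r (u r - B) Hcu) as [e [He H]]; [lra|]. have B1 := IH (Rmax a (r - e / 2)).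
    have B2 := H (Rmax a (r - e / 2)). by_cases. }
  have HE : energy f u v r <= energy f u v a.
  { apply energy_decreasing; auto.
   - intros s Hs. destruct (Hc s by_lra). repeat split; auto.
    destruct (Req_dec s r) as [->|Hsr]; [apply (D_between A B); auto|]. apply (D_between A B); auto.
    assert (A < u s < B) by (apply IH; lra). lra.
   - intros s Hs. apply Ho; [lra|]. assert (A < u s < B) by (apply IH; lra). lra. }
  have HF : F (u r) <= energy f u v r.
  { unfold energy. fold F. nra. } assert (u r <> A) by (intro E; rewrite E in HF; lra).
  assert (u r <> B) by (intro E; rewrite E in HF; lra). lra.
 - intros r Hr IH. have [Hbr|Hbr] := Rle_lt_dec b r. { exists 1. repeat split; lra. }
  have Hur : A < u r < B by (apply IH; lra). have [Hcu _] := Hc r by_lra.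
  destruct (continuous_eps u r (Rmin (u r - A) (B - u r)) Hcu) as [e [He H]]. { by_cases. } exists e. split; auto.
  intros s Hs _. have B2 := H s ltac:(by_cases). by_cases.
Qed.

(** The friction integrates to the factor [r^n], which bounds the speed at the
    start, uniformly in the starting time. *)
Lemma rest_speed u v rho M : 0 <= rho -> 0 <= M -> v rho = 0 ->
  (forall r, continuous v r) ->
  (forall r, rho < r -> is_derive v r (- (d / r) * v r - f (u r)) /\ Rabs (f (u r)) <= M) ->
  forall r, rho <= r -> Rabs (v r) <= M * (r - rho).
Proof.
 intros Hrho HM H0 Hc Ho r Hr. have [->|Hne] := Req_dec r rho. { by_cases. }
 have Pow : forall x, 0 < x -> 0 < x ^ n by positive. have Hpow : forall x, is_derive (fun x => x ^ n) x (d * x ^ pred n).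
 { intro x. auto_derive; auto. unfold d. ring. }
 have Hx : forall x, rho < x -> is_derive (fun x => x ^ n * v x) x (- x ^ n * f (u x)).
 { intros x Hx. have [O1 O2] := Ho x Hx. eapply is_derive_value.
  - apply is_derive_prod; [auto|exact O1].
  - destruct n as [|m]; [lia|]. simpl. field. lra. }
 have Hy : forall x, rho < x -> is_derive (fun x => M * (x ^ n * (x - rho))) x (M * (d * x ^ pred n * (x - rho) + x ^ n)).
 { intros x Hxr. eapply is_derive_value.
  - apply is_derive_cmul, is_derive_prod; auto. apply is_derive_diff; [apply is_derive_id|apply is_derive_const].
  - unfold one, zero; simpl. ring. }
 have Hcont : forall x, continuous (fun x => x ^ n * v x) x.
 { intro x. apply continuous_prod; auto. apply (is_derive_continuous _ _ _ (Hpow x)). }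
 have Hcont2 : forall x, continuous (fun x => M * (x ^ n * (x - rho))) x.
 { intro x. apply (ex_derive_continuous (V := R_NormedModule)). auto_derive; auto. }
 have Low : forall x, rho < x -> 0 <= M * (d * x ^ pred n * (x - rho)) by positive. have Pr := Pow r by_lra.
 apply Rabs_le. split.
 - have E : rho ^ n * v rho + M * (rho ^ n * (rho - rho)) <= r ^ n * v r + M * (r ^ n * (r - rho)).
  { apply (nondecr_deriv (fun x => x ^ n * v x + M * (x ^ n * (x - rho))) (fun x => - x ^ n * f (u x) + M * (d * x ^ pred n
    * (x - rho) + x ^ n))); auto.
   - intros x _. apply continuous_sum; auto.
   - split; [apply is_derive_sum; [apply Hx|apply Hy]; lra|]. specialize (Low x by_lra). specialize (Pow x by_lra).
    have [_ O2] := Ho x by_lra. apply Rabs_le_between in O2. nra. }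
  nra.
 - have E : r ^ n * v r - M * (r ^ n * (r - rho)) <= rho ^ n * v rho - M * (rho ^ n * (rho - rho)).
  { apply (nonincr_deriv (fun x => x ^ n * v x - M * (x ^ n * (x - rho))) (fun x => - x ^ n * f (u x) - M * (d * x ^ pred n
    * (x - rho) + x ^ n))); auto.
   - intros x _. apply continuous_diff; auto.
   - split; [apply is_derive_diff; [apply Hx|apply Hy]; lra|]. specialize (Low x by_lra).
    specialize (Pow x by_lra). have [_ O2] := Ho x by_lra. apply Rabs_le_between in O2. nra. }
  nra.
Qed.

End Trajectories.

Arguments F_zero : clear implicits.
Arguments clamped : clear implicits.
Arguments clamped_id : clear implicits.

Section Compactness.

Context {n D f delta} (n_pos : (1 <= n)%nat) (NL : nonlinearity D f delta).

Let F := primitive f.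
Let d := INR n.

Lemma rest_energy_start rho al u v r : rest_sol n D f rho al u v -> r <= rho -> energy f u v r = F al.
Proof. intros RS Hr. unfold energy. have [-> ->] := rs_rest RS r Hr. unfold F. lra. Qed.

Lemma rest_energy_mono rho al u v a b : rest_sol n D f rho al u v -> a <= b ->
  energy f u v b <= energy f u v a.
Proof.
 intros RS Hab. have H0 := rs_rho RS. have G : forall a b, rho <= a <= b -> energy f u v b <= energy f u v a.
 { intros a' b' H. apply (energy_decreasing (n := n) NL); try lra.
  - split; [apply (rs_dom RS)|apply (rs_cont RS)].
  - intros r Hr. apply (rs_ode RS). lra. }
 destruct (Rle_lt_dec rho a); auto. destruct (Rle_lt_dec rho b).
 - rewrite (rest_energy_start rho al u v a), <- (rest_energy_start rho al u v rho) by (auto; lra). apply G; lra.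
 - rewrite (rest_energy_start rho al u v a), (rest_energy_start rho al u v b) by (auto; lra). lra.
Qed.

Lemma rest_confined rho al u v A B : rest_sol n D f rho al u v -> D A -> D B -> A < al < B ->
  F al < F A -> F al < F B -> forall r, A < u r < B.
Proof.
 intros RS HA HB Hal HFA HFB r. have H0 := rs_rho RS. have [Hr|Hr] := Rle_lt_dec r rho.
 { have [-> _] := rs_rest RS r Hr. auto. } apply (confined (n := n) NL A B u v rho r); auto; try lra.
 - destruct (rs_rest RS rho) as [-> _]; lra.
 - rewrite (rest_energy_start rho al); auto; lra.
 - rewrite (rest_energy_start rho al); auto; lra.
 - intros s _. apply (rs_cont RS).
 - intros s Hs _. apply (rs_ode RS). lra.
Qed.

Definition lip_const (M T : R) : R := M * Rabs T + (d + 1) * M.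

Lemma rest_bounds rho al u v A B M : rest_sol n D f rho al u v -> D A -> D B -> A < al < B ->
  F al < F A -> F al < F B -> 0 <= M -> (forall x, A <= x <= B -> Rabs (f x) <= M) ->
  (forall r, Rabs (v r) <= M * Rabs r) /\
  forall T s t, Rabs s <= T -> Rabs t <= T ->
    Rabs (u t - u s) <= lip_const M T * Rabs (t - s) /\
    Rabs (v t - v s) <= lip_const M T * Rabs (t - s).
Proof.
 intros RS HA HB Hal HFA HFB HM Hf. have H0 := rs_rho RS. have Hc := rest_confined rho al u v A B RS HA HB Hal HFA HFB.
 have Hv : forall r, rho <= r -> Rabs (v r) <= M * (r - rho).
 { apply (rest_speed (f := f) n_pos u); auto.
  - apply (rs_rest RS). lra.
  - apply (rs_cont RS).
  - split; [apply (rs_ode RS); auto|]. apply Hf. specialize (Hc r). lra. }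
 have Hv2 : forall r, Rabs (v r) <= M * Rabs r.
 { intro r. have [Hr|Hr] := Rle_lt_dec rho r.
  - eapply Rle_trans; auto. rewrite Rabs_right by lra. nra.
  - destruct (rs_rest RS r) as [_ ->]; [lra|]. rewrite Rabs_R0. positive. }
 split; auto. have Hd : 0 <= d by positive.
 have G : forall T s t, s <= t -> t <= T -> Rabs (u t - u s) <= lip_const M T * (t - s) /\ Rabs (v t - v s) <= lip_const M T
  * (t - s).
 { intros T s t Hst HT. unfold lip_const. have PT := Rabs_pos T. have PT2 := Rle_abs T. set (s' := Rmax s rho).
  set (t' := Rmax t rho).
  have Hs' : u s = u s' /\ v s = v s' /\ u t = u t' /\ v t = v t' /\ rho <= s' <= t' /\ t' - s' <= t - s.
  { unfold s', t', Rmax. have Rst := rs_rest RS. destruct (Rst rho) as [A1 A2]; [lra|].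
   repeat destruct Rle_dec; repeat split; try lra; try (rewrite A1; apply Rst; lra); try (rewrite A2; apply Rst; lra). }
  have [-> [-> [-> [-> [[Hs1 Hs2] Hs3]]]]] := Hs'. have [->|Hne] := Req_dec t' s'.
  { rewrite !Rminus_diag, Rabs_R0. split; apply Rmult_le_pos; nra. }
  have Ht' : t' <= T by (unfold t', s' in *; unfold Rmax in *; repeat destruct Rle_dec).
  have Kp : forall X, X <= (M * Rabs T + (d + 1) * M) * (t' - s') -> X <= (M * Rabs T + (d + 1) * M) * (t - s).
  { intros X HX. eapply Rle_trans; [exact HX|]. apply Rmult_le_compat_l; [nra|lra]. } split; apply Kp.
  - apply (lipschitz_of_deriv u v); auto.
   + intros x _. apply (rs_cont RS).
   + split; [apply (rs_ode RS); lra|]. eapply Rle_trans; [apply Hv; lra|]. nra.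
  - apply (lipschitz_of_deriv v (fun r => - (d / r) * v r - f (u r))); auto.
   + intros x _. apply (rs_cont RS).
   + split; [apply (rs_ode RS); lra|]. eapply Rle_trans; [apply Rabs_triang|]. rewrite Rabs_Ropp, Rabs_mult, Rabs_Ropp.
    have B1 : Rabs (f (u x)) <= M by (apply Hf; specialize (Hc x); lra). have B2 : Rabs (d / x) * Rabs (v x) <= d * M.
    { unfold Rdiv. rewrite Rabs_mult, Rabs_right by lra. have Hix : 0 < / x by positive.
     rewrite Rabs_right, Rmult_assoc by lra. apply Rmult_le_compat_l; auto. apply Rle_trans with (/ x * (M * x)).
     - apply Rmult_le_compat_l; [lra|]. eapply Rle_trans; [apply Hv; lra|]. nra.
     - apply Req_le. field. lra. }
    nra. }
 intros T s t Hs Ht. apply Rabs_le_between in Hs. apply Rabs_le_between in Ht.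
 destruct (Rle_lt_dec s t).
 - rewrite (Rabs_right (t - s)) by lra. apply G; lra.
 - rewrite (Rabs_minus_sym t), (Rabs_minus_sym (u t)), (Rabs_minus_sym (v t)), (Rabs_right (s - t)) by lra. apply G; lra.
Qed.

Lemma lip_const_nonneg M T : 0 <= M -> 0 <= lip_const M T.
Proof. unfold lip_const. assert (0 <= d) by positive. have P := Rabs_pos T. nra. Qed.

(** Between two heights that enclose all trajectories [f] is bounded, hence speeds
    and accelerations are, up to the singular time [r = 0]. *)
Lemma rest_compact_aux (rhon aln : nat -> R) (un vn : nat -> R -> R) (rho al A B : R) :
  is_lim_seq rhon rho -> is_lim_seq aln al ->
  (forall k, rest_sol n D f (rhon k) (aln k) (un k) (vn k)) ->
  D A -> D B -> (forall k, A < aln k < B /\ F (aln k) < F A /\ F (aln k) < F B) ->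
  exists phi u v K, increasing_map phi /\ rest_sol n D f rho al u v /\
    (forall t, is_lim_seq (fun k => un (phi k) t) (u t)) /\
    (forall t, is_lim_seq (fun k => vn (phi k) t) (v t)) /\
    (forall k T s t, Rabs s <= T -> Rabs t <= T ->
       Rabs (un k t - un k s) <= K T * Rabs (t - s) /\ Rabs (vn k t - vn k s) <= K T * Rabs (t - s)).
Proof.
 intros Hrho Hal RS HA HB HAB. have HAleB : A <= B by (destruct (HAB O); lra).
 have [M [HM Hf]] := f_bounded NL A B HA HB HAleB. set (K := lip_const M).
 have HK : forall T, 0 <= K T by (intro; apply lip_const_nonneg; lra). have Hconf : forall k r, A < un k r < B.
 { intros k. have [H1 [H2 H3]] := HAB k. apply (rest_confined (rhon k) (aln k) _ (vn k)); auto. }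
 have Hb : forall k, (forall r, Rabs (vn k r) <= M * Rabs r) /\ forall T s t, Rabs s <= T -> Rabs t <= T -> Rabs (un k t - un
  k s) <= K T * Rabs (t - s) /\ Rabs (vn k t - vn k s) <= K T * Rabs (t - s).
 { intro k. have [H1 [H2 H3]] := HAB k. apply (rest_bounds (rhon k) (aln k) _ _ A B); auto; lra. }
 have L0 : is_lim_seq (fun _ : nat => 0) 0 by apply is_lim_seq_const.
 destruct (ascoli_pair K un vn (Rabs A + Rabs B) HK) as [phi [u [v [Pphi [Hu' [Hv' Hcont]]]]]]. { intros k. apply Hb. }
 { intro k. specialize (Hconf k 0). have [H1 _] := Hb k. specialize (H1 0). by_cases. } exists phi, u, v, K. split; auto.
 split; [|split; [auto|split; [auto|intros k; apply Hb]]]. have Hin : forall r, A <= u r <= B.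
 { split.
  - apply (is_lim_seq_le (fun _ => A) (fun k => un (phi k) r) A (u r)); auto.
   + intro k. specialize (Hconf (phi k) r). lra.
   + apply is_lim_seq_const.
  - apply (is_lim_seq_le (fun k => un (phi k) r) (fun _ => B) (u r) B); auto.
   + intro k. specialize (Hconf (phi k) r). lra.
   + apply is_lim_seq_const. }
 have Hrho' := subseq_lim _ _ phi Pphi Hrho. have Hal' := subseq_lim _ _ phi Pphi Hal.
 constructor.
 - apply (is_lim_seq_le (fun _ => 0) rhon 0 rho); auto. intro k. apply (rs_rho (RS k)).
 - have Hlt : forall r, r < rho -> u r = al /\ v r = 0.
  { intros r Hr. destruct (proj1 (lim_seq_eps _ _) Hrho' (rho - r)) as [N HN]; [lra|].
   have E : forall k, (N <= k)%nat -> un (phi k) r = aln (phi k) /\ vn (phi k) r = 0.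
   { intros k Hk. apply (rs_rest (RS (phi k))). specialize (HN k Hk). by_cases. } split.
   - have X : is_lim_seq (fun k => un (phi k) r) al.
    { apply (is_lim_seq_ext_loc (fun k => aln (phi k))); auto. exists N. symmetry. apply E; auto. }
    apply (lim_seq_inj _ _ _ (Hu' r) X).
   - have X : is_lim_seq (fun k => vn (phi k) r) 0.
    { apply (is_lim_seq_ext_loc (fun _ => 0)); [|apply is_lim_seq_const]. exists N. symmetry. apply E; auto. }
    apply (lim_seq_inj _ _ _ (Hv' r) X). }
  have Cl : forall (g : R -> R) c, continuous g rho -> (forall r, r < rho -> g r = c) -> g rho = c.
  { intros g c Hg H. apply NNPP; intro Hne. destruct (continuous_eps g rho (Rabs (g rho - c)) Hg) as [e [He H1]].
   { by_cases. } specialize (H1 (rho - e / 2)). rewrite H in H1 by lra. by_cases. }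
  intros r [Hr| ->]; auto.
  split; [apply Cl|apply Cl]; try apply Hcont; intros; apply Hlt; auto.
 - intro r. apply (D_between NL A B); auto.
 - auto.
 - intros r Hr. have Hrho0 : 0 <= rho.
  { apply (is_lim_seq_le (fun _ => 0) rhon 0 rho); auto. intro k. apply (rs_rho (RS k)). }
  have O : ode_at (fun s => INR n / s) (clamped f A B) u v r.
  { destruct (proj1 (lim_seq_eps _ _) Hrho' ((r - rho) / 2)) as [N HN]; [lra|].
   apply (ode_limit _ _ (fun k => un (phi k)) (fun k => vn (phi k)) u v r ((r - rho) / 2) (K (2 * r)) (M * (2 * r)) N);
    auto.
   - lra.
   - apply continuous_prod; [apply continuous_const|]. apply continuous_Rinv. lra.
   - apply (clamped_unif NL); auto.
   - intros k s Hk Hs. specialize (HN k Hk). apply Rabs_lt_between in Hs. apply Rabs_lt_between in HN. split.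
    + have [O1 O2] := rs_ode (RS (phi k)) s by_lra. split; auto. rewrite clamped_id; auto.
     specialize (Hconf (phi k) s). lra.
    + eapply Rle_trans; [apply Hb|]. rewrite Rabs_right by lra. nra.
   - intros k s t Hk Hs Ht. apply Rabs_lt_between in Hs. apply Rabs_lt_between in Ht. apply Hb; apply Rabs_le; lra. }
  have [O1 O2] := O. split; auto. rewrite clamped_id in O2; auto.
Qed.

Lemma rest_compact (rhon aln : nat -> R) (un vn : nat -> R -> R) (rho al : R) :
  is_lim_seq rhon rho -> is_lim_seq aln al -> D al ->
  (forall k, rest_sol n D f (rhon k) (aln k) (un k) (vn k)) ->
  exists phi u v K, increasing_map phi /\ rest_sol n D f rho al u v /\
    (forall t, is_lim_seq (fun k => un (phi k) t) (u t)) /\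
    (forall t, is_lim_seq (fun k => vn (phi k) t) (v t)) /\
    (forall k T s t, Rabs s <= T -> Rabs t <= T ->
       Rabs (un (phi k) t - un (phi k) s) <= K T * Rabs (t - s) /\
       Rabs (vn (phi k) t - vn (phi k) s) <= K T * Rabs (t - s)).
Proof.
 intros Hrho Hal HD RS. have [A [B [HA [HB [_ [H1 [H2 H3]]]]]]] := nl_coercive NL al HD. fold F in H2, H3.
 set (g := Rmin (F A - F al) (F B - F al)). destruct (continuous_eps F al g (F_cont NL al HD)) as [e [He HF]].
 { apply Rmin_glb_lt; lra. } destruct (proj1 (lim_seq_eps _ _) Hal (Rmin e (Rmin (al - A) (B - al)))) as [N HN].
 { by_cases. }
 destruct (rest_compact_aux (fun k => rhon (k + N)%nat) (fun k => aln (k + N)%nat) (fun k => un (k + N)%nat) (fun k => vn (k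
  + N)%nat) rho al A B) as [phi [u [v [K [P [R1 [R2 [R3 R4]]]]]]]]; auto.
 - apply is_lim_seq_incr_n; auto.
 - apply is_lim_seq_incr_n; auto.
 - intro k. specialize (HN (k + N)%nat ltac:(lia)). apply Rmin_Rgt_l in HN as [N1 N2]. specialize (HF _ N1).
  apply Rmin_Rgt_l in HF as [F1 F2]. by_cases.
 - exists (fun k => (phi k + N)%nat), u, v, K. split; [intro k; specialize (P k); lia|]. auto.
Qed.

(** ** Existence *)

Lemma rest_exists_pos rho al : 0 < rho -> D al -> exists u v, rest_sol n D f rho al u v.
Proof.
 intros Hrho HD. have [A [B [HA [HB [_ [H1 [H2 H3]]]]]]] := nl_coercive NL al HD.
 have [M [HM Hf]] := f_bounded NL A B HA HB by_lra. have Hd : 0 <= d by positive.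
 set (q := fun t => d / Rmax rho (rho + t)). destruct (friction_cut d rho (fun t => rho + t) Hrho Hd) as [HQ1 HQ2].
 { intro t. apply (ex_derive_continuous (V := R_NormedModule)). auto_derive; auto. }
 destruct (ode_exists q (clamped f A B) (d / rho) M) with (a := al) (b := 0) as [u [v [Hu0 [Hv0 [Hc [_ Ho]]]]]]; auto.
 - intro x. apply Hf, clamp_range; lra.
 - apply (clamped_unif NL); auto. lra.
 - set (u' := fun r => u (Rmax 0 (r - rho))). set (v' := fun r => v (Rmax 0 (r - rho))).
  have Hmaxc : forall r, continuous (fun r => Rmax 0 (r - rho)) r.
  { intro r. apply eps_continuous. intros eps Heps. exists eps. split; auto. by_cases. }
  have Hc' : forall r, continuous u' r /\ continuous v' r.
  { split; [apply (continuous_comp _ u)| apply (continuous_comp _ v)]; auto; apply Hc. }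
  have Hsh : forall (g g' : R -> R) r, rho < r -> is_derive g (r - rho) (g' (r - rho)) -> is_derive (fun r => g (Rmax 0 (r -
   rho))) r (g' (r - rho)).
  { intros g g' r Hr Hg. apply (is_derive_ext_loc (fun r => g (r - rho))).
   - exists (mkposreal (r - rho) (proj2 (Rlt_0_minus _ _) Hr)). intros y Hy. have Hy' : Rabs (y - r) < r - rho by auto. by_cases.
   - eapply is_derive_value.
    + apply is_derive_comp; [exact Hg|]. apply is_derive_diff; [apply is_derive_id|apply is_derive_const].
    + unfold scal, one, zero; simpl; unfold mult; simpl. ring. }
  have Ho' : forall r, rho < r -> radial n (clamped f A B) u' v' r.
  { intros r Hr. have [O1 O2] := Ho (r - rho) by_lra. split.
   - eapply is_derive_value; [apply (Hsh u v r Hr O1)|]. unfold v'. by_cases.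
   - eapply is_derive_value; [apply (Hsh v (fun t => - q t * v t - clamped f A B (u t)) r Hr O2)|]. unfold v', u', q.
    replace (rho + (r - rho)) with r by ring. by_cases. }
  have Hrest : forall r, r <= rho -> u' r = al /\ v' r = 0.
  { intros r Hr. unfold u', v'. rewrite Rmax_left by lra. auto. } have Hconf : forall r, A < u' r < B.
  { intro r. case: (Rle_lt_dec r rho) => Hr; [destruct (Hrest r Hr) as [-> _]; lra|].
   have [E1 E2] := Hrest rho (Rle_refl _).
   have E0 : energy f u' v' rho = F al by (unfold energy; rewrite E1, E2; unfold F; lra).
   apply (confined (n := n) NL A B u' v' rho r); auto; try lra.
   - rewrite E0. auto.
   - rewrite E0. auto.
   - intros s Hs Hin. have [O1 O2] := Ho' s by_lra. split; auto. rewrite clamped_id in O2; auto. }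
  exists u', v'.
  constructor; auto; try lra.
  + intro r. specialize (Hconf r). apply (D_between NL A B); auto. lra.
  + intros r Hr. have [O1 O2] := Ho' r Hr. split; auto. rewrite clamped_id in O2; auto. specialize (Hconf r). lra.
Qed.

Lemma rest_exists rho al : 0 <= rho -> D al -> exists u v, rest_sol n D f rho al u v.
Proof.
 intros Hrho HD. set (rhon := fun k : nat => rho + / INR (S k)). have Hpos : forall k, 0 < rhon k.
 { intro k. unfold rhon. assert (0 < / INR (S k)) by (apply Rinv_0_lt_compat, lt_0_INR; lia). lra. }
 destruct (choice (fun k (p : (R -> R) * (R -> R)) => rest_sol n D f (rhon k) al (fst p) (snd p))) as [p Hp].
 { intro k. have [u [v H]] := rest_exists_pos (rhon k) al (Hpos k) HD. exists (u, v). auto. }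
 destruct (rest_compact rhon (fun _ => al) (fun k => fst (p k)) (fun k => snd (p k)) rho al) as [_ [u [v [_ [_ [H _]]]]]];
  auto.
 - replace (Finite rho) with (Finite (rho + 0)) by (f_equal; ring). apply is_lim_seq_plus'; [apply is_lim_seq_const|].
  apply (is_lim_seq_incr_1 (fun k => / INR k)). apply (is_lim_seq_inv INR p_infty); [apply is_lim_seq_INR|discriminate].
 - apply is_lim_seq_const.
 - exists u, v. auto.
Qed.

End Compactness.

(** ** Uniqueness and continuous dependence *)

Definition traj (n : nat) (D : R -> Prop) (f : R -> R) (a b : R) (u v : R -> R) : Prop :=
  (forall r, a <= r <= b -> D (u r) /\ continuous u r /\ continuous v r) /\
  (forall r, a < r < b -> radial n f u v r).

Lemma traj_sub n D f a b a' b' u v : traj n D f a b u v -> a <= a' -> b' <= b -> traj n D f a' b' u v.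
Proof. intros [H1 H2] Ha Hb. split; intros; [apply H1|apply H2]; lra. Qed.

Lemma rest_traj n D f rho al u v a b : rest_sol n D f rho al u v -> rho <= a -> traj n D f a b u v.
Proof.
 intros RS Ha. split; intros r Hr.
 - split; [apply (rs_dom RS)|apply (rs_cont RS)].
 - apply (rs_ode RS). lra.
Qed.

Lemma quad_bound (a b c e x y : R) : 0 <= c -> 0 <= e -> Rabs a <= c * Rabs x + e * Rabs y ->
  Rabs (x * a) <= (c + e) * (x ^ 2 + y ^ 2).
Proof.
 intros Hc He H. have Px := Rabs_pos x. have Ex : x ^ 2 = Rabs x ^ 2 by by_cases. have Ey : y ^ 2 = Rabs y ^ 2 by by_cases.
 apply Rle_trans with (Rabs x * (c * Rabs x + e * Rabs y)).
 - rewrite ?Rabs_mult. nra.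
 - assert (0 <= e * (Rabs x ^ 2 + Rabs y ^ 2 - Rabs x * Rabs y)). { apply Rmult_le_pos; nra. } nra.
Qed.

Section Uniqueness.

Context {n D f delta} (n_pos : (1 <= n)%nat) (NL : nonlinearity D f delta).

Let F := primitive f.
Let d := INR n.

(** Where [u <> 0] the equation is locally Lipschitz in [(u, u')]. *)
Lemma unique_near_u p q r0 u1 v1 u2 v2 : 0 < p -> p <= r0 <= q ->
  traj n D f p q u1 v1 -> traj n D f p q u2 v2 -> u1 r0 = u2 r0 -> v1 r0 = v2 r0 -> u1 r0 <> 0 ->
  exists e, 0 < e /\ forall r, p <= r <= q -> Rabs (r - r0) < e -> u1 r = u2 r /\ v1 r = v2 r.
Proof.
 intros Hp Hr0 [C1 O1] [C2 O2] Eu Ev Hne. destruct (nl_lip NL (u1 r0)) as [L [e0 [He0 [HL HLip]]]]; auto. { apply C1; auto. }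
 destruct (continuous_eps u1 r0 e0) as [e1 [He1 H1]]; [apply C1; auto|auto|].
 destruct (continuous_eps u2 r0 e0) as [e2 [He2 H2]]; [apply C2; auto|auto|]. exists (Rmin e1 e2).
 split; [apply Rmin_glb_lt; auto|]. intros r Hr Hrr. assert (Hd : 0 <= d) by positive.
 set (g := fun r => (u1 r - u2 r) ^ 2 + (v1 r - v2 r) ^ 2).
 set (dv := fun r => (- (d / r) * v1 r - f (u1 r)) - (- (d / r) * v2 r - f (u2 r))).
 set (g' := fun r => 2 * (u1 r - u2 r) * (v1 r - v2 r) + 2 * (v1 r - v2 r) * dv r). set (C := 1 + 2 * (d / p + L)).
 assert (Hdp : 0 <= d / p) by (apply Rdiv_le_0_compat; lra).
 assert (G : forall x, p < x < q -> Rabs (x - r0) < Rmin e1 e2 -> is_derive g x (g' x) /\ Rabs (g' x) <= C * g x).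
 { intros x Hx Hxr. apply Rmin_Rgt_l in Hxr as [X1 X2]. split.
  - destruct (O1 x Hx) as [A1 B1]. destruct (O2 x Hx) as [A2 B2].
   apply is_derive_sum; apply (is_derive_square (fun r => _ r - _ r)); apply is_derive_diff; auto.
  - unfold g', g, C. assert (Hf : Rabs (f (u1 x) - f (u2 x)) <= L * Rabs (u1 x - u2 x)).
   { apply HLip; [apply H1; auto|rewrite Eu; apply H2; auto]. } assert (Hdx : 0 <= d / x <= d / p).
   { split; [apply Rdiv_le_0_compat; lra|]. apply Rmult_le_compat_l; auto. apply Rinv_le_contravar; lra. }
   assert (B1 : Rabs (dv x) <= d / p * Rabs (v1 x - v2 x) + L * Rabs (u1 x - u2 x)).
   { unfold dv.
    replace (- (d / x) * v1 x - f (u1 x) - (- (d / x) * v2 x - f (u2 x))) with (- (d / x * (v1 x - v2 x)) + - (f (u1 x) -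
     f (u2 x))) by ring. eapply Rle_trans; [apply Rabs_triang|].
    rewrite !Rabs_Ropp, Rabs_mult, (Rabs_right (d / x)) by lra. assert (P := Rabs_pos (v1 x - v2 x)). nra. }
   assert (Q2 := quad_bound (dv x) 0 (d / p) L (v1 x - v2 x) (u1 x - u2 x) Hdp HL B1).
   replace (2 * (u1 x - u2 x) * (v1 x - v2 x) + 2 * (v1 x - v2 x) * dv x) with (2 * ((u1 x - u2 x) * (v1 x - v2 x)) + 2 *
    ((v1 x - v2 x) * dv x)) by ring. eapply Rle_trans; [apply Rabs_triang|].
   rewrite !(Rabs_mult 2), (Rabs_right 2) by lra.
   assert (A : Rabs ((u1 x - u2 x) * (v1 x - v2 x)) <= / 2 * ((u1 x - u2 x) ^ 2 + (v1 x - v2 x) ^ 2)).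
   { assert (S1 := pow2_ge_0 ((u1 x - u2 x) - (v1 x - v2 x))). assert (S2 := pow2_ge_0 ((u1 x - u2 x) + (v1 x - v2 x))).
    apply Rabs_le. lra. }
   lra. }
 assert (Gc : forall x, p <= x <= q -> continuous g x).
 { intros x Hx. destruct (C1 x Hx) as [_ [A1 A2]]. destruct (C2 x Hx) as [_ [B1 B2]].
  apply continuous_sum; apply continuous_square; apply continuous_diff; auto. }
 assert (G0 : g r0 = 0) by (unfold g; rewrite Eu, Ev; ring). assert (Gr : g r <= 0).
 { destruct (Rle_lt_dec r0 r).
  - destruct (two_sided_gronwall g g' C r0 r) as [T _]; auto.
   + intros; apply Gc; lra.
   + intros x Hx. apply G; [lra|]. by_cases.
   nra.
  - destruct (two_sided_gronwall g g' C r r0) as [_ T]; auto; [lra| | |].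
   + intros; apply Gc; lra.
   + intros x Hx. apply G; [lra|]. by_cases.
   nra. }
 unfold g in Gr. assert (P1 := pow2_ge_0 (u1 r - u2 r)). assert (P2 := pow2_ge_0 (v1 r - v2 r)). nra.
Qed.

(** Where [u' <> 0] the equation is locally Lipschitz in [(u, E)], because the
    primitive [F] is continuously differentiable; this covers the points where
    [u = 0], at which [f] need not be Lipschitz. *)
Lemma unique_near_v p q r0 u1 v1 u2 v2 : 0 < p -> p <= r0 <= q ->
  traj n D f p q u1 v1 -> traj n D f p q u2 v2 -> u1 r0 = u2 r0 -> v1 r0 = v2 r0 -> v1 r0 <> 0 ->
  exists e, 0 < e /\ forall r, p <= r <= q -> Rabs (r - r0) < e -> u1 r = u2 r /\ v1 r = v2 r.
Proof.
 intros Hp Hr0 [C1 O1] [C2 O2] Eu Ev Hne. destruct (nl_open NL (u1 r0)) as [e0 [He0 Hop]]; [apply C1; auto|].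
 set (A := u1 r0 - e0 / 2). set (B := u1 r0 + e0 / 2). assert (HA : D A) by (apply Hop; unfold A; apply Rabs_def1; lra).
 assert (HB : D B) by (apply Hop; unfold B; apply Rabs_def1; lra).
 destruct (f_bounded NL A B HA HB) as [M [HM Hf]]; [unfold A, B; lra|]. set (m := Rabs (v1 r0) / 2).
 assert (Hm : 0 < m) by (unfold m; assert (P := Rabs_pos_lt _ Hne); lra).
 destruct (continuous_eps u1 r0 (e0 / 2)) as [e1 [He1 H1]]; [apply C1; auto|lra|].
 destruct (continuous_eps u2 r0 (e0 / 2)) as [e2 [He2 H2]]; [apply C2; auto|lra|].
 destruct (continuous_eps v1 r0 m) as [e3 [He3 H3]]; [apply C1; auto|lra|].
 destruct (continuous_eps v2 r0 m) as [e4 [He4 H4]]; [apply C2; auto|lra|]. set (ee := Rmin (Rmin e1 e2) (Rmin e3 e4)).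
 assert (Hee : 0 < ee) by (repeat apply Rmin_glb_lt; auto). exists ee. split; auto. intros r Hr Hrr.
 assert (Hd : 0 <= d) by positive. set (e := fun r => energy f u1 v1 r - energy f u2 v2 r).
 set (e' := fun r => - (d / r) * v1 r ^ 2 - - (d / r) * v2 r ^ 2). set (g := fun r => (u1 r - u2 r) ^ 2 + e r ^ 2).
 set (g' := fun r => 2 * (u1 r - u2 r) * (v1 r - v2 r) + 2 * e r * e' r).
 assert (Him : 0 < / m) by (apply Rinv_0_lt_compat; auto).
 set (C := 2 * (/ m + M * / m) + 2 * (2 * (d / p) + 2 * (d / p) * M)).
 assert (NR : forall x, Rabs (x - r0) < ee -> A <= u1 x <= B /\ A <= u2 x <= B /\ m <= Rabs (v1 x + v2 x) / 2).
 { intros x Hx. apply Rmin_Rgt_l in Hx as [X1 X2]. apply Rmin_Rgt_l in X1 as [X1 X1']. apply Rmin_Rgt_l in X2 as [X2 X2'].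
  specialize (H1 x X1). specialize (H2 x X1'). specialize (H3 x X2). specialize (H4 x X2'). rewrite <- Ev in H4.
  apply Rabs_lt_between in H1. apply Rabs_lt_between in H2. split; [unfold A, B; lra|]. split; [unfold A, B; lra|].
  unfold m in *. by_cases. }
 assert (VD : forall x, p <= x <= q -> Rabs (x - r0) < ee -> Rabs (v1 x - v2 x) <= / m * Rabs (e x) + M * / m * Rabs (u1 x -
  u2 x) /\ Rabs (v1 x ^ 2 - v2 x ^ 2) <= 2 * Rabs (e x) + 2 * M * Rabs (u1 x - u2 x)).
 { intros x Hx Hxr. destruct (NR x Hxr) as [N1 [N2 N3]]. assert (HF := F_lipschitz NL A B M (u1 x) (u2 x) HA HB Hf N1 N2).
  assert (Sq : v1 x ^ 2 - v2 x ^ 2 = 2 * (e x - (primitive f (u1 x) - primitive f (u2 x)))). { unfold e, energy. field. }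
  assert (S2 : Rabs (v1 x ^ 2 - v2 x ^ 2) <= 2 * Rabs (e x) + 2 * M * Rabs (u1 x - u2 x)) by by_cases. split; auto.
  assert (Pr : Rabs (v1 x ^ 2 - v2 x ^ 2) = Rabs (v1 x - v2 x) * Rabs (v1 x + v2 x)). { rewrite <- Rabs_mult. by_cases. }
  assert (P := Rabs_pos (v1 x - v2 x)). apply Rmult_le_reg_l with (2 * m); [lra|].
  apply Rle_trans with (2 * Rabs (e x) + 2 * M * Rabs (u1 x - u2 x)).
  - nra.
  - apply Req_le. field. lra. }
 assert (G : forall x, p < x < q -> Rabs (x - r0) < ee -> is_derive g x (g' x) /\ Rabs (g' x) <= C * g x).
 { intros x Hx Hxr. split.
  - destruct (O1 x Hx) as [A1 B1]. destruct (O2 x Hx) as [A2 B2].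
   apply is_derive_sum; apply (is_derive_square (fun r => _)).
   + apply is_derive_diff; auto.
   + apply is_derive_diff; apply (energy_derive (n := n) NL); try split; auto; [apply C1|apply C2]; lra.
  - destruct (VD x by_lra Hxr) as [V1 V2]. unfold g', g, C. assert (Hdx : 0 <= d / x <= d / p).
   { split; [apply Rdiv_le_0_compat; lra|]. apply Rmult_le_compat_l; auto. apply Rinv_le_contravar; lra. }
   assert (E1 : Rabs (e' x) <= 2 * (d / p) * Rabs (e x) + 2 * (d / p) * M * Rabs (u1 x - u2 x)).
   { unfold e'. replace (- (d / x) * v1 x ^ 2 - - (d / x) * v2 x ^ 2) with (- (d / x * (v1 x ^ 2 - v2 x ^ 2))) by ring.
    rewrite Rabs_Ropp, Rabs_mult, (Rabs_right (d / x)) by lra.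
    apply Rle_trans with (d / p * (2 * Rabs (e x) + 2 * M * Rabs (u1 x - u2 x))); [|apply Req_le; ring].
    apply Rmult_le_compat; auto; [lra|apply Rabs_pos|lra]. }
   assert (V1' : Rabs (v1 x - v2 x) <= M * / m * Rabs (u1 x - u2 x) + / m * Rabs (e x)) by lra.
   assert (Q1 := quad_bound _ 0 (M * / m) (/ m) (u1 x - u2 x) (e x) ltac:(nra) by_lra V1').
   assert (Q2 := quad_bound _ 0 (2 * (d / p)) (2 * (d / p) * M) (e x) (u1 x - u2 x) by_lra ltac:(nra) E1).
   replace (2 * (u1 x - u2 x) * (v1 x - v2 x) + 2 * e x * e' x) with (2 * ((u1 x - u2 x) * (v1 x - v2 x)) + 2 * (e x * e'
    x)) by ring. eapply Rle_trans; [apply Rabs_triang|]. rewrite !(Rabs_mult 2), (Rabs_right 2) by lra. lra. }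
 assert (Gc : forall x, p <= x <= q -> continuous g x).
 { intros x Hx. destruct (C1 x Hx) as [A0 [A1 A2]]. destruct (C2 x Hx) as [B0 [B1 B2]].
  apply continuous_sum; apply continuous_square; apply continuous_diff; auto; apply (energy_cont NL); auto. }
 assert (G0 : g r0 = 0) by (unfold g, e, energy; rewrite Eu, Ev; ring). assert (Gr : g r <= 0).
 { destruct (Rle_lt_dec r0 r).
  - destruct (two_sided_gronwall g g' C r0 r) as [T _]; auto.
   + intros; apply Gc; lra.
   + intros x Hx. apply G; [lra|]. by_cases.
   nra.
  - destruct (two_sided_gronwall g g' C r r0) as [_ T]; auto; [lra| | |].
   + intros; apply Gc; lra.
   + intros x Hx. apply G; [lra|]. by_cases.
   nra. }
 unfold g in Gr. assert (W0 : u1 r - u2 r = 0) by nra. assert (E0 : e r = 0) by nra.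
 destruct (VD r Hr Hrr) as [V1 _]. rewrite W0, E0, Rabs_R0 in V1. by_cases.
Qed.

Lemma unique_near p q r0 u1 v1 u2 v2 : 0 < p -> p <= r0 <= q ->
  traj n D f p q u1 v1 -> traj n D f p q u2 v2 -> u1 r0 = u2 r0 -> v1 r0 = v2 r0 ->
  ~ (u1 r0 = 0 /\ v1 r0 = 0) ->
  exists e, 0 < e /\ forall r, p <= r <= q -> Rabs (r - r0) < e -> u1 r = u2 r /\ v1 r = v2 r.
Proof.
 intros Hp Hr0 T1 T2 Eu Ev Hne. have [E|E] := Req_dec (u1 r0) 0.
 - apply unique_near_v; auto.
 - apply unique_near_u; auto.
Qed.

Lemma closed_agreement (u1 u2 : R -> R) (x : R) : continuous u1 x -> continuous u2 x ->
  (forall e, 0 < e -> exists y, Rabs (y - x) < e /\ u1 y = u2 y) -> u1 x = u2 x.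
Proof.
 intros C1 C2 H. apply NNPP; intro Hne. set (e := Rabs (u1 x - u2 x)). have He : 0 < e by (apply Rabs_pos_lt; lra).
 destruct (continuous_eps u1 x (e / 2) C1) as [e1 [He1 H1]]; [lra|].
 destruct (continuous_eps u2 x (e / 2) C2) as [e2 [He2 H2]]; [lra|]. destruct (H (Rmin e1 e2)) as [y [Hy E]]; [by_cases|].
 apply Rmin_Rgt_l in Hy as [Y1 Y2]. specialize (H1 y Y1). specialize (H2 y Y2).
 have T := Rabs_triang (- (u1 y - u1 x)) (u2 y - u2 x).
 replace (- (u1 y - u1 x) + (u2 y - u2 x)) with (u1 x - u2 x + (u2 y - u1 y)) in T by ring. unfold e in *. by_cases.
Qed.

(** Uniqueness holds as long as the state [(0,0)] is avoided: both ways to have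
    locally Lipschitz coordinates fail only there. *)
Lemma traj_unique_forward a b u1 v1 u2 v2 : 0 < a ->
  traj n D f a b u1 v1 -> traj n D f a b u2 v2 -> u1 a = u2 a -> v1 a = v2 a ->
  (forall r, a <= r < b -> ~ (u1 r = 0 /\ v1 r = 0)) ->
  forall r, a <= r <= b -> u1 r = u2 r /\ v1 r = v2 r.
Proof.
 intros Ha T1 T2 Eu Ev Hnz r Hr. assert (G : forall r, a <= r -> r <= b -> u1 r = u2 r /\ v1 r = v2 r); [|apply G; lra].
 clear r Hr. intros r Hr. pattern r. apply (real_induction _ a); auto; clear r Hr.
 - intros x Hx IH Hxb. destruct (Req_dec x a) as [->|Hxa]; auto.
  have Hnear : forall e, 0 < e -> exists y, Rabs (y - x) < e /\ u1 y = u2 y /\ v1 y = v2 y.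
  { intros e He. exists (Rmax a (x - e / 2)). split.
   - by_cases.
   - apply IH; unfold Rmax; destruct Rle_dec; lra. }
  have [C1 _] := T1. have [C2 _] := T2.
  have [_ [A1 A2]] := C1 x by_lra. have [_ [B1 B2]] := C2 x by_lra.
  split; apply closed_agreement; auto; intros e He; destruct (Hnear e He) as [y [Y1 [Y2 Y3]]]; exists y; auto.
 - intros x Hx IH. have [Hxb|Hxb] := Rlt_le_dec x b.
  + have [E1 E2] := IH x by_lra by_lra.
   destruct (unique_near a b x u1 v1 u2 v2) as [e [He H]]; auto; try lra; try (apply Hnz). exists (e / 2). split; [lra|].
   intros y Hy Hyb. apply H; [lra|]. by_cases.
  + exists 1. repeat split; lra.
Qed.

Lemma traj_unique_backward a b u1 v1 u2 v2 : 0 < a -> a <= b ->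
  traj n D f a b u1 v1 -> traj n D f a b u2 v2 -> u1 b = u2 b -> v1 b = v2 b ->
  (forall r, a < r <= b -> ~ (u1 r = 0 /\ v1 r = 0)) ->
  forall r, a <= r <= b -> u1 r = u2 r /\ v1 r = v2 r.
Proof.
 intros Ha Hab T1 T2 Eu Ev Hnz r Hr.
 have G : forall t, 0 <= t -> t <= b - a -> u1 (b - t) = u2 (b - t) /\ v1 (b - t) = v2 (b - t).
 2: { specialize (G (b - r) by_lra by_lra). replace (b - (b - r)) with r in G by ring. auto. } clear r Hr.
 intros r Hr. pattern r. apply (real_induction _ 0); auto; clear r Hr.
 - intros x Hx IH Hxb. destruct (Req_dec x 0) as [->|Hxa]; [rewrite Rminus_0_r; auto|].
  have Hnear : forall e, 0 < e -> exists y, Rabs (y - (b - x)) < e /\ u1 y = u2 y /\ v1 y = v2 y.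
  { intros e He. exists (b - Rmax 0 (x - e / 2)). split.
   - by_cases.
   - apply IH; unfold Rmax; destruct Rle_dec; lra. }
  have [C1 _] := T1. have [C2 _] := T2.
  have [_ [A1 A2]] := C1 (b - x) by_lra. have [_ [B1 B2]] := C2 (b - x) by_lra.
  split; apply closed_agreement; auto; intros e He; destruct (Hnear e He) as [y [Y1 [Y2 Y3]]]; exists y; auto.
 - intros x Hx IH. have [Hxb|Hxb] := Rlt_le_dec x (b - a).
  + have [E1 E2] := IH x by_lra by_lra.
   destruct (unique_near a b (b - x) u1 v1 u2 v2) as [e [He H]]; auto; try lra; try (apply Hnz; lra). exists (e / 2).
   split; [lra|]. intros y Hy Hyb. apply H; [lra|]. by_cases.
  + exists 1. repeat split; lra.
Qed.

(** At the starting point friction is singular when [rho = 0], but it acts in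
    the favourable direction. *)
Lemma rest_unique_start rho al u1 v1 u2 v2 : al <> 0 ->
  rest_sol n D f rho al u1 v1 -> rest_sol n D f rho al u2 v2 ->
  exists e, 0 < e /\ forall r, r <= rho + e -> u1 r = u2 r /\ v1 r = v2 r.
Proof.
 intros Hal R1 R2. have H0 := rs_rho R1. destruct (rs_rest R1 rho) as [S1 S2]; [lra|].
 destruct (rs_rest R2 rho) as [S3 S4]; [lra|]. destruct (nl_lip NL al) as [L [e0 [He0 [HL HLip]]]]; auto.
 { rewrite <- S1. apply (rs_dom R1). } destruct (continuous_eps u1 rho e0) as [e1 [He1 H1]]; [apply (rs_cont R1)|auto|].
 destruct (continuous_eps u2 rho e0) as [e2 [He2 H2]]; [apply (rs_cont R2)|auto|]. exists (Rmin e1 e2 / 2).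
 have Hee : 0 < Rmin e1 e2 by by_cases. split; [lra|]. intros r Hr. have [Hrr|Hrr] := Rle_lt_dec r rho.
 { have [-> ->] := rs_rest R1 r Hrr. have [-> ->] := rs_rest R2 r Hrr. auto. }
 set (g := fun r => (u1 r - u2 r) ^ 2 + (v1 r - v2 r) ^ 2).
 set (dv := fun r => (- (d / r) * v1 r - f (u1 r)) - (- (d / r) * v2 r - f (u2 r))).
 set (g' := fun r => 2 * (u1 r - u2 r) * (v1 r - v2 r) + 2 * (v1 r - v2 r) * dv r).
 have Gr : g r <= g rho * exp ((1 + L) * (r - rho)).
 { apply (gronwall g g'); try lra.
  - intros x Hx. destruct (rs_cont R1 x). destruct (rs_cont R2 x).
   apply continuous_sum; apply continuous_square; apply continuous_diff; auto.
  - split.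
   + destruct (rs_ode R1 x) as [A1 B1]; [lra|]. destruct (rs_ode R2 x) as [A2 B2]; [lra|].
    apply is_derive_sum; apply (is_derive_square (fun r => _ r - _ r)); apply is_derive_diff; auto.
   + have X : Rabs (x - rho) < Rmin e1 e2 by by_cases. apply Rmin_Rgt_l in X as [X1 X2]. specialize (H1 x X1).
    specialize (H2 x X2). rewrite S1 in H1. rewrite S3 in H2. have Hf := HLip (u1 x) (u2 x) H1 H2.
    have Hdx : 0 <= d / x by (apply Rdiv_le_0_compat; [apply pos_INR|lra]).
    have E : dv x = - (d / x) * (v1 x - v2 x) - (f (u1 x) - f (u2 x)) by (unfold dv; ring). unfold g', g. rewrite E.
    revert HL Hf Hdx. generalize (u1 x - u2 x) (v1 x - v2 x) (f (u1 x) - f (u2 x)) (d / x). intros w y z dx HL Hf Hdx.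
    have A := pow2_ge_0 (w - y). have B : - (2 * y * z) <= L * (w ^ 2 + y ^ 2).
    { have P2 := Rabs_pos y. apply Rle_trans with (2 * (Rabs y * Rabs z)).
     - rewrite <- Rabs_mult. by_cases.
     - rewrite <- pow2_abs, <- (pow2_abs y). apply Rle_trans with (L * (2 * (Rabs y * Rabs w))); [nra|].
      apply Rmult_le_compat_l; auto. assert (0 <= (Rabs w - Rabs y) ^ 2) by apply pow2_ge_0. lra. }
    nra. }
 unfold g in Gr. have P1 := pow2_ge_0 (u1 r - u2 r). have P2 := pow2_ge_0 (v1 r - v2 r). nra.
Qed.

Lemma rest_unique rho al u1 v1 u2 v2 R : al <> 0 ->
  rest_sol n D f rho al u1 v1 -> rest_sol n D f rho al u2 v2 ->
  (forall r, r < R -> ~ (u1 r = 0 /\ v1 r = 0)) ->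
  forall r, r <= R -> u1 r = u2 r /\ v1 r = v2 r.
Proof.
 intros Hal R1 R2 Hnz r Hr. have H0 := rs_rho R1. have [e [He H]] := rest_unique_start rho al u1 v1 u2 v2 Hal R1 R2.
 case: (Rle_lt_dec r (rho + e)) => Hre; auto. apply (traj_unique_forward (rho + e) R); try lra.
 - apply (rest_traj n D f rho al); auto. lra.
 - apply (rest_traj n D f rho al); auto. lra.
 - apply H; lra.
 - apply H; lra.
 abs_bounds.
Qed.

(** A sequence of counterexamples would converge, by compactness, to a second
    solution with the same start. *)
Lemma rest_continuity rho al u v S0 : D al -> al <> 0 -> rest_sol n D f rho al u v ->
  (forall r, r <= S0 -> ~ (u r = 0 /\ v r = 0)) ->
  forall e, 0 < e -> exists h, 0 < h /\ forall rho' al' u' v', rest_sol n D f rho' al' u' v' ->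
    Rabs (rho' - rho) < h -> Rabs (al' - al) < h ->
    forall r, r <= S0 -> Rabs (u' r - u r) < e /\ Rabs (v' r - v r) < e.
Proof.
 intros HD Hal RS Hnz e He. apply NNPP; intro Hno.
 have Hseq : forall k : nat, exists p : (R * R * R) * ((R -> R) * (R -> R)), let '((rho', al', r), (u', v')) := p in rest_sol
  n D f rho' al' u' v' /\ Rabs (rho' - rho) < / INR (k + 1) /\ Rabs (al' - al) < / INR (k + 1) /\ 0 <= r <= Rmax S0 0 /\ r
  <= Rmax S0 0 /\ (r <= S0 \/ r = 0) /\ ~ (Rabs (u' r - u r) < e /\ Rabs (v' r - v r) < e).
 { intro k. apply NNPP; intro Hk. apply Hno. exists (/ INR (k + 1)). split; [apply Rinv_0_lt_compat, lt_0_INR; lia|].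
  intros rho' al' u' v' RS' H1 H2 r Hr. apply NNPP; intro Hn. apply Hk. destruct (Rle_lt_dec 0 r).
  - exists ((rho', al', r), (u', v')). have Q := Rmax_l S0 0. split; auto; lra.
  - exists ((rho', al', 0), (u', v')). have Q := Rmax_r S0 0. have E1 := rs_rest RS 0 (rs_rho RS).
   have E2 := rs_rest RS' 0 (rs_rho RS'). have E3 := rs_rest RS r ltac:(assert (T := rs_rho RS); lra).
   have E4 := rs_rest RS' r ltac:(assert (T := rs_rho RS'); lra). destruct E1 as [-> ->], E2 as [-> ->].
   destruct E3 as [X1 X2], E4 as [X3 X4]. rewrite X1, X2, X3, X4 in Hn. split; auto; lra. }
 apply choice in Hseq.
 have [p Hp] := Hseq. set (rhon := fun k => fst (fst (fst (p k)))). set (aln := fun k => snd (fst (fst (p k)))).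
 set (rn := fun k => snd (fst (p k))). set (un := fun k => fst (snd (p k))). set (vn := fun k => snd (snd (p k))).
 have Hq : forall k, rest_sol n D f (rhon k) (aln k) (un k) (vn k) /\ Rabs (rhon k - rho) < / INR (k + 1) /\ Rabs (aln k -
  al) < / INR (k + 1) /\ 0 <= rn k <= Rmax S0 0 /\ rn k <= Rmax S0 0 /\ (rn k <= S0 \/ rn k = 0) /\ ~ (Rabs (un k (rn k) - u
  (rn k)) < e /\ Rabs (vn k (rn k) - v (rn k)) < e).
 { intro k. specialize (Hp k). unfold rhon, aln, rn, un, vn. destruct (p k) as [[[x1 x2] x3] [x4 x5]]. auto. }
 have Hinv : forall (x : nat -> R) l, (forall k, Rabs (x k - l) < / INR (k + 1)) -> is_lim_seq x l.
 { intros x l Hx. apply lim_seq_eps. intros eps Heps. have [N [N1 N2]] := archimed_cor1 eps Heps. exists N. intros k Hk.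
  eapply Rlt_trans; auto. eapply Rle_lt_trans; [|apply N1]. apply Rinv_le_contravar; [apply lt_0_INR; auto|].
  apply le_INR; lia. }
 destruct (rest_compact n_pos NL rhon aln un vn rho al) as [phi [u2 [v2 [K [P [R2 [L1 [L2 Lip]]]]]]]]; auto.
 { apply Hinv. apply Hq. } { apply Hinv. apply Hq. } { apply Hq. }
 have Eq := rest_unique rho al u v u2 v2 S0 Hal RS R2 (fun r Hr => Hnz r (Rlt_le _ _ Hr)).
 destruct (bounded_subsequence (fun k => rn (phi k)) (Rmax S0 0)) as [psi [Ppsi [r0 Hr0]]].
 { intro k. have [_ [_ [_ [T _]]]] := Hq (phi k). by_cases. } set (T := Rmax S0 0) in *. have Hr0T : 0 <= r0 <= T.
 { split.
  - apply (is_lim_seq_le (fun _ => 0) (fun k => rn (phi (psi k))) 0 r0); auto; [|apply is_lim_seq_const]. intro k. apply Hq.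
  - apply (is_lim_seq_le (fun k => rn (phi (psi k))) (fun _ => T) r0 T); auto; [|apply is_lim_seq_const]. intro k. apply Hq. }
 have Hr0R : u2 r0 = u r0 /\ v2 r0 = v r0.
 { destruct (Rle_lt_dec 0 S0).
  - unfold T in Hr0T. rewrite Rmax_left in Hr0T by auto. destruct (Eq r0); [lra|]. auto.
  - unfold T in Hr0T. rewrite Rmax_right in Hr0T by lra. replace r0 with 0 by lra. have [-> ->] := rs_rest RS 0 (rs_rho RS).
   have [-> ->] := rs_rest R2 0 (rs_rho R2). auto. }
 have Conv : forall (x : nat -> R -> R) (y w : R -> R), (forall t, is_lim_seq (fun k => x (phi k) t) (y t)) -> y r0 = w r0 ->
  continuous w r0 -> (forall k s t, Rabs s <= T -> Rabs t <= T -> Rabs (x (phi k) t - x (phi k) s) <= K T * Rabs (t - s)) ->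
  exists N, forall k, (N <= k)%nat -> Rabs (x (phi (psi k)) (rn (phi (psi k))) - w (rn (phi (psi k)))) < e.
 { intros x y w Hx Hyw Hw Hl. destruct (continuous_eps w r0 (e / 3) Hw) as [e1 [He1 H1]]; [lra|]. set (kk := Rabs (K T) + 1).
  have Hkk : 0 < kk by (unfold kk; assert (Q := Rabs_pos (K T)); lra).
  destruct (proj1 (lim_seq_eps _ _) Hr0 (Rmin e1 (e / 3 / kk))) as [N1 HN1]. { apply Rmin_glb_lt; auto. positive. }
  destruct (proj1 (lim_seq_eps _ _) (subseq_lim _ _ psi Ppsi (Hx r0)) (e / 3)) as [N2 HN2]; [lra|]. exists (max N1 N2).
  intros k Hk. specialize (HN1 k ltac:(lia)). specialize (HN2 k ltac:(lia)). apply Rmin_Rgt_l in HN1 as [M1 M2].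
  set (s := rn (phi (psi k))) in *. specialize (H1 s M1). have Hs : Rabs s <= T.
  { have [_ [_ [_ [Z _]]]] := Hq (phi (psi k)). fold s in Z. by_cases. } have Hr : Rabs r0 <= T by by_cases.
  have B := Hl (psi k) r0 s Hr Hs. have B2 : K T * Rabs (s - r0) < e / 3.
  { apply Rle_lt_trans with (kk * Rabs (s - r0)).
   - apply Rmult_le_compat_r; [by_cases|]. unfold kk. by_cases.
   - apply Rlt_le_trans with (kk * (e / 3 / kk)); [apply Rmult_lt_compat_l; auto|]. apply Req_le. field. lra. }
  by_cases. }
 destruct (Conv un u2 u L1) as [N1 HN1]; try apply Hr0R. { apply (rs_cont RS). } { intros k s t Hs Ht. apply Lip; auto. }
 destruct (Conv vn v2 v L2) as [N2 HN2]; try apply Hr0R. { apply (rs_cont RS). } { intros k s t Hs Ht. apply Lip; auto. }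
 set (k := max N1 N2). have [_ [_ [_ [_ [_ [_ Z]]]]]] := Hq (phi (psi k)). apply Z.
 split; [apply HN1|apply HN2]; unfold k; lia.
Qed.

End Uniqueness.

(** * Normalized solutions and their zeros *)

Definition dead (u v : R -> R) (r : R) : Prop := u r = 0 /\ v r = 0.

(** As [f] need not be Lipschitz at [0], a solution that reaches the state
    [(0, 0)] may leave it again; the normalized one stays, and is determined by
    its initial value. *)
Record normal_sol (n : nat) (D : R -> Prop) (f : R -> R) (al : R) (u v : R -> R) : Prop := {
  ns_rest : rest_sol n D f 0 al u v;
  ns_dead : forall r s, 0 <= r <= s -> dead u v r -> dead u v s
}.

Arguments ns_rest {n D f al u v}.
Arguments ns_dead {n D f al u v}.

Definition trunc (r0 : R) (g : R -> R) (r : R) : R := if Rle_dec r r0 then g r else 0.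

Lemma trunc_before r0 g r : r <= r0 -> trunc r0 g r = g r.
Proof. unfold trunc. by_cases. Qed.

Lemma trunc_after r0 g r : r0 < r -> trunc r0 g r = 0.
Proof. unfold trunc. by_cases. Qed.

Lemma locally_lt (x y : R) : x < y -> locally x (fun t => t < y).
Proof.
 intros H. exists (mkposreal (y - x) by_lra). intros t Ht. apply Rabs_lt_between in Ht.
 unfold minus, plus, opp in Ht; simpl in Ht. lra.
Qed.

Lemma locally_gt (x y : R) : y < x -> locally x (fun t => y < t).
Proof.
 intros H. exists (mkposreal (x - y) by_lra). intros t Ht. apply Rabs_lt_between in Ht.
 unfold minus, plus, opp in Ht; simpl in Ht. lra.
Qed.

Lemma trunc_continuous r0 g r : g r0 = 0 -> continuous g r -> continuous (trunc r0 g) r.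
Proof.
 intros H0 Hc. apply eps_continuous. intros e He. have [h [Hh H]] := continuous_eps g r e Hc He.
 have [[Hr|Hr]|Hr] := total_order_T r r0.
 - exists (Rmin h (r0 - r)). split; [by_cases|]. intros y Hy. apply Rmin_Rgt_l in Hy as [Y1 Y2]. apply Rabs_lt_between in Y2.
  rewrite !trunc_before by lra. auto.
 - exists h. split; auto. intros y Hy. rewrite (trunc_before r0 g r) by lra.
  destruct (Rle_lt_dec y r0); [rewrite trunc_before by lra; auto|]. rewrite trunc_after by lra. subst. by_cases.
 - exists (r - r0). split; [lra|]. intros y Hy. apply Rabs_lt_between in Hy. rewrite !trunc_after by lra. by_cases.
Qed.

Lemma trunc_derive r0 g r l : g r0 = 0 -> is_derive g r l -> r <= r0 -> (r = r0 -> l = 0) ->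
  is_derive (trunc r0 g) r l.
Proof.
 intros H0 Hd Hr Hl. destruct (Rle_lt_or_eq_dec r r0 Hr) as [Hlt| ->].
 - apply (is_derive_ext_loc g); auto. apply (filter_imp (fun t => t < r0)); [|apply locally_lt; auto]. intros t Ht.
  rewrite trunc_before by lra. auto.
 - rewrite (Hl eq_refl) in *. apply is_derive_eps. intros e He. apply is_derive_Reals in Hd. have [h H] := Hd e He. exists h.
  split; [apply cond_pos|]. intros y Hy. rewrite (trunc_before r0 g r0), H0 by lra.
  replace (trunc r0 g y - 0 - 0 * (y - r0)) with (trunc r0 g y) by ring. have P := Rabs_pos (y - r0).
  destruct (Rle_lt_dec y r0); [rewrite trunc_before by lra|rewrite trunc_after, Rabs_R0 by lra; nra].
  destruct (Req_dec y r0) as [->|Hne]; [by_cases|]. specialize (H (y - r0) by_lra Hy).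
  replace (r0 + (y - r0)) with y in H by ring. rewrite H0 in H.
  replace ((g y - 0) / (y - r0) - 0) with (g y / (y - r0)) in H by (field; lra).
  replace (g y) with (g y / (y - r0) * (y - r0)) by (field; lra). rewrite Rabs_mult. nra.
Qed.

Lemma trunc_derive_after r0 g r : r0 < r -> is_derive (trunc r0 g) r 0.
Proof.
 intros H. apply (is_derive_ext_loc (fun _ => 0)); [|apply (is_derive_const 0)].
 apply (filter_imp (fun t => r0 < t)); [|apply locally_gt; auto]. intros t Ht. rewrite trunc_after; auto.
Qed.

Lemma bounded_away (g : R -> R) a b : a <= b -> (forall x, a <= x <= b -> continuous g x /\ g x <> 0) ->
  exists m, 0 < m /\ forall x, a <= x <= b -> m <= Rabs (g x).
Proof.
 intros Hab H. destruct (continuity_ab_min (fun x => Rabs (g x)) a b Hab) as [m [Hm Hmab]].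
 { intros c Hc. apply continuous_continuity_pt. apply continuous_comp; [apply H; auto|]. apply continuous_Rabs. }
 exists (Rabs (g m)). split; [apply Rabs_pos_lt, H; auto|auto].
Qed.

(** Simple zeros are isolated, and counted in increasing order. *)
Fixpoint kth_zero (u v : R -> R) (k : nat) (r : R) : Prop :=
  match k with
  | O => r = 0
  | S j => exists s, kth_zero u v j s /\ s < r /\ u r = 0 /\ v r <> 0 /\
             forall t, s < t < r -> u t <> 0
  end.

Definition has_zeros (u v : R -> R) (k : nat) : Prop := exists r, kth_zero u v k r.

Lemma kz_unique u v k r r' : kth_zero u v k r -> kth_zero u v k r' -> r = r'.
Proof.
 revert r r'. induction k; intros r r' H H'; [simpl in *; lra|]. case: H => [s [A1 [A2 [A3 [A4 A5]]]]].
 have [s' [B1 [B2 [B3 [B4 B5]]]]] := H'. assert (s = s') by auto. subst s'. destruct (total_order_T r r') as [[H|H]|H]; auto.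
 - destruct (B5 r); auto.
 - destruct (A5 r'); auto.
Qed.

Lemma kz_nonneg u v k r : kth_zero u v k r -> 0 <= r.
Proof. revert r. induction k; intros r H; [simpl in H; lra|]. have [s [A1 [A2 _]]] := H. apply IHk in A1. lra. Qed.

Lemma has_zeros_le u v j k : (j <= k)%nat -> has_zeros u v k -> has_zeros u v j.
Proof. induction 1; auto. intros [r [s [A _]]]. apply IHle. exists s; auto. Qed.

Lemma simple_zero (u : R -> R) r l : is_derive u r l -> u r = 0 -> l <> 0 ->
  exists e, 0 < e /\ forall t, Rabs (t - r) < e -> t <> r -> 0 < l * (t - r) * u t.
Proof.
 intros Hd H0 Hl. apply is_derive_Reals in Hd. destruct (Hd (Rabs l / 2)) as [e He]; [by_cases|]. exists e.
 split; [apply cond_pos|]. intros t Ht Hne. specialize (He (t - r) by_lra Ht).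
 replace (r + (t - r)) with t in He by ring. rewrite H0, Rminus_0_r in He. set (q := u t / (t - r)) in *.
 replace (u t) with (q * (t - r)) by (unfold q; field; lra). have Q : 0 < l * q.
 { destruct (Rlt_le_dec 0 l).
  - rewrite (Rabs_right l) in He by lra. apply Rabs_lt_between in He. nra.
  - rewrite (Rabs_left l) in He by lra. apply Rabs_lt_between in He. nra. }
 replace (l * (t - r) * (q * (t - r))) with (l * q * (t - r) ^ 2) by ring. apply Rmult_lt_0_compat; auto. nra.
Qed.

Section Normal.

Context {n D f delta} (n_pos : (1 <= n)%nat) (NL : nonlinearity D f delta).

Lemma first_dead (u v : R -> R) r : (forall r, continuous u r /\ continuous v r) -> 0 <= r -> dead u v r ->
  exists r0, 0 <= r0 <= r /\ dead u v r0 /\ forall s, 0 <= s < r0 -> ~ dead u v s.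
Proof.
 intros Hc Hr Hd. apply NNPP; intro Hno. assert (G : forall s, 0 <= s -> s <= r -> ~ dead u v s); [|apply (G r); auto; lra].
 intros s Hs. pattern s. apply (real_induction _ 0); auto; clear s Hs.
 - intros x Hx IH Hxr Hdx. apply Hno. exists x. repeat split; auto; try apply Hdx. intros s Hs. apply IH; lra.
 - intros x Hx IH. have [Hxr|Hxr] := Rle_lt_dec x r. 2: { exists 1. split; [lra|]. intros; lra. }
  specialize (IH x by_lra Hxr). have [Cu Cv] := Hc x.
  have Near : forall g, continuous g x -> g x <> 0 -> exists e, 0 < e /\ forall y, x < y < x + e -> g y <> 0.
  { intros g Cg Hg. destruct (continuous_eps g x (Rabs (g x)) Cg) as [e [He H]]; [by_cases|]. exists e. split; auto.
   intros y Hy Hgy. specialize (H y ltac:(by_cases)). by_cases. }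
  have [Hu|Hu] := Req_dec (u x) 0.
  + destruct (Near v Cv) as [e [He H]]; [intro E; apply IH; split; auto|]. exists e. split; auto. intros y Hy _ [_ E].
   apply (H y); auto.
  + have [e [He H]] := Near u Cu Hu. exists e. split; auto. intros y Hy _ [E _]. apply (H y); auto.
Qed.

Lemma rest_trunc rho al u v r0 : rest_sol n D f rho al u v -> rho < r0 -> dead u v r0 ->
  rest_sol n D f rho al (trunc r0 u) (trunc r0 v).
Proof.
 intros RS Hr0 [D1 D2]. constructor.
 - apply (rs_rho RS).
 - intros r Hr. rewrite !trunc_before by lra. apply (rs_rest RS); auto.
 - intros r. destruct (Rle_lt_dec r r0).
  + rewrite trunc_before by lra. apply (rs_dom RS).
  + rewrite trunc_after by lra. apply (nl_zero NL).
 - split; apply trunc_continuous; auto; apply (rs_cont RS).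
 - intros r Hr. have [Hle|Hlt] := Rle_lt_dec r r0.
  + have [O1 O2] := rs_ode RS r Hr. split; rewrite ?trunc_before by lra; apply trunc_derive; auto; intros ->; auto.
   rewrite D1, D2, (nl_f0 NL). lra.
  + split; rewrite ?trunc_after by lra.
   * apply trunc_derive_after; auto.
   * replace (- (INR n / r) * 0 - f 0) with 0 by (rewrite (nl_f0 NL); ring). apply trunc_derive_after; auto.
Qed.

Lemma normal_exists al : D al -> al <> 0 -> exists u v, normal_sol n D f al u v.
Proof.
 intros HD Hal. destruct (rest_exists n_pos NL 0 al) as [u [v RS]]; auto; [lra|].
 have [[r [Hr Hd]]|Hno] := classic (exists r, 0 <= r /\ dead u v r).
 - destruct (first_dead u v r) as [r0 [Hr0 [Hd0 Hbefore]]]; auto. { apply (rs_cont RS). } assert (0 < r0).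
  { case: (Req_dec r0 0) => E; [|lra]. have [E1 _] := Hd0. destruct (rs_rest RS r0) as [E2 _]; lra. }
  exists (trunc r0 u), (trunc r0 v). constructor; [apply rest_trunc; auto|]. intros s t Hst [E1 E2].
  have [Hs|Hs] := Rle_lt_dec s r0.
  + rewrite trunc_before in E1, E2 by lra.
   destruct (Rle_lt_or_eq_dec s r0 Hs) as [Hlt| ->]; [destruct (Hbefore s); [lra|split; auto]|].
   destruct (Rle_lt_or_eq_dec r0 t) as [Hlt| <-]; try lra.
   * split; apply trunc_after; auto.
   * split; rewrite trunc_before; lra.
  + split; apply trunc_after; lra.
 - exists u, v. constructor; auto. intros r s Hrs Hd. destruct Hno. exists r. split; auto; lra.
Qed.

(** ** Zeros of a normalized solution *)

Lemma normal_start al u v : normal_sol n D f al u v -> u 0 = al /\ v 0 = 0.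
Proof. intros NS. apply (rs_rest (ns_rest NS)). lra. Qed.

Lemma normal_derive al u v r : normal_sol n D f al u v -> 0 < r ->
  is_derive u r (v r) /\ is_derive v r (- (INR n / r) * v r - f (u r)).
Proof. intros NS Hr. apply (rs_ode (ns_rest NS)); auto. Qed.

Lemma normal_cont al u v r : normal_sol n D f al u v -> continuous u r /\ continuous v r.
Proof. intros NS. apply (rs_cont (ns_rest NS)). Qed.

Lemma alive_before al u v r s : normal_sol n D f al u v -> al <> 0 -> ~ dead u v s -> r <= s -> ~ dead u v r.
Proof.
 intros NS Hal Hs Hr Hd. have [H|H] := Rle_lt_dec 0 r.
 - apply Hs. apply (ns_dead NS r); auto.
 - have [E _] := Hd. destruct (rs_rest (ns_rest NS) r) as [E2 _]; lra.
Qed.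

Lemma kz_next al u v j r t : normal_sol n D f al u v -> al <> 0 ->
  kth_zero u v j r -> r < t -> u t = 0 -> v t <> 0 -> exists r', kth_zero u v (S j) r' /\ r' <= t.
Proof.
 intros NS Hal Hj Hrt Hu Hv. have Hr0 := kz_nonneg _ _ _ _ Hj.
 have Iso : exists e, 0 < e /\ forall s, r < s < r + e -> u s <> 0.
 { destruct j as [|j].
  - simpl in Hj. have [E _] := normal_start _ _ _ NS. destruct (continuous_eps u 0 (Rabs al)) as [e [He H]].
   { apply (normal_cont _ _ _ 0 NS). } { by_cases. } exists e. split; auto. intros s Hs E2.
   specialize (H s ltac:(by_cases)). by_cases.
  - have [s0 [A1 [A2 [A3 [A4 _]]]]] := Hj. have H0 := kz_nonneg _ _ _ _ A1.
   destruct (simple_zero u r (v r)) as [e [He H]]; auto. { apply (normal_derive al); auto; lra. } exists e. split; auto.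
   intros s Hs E. specialize (H s ltac:(by_cases) by_lra). nra. }
 destruct Iso as [e [He Iso]].
 set (r1 := Rmin (r + e / 2) ((r + t) / 2)). have Hr1 : r < r1 < r + e /\ r1 < t. { unfold r1. by_cases. }
 destruct (first_hit (fun s => - Rabs (u s)) r1 t 0) as [r' [H1 [H2 H3]]].
 - lra.
 - intros x _. apply (continuous_opp (fun s => Rabs (u s))). apply continuous_comp; [|apply continuous_Rabs].
  apply (normal_cont _ _ _ x NS).
 - have P := Rabs_pos_lt _ (Iso r1 by_lra). lra.
 - by_cases.
 - have Hur : u r' = 0 by by_cases. exists r'. split; [|lra]. exists r. repeat split; auto; try lra.
  + intro E. destruct (ns_dead NS r' t) as [_ E2]; [lra|by_cases|]. auto.
  + intros s Hs. destruct (Rlt_le_dec s r1); [apply Iso; lra|]. specialize (H3 s by_lra). by_cases.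
Qed.

Lemma many_zeros al u v (a : nat -> R) k : normal_sol n D f al u v -> al <> 0 -> 0 <= a 0%nat ->
  (forall i, (i < k)%nat -> exists t, a i < t <= a (S i) /\ u t = 0 /\ v t <> 0) ->
  has_zeros u v k.
Proof.
 intros NS Hal Ha H. cut (exists r, kth_zero u v k r /\ r <= a k). { intros [r [H1 _]]. exists r; auto. } revert H.
 induction k; intros H; [exists 0; split; simpl; auto|]. destruct IHk as [r [H1 H2]]; auto.
 destruct (H k) as [t [T1 [T2 T3]]]; auto. destruct (kz_next al u v k r t) as [r' [P1 P2]]; auto; [lra|]. exists r'.
 abs_bounds.
Qed.

(** Zeros cannot accumulate at a time where the solution is alive. *)
Lemma finite_zeros al u v S0 : normal_sol n D f al u v -> al <> 0 -> ~ dead u v S0 ->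
  (forall t, S0 < t -> u t = 0 -> v t = 0) -> exists k, ~ has_zeros u v k.
Proof.
 intros NS Hal HS Hafter. apply NNPP; intro Hno. have Hall : forall k, exists r, kth_zero u v k r.
 { intro k. apply NNPP; intro H. apply Hno. exists k. auto. } apply choice in Hall. have [z Hz] := Hall.
 have Hz0 : forall k, u (z (S k)) = 0 /\ v (z (S k)) <> 0 /\ z k < z (S k).
 { intro k. have [s [A1 [A2 [A3 [A4 _]]]]] := Hz (S k). rewrite (kz_unique _ _ _ _ _ (Hz k) A1). auto. }
 have HzS : forall k, z k <= S0.
 { intro k. have [A [B C]] := Hz0 k. destruct (Rle_lt_dec (z (S k)) S0); [lra|]. destruct B. auto. }
 destruct (ex_finite_lim_seq_incr z S0) as [l Hl]; auto. { intro k. destruct (Hz0 k); lra. }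
 have Hinc : forall k, z k <= l by (intro k; apply is_lim_seq_incr_compare; auto; intro; destruct (Hz0 n0); lra).
 have HlS : l <= S0. { apply (is_lim_seq_le z (fun _ => S0) l S0); auto. apply is_lim_seq_const. }
 have Hnear : forall g, continuous g l -> (forall k, exists x, z k <= x <= z (S k) /\ g x = 0) -> g l = 0.
 { intros g Cg Hg. apply NNPP; intro Hgl. destruct (continuous_eps g l (Rabs (g l)) Cg) as [e [He H]]. { by_cases. }
  have [N HN] := proj1 (lim_seq_eps _ _) Hl e He. have [x [Hx E]] := Hg N. specialize (HN N (le_n _)). have T := Hinc (S N).
  specialize (H x ltac:(by_cases)). by_cases. }
 apply (alive_before al u v l S0 NS Hal HS HlS).
 have [Cu Cv] := normal_cont _ _ _ l NS. split.
 - apply Hnear; auto. intro k. exists (z (S k)). destruct (Hz0 k); split; lra.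
 - apply NNPP; intro Hv. destruct (continuous_eps v l (Rabs (v l)) Cv) as [e [He H]]; [by_cases|].
  have [N HN] := proj1 (lim_seq_eps _ _) Hl e He. specialize (HN (S N) ltac:(lia)). have T := Hinc (S (S N)).
  have [Z1 [_ Z2]] := Hz0 N. have [Z3 [_ Z4]] := Hz0 (S N). have Zn := kz_nonneg _ _ _ _ (Hz N).
  destruct (mean_value u v (z (S N)) (z (S (S N)))) as [c [C1 C2]]; auto. { intros x _. apply (normal_cont _ _ _ x NS). }
  { intros x Hx. apply (normal_derive al); auto; lra. } have Ec : v c = 0 by nra. specialize (H c ltac:(by_cases)).
  by_cases.
Qed.

Section Family.

Context (U V : R -> R -> R) (Fam : forall al, D al -> al <> 0 -> normal_sol n D f al (U al) (V al)).

Lemma family_continuity al S0 : D al -> al <> 0 -> ~ dead (U al) (V al) S0 ->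
  forall e, 0 < e -> exists h, 0 < h /\ forall be, D be -> Rabs (be - al) < h -> be <> 0 /\
    forall r, r <= S0 -> Rabs (U be r - U al r) < e /\ Rabs (V be r - V al r) < e.
Proof.
 intros HD Hal HS e He. assert (NS := Fam al HD Hal).
 destruct (rest_continuity n_pos NL 0 al (U al) (V al) S0 HD Hal (ns_rest NS)) with (e := e) as [h [Hh H]]; auto.
 { intros r Hr. apply (alive_before al (U al) (V al) r S0); auto. } exists (Rmin h (Rabs al)).
 split; [apply Rmin_glb_lt; auto; apply Rabs_pos_lt; auto|]. intros be Hbe Hb. apply Rmin_Rgt_l in Hb as [B1 B2].
 assert (be <> 0) by by_cases. split; auto. apply (H 0 be); auto.
 - apply (ns_rest (Fam be Hbe H0)).
 by_cases.
Qed.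

(** Zeros up to a time where [u <> 0] move continuously with the initial value,
    and none appears or disappears. *)
Definition tracked al k r := forall e, 0 < e -> exists h, 0 < h /\ forall be, D be -> Rabs (be - al) < h ->
  be <> 0 /\ exists r', kth_zero (U be) (V be) k r' /\ Rabs (r' - r) < e.

(** Between the tracked zero and [S0] the limit is away from [0], except near the
    zero itself, where its slope is: neighbours have no other zero. *)
Lemma tracked_gap al k r S0 : D al -> al <> 0 -> tracked al k r -> kth_zero (U al) (V al) k r -> r < S0 ->
  (forall t, r < t <= S0 -> U al t <> 0) -> ~ dead (U al) (V al) S0 ->
  exists h, 0 < h /\ forall be, D be -> Rabs (be - al) < h -> be <> 0 /\
    exists r', kth_zero (U be) (V be) k r' /\ r' < S0 /\ forall t, r' < t <= S0 -> U be t <> 0.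
Proof.
 intros HD Hal Htr Hk HrS Hgap HS. have NS := Fam al HD Hal.
 have Far : forall a, r <= a -> (a <= S0 -> U al a <> 0) -> exists h, 0 < h /\ forall be, D be -> Rabs (be - al) < h ->
  forall t, a <= t <= S0 -> U be t <> 0.
 { intros a Ha Hua. have [HaS|HaS] := Rle_lt_dec a S0. 2: { exists 1. split; [lra|]. intros; lra. }
  destruct (bounded_away (U al) a S0 HaS) as [m [Hm H]].
  { split; [apply (normal_cont _ _ _ x NS)|]. destruct (Req_dec x a) as [->|]; [lra|apply Hgap; lra]. }
  have [h [Hh H2]] := family_continuity al S0 HD Hal HS m Hm. exists h. split; auto. intros be Hbe Hb t Ht E.
  have [_ H3] := H2 be Hbe Hb. have [H4 _] := H3 t by_lra. rewrite E, Rminus_0_l, Rabs_Ropp in H4. specialize (H t Ht).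
  lra. }
 destruct k as [|k].
 - simpl in Hk. subst r. destruct (Far 0) as [h [Hh H]]; try lra. { have [-> _] := normal_start _ _ _ NS. auto. }
  have [h2 [Hh2 H2]] := Htr 1 by_lra. exists (Rmin h h2). split; [by_cases|]. intros be Hbe Hb.
  apply Rmin_Rgt_l in Hb as [B1 B2]. have [Hne _] := H2 be Hbe B2. split; auto. exists 0. repeat split; auto. intros t Ht.
  apply H; auto; lra.
 - have Hk2 := Hk. have [s0 [A1 [A2 [A3 [A4 _]]]]] := Hk2. have H0 := kz_nonneg _ _ _ _ A1.
  have [_ Cv] := normal_cont _ _ _ r NS. destruct (continuous_eps (V al) r (Rabs (V al r) / 2) Cv) as [e1 [He1 H1]].
  { by_cases. } set (e := Rmin e1 (Rmin r (S0 - r)) / 2).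
  have He : 0 < e < e1 /\ e < r /\ e < S0 - r by (unfold e, Rmin; repeat destruct Rle_dec; lra).
  destruct (Far (r + e)) as [h1 [Hh1 F1]]; [lra|intro; apply Hgap; lra|]. have [h2 [Hh2 F2]] := Htr e by_lra.
  destruct (family_continuity al S0 HD Hal HS (Rabs (V al r) / 2)) as [h3 [Hh3 F3]]. { by_cases. }
  exists (Rmin h1 (Rmin h2 h3)). split; [by_cases|]. intros be Hbe Hb. apply Rmin_Rgt_l in Hb as [B1 B2].
  apply Rmin_Rgt_l in B2 as [B2 B3]. have [Hne [r' [R1 R2]]] := F2 be Hbe B2. split; auto. exists r'. split; auto.
  apply Rabs_lt_between in R2. split; [lra|]. intros t Ht E.
  destruct (Rle_lt_dec (r + e) t) as [Hte|Hte]; [apply (F1 be Hbe B1 t); lra|]. have [_ F4] := F3 be Hbe B3.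
  have NSb := Fam be Hbe Hne. destruct (mean_value (U be) (V be) r' t) as [c [C1 C2]]; try lra.
  { intros x _. apply (normal_cont _ _ _ x NSb). } { intros x Hx. apply (normal_derive be); auto; lra. }
  have [s1 [_ [_ [Z _]]]] := R1. have Ec : V be c = 0 by nra. specialize (H1 c ltac:(by_cases)).
  have [_ F5] := F4 c by_lra. by_cases.
Qed.

Lemma kz_tracked al k r : D al -> al <> 0 -> kth_zero (U al) (V al) k r -> tracked al k r.
Proof.
 intros HD Hal. have NS := Fam al HD Hal. revert r. induction k; intros r Hk e He.
 - simpl in Hk. exists (Rabs al). split; [by_cases|]. split.
  + by_cases.
  + exists 0. repeat split. by_cases.
 - have [s [A1 [A2 [A3 [A4 A5]]]]] := Hk. have H0 := kz_nonneg _ _ _ _ A1.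
  destruct (simple_zero (U al) r (V al r)) as [e1 [He1 Hsz]]; auto. { apply (normal_derive al); auto; lra. }
  have [_ Cv] := normal_cont _ _ _ r NS. destruct (continuous_eps (V al) r (Rabs (V al r) / 2) Cv) as [e2 [He2 Hv]].
  { by_cases. } set (x := Rmin (Rmin e1 e2) (Rmin e (r - s)) / 2).
  have Hx : 0 < x /\ x < e1 /\ x < e2 /\ x < e /\ x < r - s. { unfold x. by_cases. } have HS : ~ dead (U al) (V al) (r + x).
  { intros [E _]. specialize (Hsz (r + x) ltac:(by_cases) by_lra). nra. }
  have HS2 : ~ dead (U al) (V al) (r - x) by (apply (alive_before al _ _ _ (r + x)); auto; lra).
  destruct (tracked_gap al k s (r - x)) as [h1 [Hh1 F1]]; auto; try lra; try (intros; apply A5; lra).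
  have P1 := Hsz (r + x) ltac:(by_cases) by_lra. have P2 := Hsz (r - x) ltac:(by_cases) by_lra.
  replace (r + x - r) with x in P1 by ring. replace (r - x - r) with (- x) in P2 by ring.
  set (m := Rmin (Rabs (V al r) / 2) (Rmin (Rabs (U al (r + x))) (Rabs (U al (r - x))))). have Hm : 0 < m.
  { have Q := Rabs_pos_lt _ A4. repeat apply Rmin_glb_lt; try lra; apply Rabs_pos_lt; intro E; rewrite E in *; lra. }
  have [h2 [Hh2 F2]] := family_continuity al (r + x) HD Hal HS m Hm. exists (Rmin h1 h2). split; [by_cases|].
  intros be Hbe Hb. apply Rmin_Rgt_l in Hb as [B1 B2]. have [Hne [s' [S1 [S2 S3]]]] := F1 be Hbe B1. split; auto.
  have [_ F3] := F2 be Hbe B2. have NSb := Fam be Hbe Hne. have [U1 _] := F3 (r + x) by_lra.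
  have [U2 _] := F3 (r - x) by_lra. apply Rmin_Rgt_l in U1 as [_ U1]. apply Rmin_Rgt_l in U1 as [U1 _].
  apply Rmin_Rgt_l in U2 as [_ U2]. apply Rmin_Rgt_l in U2 as [_ U2].
  have Sgn : forall p q, 0 < p * q -> forall y, Rabs (y - q) < Rabs q -> 0 < p * y.
  { intros p q Hpq y Hy. unfold Rabs in Hy. repeat destruct Rcase_abs in Hy; nra. } have Q1 := Sgn (V al r * x) _ P1 _ U1.
  have Q2 := Sgn (V al r * - x) _ P2 _ U2. have Hz : exists t, r - x <= t <= r + x /\ U be t = 0.
  { have Cb : forall y, r - x <= y <= r + x -> continuous (U be) y. { intros y _. apply (normal_cont _ _ _ y NSb). }
   have PS : forall p y, 0 < p -> 0 < p * y -> 0 < y by (intros; apply (Rmult_lt_reg_l p); lra).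
   destruct (Rlt_le_dec 0 (V al r)).
   - have Y1 := PS (V al r * x) (U be (r + x)) ltac:(nra) Q1.
    have Y2 := PS (V al r * x) (- U be (r - x)) ltac:(nra) by_lra. apply ivt; auto; lra.
   - have Y0 : 0 < - V al r * x by nra. have Y1 := PS (- V al r * x) (- U be (r + x)) Y0 by_lra.
    have Y2 := PS (- V al r * x) (U be (r - x)) Y0 by_lra. apply ivt_decr; auto; lra. }
  have [t [Ht Et]] := Hz.
  have HVt : V be t <> 0.
  { intro E. have [_ F4] := F3 t by_lra. apply Rmin_Rgt_l in F4 as [F4 _].
   specialize (Hv t ltac:(apply Rabs_def1; lra)). rewrite E, Rminus_0_l, Rabs_Ropp in F4.
   have T := Rabs_triang_inv (V al r) (V al t). rewrite Rabs_minus_sym in Hv. lra. }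
  destruct (kz_next be (U be) (V be) k s' t) as [r' [R1 R2]]; auto; [lra|]. exists r'. split; auto. have Hr' : r - x < r'.
  { apply Rnot_le_lt; intro Hle. have R3 := R1. have [s2 [T1 [T2 [T3 _]]]] := R3. rewrite (kz_unique _ _ _ _ _ T1 S1) in T2.
   apply (S3 r'); lra. }
  abs_bounds.
Qed.

Lemma zeros_persist al k : D al -> al <> 0 -> has_zeros (U al) (V al) k ->
  exists h, 0 < h /\ forall be, D be -> Rabs (be - al) < h -> has_zeros (U be) (V be) k.
Proof.
 intros HD Hal [r Hr]. destruct (kz_tracked al k r HD Hal Hr 1) as [h [Hh H]]; [lra|]. exists h. split; auto.
 intros be Hbe Hb. have [_ [r' [Hr' _]]] := H be Hbe Hb. exists r'; auto.
Qed.

(** With more zeros than the limit has, the next zero comes late. *)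
Lemma late_zero al k r S0 : D al -> al <> 0 -> kth_zero (U al) (V al) k r -> r < S0 ->
  (forall t, r < t <= S0 -> U al t <> 0) ->
  exists h, 0 < h /\ forall be, D be -> Rabs (be - al) < h -> be <> 0 /\
    exists r', kth_zero (U be) (V be) k r' /\ r' < S0 /\ (forall t, r' < t <= S0 -> U be t <> 0) /\
      forall t, kth_zero (U be) (V be) (S k) t -> S0 < t.
Proof.
 intros HD Hal Hk Hr Hgap. destruct (tracked_gap al k r S0) as [h [Hh H]]; auto; [apply kz_tracked; auto| |].
 { intros [E _]. apply (Hgap S0); lra. } exists h. split; auto. intros be Hbe Hb.
 have [Hne [r' [H1 [H2 H3]]]] := H be Hbe Hb. split; auto. exists r'. repeat split; auto. intros t [s [A1 [A2 [A3 _]]]].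
 rewrite (kz_unique _ _ _ _ _ A1 H1) in A2. apply Rnot_le_lt. intro Hle. apply (H3 t); lra.
Qed.

End Family.

End Normal.

Arguments first_dead : clear implicits.
Arguments kz_tracked : clear implicits.

Arguments normal_cont {n D f al u v}.
Arguments normal_derive {n D f al u v}.
Arguments normal_start {n D f al u v}.
Arguments alive_before {n D f al u v}.

(** * Reflection *)

Definition mirror (f : R -> R) (s : R) : R := - f (- s).

Lemma ode_mirror q f u v t : ode_at q f u v t ->
  ode_at q (mirror f) (fun r => - u r) (fun r => - v r) t.
Proof.
 intros [H1 H2]. split.
 - apply (is_derive_opp u); auto.
 - eapply is_derive_value; [apply (is_derive_opp v); exact H2|]. unfold mirror, opp; simpl. rewrite Ropp_involutive. ring.
Qed.

Section Mirror.

Context {D f delta} (NL : nonlinearity D f delta).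

Lemma primitive_mirror s : D (- s) -> primitive (mirror f) s = primitive f (- s).
Proof.
 intros HD. apply is_RInt_unique. apply (is_RInt_comp_opp f). rewrite Ropp_0 at 1.
 apply (RInt_correct (V := R_CompleteNormedModule)). apply ex_RInt_continuous. intros z Hz. apply (nl_cont NL).
 have D0 := nl_zero NL. unfold Rmin, Rmax in Hz. destruct Rle_dec; eapply (nl_conv NL); try exact Hz; auto.
Qed.

Lemma nonlinearity_mirror : nonlinearity (fun s => D (- s)) (mirror f) delta.
Proof.
 case: NL => [Z1 Z2 Z3 Z4 Z5 Z6 Z7 Z8 Z9 Z10]. constructor.
 - rewrite Ropp_0; auto.
 - intros a b x Ha Hb Hx. apply (Z2 (- b) (- a)); auto; lra.
 - intros x Hx. destruct (Z3 _ Hx) as [e [He H]]. exists e. split; auto. intros y Hy. apply H. by_cases.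
 - intros x Hx. apply (continuous_opp (fun s => f (- s))). apply continuous_opp_arg; auto.
 { intros x Hx Hne. destruct (Z5 (- x) Hx) as [L [e [He [HL H]]]]; [lra|]. exists L, e. repeat split; auto. intros y z Hy Hz.
  unfold mirror. replace (- f (- y) - - f (- z)) with (- (f (- y) - f (- z))) by ring. rewrite Rabs_Ropp.
  replace (Rabs (y - z)) with (Rabs (- y - - z)); [apply H|]. all: by_cases. }
 - unfold mirror. rewrite Ropp_0, Z6. ring.
 - intros x Hx. destruct (Z7 _ Hx) as [A [B [H1 [H2 [H3 [H4 [H5 H6]]]]]]]. exists (- B), (- A).
  rewrite !primitive_mirror; rewrite ?Ropp_involutive; auto. repeat split; auto; lra.
 - auto.
 - intros s Hs Hd. rewrite primitive_mirror by auto. apply Z9; auto. by_cases.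
 - case: Z10 => [l Hl]. exists (map Ropp l). intros s Hs Hd E. apply in_map_iff. exists (- s). split; [ring|].
  apply Hl; auto; [rewrite Rabs_Ropp; auto|]. unfold mirror in E. lra.
Qed.

Lemma traj_mirror n a b u v : traj n D f a b u v ->
  traj n (fun s => D (- s)) (mirror f) a b (fun r => - u r) (fun r => - v r).
Proof.
 intros [H1 H2]. split.
 - intros r Hr. have [A [B C]] := H1 r Hr. rewrite Ropp_involutive. repeat split; auto.
  + apply (continuous_opp u); auto.
  + apply (continuous_opp v); auto.
 - intros r Hr. apply ode_mirror; auto.
Qed.

Lemma rest_sol_mirror n rho al u v : rest_sol n D f rho al u v ->
  rest_sol n (fun s => D (- s)) (mirror f) rho (- al) (fun r => - u r) (fun r => - v r).
Proof.
 intros [H1 H2 H3 H4 H5]. constructor; auto.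
 - intros r Hr. have [-> ->] := H2 r Hr. lra.
 - intros r. rewrite Ropp_involutive; auto.
 - intros r. destruct (H4 r). split; [apply (continuous_opp u)|apply (continuous_opp v)]; auto.
 - intros r Hr. apply ode_mirror; auto.
Qed.

Lemma normal_sol_mirror n al u v : normal_sol n D f al u v ->
  normal_sol n (fun s => D (- s)) (mirror f) (- al) (fun r => - u r) (fun r => - v r).
Proof.
 intros [H1 H2]. constructor; [apply rest_sol_mirror; auto|]. intros r s Hrs [E1 E2].
 destruct (H2 r s Hrs) as [E3 E4]; [by_cases|]. split; lra.
Qed.

Lemma energy_mirror u v r : D (u r) ->
  energy (mirror f) (fun r => - u r) (fun r => - v r) r = energy f u v r.
Proof. intros HD. unfold energy. rewrite primitive_mirror; rewrite Ropp_involutive; auto. lra. Qed.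

End Mirror.

Arguments traj_mirror : clear implicits.
Arguments normal_sol_mirror : clear implicits.

(** * Energy wells *)

(** An energy band just above level [c]: at energies in [[c, c + mu]] a solution
    inside the well can only turn back near its two walls, where the force points
    inwards. *)
Record well (D : R -> Prop) (f : R -> R) (c bm bp xm xp mu : R) : Prop := {
  w_left : D xm;
  w_right : D xp;
  w_order : xm < bm < 0 /\ 0 < bp < xp;
  w_mu : 0 < mu;
  w_low : forall x, bm <= x <= bp -> primitive f x <= c;
  w_bm : primitive f bm = c;
  w_bp : primitive f bp = c;
  w_fm : forall x, xm <= x < bm -> f x < 0;
  w_fp : forall x, bp < x <= xp -> 0 < f x;
  w_xm : primitive f xm = c + mu;
  w_xp : primitive f xp = c + mu
}.

Arguments w_left {D f c bm bp xm xp mu}.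
Arguments w_right {D f c bm bp xm xp mu}.
Arguments w_order {D f c bm bp xm xp mu}.
Arguments w_mu {D f c bm bp xm xp mu}.
Arguments w_low {D f c bm bp xm xp mu}.
Arguments w_bm {D f c bm bp xm xp mu}.
Arguments w_bp {D f c bm bp xm xp mu}.
Arguments w_fm {D f c bm bp xm xp mu}.
Arguments w_fp {D f c bm bp xm xp mu}.
Arguments w_xm {D f c bm bp xm xp mu}.
Arguments w_xp {D f c bm bp xm xp mu}.

Lemma deriv_le (g g' : R -> R) (m a b : R) : a <= b ->
  (forall x, a <= x <= b -> continuous g x) ->
  (forall x, a < x < b -> is_derive g x (g' x) /\ g' x <= m) ->
  g b <= g a + m * (b - a).
Proof.
 intros Hab Hc Hd. have H := deriv_ge_le (fun x => - g x) (fun x => - g' x) (- m) a b Hab.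
 enough (- g a + - m * (b - a) <= - g b) by lra. apply H.
 - intros x Hx. apply (continuous_opp g); auto.
 - intros x Hx. destruct (Hd x Hx). split; [apply (is_derive_opp g); auto|lra].
Qed.

Section Wells.

Context {D f delta} (NL : nonlinearity D f delta).

Let F := primitive f.

Lemma well_mirror c bm bp xm xp mu : well D f c bm bp xm xp mu ->
  well (fun s => D (- s)) (mirror f) c (- bp) (- bm) (- xp) (- xm) mu.
Proof.
 intros [H1 H2 H3 H4 H5 H6 H7 H8 H9 H10 H11].
 have HD : forall x, xm <= x <= xp -> D x by (intros x Hx; apply (nl_conv NL xm xp)).
 constructor; rewrite ?Ropp_involutive; auto; try lra.
 - intros x Hx. rewrite (primitive_mirror NL); [apply H5; lra|apply HD; lra].
 - rewrite (primitive_mirror NL), Ropp_involutive; auto. apply HD; lra.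
 - rewrite (primitive_mirror NL), Ropp_involutive; auto. apply HD; lra.
 - intros x Hx. unfold mirror. specialize (H9 (- x)). lra.
 - intros x Hx. unfold mirror. specialize (H8 (- x)). lra.
 - rewrite (primitive_mirror NL), Ropp_involutive; rewrite ?Ropp_involutive; auto.
 - rewrite (primitive_mirror NL), Ropp_involutive; rewrite ?Ropp_involutive; auto.
Qed.

Lemma F_increasing a b : D a -> D b -> a < b -> (forall x, a < x < b -> 0 < f x) -> F a < F b.
Proof.
 intros Ha Hb Hab Hf. destruct (mean_value F f a b Hab) as [z [Hz E]].
 - intros x Hx. apply (F_cont NL), (D_between NL a b); auto.
 - intros x Hx. apply (F_derive NL), (D_between NL a b); auto; lra.
 - specialize (Hf z Hz). nra.
Qed.

Lemma well_D c bm bp xm xp mu x : well D f c bm bp xm xp mu -> xm <= x <= xp -> D x.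
Proof. intros W. apply (nl_conv NL); [apply W|apply W]. Qed.

Lemma well_inside_right c bm bp xm xp mu x : well D f c bm bp xm xp mu -> bm <= x < xp -> F x < c + mu.
Proof.
 intros W Hx. have O := w_order W. have M := w_mu W. have [H|H] := Rle_lt_dec x bp.
 - have T := w_low W x by_lra. unfold F. lra.
 - rewrite <- (w_xp W). apply F_increasing; [|apply W|lra|].
  + apply (well_D c bm bp xm xp mu); auto; lra.
  + intros z Hz. apply (w_fp W). lra.
Qed.

(** The right wall is climbed and left again in bounded time. *)
Lemma window_right n c bm bp xm xp mu : well D f c bm bp xm xp mu ->
  exists R0 tau, 0 < R0 /\ 0 < tau /\ forall t0 u v, R0 <= t0 -> traj n D f t0 (t0 + tau) u v ->
    (forall t, t0 <= t <= t0 + tau -> xm < u t < xp /\ c + mu / 2 <= energy f u v t <= c + mu) ->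
    0 < u t0 -> exists t, t0 < t <= t0 + tau /\ u t = 0.
Proof.
 intros W. have [Dm Dp [O1 O2] Hmu Hlow Fbm Fbp Hfm Hfp Fxm Fxp] := W. fold F in Hlow, Fbm, Fbp, Fxm, Fxp.
 have HD : forall x, xm <= x <= xp -> D x by (intros x Hx; apply (nl_conv NL xm xp)).
 destruct (ivt F bp xp (c + mu / 4)) as [x' [Hx' Fx']]; try lra. { intros x Hx. apply (F_cont NL), HD. lra. }
 have Hbx : bp < x'. { case: (Req_dec x' bp) => E; [subst x'; lra|lra]. }
 destruct (bounded_away f x' xp) as [f0 [Hf0 Hf]]; try lra.
 { split; [apply (nl_cont NL), HD; lra|]. specialize (Hfp x by_lra). lra. }
 have HfT : forall x, x' <= x <= xp -> f0 <= f x.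
 { intros x Hx. specialize (Hf x Hx). specialize (Hfp x by_lra). by_cases. }
 destruct (f_bounded NL xm xp Dm Dp) as [Mf [HMf HMb]]; [lra|]. set (Mo := Mf * (xp - xm) + Rabs c + mu).
 have HMo : forall x, xm <= x <= xp -> - Mo <= F x.
 { intros x Hx. have L := F_lipschitz NL xm xp Mf x xp Dm Dp HMb Hx by_lra. apply Rabs_le_between in L. fold F in L.
  rewrite Rabs_left1 in L by lra. have Q := Rle_abs (- c). rewrite Rabs_Ropp in Q. unfold Mo. nra. }
 set (Vb := 2 * (c + mu + Mo) + 1). have HVb : 1 <= Vb. { specialize (HMo xp by_lra). unfold Vb. lra. }
 set (v0 := Rmin 1 (mu / 2)). have Hv0 : 0 < v0 <= 1 /\ v0 <= mu / 2. { unfold v0. by_cases. }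
 have Hd : 0 <= INR n by positive. set (ta := xp / v0 + 1). set (tb := 2 * (Vb + 1) / f0). set (tc := 1 + 8 * (xp / f0)).
 have Hta : 0 < ta /\ v0 * ta = xp + v0.
 { split; [|unfold ta; field; lra]. unfold ta. assert (0 < xp / v0) by positive. lra. }
 have Htb : 0 < tb /\ f0 / 2 * tb = Vb + 1. { split; [|unfold tb; field; lra]. positive. }
 have Htc : 1 < tc /\ f0 * tc = f0 + 8 * xp.
 { split; [|unfold tc; field; lra]. unfold tc. assert (0 < xp / f0) by positive. lra. }
 exists (2 * INR n * Vb / f0 + 1), (2 * ta + tb + tc). have HR0 : 0 <= 2 * INR n * Vb / f0 by (apply Rdiv_le_0_compat; nra).
 repeat split; try lra. set (tau := 2 * ta + tb + tc). intros t0 u v Ht0 [TC TO] HW Hu0. apply NNPP; intro Hno.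
 have Hpos : forall t, t0 <= t <= t0 + tau -> 0 < u t.
 { intros t Ht. apply Rnot_le_lt; intro Hle. destruct (ivt_decr u t0 t 0) as [z [Hz E]]; try lra.
  { intros x Hx. apply TC; lra. } apply Hno. exists z. destruct (Req_dec z t0) as [->|]; lra. }
 have HV : forall t, t0 <= t <= t0 + tau -> Rabs (v t) <= Vb.
 { intros t Ht. have [W1 W2] := HW t Ht. unfold energy in W2. fold F in W2. specialize (HMo (u t) by_lra).
  assert (v t ^ 2 <= Vb ^ 2) by (unfold Vb in *; nra). apply Rabs_le. nra. }
 have HM : forall t, t0 <= t <= t0 + tau -> u t <= x' -> v0 <= v t \/ v t <= - v0.
 { intros t Ht Hut. have [W1 W2] := HW t Ht. unfold energy in W2. fold F in W2. have HF : F (u t) <= c + mu / 4.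
  { specialize (Hpos t Ht). have [Hb|Hb] := Rle_lt_dec (u t) bp.
   - specialize (Hlow (u t) by_lra). lra.
   - rewrite <- Fx'. destruct (Req_dec (u t) x') as [->|Hne]; [lra|].
    apply Rlt_le, F_increasing; try (apply HD; lra); [lra|]. intros; apply Hfp; lra. }
  nra. }
 have HT : forall t, t0 < t < t0 + tau -> x' <= u t -> - (INR n / t) * v t - f (u t) <= - (f0 / 2).
 { intros t Ht Hut. specialize (HfT (u t) ltac:(destruct (HW t by_lra); lra)). have Q : Rabs (INR n / t * v t) <= f0 / 2.
  { rewrite Rabs_mult, Rabs_right. 2: { apply Rle_ge, Rdiv_le_0_compat; lra. } apply Rle_trans with (INR n / t * Vb).
   - apply Rmult_le_compat_l; [apply Rdiv_le_0_compat; lra|apply HV; lra].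
   - apply (Rmult_le_reg_r t); [lra|]. replace (INR n / t * Vb * t) with (INR n * Vb) by (field; lra).
    have T : 2 * INR n * Vb / f0 * f0 = 2 * INR n * Vb by (field; lra). nra. }
  by_cases. }
 have Uc : forall a b, t0 <= a -> b <= t0 + tau -> forall x, a <= x <= b -> continuous u x by (intros; apply TC; lra).
 have Vc : forall a b, t0 <= a -> b <= t0 + tau -> forall x, a <= x <= b -> continuous v x by (intros; apply TC; lra).
 have Fall : forall a b m, t0 <= a -> a <= b -> b <= t0 + tau -> (forall t, a < t < b -> v t <= m) -> u b <= u a + m * (b -
  a). { intros a b m Ha Hab Hb H. apply (deriv_le u v); [auto|apply Uc; auto|]. split; [apply TO; lra|auto]. }
 have Brake : forall a b, t0 <= a -> a <= b -> b <= t0 + tau -> (forall t, a < t < b -> x' <= u t) -> v b <= v a + - (f0 / 2)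
  * (b - a).
 { intros a b Ha Hab Hb H. apply (deriv_le v (fun t => - (INR n / t) * v t - f (u t))); [auto|apply Vc; auto|].
  split; [apply TO; lra|]. apply HT; auto; lra. }
 (* the upward phase ends *)
 have P1 : exists s, t0 <= s <= t0 + ta + tb /\ v s < 0.
 { apply NNPP; intro H1. have Hv : forall t, t0 <= t <= t0 + ta + tb -> 0 <= v t.
  { intros t Ht. apply Rnot_lt_le; intro. apply H1. exists t; auto. }
  have Mono : forall a b, t0 <= a -> a <= b -> b <= t0 + ta + tb -> u a <= u b.
  { intros a b Ha Hab Hb. apply (nondecr_deriv u v); [auto|apply Uc; unfold tau; lra|].
   split; [apply TO; unfold tau; lra|apply Hv; lra]. }
  have H2 : x' <= u (t0 + ta).
  { apply Rnot_lt_le; intro Hlt. have G : u t0 + v0 * (t0 + ta - t0) <= u (t0 + ta).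
   { apply (deriv_ge_le u v); [lra|apply Uc; unfold tau; lra|]. split; [apply TO; unfold tau; lra|].
    have B := Mono x (t0 + ta) by_lra by_lra by_lra. specialize (Hv x by_lra).
    destruct (HM x ltac:(unfold tau; lra) by_lra); lra. }
   lra. }
  have B := Brake (t0 + ta) (t0 + ta + tb) by_lra by_lra ltac:(unfold tau; lra).
  have B2 : v (t0 + ta + tb) <= v (t0 + ta) + - (f0 / 2) * (t0 + ta + tb - (t0 + ta)).
  { apply B. intros t Ht. apply Rle_trans with (u (t0 + ta)); auto. apply Mono; lra. }
  have B3 := HV (t0 + ta) ltac:(unfold tau; lra). apply Rabs_le_between in B3. specialize (Hv (t0 + ta + tb) by_lra).
  lra. }
 have [s [Hs Hvs]] := P1. have P2 : forall t, s <= t <= t0 + tau -> v t < 0.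
 { intros t Ht. apply Rnot_le_lt; intro Hle.
  destruct (first_hit v s t 0) as [z [Z1 [Z2 Z3]]]; [lra|apply Vc; lra|auto|auto|]. have Hxz : x' < u z.
  { apply Rnot_le_lt; intro. destruct (HM z by_lra by_lra); lra. }
  destruct (continuous_eps u z (u z - x')) as [e [He H]]; [apply TC; lra|lra|]. set (y := Rmax s (z - e / 2)).
  have Hy : s <= y < z /\ z - e / 2 <= y by (unfold y, Rmax; destruct Rle_dec; lra).
  have B := Brake y z by_lra by_lra by_lra. have B2 : v z <= v y + - (f0 / 2) * (z - y).
  { apply B. intros q Hq. specialize (H q ltac:(by_cases)). by_cases. } specialize (Z3 y by_lra). nra. }
 have Mono : forall a b, s <= a -> a <= b -> b <= t0 + tau -> u b <= u a.
 { intros a b Ha Hab Hb. have Q := Fall a b 0 by_lra Hab Hb. rewrite Rmult_0_l, Rplus_0_r in Q. apply Q. intros t Ht.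
  apply Rlt_le, P2; lra. }
 have P3 : u (s + tc) < x'.
 { apply Rnot_le_lt; intro Hle. have Hx : forall t, s <= t <= s + tc -> x' <= u t.
  { intros t Ht. apply Rle_trans with (u (s + tc)); auto. apply Mono; unfold tau in *; lra. }
  have G : u (s + tc) <= u (s + tc / 2) + - (f0 * tc / 4) * (s + tc - (s + tc / 2)).
  { apply Fall; try (unfold tau; lra). intros t Ht. have B : v t <= v s + - (f0 / 2) * (t - s).
   { apply Brake; try (unfold tau; lra). intros q Hq. apply Hx; lra. } nra. }
  destruct (HW (s + tc / 2)) as [T _]; [unfold tau; lra|]. nra. }
 have P4 : u (s + tc + ta) <= u (s + tc) + - v0 * (s + tc + ta - (s + tc)).
 { apply Fall; try (unfold tau; lra). intros t Ht. assert (u t <= u (s + tc)) by (apply Mono; unfold tau; lra).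
  assert (v t < 0) by (apply P2; unfold tau; lra). destruct (HM t ltac:(unfold tau; lra) by_lra); lra. }
 specialize (Hpos (s + tc + ta) ltac:(unfold tau; lra)). lra.
Qed.

End Wells.

Section Wells2.

Context {n D f delta} (n_pos : (1 <= n)%nat) (NL : nonlinearity D f delta).

Let F := primitive f.

Lemma well_inside c bm bp xm xp mu x : well D f c bm bp xm xp mu -> xm < x < xp -> F x < c + mu.
Proof.
 intros W Hx. have O := w_order W. destruct (Rle_lt_dec bm x).
 - apply (well_inside_right NL c bm bp xm xp); auto; lra.
 - have T := well_inside_right (nonlinearity_mirror NL) _ _ _ _ _ _ (- x) (well_mirror NL _ _ _ _ _ _ W) by_lra.
  rewrite (primitive_mirror NL), Ropp_involutive in T; auto; rewrite Ropp_involutive.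
  apply (well_D NL c bm bp xm xp mu); auto; lra.
Qed.

(** In the energy band solutions keep oscillating, in bounded time. *)
Lemma window c bm bp xm xp mu : well D f c bm bp xm xp mu ->
  exists R0 tau, 0 < R0 /\ 0 < tau /\ forall t0 u v, R0 <= t0 -> traj n D f t0 (t0 + tau) u v ->
    (forall t, t0 <= t <= t0 + tau -> xm < u t < xp /\ c + mu / 2 <= energy f u v t <= c + mu) ->
    exists t, t0 < t <= t0 + tau /\ u t = 0.
Proof.
 intros W. have [R1 [T1 [P1 [Q1 H1]]]] := window_right NL n _ _ _ _ _ _ W.
 have [R2 [T2 [P2 [Q2 H2]]]] := window_right (nonlinearity_mirror NL) n _ _ _ _ _ _ (well_mirror NL _ _ _ _ _ _ W).
 have HD : forall x, xm <= x <= xp -> D x by (intros x; apply (well_D NL c bm bp xm xp mu)). set (T := Rmax T1 T2).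
 have L1 := Rmax_l T1 T2. have L2 := Rmax_r T1 T2. have HF0 : primitive f 0 <= c.
 { apply (w_low W). have O := w_order W. lra. } have Hmu := w_mu W.
 (* a start away from zero *)
 have Main : forall t0 u v, Rmax R1 R2 <= t0 -> traj n D f t0 (t0 + T) u v -> (forall t, t0 <= t <= t0 + T -> xm < u t < xp
  /\ c + mu / 2 <= energy f u v t <= c + mu) -> u t0 <> 0 -> exists t, t0 < t <= t0 + T /\ u t = 0.
 { intros t0 u v Ht0 TR HW Hu. have M1 := Rmax_l R1 R2. have M2 := Rmax_r R1 R2. unfold T in *.
  have [Hneg|Hp] := Rle_lt_dec (u t0) 0.
  - destruct (H2 t0 (fun r => - u r) (fun r => - v r)) as [t [Ht E]]; try lra.
   + apply traj_mirror. apply (traj_sub n D f t0 (t0 + Rmax T1 T2)); auto; lra.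
   + intros t Ht. have [A B] := HW t by_lra. split; [lra|]. rewrite (energy_mirror NL); [auto|apply HD; lra].
   + exists t. lra.
  - destruct (H1 t0 u v) as [t [Ht E]]; try lra.
   + apply (traj_sub n D f t0 (t0 + Rmax T1 T2)); auto; lra.
   + intros t Ht. apply HW. lra.
   + exists t. split; lra. }
 exists (Rmax R1 R2), (T + 1). split; [by_cases|]. split; [unfold T; lra|].
 intros t0 u v Ht0 TR HW. have HT : 0 < T by (unfold T; lra). have [Hu|Hu] := Req_dec (u t0) 0.
 - have Ht' : exists t1, t0 < t1 < t0 + 1 /\ u t1 <> 0.
  { apply NNPP; intro Hno. have Hz : forall t, t0 < t < t0 + 1 -> u t = 0.
   { intros t Ht. apply NNPP; intro. apply Hno. exists t; auto. } have [TC TO] := TR.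
   destruct (TO (t0 + / 2)) as [O1 _]; [lra|]. have Ev : v (t0 + / 2) = 0.
   { apply is_derive_unique in O1. rewrite <- O1. transitivity (Derive (fun _ => 0) (t0 + / 2)); [|apply Derive_const].
    apply Derive_ext_loc. exists (mkposreal (/ 2) by_lra). intros y Hy. apply Rabs_lt_between in Hy.
    unfold minus, plus, opp in Hy; simpl in Hy. apply Hz. lra. }
   destruct (HW (t0 + / 2)) as [_ E]; [lra|].
   unfold energy in E. rewrite Ev, Hz in E by lra. lra. }
  have [t1 [Ht1 Hu1]] := Ht'.
  destruct (Main t1 u v) as [t [Ht E]]; try lra.
  + apply (traj_sub n D f t0 (t0 + (T + 1))); auto; lra.
  + intros t Ht. apply HW; lra.
  + exists t. split; lra.
 - destruct (Main t0 u v) as [t [Ht E]]; auto.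
  + apply (traj_sub n D f t0 (t0 + (T + 1))); auto; lra.
  + intros t Ht. apply HW; lra.
  + exists t. split; lra.
Qed.

End Wells2.

Lemma finite_gap (l : list R) (b : R) : exists e, 0 < e /\ forall s, b < s < b + e -> ~ In s l.
Proof.
 induction l as [|x l IH].
 - exists 1. split; auto; lra.
 - have [e [He H]] := IH. destruct (Rle_lt_dec x b).
  + exists e. split; auto. intros s Hs [E|E]; [lra|]. apply (H s); auto.
  + exists (Rmin e (x - b)). have M1 := Rmin_l e (x - b). have M2 := Rmin_r e (x - b). split; [by_cases|].
   intros s Hs [E|E]; [lra|]. apply (H s); auto; lra.
Qed.

Section WellExists.

Context {D f delta} (NL : nonlinearity D f delta).

Let F := primitive f.

Lemma wall c y : 0 <= c -> 0 < y -> D y -> c < F y ->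
  exists b x, delta <= b < x /\ x <= y /\ F b = c /\ (forall t, 0 <= t <= b -> F t <= c) /\
    forall t, b < t <= x -> 0 < f t.
Proof.
 intros Hc Hy HDy HFy. have Hdel := nl_delta NL. have D0 := nl_zero NL.
 have HD : forall t, 0 <= t <= y -> D t by (intros t; apply (D_between NL)). have HF0 : F 0 = 0 by apply F_zero.
 have Hdy : delta <= y. { have T := nl_neg NL y HDy. rewrite Rabs_right in T by lra. unfold F in HFy. lra. }
 set (E := fun t => 0 <= t <= y /\ forall s, 0 <= s <= t -> F s <= c). have E0 : E 0.
 { split; [lra|]. intros s Hs. replace s with 0 by lra. lra. } destruct (completeness E) as [b [Hb1 Hb2]].
 { exists y. intros t [Ht _]. lra. } { exists 0; auto. } have Hby : b <= y by (apply Hb2; intros t [Ht _]; lra).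
 have Hlow : forall t, 0 <= t < b -> F t <= c.
 { intros t Ht. apply NNPP; intro Hn. assert (b <= t); [|lra]. apply Hb2. intros z [Z1 Z2]. apply Rnot_lt_le; intro.
  apply Hn, Z2. lra. }
 have Hdb : delta <= b.
 { apply Rnot_lt_le; intro. set (z := (Rmax b 0 + delta) / 2).
  assert (b < z < delta /\ 0 < z) by (unfold z, Rmax; destruct Rle_dec; lra). assert (z <= b); [|lra]. apply Hb1.
  split; [lra|]. intros s Hs. destruct (Req_dec s 0) as [->|]; [lra|]. have T := nl_neg NL s ltac:(apply HD).
  rewrite Rabs_right in T by lra. unfold F. lra. }
 have Fb_le : F b <= c.
 { apply Rnot_lt_le; intro Hlt. destruct (continuous_eps F b (F b - c)) as [e [He H]]; [apply (F_cont NL), HD; lra|lra|].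
  set (t := Rmax 0 (b - e / 2)). assert (0 <= t < b /\ b - e / 2 <= t) by (unfold t, Rmax; destruct Rle_dec; lra).
  specialize (H t ltac:(by_cases)). apply Rabs_lt_between in H. specialize (Hlow t by_lra). lra. }
 have Hby2 : b < y by (case: (Req_dec b y) => [E1|]; [rewrite E1 in Fb_le; lra|lra]).
 have Hbeyond : forall t, b < t -> exists s, b < s <= t /\ c < F s.
 { intros t Ht. apply NNPP; intro Hn. assert (Rmin t y <= b).
  { apply Hb1. split; [by_cases|]. intros s Hs. destruct (Rlt_le_dec s b); [apply Hlow; lra|].
   destruct (Req_dec s b) as [->|]; auto. apply Rnot_lt_le; intro. apply Hn. exists s. by_cases. }
  by_cases. }
 have Fb : F b = c.
 { apply Rle_antisym; auto. apply Rnot_lt_le; intro Hlt.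
  destruct (continuous_eps F b (c - F b)) as [e [He H]]; [apply (F_cont NL), HD; lra|lra|].
  destruct (Hbeyond (b + e / 2)) as [s [Hs1 Hs2]]; [lra|]. specialize (H s ltac:(by_cases)). by_cases. }
 have [l Hl] := nl_finite NL. have [e [He Hgap]] := finite_gap l b. set (x := Rmin (b + e / 2) y).
 have Hx : b < x <= y /\ x <= b + e / 2 by (unfold x, Rmin; destruct Rle_dec; lra).
 have Hnz : forall t, b < t <= x -> f t <> 0.
 { intros t Ht E1. apply (Hgap t); [lra|]. apply Hl; auto; [apply HD; lra|]. by_cases. }
 have Cf : forall t, b <= t <= y -> continuous f t by (intros; apply (nl_cont NL), HD; lra). exists b, x.
 repeat split; try lra. { intros t Ht. destruct (Req_dec t b) as [->|]; auto. apply Hlow; lra. } intros t Ht.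
 apply Rnot_le_lt; intro Hft. destruct (Hbeyond t) as [s [Hs1 Hs2]]; [lra|]. have Hneg : forall z, b < z <= x -> f z <= 0.
 { intros z Hz. apply Rnot_lt_le; intro Hfz. destruct (Rle_lt_dec t z).
  - destruct (ivt f t z 0) as [w [W1 W2]]; [lra|intros; apply Cf; lra|lra|]. apply (Hnz w); lra.
  - destruct (ivt_decr f z t 0) as [w [W1 W2]]; [lra|intros; apply Cf; lra|lra|]. apply (Hnz w); lra. }
 assert (F s <= F b).
 { apply (nonincr_deriv F f); try lra.
  - intros z Hz. apply (F_cont NL), HD; lra.
  - split; [apply (F_derive NL), HD; lra|apply Hneg; lra]. }
 lra.
Qed.

End WellExists.

Lemma well_exists D f delta c y : nonlinearity D f delta -> 0 <= c -> 0 < y -> D y -> c < primitive f y ->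
  exists bm bp xm xp mu, well D f c bm bp xm xp mu /\ xp <= y /\ delta <= bp /\ bm <= - delta.
Proof.
 intros NL Hc Hy HDy HFy. have [b [x [B1 [B2 [B3 [B4 B5]]]]]] := wall NL c y Hc Hy HDy HFy.
 have [A [B0 [HA [_ [[A1 _] [A2 [A3 _]]]]]]] := nl_coercive NL y HDy. have Hdel := nl_delta NL.
 destruct (wall (nonlinearity_mirror NL) c (- A)) as [b' [x' [C1 [C2 [C3 [C4 C5]]]]]]; auto; [lra|rewrite Ropp_involutive;
  auto| |]. { rewrite (primitive_mirror NL), Ropp_involutive; rewrite ?Ropp_involutive; auto. lra. }
 have HD : forall t, A <= t <= y -> D t by (intros t; apply (D_between NL)).
 have PM : forall t, 0 <= t <= - A -> primitive (mirror f) t = primitive f (- t).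
 { intros t Ht. apply (primitive_mirror NL). apply HD; lra. } have Fx : c < primitive f x.
 { rewrite <- B3. apply (F_increasing NL); try (apply HD; lra); [lra|]. intros; apply B5; lra. }
 have Fx' : c < primitive f (- x').
 { rewrite <- PM, <- C3 by lra. apply (F_increasing (nonlinearity_mirror NL)); try (apply HD; lra); [lra|].
  intros; apply C5; lra. }
 set (mu := Rmin (primitive f x - c) (primitive f (- x') - c)).
 have Hmu : 0 < mu /\ mu <= primitive f x - c /\ mu <= primitive f (- x') - c. { unfold mu. by_cases. }
 destruct (ivt (primitive f) b x (c + mu)) as [xp [X1 X2]]; try lra. { intros t Ht. apply (F_cont NL), HD; lra. }
 rewrite PM in C3 by lra. destruct (ivt_decr (primitive f) (- x') (- b') (c + mu)) as [xm [Y1 Y2]]; try lra.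
 { intros t Ht. apply (F_cont NL), HD; lra. } exists (- b'), b, xm, xp, mu. assert (xp <> b) by (intro; subst xp; lra).
 assert (xm <> - b') by (intro; subst xm; lra). split; [|lra]. constructor; try (apply HD); try lra.
 - intros t Ht. destruct (Rle_lt_dec 0 t); [apply B4; lra|]. specialize (C4 (- t) by_lra).
  rewrite PM, Ropp_involutive in C4 by lra. lra.
 - intros t Ht. specialize (C5 (- t) by_lra). unfold mirror in C5. rewrite Ropp_involutive in C5. lra.
 - intros t Ht. apply B5; lra.
Qed.

(** * Solutions trapped in the central well *)

Section Trapped.

Context {n D f delta} (n_pos : (1 <= n)%nat) (NL : nonlinearity D f delta).
Context {c bm bp xm xp mu} (W : well D f c bm bp xm xp mu).

Let F := primitive f.

Lemma energy_near u0 v0 e : D u0 -> 0 < e -> exists h, 0 < h /\ forall x y, Rabs (x - u0) < h -> Rabs (y - v0) < h ->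
  Rabs (y ^ 2 / 2 + F x - (v0 ^ 2 / 2 + F u0)) < e.
Proof.
 intros HD He. destruct (continuous_eps F u0 (e / 2)) as [h1 [Hh1 H1]]; [apply (F_cont NL); auto|lra|].
 destruct (continuous_eps (fun y => y ^ 2 / 2) v0 (e / 2)) as [h2 [Hh2 H2]]; [|lra|].
 { apply (ex_derive_continuous (V := R_NormedModule)). auto_derive. auto. } exists (Rmin h1 h2). split; [by_cases|].
 intros x y Hx Hy. apply Rmin_Rgt_l in Hx as [Hx _]. apply Rmin_Rgt_l in Hy as [_ Hy]. specialize (H1 x Hx).
 specialize (H2 y Hy). by_cases.
Qed.

Definition inwell (u v : R -> R) (r : R) : Prop := xm < u r < xp /\ energy f u v r < c + mu.

Lemma rest_energy_decr rho al u v a b : rest_sol n D f rho al u v -> rho <= a <= b ->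
  energy f u v b <= energy f u v a.
Proof.
 intros RS Hab. have H := rs_rho RS. apply (energy_decreasing (n := n) NL); try lra.
 - split; [apply (rs_dom RS)|apply (rs_cont RS)].
 - intros r Hr. apply (rs_ode RS). lra.
Qed.

Lemma F_le_E u v r : F (u r) <= energy f u v r.
Proof. unfold energy. fold F. nra. Qed.

Lemma inwell_after rho al u v r s : rest_sol n D f rho al u v -> rho <= r <= s -> inwell u v r -> inwell u v s.
Proof.
 intros RS Hrs [H1 H2]. have H := rs_rho RS. have HE := rest_energy_decr rho al u v r s RS Hrs. split; [|lra].
 apply (confined (n := n) NL xm xp u v r s); try apply W; try lra.
 - rewrite (w_xm W). auto.
 - rewrite (w_xp W). auto.
 - intros t Ht. apply (rs_cont RS).
 - intros t Ht _. apply (rs_ode RS). lra.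
Qed.

Lemma inwell_before rho al u v r s : rest_sol n D f rho al u v -> rho <= r <= s -> inwell u v s ->
  energy f u v r < c + mu -> inwell u v r.
Proof.
 intros RS Hrs [H1 H2] HE. split; auto. have Hne : forall t, r <= t <= s -> F (u t) < c + mu.
 { intros t Ht. eapply Rle_lt_trans; [apply F_le_E|]. eapply Rle_lt_trans; [|apply HE].
  apply (rest_energy_decr rho al u v r t RS). lra. }
 have Cu : forall t, r <= t <= s -> continuous u t by (intros; apply (rs_cont RS)). split; apply Rnot_le_lt; intro Hle.
 - destruct (ivt u r s xm) as [t [Ht E]]; auto; try lra. specialize (Hne t Ht). rewrite E in Hne. unfold F in Hne.
  rewrite (w_xm W) in Hne. lra.
 - destruct (ivt_decr u r s xp) as [t [Ht E]]; auto; try lra. specialize (Hne t Ht). rewrite E in Hne. unfold F in Hne.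
  rewrite (w_xp W) in Hne. lra.
Qed.

Lemma well_speed : exists Vb, 1 <= Vb /\ forall u v r, inwell u v r -> Rabs (v r) <= Vb.
Proof.
 have O := w_order W. destruct (f_bounded NL xm xp) as [Mf [HMf HMb]]; try apply W; [lra|].
 set (Mo := Mf * (xp - xm) + Rabs c + mu). have Q := Rle_abs (- c). rewrite Rabs_Ropp in Q. have Hmu := w_mu W.
 exists (2 * (c + mu + Mo) + 1). assert (0 <= Mf * (xp - xm)) by nra. split; [unfold Mo; lra|]. intros u v r [H1 H2].
 unfold energy in H2. have L := F_lipschitz NL xm xp Mf (u r) xp ltac:(apply W) ltac:(apply W) HMb by_lra by_lra.
 apply Rabs_le_between in L. rewrite Rabs_left1, (w_xp W) in L by lra.
 have HMo : - Mo <= primitive f (u r) by (unfold Mo; nra). apply Rabs_le. nra.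
Qed.

End Trapped.

Arguments inwell : clear implicits.

Arguments F_le_E f u v r : clear implicits.

Section Central.

Context {n D f delta} (n_pos : (1 <= n)%nat) (NL : nonlinearity D f delta).
Context (bm bp xm xp mu : R) (W : well D f 0 bm bp xm xp mu).
Context (U V : R -> R -> R) (Fam : forall al, D al -> al <> 0 -> normal_sol n D f al (U al) (V al)).

Let F := primitive f.
Notation E al := (energy f (U al) (V al)).
Notation inw al := (inwell f 0 xm xp mu (U al) (V al)).

(** At some time the solution is inside the central well, with an energy below
    its walls, and has not died; it then remains in the well. *)
Definition trapped (al : R) : Prop :=
  D al /\ al <> 0 /\ exists r, 0 <= r /\ ~ dead (U al) (V al) r /\ inw al r.

Lemma family_state al S0 : D al -> al <> 0 -> ~ dead (U al) (V al) S0 ->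
  forall e, 0 < e -> exists h, 0 < h /\ forall be, D be -> Rabs (be - al) < h -> be <> 0 /\
    Rabs (E be S0 - E al S0) < e /\ Rabs (U be S0 - U al S0) < e /\ Rabs (V be S0 - V al S0) < e.
Proof.
 intros HD Hal HS e He. have NS := Fam al HD Hal. destruct (energy_near NL (U al S0) (V al S0) e) as [h1 [Hh1 H1]]; auto.
 { apply (rs_dom (ns_rest NS)). }
 destruct (family_continuity n_pos NL U V Fam al S0 HD Hal HS (Rmin e h1)) as [h [Hh H]]; [by_cases|]. exists h. split; auto.
 intros be Hbe Hb. have [Hne H2] := H be Hbe Hb. split; auto. have [A B] := H2 S0 (Rle_refl _).
 apply Rmin_Rgt_l in A as [A1 A2]. apply Rmin_Rgt_l in B as [B1 B2]. split; [apply H1; auto|auto].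
Qed.

Lemma trapped_open al : trapped al -> exists h, 0 < h /\ forall be, D be -> Rabs (be - al) < h -> trapped be.
Proof.
 intros [HD [Hal [r [Hr [Hd [H1 H2]]]]]]. set (e := Rmin (Rmin (U al r - xm) (xp - U al r)) (mu - E al r)).
 have He : 0 < e /\ e <= U al r - xm /\ e <= xp - U al r /\ e <= mu - E al r. { unfold e. by_cases. }
 have Hstate : exists d, 0 < d /\ forall x y, Rabs (x - U al r) < d -> Rabs (y - V al r) < d -> ~ (x = 0 /\ y = 0).
 { have [Hu|Hu] := Req_dec (U al r) 0.
  - exists (Rabs (V al r)). have Hv : V al r <> 0 by (intro; apply Hd; split). split; [by_cases|]. by_cases.
  - exists (Rabs (U al r)). split; [by_cases|]. by_cases. }
 case: Hstate => [d [Hd0 Hstate]].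
 destruct (family_state al r HD Hal Hd (Rmin e d)) as [h [Hh H]]; [by_cases|]. exists h. split; auto. intros be Hbe Hb.
 have [Hne [A1 [A2 A3]]] := H be Hbe Hb. apply Rmin_Rgt_l in A1 as [A1 _]. apply Rmin_Rgt_l in A2 as [A2 B2].
 apply Rmin_Rgt_l in A3 as [A3 B3]. apply Rabs_lt_between in A1. apply Rabs_lt_between in A2. repeat split; auto. exists r.
 split; auto. split; [exact (Hstate _ _ B2 B3)|]. split; lra.
Qed.

(** Friction costs little at large times, so a solution that is still energetic
    there oscillates many times before it settles. *)
Lemma energetic_zeros k : exists S0, 0 < S0 /\ forall al, trapped al -> 3 * mu / 4 <= E al S0 -> has_zeros (U al) (V al) k.
Proof.
 have [R0 [tau [HR0 [Htau Hwin]]]] := window NL 0 bm bp xm xp mu W (n := n). have [Vb [HVb Hspeed]] := well_speed NL W.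
 have Hmu := w_mu W. have Hd : 0 <= INR n by positive. set (X := INR n * Vb ^ 2 * (INR k * tau)).
 have HX : 0 <= X by positive. set (S0 := R0 + 4 * X / mu).
 have HS0 : R0 <= S0 by (unfold S0; assert (0 <= 4 * X / mu) by (apply Rdiv_le_0_compat; lra); lra). exists S0.
 split; [lra|]. intros al [HD [Hal [rT [HrT [_ HT]]]]] HE. have NS := Fam al HD Hal. have RS := ns_rest NS.
 have Hr1 : exists r1, S0 <= r1 /\ inw al r1 /\ 3 * mu / 4 <= E al r1.
 { have [H|H] := Rle_lt_dec rT S0.
  - exists S0. split; [lra|]. split; auto. apply (inwell_after (n := n) NL W 0 al _ _ rT); auto.
  - have [H2|H2] := Rle_lt_dec (3 * mu / 4) (E al rT).
   + exists rT. split; auto; lra.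
   + destruct (ivt_decr (E al) S0 rT (3 * mu / 4)) as [r1 [A1 A2]]; try lra.
    * intros x _. apply (energy_cont NL); [apply (rs_dom RS)|apply (normal_cont x NS)|apply (normal_cont x NS)].
    * exists r1. split; [lra|]. split; [|lra]. apply (inwell_before (n := n) NL W 0 al _ _ r1 rT); auto; lra. }
 case: Hr1 => [r1 [Hr1 [HW1 HE1]]].
 have HIn : forall t, r1 <= t -> inw al t by (intros t Ht; apply (inwell_after (n := n) NL W 0 al _ _ r1); auto; lra).
 have HEn : forall t, r1 <= t <= r1 + INR k * tau -> mu / 2 <= E al t.
 { intros t Ht. have G : E al r1 + - (INR n * Vb ^ 2 / S0) * (t - r1) <= E al t.
  { apply (deriv_ge_le _ (fun x => - (INR n / x) * V al x ^ 2)); try lra.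
   - intros x _. apply (energy_cont NL); [apply (rs_dom RS)|apply (normal_cont x NS)|apply (normal_cont x NS)].
   - split.
    + apply (energy_derive NL); [apply (rs_dom RS)|apply (rs_ode RS); lra].
    + have Q := Hspeed _ _ x (HIn x by_lra).
     assert (V al x ^ 2 <= Vb ^ 2) by (rewrite <- pow2_abs; apply pow_incr; split; [apply Rabs_pos|auto]).
     assert (0 <= V al x ^ 2) by nra. assert (INR n / x <= INR n / S0).
     { apply Rmult_le_compat_l; auto. apply Rinv_le_contravar; lra. }
     assert (INR n / x * V al x ^ 2 <= INR n / S0 * Vb ^ 2).
     { apply Rmult_le_compat; auto. apply Rdiv_le_0_compat; lra. } lra. }
  have G2 : INR n * Vb ^ 2 / S0 * (t - r1) <= mu / 4.
  { apply (Rmult_le_reg_r S0); [lra|].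
   replace (INR n * Vb ^ 2 / S0 * (t - r1) * S0) with (INR n * Vb ^ 2 * (t - r1)) by (field; lra).
   apply Rle_trans with X; [unfold X; apply Rmult_le_compat_l; [|lra]; apply Rmult_le_pos; auto; apply pow2_ge_0|].
   unfold S0. replace (mu / 4 * (R0 + 4 * X / mu)) with (mu / 4 * R0 + X) by (field; lra). nra. }
  lra. }
 apply (many_zeros al _ _ (fun i => r1 + INR i * tau) k NS Hal). { simpl. lra. } intros i Hi.
 have Hi1 : 0 <= INR i by positive. have Hi2 : INR i + 1 <= INR k. { rewrite <- S_INR. apply le_INR. lia. }
 have T1 : (INR i + 1) * tau <= INR k * tau by nra. have T2 : 0 <= INR i * tau by nra.
 destruct (Hwin (r1 + INR i * tau) (U al) (V al)) as [t [Ht Et]].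
 - lra.
 - apply (rest_traj n D f 0 al); auto. lra.
 - intros t Ht. have [A B] := HIn t by_lra. specialize (HEn t by_lra). lra.
 - exists t. rewrite S_INR. do 2 (split; [lra|]). intro Ev. specialize (HEn t by_lra). unfold energy in HEn.
  rewrite Et, Ev in HEn. assert (primitive f 0 = 0) by apply F_zero. lra.
Qed.

(** At a limit of trapped heights, an energy below [mu] would be reached either
    inside the well, which means trapped, or outside, where the neighbours could
    not have entered. *)
Lemma untrapped_energy t : D t -> t <> 0 -> ~ trapped t ->
  (forall h, 0 < h -> exists al, trapped al /\ Rabs (al - t) < h) ->
  forall r, 0 <= r -> ~ dead (U t) (V t) r /\ mu <= E t r.
Proof.
 intros HD Ht HnT Hlim r Hr. have NS := Fam t HD Ht. have RS := ns_rest NS. have O := w_order W. have Hmu := w_mu W.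
 have HF0 : F 0 = 0 by apply F_zero. have Hd : ~ dead (U t) (V t) r.
 { intro Hd. destruct (first_dead (U t) (V t) r) as [r0 [Hr0 [Hd0 Hbef]]]; auto. { intro; apply (normal_cont _ NS). }
  assert (0 < r0).
  { case: (Req_dec r0 0) => [E0|]; [|lra]. rewrite E0 in Hd0. have [E1 _] := Hd0.
   rewrite (proj1 (normal_start NS)) in E1. lra. }
  have [D1 D2] := Hd0.
  destruct (energy_near NL (U t r0) (V t r0) mu) as [h [Hh HN]]; auto. { apply (rs_dom RS). }
  destruct (continuous_eps (U t) r0 (Rmin h (Rmin (- xm) xp))) as [e1 [He1 H1]]. { apply (normal_cont _ NS). } { by_cases. }
  destruct (continuous_eps (V t) r0 h) as [e2 [He2 H2]]; [apply (normal_cont _ NS)|auto|].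
  set (s := Rmax 0 (r0 - Rmin e1 e2 / 2)). have Hs : 0 <= s < r0 /\ r0 - Rmin e1 e2 / 2 <= s. { unfold s. by_cases. }
  specialize (H1 s ltac:(by_cases)). specialize (H2 s ltac:(by_cases)). apply Rmin_Rgt_l in H1 as [H1 H3].
  apply Rmin_Rgt_l in H3 as [H3 H4]. specialize (HN _ _ H1 H2). apply Rabs_lt_between in HN. rewrite D1, D2 in HN.
  fold F in HN. apply Rabs_lt_between in H3. apply Rabs_lt_between in H4. apply HnT. repeat split; auto. exists s.
  split; [lra|]. split; [apply Hbef; lra|]. split; [lra|]. unfold energy. fold F. lra. }
 split; auto.
 apply Rnot_lt_le; intro HE. have Hout : U t r < xm \/ xp < U t r.
 { have HF := F_le_E f (U t) (V t) r. apply NNPP; intro Hn.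
  assert (U t r <> xm) by (intro E1; rewrite E1, (w_xm W) in HF; lra).
  assert (U t r <> xp) by (intro E1; rewrite E1, (w_xp W) in HF; lra). apply HnT. repeat split; auto. exists r.
  repeat split; auto; lra. }
 set (e := Rmin (mu - E t r) (Rmax (xm - U t r) (U t r - xp))). have He : 0 < e.
 { apply Rmin_glb_lt; [lra|]. by_cases. } have [h [Hh H]] := family_state t r HD Ht Hd e He.
 have [al [[HDa [Hal [rT [HrT [_ HT]]]]] Hclose]] := Hlim h Hh. have [_ [A1 [A2 _]]] := H al HDa Hclose.
 apply Rmin_Rgt_l in A1 as [A1 _]. apply Rmin_Rgt_l in A2 as [_ A2]. apply Rabs_lt_between in A1.
 have RSa := ns_rest (Fam al HDa Hal). have Hin : inw al r.
 { destruct (Rle_lt_dec rT r).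
  - apply (inwell_after (n := n) NL W 0 al _ _ rT); auto.
  - apply (inwell_before (n := n) NL W 0 al _ _ r rT); auto; lra. }
 case: Hin => [Hin _]. by_cases.
Qed.

End Central.

Arguments family_state : clear implicits.
Arguments trapped_open : clear implicits.
Arguments energetic_zeros : clear implicits.
Arguments untrapped_energy : clear implicits.

Arguments trapped : clear implicits.

(** * The quantity [r E(r)] *)

Section Cost.

Context {n D f delta} (n_pos : (1 <= n)%nat) (NL : nonlinearity D f delta).

Let F := primitive f.

(** [(r E)' = F(u) - (n - 1/2) u'^2], so that [r E] decreases where [F <= 0],
    and crossing a region where [F] is negative costs a fixed amount. *)
Lemma rE_drop al u v t1 t2 k : rest_sol n D f 0 al u v -> 0 <= t1 <= t2 -> 0 <= k ->
  (forall t, t1 <= t <= t2 -> F (u t) <= - (k ^ 2 / 2)) ->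
  t2 * energy f u v t2 + k * Rabs (u t2 - u t1) <= t1 * energy f u v t1.
Proof.
 intros RS Ht Hk HF. have Hd : 1 <= INR n by (apply (le_INR 1)).
 set (g' := fun r => 1 * energy f u v r + r * (- (INR n / r) * v r ^ 2)).
 have G : forall r, 0 < r -> is_derive (fun r => r * energy f u v r) r (g' r).
 { intros r Hr. apply is_derive_prod; [apply (is_derive_id r)|].
  apply (energy_derive NL); [apply (rs_dom RS)|apply (rs_ode RS); auto]. }
 have Gc : forall r, continuous (fun r => r * energy f u v r) r.
 { intro r. apply continuous_prod; [apply continuous_id|].
  apply (energy_cont NL); [apply (rs_dom RS)|apply (rs_cont RS)|apply (rs_cont RS)]. }
 have Gb : forall r, t1 < r < t2 -> g' r <= - k * Rabs (v r).
 { intros r Hr. specialize (HF r by_lra). unfold g', energy. fold F.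
  have E : r * (- (INR n / r) * v r ^ 2) = - INR n * v r ^ 2 by (field; lra). rewrite E. rewrite <- pow2_abs.
  have Q := pow2_ge_0 (Rabs (v r) - k). nra. }
 have Side : forall c, Rabs c <= k -> t2 * energy f u v t2 + c * u t2 <= t1 * energy f u v t1 + c * u t1.
 { intros c Hc. apply (nonincr_deriv (fun r => r * energy f u v r + c * u r) (fun r => g' r + c * v r)); try lra.
  - intros r _. apply continuous_sum; auto. apply continuous_prod; [apply continuous_const|]. apply (rs_cont RS).
  - intros r Hr. split.
   + apply is_derive_sum; [apply G; lra|]. apply is_derive_cmul. apply (rs_ode RS). lra.
   + specialize (Gb r Hr). have T := Rle_abs (c * v r). rewrite Rabs_mult in T.
    assert (Rabs c * Rabs (v r) <= k * Rabs (v r)) by (apply Rmult_le_compat_r; auto; apply Rabs_pos). lra. }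
 have S1 := Side k. have S2 := Side (- k). by_cases.
Qed.

Lemma rE_decr al u v t1 t2 : rest_sol n D f 0 al u v -> 0 <= t1 <= t2 ->
  (forall t, t1 <= t <= t2 -> F (u t) <= 0) -> t2 * energy f u v t2 <= t1 * energy f u v t1.
Proof.
 intros RS Ht HF. have T := rE_drop al u v t1 t2 0 RS Ht (Rle_refl _). rewrite Rmult_0_l, Rplus_0_r in T. apply T.
 intros t Htt. specialize (HF t Htt). lra.
Qed.

Lemma crossing_cost y1 y2 : D y1 -> D y2 -> y1 < y2 -> (forall x, y1 <= x <= y2 -> F x < 0) ->
  exists C, 0 < C /\ forall al u v t1 t2, rest_sol n D f 0 al u v -> 0 <= t1 <= t2 ->
    (forall t, t1 <= t <= t2 -> F (u t) <= 0) ->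
    (u t1 <= y1 /\ y2 <= u t2) \/ (y2 <= u t1 /\ u t2 <= y1) ->
    t2 * energy f u v t2 + C <= t1 * energy f u v t1.
Proof.
 intros D1 D2 Hy HF. destruct (bounded_away F y1 y2) as [m [Hm Hb]]; try lra.
 { intros x Hx. split; [apply (F_cont NL), (D_between NL y1 y2); auto|]. specialize (HF x Hx). lra. } set (k := Rmin 1 m).
 have Hk : 0 < k <= 1 /\ k <= m by (unfold k, Rmin; destruct Rle_dec; lra). exists (k * (y2 - y1)). split; [positive|].
 intros al u v t1 t2 RS Ht HF0 Hcr. have Cu : forall x, continuous u x by (intro; apply (rs_cont RS)).
 have Hs : exists s1 s2, t1 <= s1 <= s2 /\ s2 <= t2 /\ Rabs (u s2 - u s1) = y2 - y1 /\ forall s, s1 <= s <= s2 -> y1 <= u s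
  <= y2.
 { have [[U1 U2]|[U1 U2]] := Hcr.
  - destruct (first_hit u t1 t2 y2) as [s2 [A1 [A2 A3]]]; try lra; auto.
   destruct (last_hit (fun s => - u s) t1 s2 (- y1)) as [s1 [B1 [B2 B3]]]; try lra.
   { intros x _. apply (continuous_opp u); auto. } exists s1, s2. do 2 (split; [lra|]). split; [by_cases|]. split.
   + destruct (Req_dec s s1) as [->|]; [lra|]. specialize (B3 s by_lra). lra.
   + destruct (Req_dec s s2) as [->|]; [lra|]. specialize (A3 s by_lra). lra.
  - destruct (first_hit (fun s => - u s) t1 t2 (- y1)) as [s2 [A1 [A2 A3]]]; try lra.
   { intros x _. apply (continuous_opp u); auto. } destruct (last_hit u t1 s2 y2) as [s1 [B1 [B2 B3]]]; try lra; auto.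
   exists s1, s2. do 2 (split; [lra|]). split; [by_cases|]. split.
   + destruct (Req_dec s s2) as [->|]; [lra|]. specialize (A3 s by_lra). lra.
   + destruct (Req_dec s s1) as [->|]; [lra|]. specialize (B3 s by_lra). lra. }
 have [s1 [s2 [S1 [S2 [S3 S4]]]]] := Hs.
 have G1 := rE_decr al u v t1 s1 RS by_lra ltac:(intros; apply HF0; lra).
 have G2 := rE_decr al u v s2 t2 RS by_lra ltac:(intros; apply HF0; lra).
 have G3 := rE_drop al u v s1 s2 k RS by_lra by_lra. rewrite S3 in G3.
 have G4 : forall t, s1 <= t <= s2 -> F (u t) <= - (k ^ 2 / 2).
 { intros t Htt. specialize (S4 t Htt). specialize (Hb _ S4). rewrite Rabs_left in Hb by auto. nra. } specialize (G3 G4).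
 lra.
Qed.

(** Too little of [r E] left near [u = 0]: no further excursion is possible. *)
Lemma few_zeros : exists C, 0 < C /\ forall al u v S0 t1 t2, rest_sol n D f 0 al u v ->
  0 <= S0 <= t1 -> t1 < t2 -> S0 * energy f u v S0 < C -> Rabs (u S0) < delta / 3 ->
  u t1 = 0 -> u t2 = 0 -> v t2 <> 0 -> False.
Proof.
 assert (Hdel := nl_delta NL). assert (D0 := nl_zero NL).
 case: (classic (D (2 * delta / 3) /\ D (- (2 * delta / 3)))) => [[Dp Dm]|Hno].
 - assert (HD : forall x, - (2 * delta / 3) <= x <= 2 * delta / 3 -> D x).
  { intros x Hx. apply (D_between NL (- (2 * delta / 3)) (2 * delta / 3)); auto. }
  assert (HF : forall x, Rabs x <= 2 * delta / 3 -> x <> 0 -> F x < 0).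
  { intros x Hx Hne. apply (nl_neg NL).
   - apply HD. by_cases.
   by_cases. }
  destruct (crossing_cost (delta / 3) (2 * delta / 3)) as [C1 [HC1 K1]]; try (apply HD; lra); [lra| |].
  { intros x Hx. apply HF; [rewrite Rabs_right|]; lra. }
  destruct (crossing_cost (- (2 * delta / 3)) (- (delta / 3))) as [C2 [HC2 K2]]; try (apply HD; lra); [lra| |].
  { intros x Hx. apply HF; [rewrite Rabs_left|]; lra. } exists (Rmin C1 C2). split; [apply Rmin_glb_lt; auto|].
  intros al u v S0 t1 t2 RS HS Ht HE Hu U1 U2 V2. apply Rmin_Rgt_l in HE as [HE1 HE2].
  assert (HEt : forall t, 0 <= t <= t2 -> 0 < energy f u v t).
  { intros t Htt. apply Rlt_le_trans with (energy f u v t2).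
   - unfold energy. rewrite U2. assert (T : primitive f 0 = 0) by apply F_zero. nra.
   - apply (rest_energy_decr (n := n) NL 0 al); auto. }
  assert (F0 : F 0 = 0) by apply F_zero.
  assert (HF0 : forall x, Rabs x <= 2 * delta / 3 -> F x <= 0).
  { intros x Hx. destruct (Req_dec x 0) as [->|]; [lra|]. apply Rlt_le, HF; auto. }
  assert (Small : forall t, S0 <= t <= t2 -> Rabs (u t) < 2 * delta / 3).
  { intros t Htt. apply Rnot_le_lt; intro Hle.
   destruct (first_hit (fun s => Rabs (u s)) S0 t (2 * delta / 3)) as [z [Z1 [Z2 Z3]]]; try lra.
   { intros x _. apply (continuous_comp u Rabs); [apply (rs_cont RS)|apply continuous_Rabs]. }
   assert (Hz : forall s, S0 <= s <= z -> F (u s) <= 0).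
   { intros s Hs. apply HF0. destruct (Req_dec s z) as [->|]; [lra|]. specialize (Z3 s by_lra). lra. }
   assert (HEz : 0 < energy f u v z) by (apply HEt; lra). assert (0 <= z * energy f u v z) by nra.
   apply Rabs_lt_between in Hu. case: (Rle_lt_dec 0 (u z)) => [Hp|Hn].
   - rewrite Rabs_right in Z2 by lra. assert (T := K1 al u v S0 z RS by_lra Hz ltac:(left; lra)). lra.
   - rewrite Rabs_left in Z2 by lra. assert (T := K2 al u v S0 z RS by_lra Hz ltac:(right; lra)). lra. }
  destruct (mean_value u v t1 t2 Ht) as [z [Z1 Z2]].
  + intros x _. apply (rs_cont RS).
  + intros x Hx. apply (rs_ode RS). lra.
  + assert (Vz : v z = 0) by nra. specialize (HEt z by_lra). specialize (Small z by_lra). unfold energy in HEt.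
   rewrite Vz in HEt. specialize (HF0 (u z) by_lra). fold F in HEt. lra.
 -
  (* the domain contains [-delta, delta] because [F] is negative in between *)
  exfalso. apply Hno. destruct (nl_coercive NL 0 D0) as [A [B [HA [HB [[A1 B1] [_ [A2 B2]]]]]]].
  assert (F0 : primitive f 0 = 0) by apply F_zero. assert (HAd : A <= - delta).
  { apply Rnot_lt_le; intro. assert (T := nl_neg NL A HA). by_cases. } assert (HBd : delta <= B).
  { apply Rnot_lt_le; intro. assert (T := nl_neg NL B HB). by_cases. } split; apply (D_between NL A B); auto; lra.
Qed.

End Cost.

(** * Solutions with nonnegative energy and no further zero *)

Lemma monotone_limit (g : R -> R) S0 B : (forall s t, S0 <= s <= t -> g s <= g t) -> (forall t, S0 <= t -> g t <= B) ->
  exists l, forall e, 0 < e -> exists S1, S0 <= S1 /\ forall t, S1 <= t -> l - e < g t <= l.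
Proof.
 intros Hm HB. destruct (completeness (fun y => exists t, S0 <= t /\ y = g t)) as [l [L1 L2]].
 - exists B. intros y [t [Ht ->]]. auto.
 - exists (g S0), S0. split; lra.
 - exists l. intros e He. have Hex : exists t, S0 <= t /\ l - e < g t.
  { apply NNPP; intro Hn. assert (l <= l - e); [|lra]. apply L2. intros y [t [Ht ->]]. apply Rnot_lt_le; intro. apply Hn.
   exists t; auto. }
  have [S1 [H1 H2]] := Hex. exists S1. split; auto. split.
  + apply Rlt_le_trans with (g S1); auto.
  + apply L1. exists t. split; lra.
Qed.

Section Settle.

Context {n D f delta} (n_pos : (1 <= n)%nat) (NL : nonlinearity D f delta).
Context (bm bp xm xp mu : R) (W : well D f 0 bm bp xm xp mu).

Let F := primitive f.

Variables (al : R) (u v : R -> R) (S0 : R).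
Hypothesis RS : rest_sol n D f 0 al u v.
Hypothesis S0_pos : 0 < S0.
Hypothesis IW : inwell f 0 xm xp mu u v S0.
Hypothesis u_pos : forall t, S0 <= t -> 0 < u t.
Hypothesis E_pos : forall t, S0 <= t -> 0 <= energy f u v t.

Let Cu : forall x, continuous u x := fun x => proj1 (rs_cont RS x).
Let Cv : forall x, continuous v x := fun x => proj2 (rs_cont RS x).

Lemma settle_inwell t : S0 <= t -> inwell f 0 xm xp mu u v t.
Proof. intros Ht. apply (inwell_after (n := n) NL W 0 al u v S0); auto; lra. Qed.

Lemma settle_turn r1 r2 : S0 <= r1 -> r1 < r2 -> v r1 < 0 -> 0 < v r2 -> False.
Proof.
 intros H1 H12 V1 V2. destruct (first_hit v r1 r2 0) as [z [Z1 [Z2 Z3]]]; try lra; auto. have HzS : S0 <= z by lra.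
 have [Iz _] := settle_inwell z HzS. have Pz := u_pos z HzS. have [Hb|Hb] := Rle_lt_dec (u z) bp.
 -
  (* at rest with [F <= 0]: all energy is gone *)
  have HEz : energy f u v z <= 0. { unfold energy. rewrite Z2. have T := w_low W (u z). have O := w_order W. lra. }
  have [e [He H]] := continuous_eps v r2 (v r2) (Cv r2) V2. set (y := Rmax z (r2 - e / 2)).
  have Hy : z <= y < r2 /\ r2 - e / 2 <= y. { assert (z <> r2) by (intro; subst z; lra). unfold y. by_cases. }
  destruct (mean_value (energy f u v) (fun r => - (INR n / r) * v r ^ 2) y r2) as [c [C1 C2]]; try lra.
  + intros x _. apply (energy_cont NL); auto. apply (rs_dom RS).
  + intros x Hx. apply (energy_derive NL); [apply (rs_dom RS)|apply (rs_ode RS); lra].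
  + specialize (H c ltac:(by_cases)). apply Rabs_lt_between in H.
   have HEy := rest_energy_decr (n := n) NL 0 al u v z y RS by_lra. have HEr := E_pos r2 by_lra.
   assert (0 < INR n / c) by (apply Rdiv_lt_0_compat; [apply lt_0_INR; auto|lra]). assert (0 < v c ^ 2) by nra.
   assert (0 < INR n / c * v c ^ 2 * (r2 - y)) by (apply Rmult_lt_0_compat; [apply Rmult_lt_0_compat; auto|lra]). lra.
 - have Hf : 0 < f (u z) by (apply (w_fp W); lra). destruct (rs_ode RS z) as [_ O2]; [lra|].
  destruct (simple_zero v z (- (INR n / z) * v z - f (u z))) as [e [He H]]; auto. { nra. } set (y := Rmax r1 (z - e / 2)).
  have Hy : r1 <= y < z /\ z - e / 2 <= y by (unfold y, Rmax; destruct Rle_dec; lra).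
  specialize (H y ltac:(by_cases) by_lra). specialize (Z3 y by_lra). assert (0 < f (u z) * (z - y)) by nra. nra.
Qed.

Lemma settle_monotone : exists S1 sg, S0 <= S1 /\ Rabs sg = 1 /\ forall t, S1 <= t -> 0 <= sg * v t.
Proof.
 have [[r [Hr Hv]]|Hno] := classic (exists r, S0 <= r /\ v r < 0).
 - exists r, (-1). repeat split; auto. { by_cases. } intros t Ht. apply Rnot_lt_le; intro.
  case: (Req_dec r t) => E; [subst t; lra|]. apply (settle_turn r t); lra.
 - exists S0, 1. repeat split; [lra|apply Rabs_R1|]. intros t Ht. apply Rnot_lt_le; intro. apply Hno. exists t. lra.
Qed.

(** A bounded function has a small derivative at arbitrarily late times. *)
Lemma slow_times (g g' : R -> R) S1 B : (forall x, continuous g x) -> (forall t, S1 < t -> is_derive g t (g' t)) ->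
  (forall t, S1 <= t -> Rabs (g t) <= B) -> forall X e, 0 < e -> exists t, S1 <= t /\ X <= t /\ Rabs (g' t) < e.
Proof.
 intros Cg Dg HB X e He. set (Y := Rmax S1 X). have M1 := Rmax_l S1 X. have M2 := Rmax_r S1 X. fold Y in M1, M2.
 have P := Rabs_pos (g Y). have B1 := HB Y M1. set (T := (2 * B + 1) / e). have HT : 0 < T by positive.
 have ET : e * T = 2 * B + 1 by (unfold T; field; lra).
 destruct (mean_value g g' Y (Y + T)) as [c [C1 C2]]; [lra|auto|intros; apply Dg; lra|]. exists c. split; [lra|].
 split; [lra|]. apply Rnot_le_lt; intro Hle. have B2 := HB (Y + T) by_lra. have Q := Rabs_triang (g (Y + T)) (- g Y).
 unfold Rminus in C2. rewrite Rabs_Ropp, C2, Rabs_mult, (Rabs_right (Y + T + - Y)) in Q by lra. nra.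
Qed.

(** The solution is monotone at late times, so it has a limit [l], where [f]
    vanishes. As [E >= 0] and [F <= 0] between the walls, [F l = 0]. Since friction
    is at most [n / r] times a bounded speed, the energy lost after time [r] is at
    most a constant times [|u r - l| / r], so [r E] tends to [0]. *)
Lemma settle : exists l, 0 <= l <= bp /\ F l = 0 /\ f l = 0 /\
  forall e S1, 0 < e -> exists S2, S1 <= S2 /\ S0 <= S2 /\
    S2 * energy f u v S2 < e /\ forall t, S2 <= t -> Rabs (u t - l) < e.
Proof.
 have [S1 [sg [HS1 [Hsg Hmono]]]] := settle_monotone. have [Vb [HVb Hsp]] := well_speed NL W. have O := w_order W.
 have Hd : 1 <= INR n by (apply (le_INR 1); auto). have Hsg2 : sg * sg = 1 by (unfold Rabs in Hsg; destruct Rcase_abs; nra).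
 have Hspeed : forall t, S1 <= t -> Rabs (v t) <= Vb by (intros t Ht; apply (Hsp u v), settle_inwell; lra).
 have Hin : forall t, S1 <= t -> 0 < u t < xp. { split; [apply u_pos; lra|]. apply settle_inwell. lra. }
 have Od : forall t, S1 < t -> radial n f u v t by (intros; apply (rs_ode RS); lra).
 have Hlim : exists l, forall e, 0 < e -> exists S2, S1 <= S2 /\ forall t, S2 <= t -> Rabs (u t - l) < e.
 { destruct (monotone_limit (fun t => sg * u t) S1 xp) as [l Hl].
  - intros s t Hst. apply (nondecr_deriv (fun t => sg * u t) (fun t => sg * v t)); [lra|smooth|].
   split; [apply is_derive_cmul, Od; lra|apply Hmono; lra].
  - intros t Ht. specialize (Hin t Ht). nra.
  - exists (sg * l). intros e He. have [S2 [A B]] := Hl e He. exists S2. split; auto. intros t Ht. specialize (B t Ht).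
   replace (u t - sg * l) with (sg * (sg * u t - l)) by (ring [Hsg2]). rewrite Rabs_mult, Hsg. by_cases. }
 have [l Hl] := Hlim. exists l. have Hl0 : 0 <= l <= xp.
 { split; apply Rnot_lt_le; intro Hlt.
  - destruct (Hl (- l)) as [S2 [A B]]; [lra|]. specialize (B S2 (Rle_refl _)). specialize (Hin S2 A). by_cases.
  - destruct (Hl (l - xp)) as [S2 [A B]]; [lra|]. specialize (B S2 (Rle_refl _)). specialize (Hin S2 A). by_cases. }
 have Dl : D l by (apply (well_D NL 0 bm bp xm xp mu); auto; lra).
 have Hlate : forall g e, continuous g l -> 0 < e -> exists S2, S1 <= S2 /\ forall t, S2 <= t -> Rabs (g (u t) - g l) < e.
 { intros g e Cg He. have [e1 [He1 H1]] := continuous_eps g l e Cg He. have [S2 [A B]] := Hl e1 He1. exists S2. auto. }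
 (* an unbalanced force would accelerate forever *)
 have Hfl : f l = 0.
 { apply NNPP; intro Hne. have Ha := Rabs_pos_lt _ Hne. set (a := Rabs (f l)) in *.
  destruct (Hlate f (a / 3) (nl_cont NL l Dl)) as [S2 [A B]]; [lra|]. set (S3 := S2 + INR n * Vb * 3 / a).
  have P0 : 0 <= INR n * Vb * 3 / a by (apply Rdiv_le_0_compat; [repeat apply Rmult_le_pos; lra|auto]).
  destruct (slow_times v (fun t => - (INR n / t) * v t - f (u t)) S1 Vb Cv) with (X := S3) (e := a / 3) as [t [T1 [T2 T3]]];
   auto; [intros; apply Od; auto|lra|]. unfold S3 in T2. specialize (B t by_lra). specialize (Hspeed t T1).
  have Q : Rabs (INR n / t * v t) <= a / 3.
  { rewrite Rabs_mult, Rabs_right by (apply Rle_ge, Rdiv_le_0_compat; lra). apply (Rmult_le_reg_r t); [lra|].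
   replace (INR n / t * Rabs (v t) * t) with (INR n * Rabs (v t)) by (field; lra).
   assert (INR n * Vb * 3 / a * a <= t * a) by nra.
   replace (INR n * Vb * 3 / a * a) with (INR n * Vb * 3) in H by (field; lra). nra. }
  unfold a in *. by_cases. }
 have Hlb : l <= bp. { have T := w_fp W l. lra. }
 (* slow times have almost no kinetic energy *)
 assert (HE : forall e X, 0 < e -> exists t, X <= t /\ S1 <= t /\ energy f u v t < F l + e).
 { intros e X He. destruct (Hlate F (e / 2) (F_cont NL l Dl)) as [S2 [A B]]; [lra|].
  destruct (slow_times u v S1 xp Cu) with (X := Rmax X S2) (e := Rmin 1 e) as [t [T1 [T2 T3]]]. { intros; apply Od; auto. }
  { intros t Ht. specialize (Hin t Ht). abs_bounds. } { abs_bounds. } apply Rmin_Rgt_l in T3. assert (M1 := Rmax_l X S2).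
  have M2 := Rmax_r X S2. exists t. split; [lra|]. specialize (B t by_lra). apply Rabs_lt_between in B. unfold energy.
  fold F. rewrite <- pow2_abs. have P := Rabs_pos (v t). nra. }
 have HFl : F l = 0.
 { apply Rle_antisym; [apply (w_low W); lra|]. apply Rnot_lt_le; intro Hneg.
  destruct (HE (- F l) S1) as [t [_ [T1 T2]]]; [lra|]. specialize (E_pos t by_lra). lra. }
 repeat split; auto; try lra.
 intros e S2 He.
 assert (HrE : forall r s, S1 <= r <= s -> 0 < r -> r * energy f u v r <= r * energy f u v s + INR n * Vb * Rabs (u r - u
  s)).
 { intros r s Hrs Hr0. set (K := INR n * Vb / r).
  assert (G : energy f u v r + K * sg * u r <= energy f u v s + K * sg * u s).
  { apply (nondecr_deriv (fun t => energy f u v t + K * sg * u t) (fun t => - (INR n / t) * v t ^ 2 + K * sg * v t)); [lra|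
    |].
   - intros x _. apply continuous_sum; [apply (energy_cont NL); auto; apply (rs_dom RS)|]. smooth.
   - intros t Ht. destruct (Od t) as [O1 O2]; [lra|]. split.
    + apply is_derive_sum; [apply (energy_derive NL); [apply (rs_dom RS)|split; auto]|apply is_derive_cmul; auto].
    + have Q := Hspeed t by_lra. have M := Hmono t by_lra. have Ev : v t ^ 2 = Rabs (v t) * (sg * v t).
     { rewrite <- (Rmult_1_l (Rabs (v t))), <- Hsg, <- Rabs_mult, Rabs_right by lra. nra. } rewrite Ev.
     assert (INR n / t <= INR n / r) by (unfold Rdiv; apply Rmult_le_compat_l; [lra|apply Rinv_le_contravar; lra]).
     assert (0 <= INR n / t) by (apply Rdiv_le_0_compat; lra). have P := Rabs_pos (v t).
     assert (INR n / t * Rabs (v t) <= K). { replace K with (INR n / r * Vb) by (unfold K; field; lra). nra. } nra. }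
  have HK : 0 <= K by (apply Rdiv_le_0_compat; [apply Rmult_le_pos; lra|auto]). have Q := Rle_abs (- (sg * (u r - u s))).
  rewrite Rabs_Ropp, Rabs_mult, Hsg in Q. apply (Rmult_le_compat_l K) in Q; auto.
  have G2 : energy f u v r <= energy f u v s + K * Rabs (u r - u s) by lra. apply (Rmult_le_compat_l r) in G2; [|lra].
  replace (r * (energy f u v s + K * Rabs (u r - u s))) with (r * energy f u v s + INR n * Vb * Rabs (u r - u s)) in G2 by
   (unfold K; field; lra). auto. }
 have HnV : 0 < INR n * Vb by nra.
 destruct (Hl (Rmin e (e / 4 / (INR n * Vb)))) as [S3 [A B]]. { apply Rmin_glb_lt; auto. positive. } set (r := Rmax S2 S3).
 have M1 := Rmax_l S2 S3. have M2 := Rmax_r S2 S3. fold r in M1, M2. exists r. repeat split; try lra.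
 - destruct (HE (e / 4 / r) r) as [s [N1 [_ HS4]]]; [positive|]. rewrite HFl in HS4. have G := HrE r s by_lra by_lra.
  have B1 := B r M2. have B2 := B s by_lra. have Hus : Rabs (u r - u s) < e / 2 / (INR n * Vb) by by_cases.
  apply (Rmult_lt_compat_l (INR n * Vb)) in Hus; auto.
  replace (INR n * Vb * (e / 2 / (INR n * Vb))) with (e / 2) in Hus by (field; lra).
  apply (Rmult_lt_compat_l r) in HS4; [|lra]. replace (r * (0 + e / 4 / r)) with (e / 4) in HS4 by (field; lra). lra.
 - intros t Ht. specialize (B t by_lra). by_cases.
Qed.

End Settle.

(** * The degenerate wall *)

(** The energy of a solution that crosses downwards through the height [b]. *)
Lemma friction_derive n D f al u v r : rest_sol n D f 0 al u v -> 0 < r ->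
  is_derive (fun x => x ^ n * v x) r (- (r ^ n * f (u r))).
Proof.
 intros RS Hr. have [_ O2] := rs_ode RS r Hr.
 apply (is_derive_value _ _ (INR n * r ^ pred n * v r + r ^ n * (- (INR n / r) * v r - f (u r)))).
 - apply is_derive_prod; auto. apply is_derive_Reals, derivable_pt_lim_pow.
 - match goal with |- ?a = ?b => change (@eq R a b) end. destruct n as [|m]; [simpl; field; lra|]. simpl pow. field. lra.
Qed.

Lemma pow_quarter n r s : 0 < s -> s <= r -> r <= 4 * s -> (/ 4) ^ n * r ^ n <= s ^ n.
Proof. intros H1 H2 H3. rewrite <- Rpow_mult_distr. apply pow_incr. lra. Qed.

Section Degenerate.

Context {n D f delta} (n_pos : (1 <= n)%nat) (NL : nonlinearity D f delta).
Context (bm bp xm xp mu : R) (W : well D f 0 bm bp xm xp mu).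

Let F := primitive f.

(** A long stay [[ru, p]] above a wall [bp] where the force vanishes, ended by a
    fall that still carries the energy [C0 / p], is slow in its middle: so all
    of the energy there is potential, while the force is as small as the speed. *)
Lemma slow_middle C0 L e : f bp = 0 -> 0 < C0 -> 0 <= L -> 0 < e ->
  (forall x y, Rabs (x - bp) < e -> Rabs (y - bp) < e -> Rabs (f x - f y) <= L * Rabs (x - y)) ->
  exists P0 C, 0 < P0 /\ 0 < C /\ forall al u v ru p, rest_sol n D f 0 al u v -> 0 < ru -> 8 * ru <= p -> P0 <= p ->
    (forall s, ru < s < p -> bp < u s < xp /\ u s < bp + e) -> u p = bp -> C0 <= p * energy f u v p ->
    f (u (p / 2)) <= C * F (u (p / 2)).
Proof.
 intros Hfb HC0 HL He Hlip. have O := w_order W. have Hn : 1 <= INR n by (apply (le_INR 1)). set (K := 4 ^ (n + 1) + 8).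
 have H4 : 0 < 4 ^ (n + 1) by positive. have HK : 8 < K by (unfold K; lra). set (X := K * xp). have HX : 0 < X by positive.
 set (P0 := 8 + X ^ 2 / C0).
 have HP0 : 8 <= P0 by (unfold P0; assert (0 <= X ^ 2 / C0) by (apply Rdiv_le_0_compat; [apply pow2_ge_0|auto]); lra).
 set (N := INR n + L + 2). exists P0, (N * X * 2 / C0). have HN : 0 < N by (unfold N; lra). split; [lra|].
 split; [positive|]. intros al u v ru p RS Hru Hp HpP Hu Hup HE.
 have Cu : forall x, continuous u x by (intro; apply (rs_cont RS)).
 have Cv : forall x, continuous v x by (intro; apply (rs_cont RS)).
 have Od : forall x, 0 < x -> is_derive u x (v x) by (intros; apply (rs_ode RS)).
 have Phi : forall a b, ru <= a <= b -> b <= p -> b ^ n * v b <= a ^ n * v a.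
 { intros a b Hab Hbp. apply (nonincr_deriv (fun x => x ^ n * v x) (fun x => - (x ^ n * f (u x)))); try lra.
  - intros x _. apply continuous_prod; auto. apply (ex_derive_continuous (V := R_NormedModule)). auto_derive; auto.
  - split; [apply (friction_derive n D f al); auto; lra|]. assert (0 < f (u x)) by (apply (w_fp W); destruct (Hu x); lra).
   assert (0 < x ^ n) by positive. nra. }
 set (Wm := X / p). have HWm : 0 < Wm by positive.
 have Slow : forall s, p / 4 <= s <= 3 * p / 4 -> Rabs (v s) <= Wm.
 { intros s Hs. destruct (Hu s) as [[U1 U2] _]; [lra|]. apply Rabs_le. split.
  - apply Rnot_lt_le; intro Hlt. have G : u p <= u s + (/ 4) ^ n * v s * (p - s).
   { apply (deriv_le u v); [lra|auto|]. split; [apply Od; lra|]. have Q := Phi s x by_lra by_lra.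
    have Q2 := pow_quarter n x s by_lra by_lra by_lra. have Px : 0 < x ^ n by positive. nra. }
   have P4 : 0 < (/ 4) ^ n by positive. have G2 : (/ 4) ^ n * - v s * (p / 4) <= (/ 4) ^ n * - v s * (p - s).
   { apply Rmult_le_compat_l; [apply Rmult_le_pos|]; lra. } have G3 : (/ 4) ^ n * (- v s * (p / 4)) < xp by lra.
   apply (Rmult_lt_compat_l (4 ^ (n + 1))) in G3; auto.
   replace (4 ^ (n + 1) * ((/ 4) ^ n * (- v s * (p / 4)))) with (- v s * p) in G3.
   2: { rewrite pow_add, pow_inv. assert (0 < 4 ^ n) by positive. field. lra. } have G4 : X < - v s * p.
   { replace X with (Wm * p) by (unfold Wm; field; lra). nra. } unfold X, K in G4. lra.
  - apply Rnot_lt_le; intro Hlt. have G : u (p / 8) + v s * (s - p / 8) <= u s.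
   { apply (deriv_ge_le u v); [lra|auto|]. split; [apply Od; lra|]. have Q := Phi x s by_lra by_lra.
    have Px : 0 < x ^ n by positive. have Q2 : x ^ n <= s ^ n by (apply pow_incr; lra). nra. }
   have U8 : bp <= u (p / 8).
   { apply Rnot_lt_le; intro Hlow. destruct (continuous_eps u (p / 8) (bp - u (p / 8)) (Cu _)) as [e1 [He1 H1]]; [lra|].
    set (y := Rmin (p / 8 + e1 / 2) (p / 4)).
    assert (p / 8 < y <= p / 8 + e1 / 2 /\ y <= p / 4) by (unfold y, Rmin; destruct Rle_dec; lra).
    specialize (H1 y ltac:(by_cases)). apply Rabs_lt_between in H1. destruct (Hu y); lra. }
   have G4 : X < v s * p.
   { replace X with (Wm * p) by (unfold Wm; field; lra). nra. } unfold X in G4. nra. }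
 set (s1 := p / 2).
 have HF : C0 / (2 * p) <= F (u s1).
 { have E1 := rest_energy_decr (n := n) NL 0 al u v s1 p RS ltac:(unfold s1). have E2 : C0 / p <= energy f u v p.
  { apply (Rmult_le_reg_l p); [lra|]. replace (p * (C0 / p)) with C0 by (field; lra). auto. }
  have V1 := Slow s1 ltac:(unfold s1; lra).
  have V2 : v s1 ^ 2 <= Wm ^ 2 by (rewrite <- pow2_abs; apply pow_incr; split; [apply Rabs_pos|auto]).
  have V3 : Wm ^ 2 <= C0 / p.
  { unfold Wm. apply (Rmult_le_reg_r (p * p)); [nra|]. replace ((X / p) ^ 2 * (p * p)) with (X ^ 2) by (field; lra).
   replace (C0 / p * (p * p)) with (p * C0) by (field; lra).
   have T : X ^ 2 / C0 * C0 <= p * C0 by (apply Rmult_le_compat_r; unfold P0 in HpP; lra).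
   replace (X ^ 2 / C0 * C0) with (X ^ 2) in T by (field; lra). auto. }
  unfold energy in E1 at 2. fold F in E1.
  replace (C0 / (2 * p)) with (C0 / p - C0 / p / 2) by (field; lra). lra. }
 have Hg : f (u s1) <= N * Wm.
 { set (g1 := f (u s1)). have G : v (s1 + 1) <= v s1 + (INR n * Wm + L * Wm - g1) * (s1 + 1 - s1).
  { apply (deriv_le v (fun x => - (INR n / x) * v x - f (u x))); [lra|auto|]. intros x Hx.
   have Hx2 : p / 4 <= x <= 3 * p / 4 by (unfold s1 in Hx; lra). split; [apply (rs_ode RS); lra|].
   have A1 : Rabs (- (INR n / x) * v x) <= INR n * Wm.
   { rewrite Rabs_mult, Rabs_Ropp, Rabs_right. 2: { apply Rle_ge, Rdiv_le_0_compat; lra. }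
    apply Rmult_le_compat; try apply Rabs_pos; [apply Rdiv_le_0_compat; lra| |auto]. apply (Rmult_le_reg_r x); [lra|].
    replace (INR n / x * x) with (INR n * 1) by (field; lra). nra. }
   have A2 : Rabs (u x - u s1) <= Wm * (x - s1).
   { apply (lipschitz_of_deriv u v); [lra|auto|]. intros y Hy. split; [apply Od; unfold s1 in Hy; lra|]. apply Slow.
    unfold s1 in *; lra. }
   have A3 : Rabs (f (u x) - f (u s1)) <= L * Rabs (u x - u s1).
   { destruct (Hu x) as [B1 B2]; [lra|]. destruct (Hu s1) as [B3 B4]; [lra|]. apply Hlip; rewrite Rabs_right; lra. }
   have A4 : L * Rabs (u x - u s1) <= L * Wm. { apply Rmult_le_compat_l; auto. nra. } apply Rabs_le_between in A1.
   have A5 := Rle_trans _ _ _ A3 A4. apply Rabs_le_between in A5. unfold g1. lra. }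
  have V1 := Slow s1 ltac:(unfold s1; lra). have V2 := Slow (s1 + 1) ltac:(unfold s1; lra). apply Rabs_le_between in V1.
  apply Rabs_le_between in V2. unfold N. lra. }
 apply Rle_trans with (N * Wm); auto.
 apply Rle_trans with (N * X * 2 / C0 * (C0 / (2 * p))).
 - apply Req_le. unfold Wm. field. lra.
 - apply Rmult_le_compat_l; auto. apply Rlt_le, Rdiv_lt_0_compat; auto. nra.
Qed.

End Degenerate.

(** * Bound states at the edge of a set of initial values *)

Definition settles (u : R -> R) : Prop := forall e, 0 < e -> exists S0, forall t, S0 <= t -> Rabs (u t) < e.

Lemma last_zero u v k : ~ has_zeros u v (S k) ->
  exists j r, (j <= k)%nat /\ kth_zero u v j r /\ ~ has_zeros u v (S j).
Proof.
 induction k; intros H.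
 - exists 0%nat, 0. repeat split; auto.
 - have [[r Hr]|Hn] := classic (has_zeros u v (S k)).
  + exists (S k), r. auto.
  + have [j [r [H1 H2]]] := IHk Hn. exists j, r. auto.
Qed.

Section Edge.

Context {n D f delta} (n_pos : (1 <= n)%nat) (NL : nonlinearity D f delta).
Context (bm bp xm xp mu : R) (W : well D f 0 bm bp xm xp mu) (bp_delta : delta <= bp).
Context (U V : R -> R -> R) (Fam : forall al, D al -> al <> 0 -> normal_sol n D f al (U al) (V al)).

Let F := primitive f.
Notation E al := (energy f (U al) (V al)).
Notation inw al := (inwell f 0 xm xp mu (U al) (V al)).
Notation zeros al k := (has_zeros (U al) (V al) k).
Notation kz al k r := (kth_zero (U al) (V al) k r).

(** [be] is the end of an interval of initial values with more than [k] zeros. *)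
Variables (be sg h0 : R) (k j : nat) (rj : R).
Hypothesis T_be : trapped D f xm xp mu U V be.
Hypothesis few : ~ zeros be (S k).
Hypothesis sg_abs : Rabs sg = 1.
Hypothesis h0_pos : 0 < h0.
Hypothesis many : forall t, 0 < t < h0 -> D (be + sg * t) -> zeros (be + sg * t) (S k).
Hypothesis jk : (j <= k)%nat.
Hypothesis kz_j : kz be j rj.
Hypothesis last_j : ~ zeros be (S j).

Let D_be : D be := proj1 T_be.
Let be_nz : be <> 0 := proj1 (proj2 T_be).
Let NS : normal_sol n D f be (U be) (V be) := Fam be D_be be_nz.
Let RS := ns_rest NS.

Lemma sg_dist s t : Rabs ((be + sg * s) - (be + sg * t)) = Rabs (s - t).
Proof. replace (be + sg * s - (be + sg * t)) with (sg * (s - t)) by ring. rewrite Rabs_mult, sg_abs. ring. Qed.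

Lemma edge_point h : 0 < h -> exists t, 0 < t < h /\ t < h0 /\ D (be + sg * t) /\ Rabs (be + sg * t - be) < h.
Proof.
 intros Hh. have [e [He H]] := nl_open NL be D_be. set (t := Rmin h (Rmin h0 e) / 2).
 have Ht : 0 < t /\ t < h /\ t < h0 /\ t < e by (unfold t, Rmin; repeat destruct Rle_dec; lra).
 have Hd : Rabs (be + sg * t - be) = t. { have T := sg_dist t 0. by_cases. } exists t. repeat split; try lra. apply H. lra.
Qed.

Lemma later_zero_dead t : rj < t -> U be t = 0 -> dead (U be) (V be) t.
Proof.
 intros Ht Hu. split; auto. apply NNPP; intro Hv. apply last_j.
 have [r [Hr _]] := kz_next be (U be) (V be) j rj t NS be_nz kz_j Ht Hu Hv. exists r; auto.
Qed.

Lemma zero_energy_pos al u v t s : rest_sol n D f 0 al u v -> 0 <= s <= t -> u t = 0 -> v t <> 0 -> 0 < energy f u v s.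
Proof.
 intros R Hs Hu Hv. apply Rlt_le_trans with (energy f u v t).
 - unfold energy. rewrite Hu. have T : primitive f 0 = 0 by apply F_zero. nra.
 - apply (rest_energy_decr (n := n) NL 0 al); auto.
Qed.

(** Past the last zero of [be], its neighbours still have a zero to come. *)
Lemma neighbour S0 e : rj < S0 -> (forall t, rj < t <= S0 -> U be t <> 0) -> 0 < e ->
  exists h, 0 < h /\ forall al, D al -> Rabs (al - be) < h -> al <> 0 /\
    Rabs (E al S0 - E be S0) < e /\ Rabs (U al S0 - U be S0) < e /\
    (forall i, (j <= i)%nat -> zeros al (S i) -> exists t, kz al (S j) t /\ S0 < t /\ U al t = 0 /\ V al t <> 0 /\
      (forall s, S0 <= s < t -> U al s <> 0) /\ (forall s, 0 <= s <= t -> 0 < E al s) /\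
      ((j < i)%nat -> exists t2, t < t2 /\ U al t2 = 0 /\ V al t2 <> 0)).
Proof.
 intros HS Hgap He. have [h1 [Hh1 H1]] := late_zero n_pos NL U V Fam be j rj S0 D_be be_nz kz_j HS Hgap.
 destruct (family_state n D f delta n_pos NL U V Fam be S0 D_be be_nz) with (e := e) as [h2 [Hh2 H2]]; auto.
 { intros [E1 _]. apply (Hgap S0); lra. } exists (Rmin h1 h2). split; [by_cases|]. intros al Hal Ha.
 apply Rmin_Rgt_l in Ha as [A1 A2]. have [Hne [r' [K1 [K2 [K3 K4]]]]] := H1 al Hal A1. have [_ [B1 [B2 _]]] := H2 al Hal A2.
 repeat split; auto. intros i Hi Hz. have [t Ht] := has_zeros_le _ _ (S j) (S i) ltac:(lia) Hz.
 have [s0 [L1 [L2 [L3 [L4 L5]]]]] := Ht. have Es : s0 = r' by (apply (kz_unique _ _ _ _ _ L1)). subst s0. exists t.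
 repeat split; auto.
 - intros s Hs. apply L5; lra.
 - intros s Hs. apply (zero_energy_pos al _ _ t); auto. apply (ns_rest (Fam al Hal Hne)).
 - intro Hji. destruct (has_zeros_le _ _ (S (S j)) (S i) ltac:(lia) Hz) as [t2 [s2 [M1 [M2 [M3 [M4 _]]]]]].
  have Es : s2 = t by (apply (kz_unique _ _ _ _ _ M1); exists r'). subst s2. exists t2; auto.
Qed.

(** Negative energy would be shared by the neighbours, and they could not reach
    zero again. *)
Lemma edge_energy r : 0 <= r -> 0 <= E be r.
Proof.
 intros Hr. apply Rnot_lt_le; intro Hneg. have Hrj := kz_nonneg _ _ _ _ kz_j. set (S0 := Rmax r (rj + 1)).
 have M1 := Rmax_l r (rj + 1). have M2 := Rmax_r r (rj + 1). fold S0 in M1, M2. have HE : E be S0 < 0.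
 { eapply Rle_lt_trans; [apply (rest_energy_decr NL 0 be _ _ r S0 RS); lra|auto]. }
 have Hdead : forall t, 0 <= t <= S0 -> ~ dead (U be) (V be) t.
 { intros t Ht Hd. have [D1 D2] := ns_dead NS t S0 by_lra Hd. unfold energy in HE. rewrite D1, D2 in HE.
  have T : primitive f 0 = 0 by apply F_zero. lra. }
 destruct (neighbour S0 (- E be S0)) as [h [Hh H]]; try lra.
 { intros t Ht Hu. apply (Hdead t); [lra|]. apply later_zero_dead; lra. } have [t [T1 [T2 [T3 T4]]]] := edge_point h Hh.
 have [_ [A1 [_ A2]]] := H _ T3 T4. have [z [_ [Z2 [_ [_ [_ [Z5 _]]]]]]] := A2 k jk (many t by_lra T3).
 apply Rabs_lt_between in A1. specialize (Z5 S0 by_lra). lra.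
Qed.

(** Once [r E] is small near zero, the neighbours have at most one more zero. *)
Lemma edge_count C S0 : (forall al u v S0 t1 t2, rest_sol n D f 0 al u v ->
    0 <= S0 <= t1 -> t1 < t2 -> S0 * energy f u v S0 < C -> Rabs (u S0) < delta / 3 ->
    u t1 = 0 -> u t2 = 0 -> v t2 <> 0 -> False) ->
  rj < S0 -> (forall t, rj < t <= S0 -> U be t <> 0) -> S0 * E be S0 < C -> Rabs (U be S0) < delta / 3 ->
  zeros be k.
Proof.
 intros HC HS Hgap HE Hu. assert (Hrj := kz_nonneg _ _ _ _ kz_j). destruct (proj1 (Nat.lt_eq_cases j k) jk) as [Hlt|Heq].
 2: { rewrite <- Heq. exists rj. auto. } exfalso. set (e := Rmin ((C - S0 * E be S0) / S0) (delta / 3 - Rabs (U be S0))).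
 assert (He : 0 < e). { apply Rmin_glb_lt; [apply Rdiv_lt_0_compat|]; lra. } destruct (neighbour S0 e) as [h [Hh H]]; auto.
 destruct (edge_point h Hh) as [t [T1 [T2 [T3 T4]]]]. destruct (H _ T3 T4) as [Hne [A1 [A2 A3]]].
 destruct (A3 k jk (many t by_lra T3)) as [z [_ [Z2 [Z3 [_ [_ [_ Z6]]]]]]]. destruct (Z6 Hlt) as [t2 [Y1 [Y2 Y3]]].
 apply Rmin_Rgt_l in A1 as [A1 _]. apply Rmin_Rgt_l in A2 as [_ A2].
 apply (HC _ _ _ S0 z t2 (ns_rest (Fam _ T3 Hne))); auto; [lra| |].
 - apply Rabs_lt_between in A1. assert (Q : E (be + sg * t) S0 < E be S0 + (C - S0 * E be S0) / S0) by lra.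
  apply (Rmult_lt_compat_l S0) in Q; [|lra]. replace (S0 * (E be S0 + (C - S0 * E be S0) / S0)) with C in Q by (field; lra).
  auto.
 by_cases.
Qed.

Lemma edge_dead r : 0 <= r -> dead (U be) (V be) r -> settles (U be) /\ zeros be k.
Proof.
 intros Hr Hd. split. { exists r. intros t Ht. have [-> _] := ns_dead NS r t by_lra Hd. by_cases. }
 destruct (first_dead (U be) (V be) r) as [r0 [Hr0 [[D1 D2] Hbef]]]; auto. { intro; apply (normal_cont _ NS). }
 have Hrj := kz_nonneg _ _ _ _ kz_j. have Hj : rj < r0.
 { apply Rnot_le_lt; intro Hle. have [P|P] := Rle_lt_or_eq_dec _ _ (proj1 Hr0).
  - destruct j as [|i]; [simpl in kz_j; lra|]. have [s [_ [_ [_ [Q _]]]]] := kz_j. apply Q. apply (ns_dead NS r0); [lra|].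
   by_cases.
  - rewrite <- P in D1. rewrite (proj1 (normal_start NS)) in D1. auto. }
 have [C [HC HF]] := few_zeros n_pos NL.
 destruct (energy_near NL (U be r0) (V be r0) (C / r0)) as [h [Hh H]]. { apply (rs_dom RS). } { positive. }
 have Hdel := nl_delta NL.
 destruct (continuous_eps (U be) r0 (Rmin h (delta / 3))) as [e1 [He1 H1]]; [apply (normal_cont _ NS)|apply Rmin_glb_lt;
  lra|]. destruct (continuous_eps (V be) r0 h) as [e2 [He2 H2]]; [apply (normal_cont _ NS)|auto|].
 set (S0 := Rmax ((rj + r0) / 2) (r0 - Rmin e1 e2 / 2)). have HS : rj < S0 < r0 /\ r0 - Rmin e1 e2 / 2 <= S0.
 { unfold S0. by_cases. } specialize (H1 S0 ltac:(by_cases)). specialize (H2 S0 ltac:(by_cases)).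
 apply Rmin_Rgt_l in H1 as [H1 H3]. specialize (H _ _ H1 H2). apply Rabs_lt_between in H. rewrite D1, D2 in H.
 have T : primitive f 0 = 0 by apply F_zero. rewrite D1, Rminus_0_r in H3. apply (edge_count C S0 HF); try lra.
 - intros t Ht Hu. apply (Hbef t); [lra|]. apply later_zero_dead; lra.
 - have Q : V be S0 ^ 2 / 2 + primitive f (U be S0) < C / r0 by lra. apply (Rmult_lt_compat_l S0) in Q; [|lra].
  eapply Rlt_le_trans; [apply Q|]. apply (Rmult_le_reg_r r0); [lra|].
  replace (S0 * (C / r0) * r0) with (S0 * C) by (field; lra). nra.
Qed.

(** ** The solution stays positive after its last zero *)

Hypothesis pos_be : forall t, rj < t -> 0 < U be t.

Let gap S0 : forall t, rj < t <= S0 -> U be t <> 0.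
Proof. intros t Ht E1. have T := pos_be t by_lra. lra. Qed.

Lemma neighbour_pos S0 e : rj < S0 -> 0 < e -> exists h, 0 < h /\ forall al, D al -> Rabs (al - be) < h -> al <> 0 /\
    Rabs (E al S0 - E be S0) < e /\ Rabs (U al S0 - U be S0) < e /\
    (zeros al (S k) -> exists t, kz al (S j) t /\ S0 < t /\ U al t = 0 /\ V al t <> 0 /\
      (forall s, S0 <= s < t -> 0 < U al s) /\ (forall s, 0 <= s <= t -> 0 < E al s)).
Proof.
 intros HS He. destruct (neighbour S0 (Rmin e (U be S0)) HS (gap S0)) as [h [Hh H]]. { abs_bounds. } exists h. split; auto.
 intros al Hal Ha. have [Hne [A1 [A2 A3]]] := H al Hal Ha. apply Rmin_Rgt_l in A1 as [A1 _].
 apply Rmin_Rgt_l in A2 as [A2 A4]. repeat split; auto. intros Hz. have [t [B1 [B2 [B3 [B4 [B5 [B6 _]]]]]]] := A3 k jk Hz.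
 exists t. repeat (split; auto). intros s Hs. apply Rnot_le_lt; intro Hle. apply Rabs_lt_between in A4.
 destruct (ivt_decr (U al) S0 s 0) as [z [Z1 Z2]]; try lra.
 - intros x _. apply (normal_cont x (Fam al Hal Hne)).
 - apply (B5 z); lra.
Qed.

(** Falling from the wall, a solution with positive energy does not stop before zero. *)
Lemma fall al u v z t : rest_sol n D f 0 al u v -> 0 < z -> u z <= bp -> v z < 0 ->
  (forall s, z <= s <= t -> 0 <= u s) -> (forall s, z <= s <= t -> 0 < energy f u v s) ->
  forall s, z <= s <= t -> v s < 0.
Proof.
 intros R Hz Hu Hv Hpos HE s Hs. apply Rnot_le_lt; intro Hle. destruct (first_hit v z s 0) as [w [W1 [W2 W3]]]; try lra.
 { intros x _. apply (rs_cont R). } have Hw : u w <= u z.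
 { apply (nonincr_deriv u v); try lra.
  - intros x _. apply (rs_cont R).
  - split; [apply (rs_ode R); lra|]. apply Rlt_le, W3; lra. }
 specialize (HE w by_lra). specialize (Hpos w by_lra).
 unfold energy in HE. rewrite W2 in HE. have T := w_low W (u w). have O := w_order W. lra.
Qed.

(** The last downward crossing of [bp] before the next zero. *)
Definition crossing al p := exists t, kz al (S j) t /\ p < t /\ U al p = bp /\ forall s, p < s <= t -> U al s < bp.

Lemma crossing_unique al p q : crossing al p -> crossing al q -> p = q.
Proof.
 intros [t [A1 [A2 [A3 A4]]]] [s [B1 [B2 [B3 B4]]]]. assert (t = s) by (apply (kz_unique _ _ _ _ _ A1 B1)). subst s.
 destruct (total_order_T p q) as [[H|H]|H]; auto.
 - specialize (A4 q by_lra). lra.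
 - specialize (B4 p by_lra). lra.
Qed.

Lemma crossing_exists C0 S0 al t :
  (forall al u v t1 t2, rest_sol n D f 0 al u v -> 0 <= t1 <= t2 -> (forall t, t1 <= t <= t2 -> F (u t) <= 0) ->
    (u t1 <= delta / 3 /\ 2 * delta / 3 <= u t2) \/ (2 * delta / 3 <= u t1 /\ u t2 <= delta / 3) ->
    t2 * energy f u v t2 + C0 <= t1 * energy f u v t1) ->
  0 < S0 -> D al -> al <> 0 -> S0 * E al S0 < C0 -> 2 * delta / 3 <= U al S0 ->
  kz al (S j) t -> S0 < t -> V al t <> 0 -> (forall s, S0 <= s < t -> 0 < U al s) -> (forall s, 0 <= s <= t -> 0 < E al s) ->
  exists p ru, crossing al p /\ V al p < 0 /\ C0 <= p * E al p /\ S0 <= ru < p /\ p < t /\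
    ru * E al ru <= S0 * E al S0 /\ forall s, ru < s < p -> bp < U al s.
Proof.
 intros Hcost HS0 HD Hne HE HU Hkz HSt Hvt Hpos HEp. have Hdel := nl_delta NL. have O := w_order W.
 have R := ns_rest (Fam al HD Hne). have Cu : forall x, continuous (U al) x by (intro; apply (rs_cont R)).
 have Ut : U al t = 0 by (case: Hkz => [s [_ [_ [Q _]]]]; auto). have Hpos' : forall s, S0 <= s <= t -> 0 <= U al s.
 { intros s Hs. destruct (Req_dec s t) as [->|]; [lra|]. apply Rlt_le, Hpos; lra. }
 have HFl : forall x, 0 <= x <= bp -> F x <= 0 by (intros x Hx; apply (w_low W); lra).
 have HEt : 0 <= t * E al t by (apply Rmult_le_pos; [lra|apply Rlt_le, HEp; lra]).
 have Hs : exists s, S0 <= s < t /\ bp <= U al s.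
 { apply NNPP; intro Hno. have T := Hcost al (U al) (V al) S0 t R by_lra.
  enough (t * E al t + C0 <= S0 * E al S0) by lra. apply T; [|lra]. intros s Hs. apply HFl. repeat split; auto.
  apply Rnot_lt_le; intro. destruct (Req_dec s t) as [->|]; [lra|]. apply Hno. exists s. lra. }
 have [s [Hs1 Hs2]] := Hs.
 destruct (last_hit (U al) s t bp) as [p [P1 [P2 P3]]]; try lra; auto. have HpE : C0 <= p * E al p.
 { assert (T : t * E al t + C0 <= p * E al p); [|lra]. apply (Hcost al _ _ p t R); try lra. intros x Hx. apply HFl.
  split; [apply Hpos'; lra|]. destruct (Req_dec x p) as [->|]; [lra|]. apply Rlt_le, P3; lra. }
 have HpS : S0 < p.
 { case: (Req_dec p S0) => [E1|]; [rewrite E1 in HpE|]; lra. } have Fbp : primitive f bp = 0 by apply (w_bp W).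
 have Vnz : forall x, 0 <= x <= t -> U al x = bp -> V al x <> 0.
 { intros x Hx E1 E2. specialize (HEp x Hx). unfold energy in HEp. rewrite E1, E2 in HEp. lra. }
 have Cross : forall x, 0 < x <= t -> U al x = bp -> exists e, 0 < e /\ forall y, Rabs (y - x) < e -> y <> x -> 0 < V al x *
  (y - x) * (U al y - bp).
 { intros x Hx E1. apply simple_zero; [|lra|apply Vnz; lra]. apply (is_derive_value _ _ (V al x - 0)); [|lra].
  apply is_derive_diff; [apply (rs_ode R); lra|apply (is_derive_const bp)]. }
 have [e [He Hcr]] := Cross p by_lra P2.
 have Hvp : V al p < 0.
 { set (y := Rmin (p + e / 2) ((p + t) / 2)).
  have Hy : p < y < t /\ y <= p + e / 2 by (unfold y, Rmin; destruct Rle_dec; lra).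
  specialize (Hcr y ltac:(by_cases) by_lra). specialize (P3 y by_lra). apply Rnot_le_lt; intro Hv.
  assert (0 <= V al p * (y - p)) by positive. nra. }
 have Hleft : forall y, p - e < y < p -> bp < U al y.
 { intros y Hy. specialize (Hcr y ltac:(by_cases) by_lra). assert (0 < V al p * (y - p)) by nra. nra. }
 (* the last upward crossing, if any *)
 have Hru : exists ru, S0 <= ru < p /\ (ru = S0 \/ U al ru = bp) /\ forall x, ru < x < p -> bp < U al x.
 { have [[x [Hx1 Hx2]]|Hno] := classic (exists x, S0 <= x < p /\ U al x <= bp).
  - set (q := Rmax ((x + p) / 2) (p - e / 2)).
   have Hq : x < q < p /\ p - e / 2 <= q by (unfold q, Rmax; destruct Rle_dec; lra). have Hqb := Hleft q by_lra.
   destruct (last_hit (fun y => - U al y) x q (- bp)) as [ru [R1 [R2 R3]]]; try lra.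
   { intros y _. apply (continuous_opp (U al)); auto. } exists ru. repeat split; try lra. intros y Hy.
   destruct (Rle_lt_dec y q); [specialize (R3 y by_lra); lra|apply Hleft; lra].
  - exists S0. do 2 (split; [lra|]). intros y Hy. apply Rnot_le_lt; intro. apply Hno. exists y. lra. }
 have [ru [Ru1 [Ru2 Ru3]]] := Hru. exists p, ru. split; [exists t; repeat split; auto; lra|]. repeat split; auto; try lra.
 destruct Ru2 as [->|Hub]; [lra|]. apply (rE_decr n_pos NL al _ _ S0 ru R); [lra|]. intros x Hx. apply HFl.
 split; [apply Hpos'; lra|]. apply Rnot_lt_le; intro Hlt.
 destruct (first_hit (fun y => - U al y) x ru (- bp)) as [z [Z1 [Z2 Z3]]]; try lra.
 { intros y _. apply (continuous_opp (U al)); auto. } have [e2 [He2 Hcr2]] := Cross z by_lra by_lra.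
 have Hvz : V al z < 0.
 { set (y := Rmax (z - e2 / 2) x). have Hy : x <= y < z /\ z - e2 / 2 <= y by (unfold y, Rmax; destruct Rle_dec; lra).
  specialize (Hcr2 y ltac:(by_cases) by_lra). specialize (Z3 y by_lra). apply Rnot_le_lt; intro Hv.
  assert (0 <= V al z * (z - y)) by positive. nra. }
 have Hf := fall al (U al) (V al) z t R by_lra by_lra Hvz ltac:(intros; apply Hpos'; lra) ltac:(intros; apply HEp;
  lra). destruct (mean_value (U al) (V al) z p) as [c [C1 C2]]; [lra|auto| |].
 - intros y Hy. apply (rs_ode R). lra.
 - specialize (Hf c by_lra). assert (V al c * (p - z) < 0) by nra. lra.
Qed.

(** The crossing is transversal, so its time is continuous in the height. *)
Lemma crossing_continuous S0 al p : 0 < S0 -> D al -> al <> 0 -> crossing al p -> S0 < p -> V al p < 0 ->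
  (exists h, 0 < h /\ forall be', D be' -> Rabs (be' - al) < h -> be' <> 0 /\ exists t, kz be' (S j) t /\ S0 < t /\
     (forall s, S0 <= s < t -> 0 < U be' s) /\ (forall s, 0 <= s <= t -> 0 < E be' s)) ->
  forall e, 0 < e -> exists h, 0 < h /\ forall be' q, D be' -> Rabs (be' - al) < h -> crossing be' q ->
    Rabs (U be' (q / 2) - U al (p / 2)) < e.
Proof.
 intros HS0 HD Hne [t0 [K1 [K2 [K3 K4]]]] HSp Hvp [h1 [Hh1 Hnb]] e He. have NSa := Fam al HD Hne. have R := ns_rest NSa.
 have Halive : ~ dead (U al) (V al) t0. { have [s [_ [_ [_ [Q _]]]]] := K1. intros [_ E1]. auto. }
 destruct (simple_zero (fun y => U al y - bp) p (V al p)) as [e1 [He1 H1]]; try lra.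
 { apply (is_derive_value _ _ (V al p - 0)); [|lra].
  apply is_derive_diff; [apply (rs_ode R); lra|apply (is_derive_const bp)]. }
 destruct (continuous_eps (V al) p (- V al p / 2)) as [e2 [He2 H2]]; [apply (normal_cont _ NSa)|lra|].
 destruct (continuous_eps (U al) (p / 2) (e / 2)) as [e3 [He3 H3]]; [apply (normal_cont _ NSa)|lra|].
 set (x := Rmin (Rmin (Rmin e1 e2) e3) (Rmin (p - S0) (t0 - p)) / 3).
 have Hx : 0 < x /\ x < e1 /\ x < e2 /\ x < e3 /\ 2 * x < p - S0 /\ 2 * x < t0 - p. { unfold x. by_cases. }
 have U1 := H1 (p - x) ltac:(by_cases) by_lra. have U2 := H1 (p + x) ltac:(by_cases) by_lra.
 have Q0 : 0 < - V al p * x by nra. have U1' : bp < U al (p - x) by nra. have U2' : U al (p + x) < bp by nra.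
 set (m := Rmin (Rmin (U al (p - x) - bp) (bp - U al (p + x))) (Rmin (- V al p / 2) (e / 2))).
 have Hm : 0 < m /\ m <= U al (p - x) - bp /\ m <= bp - U al (p + x) /\ m <= - V al p / 2 /\ m <= e / 2.
 { unfold m. by_cases. } destruct (family_continuity n_pos NL U V Fam al t0 HD Hne Halive m) as [h2 [Hh2 Hc]]; [lra|].
 destruct (kz_tracked n D f delta n_pos NL U V Fam al (S j) t0 HD Hne K1 x) as [h3 [Hh3 Htr]]; [lra|].
 exists (Rmin h1 (Rmin h2 h3)). split; [by_cases|]. intros be' q HDb Hb Hq. apply Rmin_Rgt_l in Hb as [B1 B2].
 apply Rmin_Rgt_l in B2 as [B2 B3]. have [Hneb [t [T1 [T2 [T3 T4]]]]] := Hnb be' HDb B1. have [_ Hc2] := Hc be' HDb B2.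
 have [_ [t' [T5 T6]]] := Htr be' HDb B3. assert (t' = t) by (apply (kz_unique _ _ _ _ _ T5 T1)).
 apply Rabs_lt_between in T6. have Rb := ns_rest (Fam be' HDb Hneb). have [C1 _] := Hc2 (p - x) by_lra.
 have [C2 _] := Hc2 (p + x) by_lra. apply Rabs_lt_between in C1. apply Rabs_lt_between in C2.
 destruct (ivt_decr (U be') (p - x) (p + x) bp) as [z [Z1 Z2]]; try lra. { intros y _. apply (rs_cont Rb). }
 have Vz : V be' z < 0. { have [_ C3] := Hc2 z by_lra. specialize (H2 z ltac:(by_cases)). by_cases. }
 have Ut : U be' t = 0 by (case: T1 => [s [_ [_ [Q _]]]]).
 have Hf := fall be' (U be') (V be') z t Rb by_lra by_lra Vz. have Hf' : forall s, z <= s <= t -> V be' s < 0.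
 { apply Hf.
  - intros s Hs. destruct (Req_dec s t) as [->|]; [lra|]. apply Rlt_le, T3; lra.
  - intros s Hs. apply T4; lra. }
 have Hzq : q = z.
 { apply (crossing_unique be'); auto. exists t. repeat split; auto; try lra. intros s Hs.
  destruct (mean_value (U be') (V be') z s) as [c [X1 X2]]; try lra.
  - intros y _. apply (rs_cont Rb).
  - intros y Hy. apply (rs_ode Rb). lra.
  - specialize (Hf' c by_lra). assert (V be' c * (s - z) < 0) by nra. lra. }
 subst q.
 have [C3 _] := Hc2 (z / 2) by_lra. have C4 := H3 (z / 2) ltac:(by_cases). by_cases.
Qed.

Lemma neighbour_quiet S0 eps x : rj < S0 -> 1 <= S0 -> 0 < eps -> 0 < x -> S0 * E be S0 < eps -> Rabs (U be S0 - bp) < x ->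
  exists h, 0 < h /\ forall al, D al -> Rabs (al - be) < h -> al <> 0 /\
    S0 * E al S0 < eps /\ Rabs (U al S0 - bp) < x /\
    (zeros al (S k) -> exists t, kz al (S j) t /\ S0 < t /\ U al t = 0 /\ V al t <> 0 /\
      (forall s, S0 <= s < t -> 0 < U al s) /\ (forall s, 0 <= s <= t -> 0 < E al s)).
Proof.
 intros HS HS1 Heps Hx HE HU.
 destruct (neighbour_pos S0 (Rmin ((eps - S0 * E be S0) / S0) (x - Rabs (U be S0 - bp)))) as [h [Hh H]]; auto.
 { apply Rmin_glb_lt; [apply Rdiv_lt_0_compat|]; lra. } exists h. split; auto. intros al Hal Ha.
 destruct (H al Hal Ha) as [Hne [A1 [A2 A3]]]. apply Rmin_Rgt_l in A1 as [A1 _]. apply Rmin_Rgt_l in A2 as [_ A2].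
 split; auto. split; [|split; auto].
 - apply Rabs_lt_between in A1. assert (Q : E al S0 < E be S0 + (eps - S0 * E be S0) / S0) by lra.
  apply (Rmult_lt_compat_l S0) in Q; [|lra].
  replace (S0 * (E be S0 + (eps - S0 * E be S0) / S0)) with eps in Q by (field; lra). auto.
 by_cases.
Qed.

(** The limit cannot be the wall [bp]: by continuity the neighbours would be
    slow at every small height above the wall, so that [f <= C F] there, which
    is impossible for the primitive [F] of [f > 0] that vanishes at [bp]. *)
Lemma no_limit_at_wall : f bp = 0 ->
  (forall e S1, 0 < e -> exists S2, S1 <= S2 /\ rj < S2 /\ S2 * E be S2 < e /\ forall t, S2 <= t -> Rabs (U be t - bp) < e) ->
  False.
Proof.
 intros Hfb Hset. have O := w_order W. have Hdel := nl_delta NL. have Hmu := w_mu W.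
 have HDw : forall x, xm <= x <= xp -> D x by (intros x; apply (well_D NL 0 bm bp xm xp mu)).
 have Fbp : F bp = 0 by apply (w_bp W).
 destruct (crossing_cost n_pos NL (delta / 3) (2 * delta / 3)) as [C0 [HC0 Hcost]]; try (apply HDw); try lra.
 { intros x Hx. apply (nl_neg NL); [apply HDw; lra|]. by_cases. }
 destruct (nl_lip NL bp) as [L [e1 [He1 [HL Hlip]]]]; [apply HDw; lra|lra|]. set (eta := Rmin e1 (xp - bp) / 2).
 have Heta : 0 < eta /\ eta < e1 /\ bp + eta < xp. { unfold eta. by_cases. }
 have [P0 [C [HP0 [HC Hslow]]]] := slow_middle n_pos NL bm bp xm xp mu W C0 L e1 Hfb HC0 HL He1 Hlip.
 have Fmono : forall x y, bp <= x -> x < y -> y <= xp -> F x < F y.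
 { intros x y Hx Hxy Hy. apply (F_increasing NL); try (apply HDw; lra); auto. intros z Hz. apply (w_fp W). lra. }
 have [eD [HeD HopD]] := nl_open NL be D_be. have Dt : forall t, 0 <= t < eD -> D (be + sg * t).
 { intros t Ht. apply HopD. replace (be + sg * t - be) with (be + sg * t - (be + sg * 0)) by ring.
  rewrite sg_dist, Rabs_right; lra. }
 have Stage : forall x, bp < x <= bp + eta -> exists S0 h, 0 < S0 /\ 0 < h /\ h <= eD /\ h <= h0 /\ forall t, 0 < t < h -> be
  + sg * t <> 0 /\ (exists tz, kz (be + sg * t) (S j) tz /\ S0 < tz /\ (forall s, S0 <= s < tz -> 0 < U (be + sg * t) s) /\
  (forall s, 0 <= s <= tz -> 0 < E (be + sg * t) s)) /\ exists p, crossing (be + sg * t) p /\ V (be + sg * t) p < 0 /\ S0 <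
  p /\ f (U (be + sg * t) (p / 2)) <= C * F (U (be + sg * t) (p / 2)) /\ bp < U (be + sg * t) (p / 2) < x.
 { intros x Hx. have HFx : 0 < F x by (rewrite <- Fbp; apply Fmono; lra). set (eps := Rmin (C0 / 8) (Rmin (F x) mu)).
  have Heps : 0 < eps /\ eps <= C0 / 8 /\ eps <= F x /\ eps <= mu by (unfold eps, Rmin; repeat destruct Rle_dec; lra).
  set (y := Rmin (delta / 3) (Rmin (xp - bp) (- xm))).
  have Hy : 0 < y /\ y <= delta / 3 /\ y <= xp - bp /\ y <= - xm by (unfold y, Rmin; repeat destruct Rle_dec; lra).
  destruct (Hset (Rmin eps y) (Rmax P0 1)) as [S0 [HS1 [HS2 [HS3 HS4]]]]; [by_cases|]. have M1 := Rmax_l P0 1.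
  have M2 := Rmax_r P0 1. specialize (HS4 S0 (Rle_refl _)). apply Rmin_Rgt_l in HS3 as [HS3 _].
  apply Rmin_Rgt_l in HS4 as [_ HS4]. destruct (neighbour_quiet S0 eps y) as [h [Hh H]]; try lra.
  set (h' := Rmin h (Rmin eD h0)). have Hh' : 0 < h' /\ h' <= h /\ h' <= eD /\ h' <= h0. { unfold h'. by_cases. }
  exists S0, h'. do 2 (split; [lra|]). do 2 (split; [lra|]). intros t Ht. have HDt : D (be + sg * t) by (apply Dt; lra).
  destruct (H _ HDt) as [Hne [A1 [A2 A3]]].
  { replace (be + sg * t - be) with (be + sg * t - (be + sg * 0)) by ring. rewrite sg_dist, Rabs_right; lra. }
  have [tz [B1 [B2 [B3 [B4 [B5 B6]]]]]] := A3 (many t by_lra HDt). split; auto. split; [exists tz; auto|].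
  apply Rabs_lt_between in A2. set (al := be + sg * t) in *. have RSa := ns_rest (Fam al HDt Hne).
  destruct (crossing_exists C0 S0 al tz Hcost) as [p [ru [Q1 [Q2 [Q3 [Q4 [Q5 [Q6 Q7]]]]]]]]; auto; try lra.
  have HE0 : 0 < E al S0 by (apply B6; lra). have HEs : E al S0 < eps by nra. have Hin : inw al S0 by by_cases.
  have Hp8 : 8 * ru <= p.
  { have G := rest_energy_decr (n := n) NL 0 al _ _ ru p RSa by_lra.
   have G1 : C0 * ru <= p * E al p * ru by (apply Rmult_le_compat_r; lra).
   have G2 : p * ru * E al p <= p * (ru * E al ru) by (rewrite Rmult_assoc; apply Rmult_le_compat_l; [lra|apply
    Rmult_le_compat_l; lra]). have G3 : p * (ru * E al ru) <= p * (C0 / 8) by (apply Rmult_le_compat_l; lra).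
   apply (Rmult_le_reg_l C0); auto. lra. }
  have Hux : forall s, ru < s < p -> bp < U al s < xp /\ U al s < x.
  { intros s Hs. specialize (Q7 s Hs). have [I1 _] := inwell_after (n := n) NL W 0 al _ _ S0 s RSa by_lra Hin.
   split; [lra|]. apply Rnot_le_lt; intro Hle. have G := rest_energy_decr (n := n) NL 0 al _ _ S0 s RSa by_lra.
   have G1 := F_le_E f (U al) (V al) s. have G2 : F x <= F (U al s).
   { destruct (Req_dec x (U al s)) as [<-|]; [lra|]. apply Rlt_le, Fmono; lra. } unfold F in *. lra. }
  exists p.
  do 2 (split; auto). split; [lra|]. split; [|destruct (Hux (p / 2)); lra]. apply (Hslow al _ (V al) ru); auto; try lra.
  - intros s Hs. destruct (Hux s Hs). split; lra.
  - destruct Q1 as [t' [_ [_ [Q _]]]]; auto. }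
 destruct (Stage (bp + eta)) as [S0 [h [HS0 [Hh [HhD [Hhh0 Hst]]]]]]; [lra|].
 have Hw : exists w : R -> R, forall t, 0 < t < h -> exists p, crossing (be + sg * t) p /\ V (be + sg * t) p < 0 /\ S0 < p /\
  w t = U (be + sg * t) (p / 2) /\ f (w t) <= C * F (w t) /\ bp < w t < bp + eta.
 { destruct (choice (fun t y => 0 < t < h -> exists p, crossing (be + sg * t) p /\ V (be + sg * t) p < 0 /\ S0 < p /\ y = U
   (be + sg * t) (p / 2) /\ f y <= C * F y /\ bp < y < bp + eta)) as [w Hw]; [|exists w; auto]. intro t.
  destruct (classic (0 < t < h)) as [Ht|Ht]; [|exists 0; intro; contradiction].
  have [_ [_ [p [Q1 [Q2 [Q3 [Q4 Q5]]]]]]] := Hst t Ht. exists (U (be + sg * t) (p / 2)). exists p. split; auto. }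
 destruct Hw as [w Hw]. have Cw : forall t, 0 < t < h -> continuous w t.
 { intros t Ht. apply eps_continuous. intros e He. have [p [Q1 [Q2 [Q3 [Q4 _]]]]] := Hw t Ht. have [Hne _] := Hst t Ht.
  destruct (crossing_continuous S0 (be + sg * t) p) with (e := e) as [h2 [Hh2 Hc]]; auto. { apply Dt; lra. }
  { exists (Rmin t (h - t)). split; [by_cases|]. intros be' Hb' Hd. apply Rmin_Rgt_l in Hd as [D1 D2].
   set (t' := sg * (be' - be)). have Sq : sg * sg = 1 by (unfold Rabs in sg_abs; destruct Rcase_abs in sg_abs; nra).
   have Eb : be' = be + sg * t' by (unfold t'; rewrite <- Rmult_assoc, Sq; ring). rewrite Eb in D1, D2 |- *.
   rewrite sg_dist in D1, D2. apply Rabs_lt_between in D1. apply Rabs_lt_between in D2.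
   have [N1 [N2 _]] := Hst t' by_lra. auto. }
  exists (Rmin h2 (Rmin t (h - t))). split; [by_cases|]. intros t' Ht'.
  apply Rmin_Rgt_l in Ht' as [T1 T2]. apply Rmin_Rgt_l in T2 as [T2 T3]. apply Rabs_lt_between in T2.
  apply Rabs_lt_between in T3. have [q [W1 [_ [_ [W4 _]]]]] := Hw t' by_lra. rewrite W4, Q4.
  apply Hc; auto; [apply Dt; lra|rewrite sg_dist; auto]. }
 set (ts := h / 2).
 destruct (Hw ts) as [_ [_ [_ [_ [_ [Hf0 Hb0]]]]]]; [unfold ts; lra|].
 have Hall : forall y, bp < y <= w ts -> f y <= C * F y.
 { intros y Hy. destruct (Stage y) as [S2 [h2 [_ [Hh2 [_ [_ Hst2]]]]]]; [lra|]. set (t' := Rmin h2 ts / 2).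
  have Ht' : 0 < t' /\ t' < h2 /\ t' < ts. { assert (0 < ts) by positive. unfold t'. by_cases. }
  have [_ [_ [p [Q1 [_ [_ [_ Q5]]]]]]] := Hst2 t' by_lra.
  destruct (Hw t') as [q [W1 [_ [_ [W4 _]]]]]; [unfold ts in Ht'; lra|]. rewrite (crossing_unique _ _ _ Q1 W1) in Q5.
  destruct (ivt w t' ts y) as [c [C1 C2]]; try lra. { intros c Hc. apply Cw. unfold ts in *; lra. }
  destruct (Hw c) as [_ [_ [_ [_ [_ [Hfc _]]]]]]; [unfold ts in *; lra|]. congruence. }
 have G : F (w ts) <= F bp * exp (C * (w ts - bp)).
 { apply (gronwall F f); try lra.
  - intros x Hx. apply (F_cont NL), HDw. lra.
  - split; [apply (F_derive NL), HDw; lra|apply Hall; lra]. }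
 rewrite Fbp in G.
 have T := Fmono bp (w ts) by_lra by_lra by_lra. lra.
Qed.

(** Nor can it be a point strictly between [0] and the wall: on both sides of it
    [F] is negative somewhere. *)
Lemma no_limit_between l : 0 < l < bp -> F l = 0 ->
  (forall e S1, 0 < e -> exists S2, S1 <= S2 /\ rj < S2 /\ S2 * E be S2 < e /\ forall t, S2 <= t -> Rabs (U be t - l) < e) ->
  False.
Proof.
 intros Hl HFl Hset. have O := w_order W. have Hdel := nl_delta NL.
 have HDw : forall x, xm <= x <= xp -> D x by (intros x; apply (well_D NL 0 bm bp xm xp mu)).
 have HFw : forall x, 0 <= x <= bp -> F x <= 0 by (intros x Hx; apply (w_low W); lra). have Hld : delta <= l.
 { have T := nl_neg NL l ltac:(apply HDw). rewrite Rabs_right in T by lra. unfold F in HFl. lra. }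
 have Hy : exists y1 y2, l < y1 < y2 /\ y2 < bp /\ forall x, y1 <= x <= y2 -> F x < 0.
 { have [li Hli] := nl_finite NL. have [e [He Hgap]] := finite_gap li l. set (y := l + Rmin e (bp - l) / 2).
  have Hy : l < y /\ y < l + e /\ y < bp by (unfold y, Rmin; destruct Rle_dec; lra). have HFy : F y < 0.
  { destruct (mean_value F f l y) as [c [C1 C2]]; try lra.
   - intros x Hx. apply (F_cont NL), HDw; lra.
   - intros x Hx. apply (F_derive NL), HDw; lra.
   - have Hc : f c <> 0. { intro E1. apply (Hgap c); [lra|]. apply Hli; auto; [apply HDw; lra|by_cases]. }
    have T := HFw y by_lra. nra. }
  destruct (continuous_eps F y (- F y)) as [e2 [He2 H2]]; [apply (F_cont NL), HDw; lra|lra|].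
  set (y2 := y + Rmin e2 (bp - y) / 2).
  have Hy2 : y < y2 /\ y2 < y + e2 /\ y2 < bp by (unfold y2, Rmin; destruct Rle_dec; lra). exists y, y2.
  repeat split; try lra. intros x Hx. specialize (H2 x ltac:(by_cases)). by_cases. }
 have [y1 [y2 [Y1 [Y2 Y3]]]] := Hy.
 destruct (crossing_cost n_pos NL (delta / 3) (2 * delta / 3)) as [C1 [HC1 K1]]; try (apply HDw); try lra.
 { intros x Hx. apply (nl_neg NL); [apply HDw; lra|]. by_cases. }
 destruct (crossing_cost n_pos NL y1 y2) as [C2 [HC2 K2]]; try (apply HDw; lra); [lra|auto|]. set (eps := Rmin C1 C2).
 have Heps : 0 < eps /\ eps <= C1 /\ eps <= C2 by (unfold eps, Rmin; destruct Rle_dec; lra).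
 set (x := Rmin (delta / 3) (y1 - l) / 2). have Hx : 0 < x /\ 2 * x <= delta / 3 /\ 2 * x <= y1 - l. { unfold x. by_cases. }
 destruct (Hset (Rmin eps x) 1) as [S0 [HS1 [HS2 [HS3 HS4]]]]; [by_cases|]. specialize (HS4 S0 (Rle_refl _)).
 apply Rmin_Rgt_l in HS3 as [HS3 _]. apply Rmin_Rgt_l in HS4 as [_ HS4].
 destruct (neighbour_pos S0 (Rmin ((eps - S0 * E be S0) / S0) x)) as [h [Hh H]]; auto.
 { apply Rmin_glb_lt; [apply Rdiv_lt_0_compat|]; lra. } have [t0 [T1 [T2 [T3 T4]]]] := edge_point h Hh.
 have [Hne [A1 [A2 A3]]] := H _ T3 T4. have [t [B1 [B2 [B3 [B4 [B5 B6]]]]]] := A3 (many t0 by_lra T3).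
 set (al := be + sg * t0) in *. have R := ns_rest (Fam al T3 Hne). apply Rmin_Rgt_l in A1 as [A1 _].
 apply Rmin_Rgt_l in A2 as [_ A2]. apply Rabs_lt_between in A1. apply Rabs_lt_between in A2. apply Rabs_lt_between in HS4.
 have HE : S0 * E al S0 < eps.
 { have Q : E al S0 < E be S0 + (eps - S0 * E be S0) / S0 by lra. apply (Rmult_lt_compat_l S0) in Q; [|lra].
  replace (S0 * (E be S0 + (eps - S0 * E be S0) / S0)) with eps in Q by (field; lra). auto. }
 have Hpos : forall s, S0 <= s <= t -> 0 <= U al s.
 { intros s Hs. destruct (Req_dec s t) as [->|]; [lra|]. apply Rlt_le, B5; lra. }
 have HEp : forall s, S0 <= s <= t -> 0 <= s * E al s. { intros s Hs. apply Rmult_le_pos; [lra|]. apply Rlt_le, B6; lra. }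
 have Hlow : forall s, S0 <= s <= t -> U al s < y2.
 { intros s Hs. apply Rnot_le_lt; intro Hle. destruct (first_hit (U al) S0 s y2) as [z [Z1 [Z2 Z3]]]; try lra.
  { intros q _. apply (rs_cont R). } have G := K2 al (U al) (V al) S0 z R by_lra. specialize (HEp z by_lra).
  assert (G2 : z * E al z + C2 <= S0 * E al S0); [|lra]. apply G; [|lra]. intros q Hq. apply HFw. split; [apply Hpos; lra|].
  destruct (Req_dec q z) as [->|]; [lra|]. specialize (Z3 q by_lra). lra. }
 have G : t * E al t + C1 <= S0 * E al S0.
 { apply (K1 al _ _ S0 t R); try lra. intros q Hq. apply HFw. repeat split; auto. specialize (Hlow q Hq). lra. }
 specialize (HEp t by_lra). lra.
Qed.

(** Once the limit is known to be [0], [few_zeros] applies to the neighbours. *)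
Lemma edge_positive : settles (U be) /\ zeros be k.
Proof.
 have [rT [HrT [_ HT]]] := proj2 (proj2 T_be). have Hdel := nl_delta NL. set (S0 := Rmax rT rj + 1).
 have HS : rT < S0 /\ rj < S0 by (unfold S0, Rmax; destruct Rle_dec; lra).
 have HIW : inw be S0 by (apply (inwell_after (n := n) NL W 0 be _ _ rT); auto; lra).
 destruct (settle n_pos NL bm bp xm xp mu W be (U be) (V be) S0 RS by_lra HIW) as [l [Hl [HFl [Hfl Hlim]]]].
 { intros t Ht. apply pos_be; lra. } { intros t Ht. apply edge_energy; lra. }
 have Hset : forall e S1, 0 < e -> exists S2, S1 <= S2 /\ rj < S2 /\ S2 * E be S2 < e /\ forall t, S2 <= t -> Rabs (U be t -
  l) < e. { intros e S1 He. have [S2 [A1 [A2 [A3 A4]]]] := Hlim e S1 He. exists S2. repeat split; auto; lra. }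
 destruct (Req_dec l 0) as [->|Hl0].
 - split.
  + intros e He. have [S2 [_ [_ [_ A]]]] := Hset e 0 He. exists S2. intros t Ht. specialize (A t Ht). by_cases.
  + have [C [HC HF]] := few_zeros n_pos NL. destruct (Hset (Rmin C (delta / 3)) 0) as [S2 [_ [A2 [A3 A4]]]]; [by_cases|].
   specialize (A4 S2 (Rle_refl _)). rewrite Rminus_0_r in A4. apply Rmin_Rgt_l in A3 as [A3 _].
   apply Rmin_Rgt_l in A4 as [_ A4]. apply (edge_count C S2); auto. exact (gap S2).
 - exfalso. destruct (Req_dec l bp) as [->|Hlb].
  + apply no_limit_at_wall; auto.
  + apply (no_limit_between l); auto; lra.
Qed.

End Edge.

Arguments sg_dist : clear implicits.
Arguments later_zero_dead : clear implicits.
Arguments edge_dead : clear implicits.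
Arguments fall : clear implicits.
Arguments edge_positive : clear implicits.

Lemma kz_mirror u v k r : kth_zero u v k r <-> kth_zero (fun r => - u r) (fun r => - v r) k r.
Proof.
 revert r. induction k; intro r; [simpl; tauto|]. split; intros [s [A1 [A2 [A3 [A4 A5]]]]]; exists s.
 - split; [apply IHk; auto|]. repeat split; try lra. intros t Ht. specialize (A5 t Ht). lra.
 - split; [apply IHk; auto|]. repeat split; try lra. intros t Ht. specialize (A5 t Ht). lra.
Qed.

Lemma zeros_mirror u v k : has_zeros u v k <-> has_zeros (fun r => - u r) (fun r => - v r) k.
Proof. split; intros [r Hr]; exists r; apply kz_mirror in Hr; auto. Qed.

(** After its last zero the solution dies, or is positive, or is negative, which
    reduces to the positive case by reflection. *)
Theorem edge_bound_state n D f delta bm bp xm xp mu (U V : R -> R -> R) be sg h0 k : (1 <= n)%nat ->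
  nonlinearity D f delta -> well D f 0 bm bp xm xp mu -> delta <= bp -> bm <= - delta ->
  (forall al, D al -> al <> 0 -> normal_sol n D f al (U al) (V al)) ->
  trapped D f xm xp mu U V be -> ~ has_zeros (U be) (V be) (S k) -> Rabs sg = 1 -> 0 < h0 ->
  (forall t, 0 < t < h0 -> D (be + sg * t) -> has_zeros (U (be + sg * t)) (V (be + sg * t)) (S k)) ->
  settles (U be) /\ has_zeros (U be) (V be) k.
Proof.
 intros Hn NL W Hbp Hbm Fam HT Hfew Hsg Hh Hmany. have [j [rj [Hj [Hkz Hlast]]]] := last_zero _ _ _ Hfew.
 have HD := proj1 HT. have Hne := proj1 (proj2 HT). have NS := Fam be HD Hne. have Hrj := kz_nonneg _ _ _ _ Hkz.
 have [[r [Hr Hd]]|Hnd] := classic (exists r, 0 <= r /\ dead (U be) (V be) r).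
 { apply (edge_dead n D f _ Hn NL xm xp mu U V Fam be sg h0 k j rj) with (r := r); auto. }
 have Hnz : forall t, rj < t -> U be t <> 0.
 { intros t Ht Hu. apply Hnd. exists t. split; [lra|].
  apply (later_zero_dead n D f xm xp mu U V Fam be j rj HT Hkz Hlast t Ht Hu). }
 have Cu : forall x, continuous (U be) x by (intro x; apply (normal_cont x NS)).
 have [Hp|Hp] := Rlt_le_dec 0 (U be (rj + 1)).
 - apply (edge_positive n D f _ Hn NL bm bp xm xp mu W Hbp U V Fam be sg h0 k j rj); auto. intros t Ht.
  apply Rnot_le_lt; intro Hle. destruct (Rle_lt_dec t (rj + 1)).
  + destruct (ivt (U be) t (rj + 1) 0) as [z [Z1 Z2]]; auto; try lra. apply (Hnz z); lra.
  + destruct (ivt_decr (U be) (rj + 1) t 0) as [z [Z1 Z2]]; auto; try lra. apply (Hnz z); lra.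
 - set (U' := fun al r => - U (- al) r). set (V' := fun al r => - V (- al) r).
  destruct (edge_positive n (fun s => D (- s)) (mirror f) delta Hn (nonlinearity_mirror NL) (- bp) (- bm) (- xp) (- xm) mu
   (well_mirror NL _ _ _ _ _ _ W) by_lra U' V') with (be := - be) (sg := - sg) (h0 := h0) (k := k) (j := j) (rj := rj)
   as [S1 S2].
  + intros al Ha Ha0. replace al with (- - al) at 1 by ring. apply normal_sol_mirror. apply Fam; auto; lra.
  + have [_ [_ [r [Hr [Hdr [I1 I2]]]]]] := HT. unfold trapped, U', V'. rewrite Ropp_involutive. split; auto. split; [lra|].
   exists r. split; auto. split.
   * intros [E1 E2]. apply Hdr. split; lra.
   * split; [lra|]. rewrite (energy_mirror NL); auto. apply (rs_dom (ns_rest NS)).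
  + by_cases.
  + auto.
  + intros t Ht HDt. unfold U', V'. replace (- (- be + - sg * t)) with (be + sg * t) in * by ring. apply -> zeros_mirror.
   auto.
  + auto.
  + unfold U', V'. rewrite Ropp_involutive. apply -> kz_mirror. auto.
  + unfold U', V'. rewrite Ropp_involutive. intro Hz. apply zeros_mirror in Hz. auto.
  + unfold U'. rewrite Ropp_involutive. intros t Ht. apply Rnot_le_lt; intro Hle. destruct (Rle_lt_dec t (rj + 1)).
   * destruct (ivt_decr (U be) t (rj + 1) 0) as [z [Z1 Z2]]; auto; try lra. apply (Hnz z); lra.
   * destruct (ivt (U be) (rj + 1) t 0) as [z [Z1 Z2]]; auto; try lra. apply (Hnz z); lra.
  + unfold U', V' in *. rewrite Ropp_involutive in S1, S2. split; [|apply zeros_mirror; auto]. intros e He.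
   have [S0 HS] := S1 e He. exists S0. intros t Ht. specialize (HS t Ht). by_cases.
Qed.

Section Sweep.

Context {n D f delta} (n_pos : (1 <= n)%nat) (NL : nonlinearity D f delta).
Context (bm bp xm xp mu : R) (W : well D f 0 bm bp xm xp mu) (bp_delta : delta <= bp) (bm_delta : bm <= - delta).
Context (U V : R -> R -> R) (Fam : forall al, D al -> al <> 0 -> normal_sol n D f al (U al) (V al)).

Let F := primitive f.
Notation E al := (energy f (U al) (V al)).
Notation trap al := (trapped D f xm xp mu U V al).
Notation zeros al k := (has_zeros (U al) (V al) k).

Record open_interval (I : R -> Prop) : Prop := {
  oi_conv : forall a b x, I a -> I b -> a <= x <= b -> I x;
  oi_open : forall x, I x -> exists e, 0 < e /\ forall y, Rabs (y - x) < e -> I y;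
  oi_dom : forall x, I x -> D x /\ x <> 0
}.

(** Initial values of [I] close to its end in the direction [sg] keep their
    energy for a long time. *)
Definition high_end (I : R -> Prop) (sg : R) : Prop :=
  forall S0, exists b, I b /\ forall al, I al -> 0 < sg * (al - b) -> mu <= E al S0.

(** Let [J] be the stretch of trapped heights next to [al1]. It ends where [I]
    ends or at an untrapped height; in both cases the energy stays above [mu] for
    a long time, so that there are many zeros towards the end of [J]. The height
    looked for is the last one of [J] with at most [k] zeros. *)
Lemma sweep I sg al1 m : open_interval I -> Rabs sg = 1 -> I al1 -> trap al1 -> ~ zeros al1 (S m) -> high_end I sg ->
  forall k, (m < k)%nat -> exists al, I al /\ 0 < sg * (al - al1) /\ settles (U al) /\ zeros al k /\ ~ zeros al (S k).
Proof.
 intros OI Hsg HI1 HT1 Hz1 Hend k Hk. have Hmu := w_mu W.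
 have Sq : sg * sg = 1 by (unfold Rabs in Hsg; destruct Rcase_abs in Hsg; nra).
 have Dist : forall s t, Rabs ((al1 + sg * s) - (al1 + sg * t)) = Rabs (s - t) by (intros; apply sg_dist).
 have E0 : al1 + sg * 0 = al1 by lra.
 set (J := fun t => 0 <= t /\ forall s, 0 <= s <= t -> I (al1 + sg * s) /\ trap (al1 + sg * s)). have J0 : J 0.
 { split; [lra|]. intros s Hs. replace s with 0 by lra. rewrite E0. auto. } have Jle : forall s t, 0 <= s <= t -> J t -> J s.
 { intros s t Hst [H1 H2]. split; [lra|]. intros x Hx. apply H2; lra. }
 have Jopen : forall t, J t -> exists h, 0 < h /\ forall s, t <= s < t + h -> J s.
 { intros t [H1 H2]. have [A1 A2] := H2 t by_lra. have [h1 [Hh1 B1]] := oi_open I OI _ A1.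
  have [h2 [Hh2 B2]] := trapped_open n D f delta n_pos NL xm xp mu U V Fam _ A2. exists (Rmin h1 h2). split; [by_cases|].
  split; [lra|]. intros x Hx. destruct (Rle_lt_dec x t); [apply H2; lra|].
  have Hd : Rabs ((al1 + sg * x) - (al1 + sg * t)) < Rmin h1 h2 by (rewrite Dist, Rabs_right; lra).
  apply Rmin_Rgt_l in Hd as [D1 D2]. split; auto. apply B2; auto. apply (oi_dom I); auto. }
 have Step : forall K, exists t1, J t1 /\ forall t, J t -> t1 <= t -> zeros (al1 + sg * t) K.
 { intro K. have [S0 [HS0 HK]] := energetic_zeros n D f delta n_pos NL bm bp xm xp mu W U V Fam K.
  have [b [Hb1 Hb2]] := Hend S0. have [[t1 [Ht1 Hp]]|Hno] := classic (exists t1, J t1 /\ 0 < sg * (al1 + sg * t1 - b)).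
  - exists t1. split; auto. intros t Ht Htt. have [T1 T2] := Ht. have [A1 A2] := T2 t by_lra. apply HK; auto.
   specialize (Hb2 _ A1). nra.
  - have HB : forall t, J t -> t <= sg * (b - al1).
   { intros t Ht. apply Rnot_lt_le; intro. apply Hno. exists t. split; auto.
    replace (sg * (al1 + sg * t - b)) with ((sg * sg) * t - sg * (b - al1)) by ring. rewrite Sq. lra. }
   destruct (completeness J) as [L [L1 L2]]; [exists (sg * (b - al1)); intros t Ht; auto|exists 0; auto|].
   have HL0 : 0 <= L by auto. have HLb : L <= sg * (b - al1) by auto. have Jlt : forall t, 0 <= t < L -> J t.
   { intros t Ht. apply NNPP; intro Hn. assert (L <= t); [|lra]. apply L2. intros s Hs. apply Rnot_lt_le; intro. apply Hn.
    apply (Jle t s); auto; lra. }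
   have HnJ : ~ J L.
   { intro HJ. have [h [Hh H]] := Jopen L HJ. assert (L + h / 2 <= L); [|lra]. apply L1. apply H; lra. }
   have HLpos : 0 < L by (case: (Req_dec L 0) => [E1|]; [rewrite E1 in HnJ; contradiction|lra]).
   have HIL : I (al1 + sg * L).
   { unfold Rabs in Hsg. destruct Rcase_abs in Hsg.
    - apply (oi_conv I OI b al1); auto. nra.
    - apply (oi_conv I OI al1 b); auto. nra. }
   have [HDL HLne] := oi_dom I OI _ HIL. have HnT : ~ trap (al1 + sg * L).
   { intro HT. apply HnJ. split; auto. intros s Hs. destruct (Req_dec s L) as [->|]; auto. have [_ HJ] := Jlt s by_lra.
    apply HJ; lra. }
   destruct (untrapped_energy n D f delta n_pos NL bm bp xm xp mu W U V Fam (al1 + sg * L) HDL HLne HnT) with (r := S0) as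
    [A1 A2]; [|lra|].
   { intros h Hh. set (s := Rmax 0 (L - h / 2)).
    have Hs : 0 <= s < L /\ L - h / 2 <= s by (unfold s, Rmax; destruct Rle_dec; lra). exists (al1 + sg * s).
    have [_ HJ] := Jlt s by_lra. split; [apply HJ; lra|]. rewrite Dist, Rabs_left; lra. }
   destruct (family_state n D f delta n_pos NL U V Fam _ S0 HDL HLne A1 (mu / 4)) as [h [Hh H]]; [lra|].
   set (t1 := Rmax 0 (L - h / 2)). have Ht1 : 0 <= t1 < L /\ L - h / 2 <= t1 by (unfold t1, Rmax; destruct Rle_dec; lra).
   exists t1. split; [apply Jlt; lra|]. intros t Ht Htt. assert (t <= L) by auto. have [T1 T2] := Ht.
   have [B1 B2] := T2 t by_lra. apply HK; auto. have [B3 _] := oi_dom I OI _ B1.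
   destruct (H _ B3) as [_ [C1 _]]; [rewrite Dist, Rabs_left1; lra|]. by_cases. }
 have [t1 [Ht1 Hmany]] := Step (S k).
 set (A := fun t => J t /\ ~ zeros (al1 + sg * t) (S k)). have A0 : A 0.
 { split; auto. rewrite E0. intro Hz. apply Hz1. apply (has_zeros_le _ _ _ (S k)); auto; lia. }
 have Abound : forall t, A t -> t <= t1. { intros t [H1 H2]. apply Rnot_lt_le; intro. apply H2, Hmany; auto; lra. }
 destruct (completeness A) as [tb [B1 B2]]; [exists t1; intros t Ht; auto|exists 0; auto|]. have Htb : 0 <= tb <= t1 by auto.
 have Jb : J tb by (apply (Jle tb t1)). have [Ib Tb] := proj2 Jb tb by_lra. have Hzb : ~ zeros (al1 + sg * tb) (S k).
 { intro Hz. have [Db [Nb _]] := Tb. have [h [Hh H]] := zeros_persist n_pos NL U V Fam _ (S k) Db Nb Hz.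
  assert (tb <= tb - h / 2); [|lra]. apply B2. intros t [At1 At2]. assert (t <= tb) by (apply B1; split; auto).
  apply Rnot_lt_le; intro. apply At2. have [Q1 Q2] := At1. have [Q3 _] := Q2 t by_lra.
  apply H; [apply (oi_dom I); auto|]. rewrite Dist, Rabs_left1; lra. }
 have [h0 [Hh0 Hright]] := Jopen tb Jb.
 destruct (edge_bound_state n D f delta bm bp xm xp mu U V (al1 + sg * tb) sg h0 k) as [S1 S2]; auto.
 { intros t Ht _. replace (al1 + sg * tb + sg * t) with (al1 + sg * (tb + t)) by ring. apply NNPP; intro Hn.
  assert (tb + t <= tb); [|lra]. apply B1. split; auto. apply Hright. lra. }
 exists (al1 + sg * tb). repeat split; auto.
 replace (sg * (al1 + sg * tb - al1)) with ((sg * sg) * tb) by ring. rewrite Sq. case: (Req_dec tb 0) => [E1|]; [|lra].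
 exfalso. rewrite E1, E0 in S2. apply Hz1. apply (has_zeros_le _ _ _ k); auto.
Qed.

End Sweep.

Arguments open_interval : clear implicits.
Arguments high_end : clear implicits.

Arguments oi_conv {D I}.
Arguments oi_open {D I}.
Arguments oi_dom {D I}.

Lemma const_rest n D f rho p : 0 <= rho -> D p -> f p = 0 -> rest_sol n D f rho p (fun _ => p) (fun _ => 0).
Proof.
 intros Hr HD Hf. constructor; auto.
 - split; apply continuous_const.
 - split; [apply (is_derive_const p)|]. replace (- (INR n / r) * 0 - f p) with 0 by (rewrite Hf; ring).
  apply (is_derive_const 0).
Qed.

(** Near a critical point of [F] the solution stays for a long time, whatever
    the starting time is. *)
Lemma critical_end n D f delta mu p S0 : (1 <= n)%nat -> nonlinearity D f delta -> D p -> p <> 0 -> f p = 0 ->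
  mu < primitive f p -> exists h, 0 < h /\ forall al rho u v, D al -> Rabs (al - p) < h -> rest_sol n D f rho al u v ->
    forall r, r <= S0 -> mu <= energy f u v r.
Proof.
 intros Hn NL HD Hp Hfp Hmu. destruct (energy_near NL p 0 (primitive f p - mu) HD) as [h0 [Hh0 Hnear]]; [lra|].
 have Hrest : forall al x, Rabs (al - p) < h0 -> x = 0 -> mu < x ^ 2 / 2 + primitive f al.
 { intros al x Ha ->. specialize (Hnear al 0 Ha). by_cases. } apply NNPP; intro Hno.
 have Hseq : forall k : nat, exists q : (R * R) * ((R -> R) * (R -> R)), let '((rho, al), (u, v)) := q in rest_sol n D f rho
  al u v /\ Rabs (al - p) < / INR (k + 1) /\ Rabs (al - p) < h0 /\ rho <= S0 /\ energy f u v S0 < mu.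
 { intro k. apply NNPP; intro Hk. apply Hno. exists (Rmin h0 (/ INR (k + 1))). split.
  { apply Rmin_glb_lt; auto. apply Rinv_0_lt_compat, lt_0_INR; lia. } intros al rho u v Ha Hd RS r Hr.
  apply Rmin_Rgt_l in Hd as [D1 D2]. apply Rnot_lt_le; intro Hlt. apply Hk. exists ((rho, al), (u, v)). have Hrr : rho < r.
  { apply Rnot_le_lt; intro Hle. have [E1 E2] := rs_rest RS r Hle. unfold energy in Hlt. rewrite E1, E2 in Hlt.
   specialize (Hrest al 0 D1 eq_refl). lra. }
  do 2 (split; auto). do 2 (split; [lra|]). eapply Rle_lt_trans; [|apply Hlt].
  apply (rest_energy_decr (n := n) NL rho al); auto; lra. }
 apply choice in Hseq. have [q Hq] := Hseq.
 set (rhon := fun k => fst (fst (q k))). set (aln := fun k => snd (fst (q k))). set (un := fun k => fst (snd (q k))).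
 set (vn := fun k => snd (snd (q k))).
 have Hq' : forall k, rest_sol n D f (rhon k) (aln k) (un k) (vn k) /\ Rabs (aln k - p) < / INR (k + 1) /\ Rabs (aln k - p) <
  h0 /\ rhon k <= S0 /\ energy f (un k) (vn k) S0 < mu.
 { intro k. specialize (Hq k). unfold rhon, aln, un, vn. destruct (q k) as [[x1 x2] [x3 x4]]. auto. }
 destruct (bounded_subsequence rhon S0) as [phi [Hphi [rho Hrho]]].
 { intro k. have [A [_ [_ [B _]]]] := Hq' k. have C := rs_rho A. by_cases. } have Hal : is_lim_seq (fun k => aln (phi k)) p.
 { apply lim_seq_eps. intros e He. have [N [N1 N2]] := archimed_cor1 e He. exists N. intros k Hk.
  eapply Rlt_trans; [apply (proj1 (proj2 (Hq' (phi k))))|]. eapply Rle_lt_trans; [|apply N1].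
  apply Rinv_le_contravar; [apply lt_0_INR; auto|]. apply le_INR. have T := increasing_map_le phi Hphi k. lia. }
 destruct (rest_compact Hn NL (fun k => rhon (phi k)) (fun k => aln (phi k)) (fun k => un (phi k)) (fun k => vn (phi k)) rho
  p) as [psi [u [v [K [Hpsi [RS [L1 [L2 _]]]]]]]]; auto. { intro k. apply Hq'. } have Hr0 := rs_rho RS.
 destruct (rest_unique NL rho p _ _ u v S0 Hp (const_rest n D f rho p Hr0 HD Hfp) RS) with (r := S0) as [E1 E2]; [|lra|].
 { by_cases. } specialize (L1 S0). specialize (L2 S0). rewrite <- E1 in L1. rewrite <- E2 in L2.
 have [N1 HN1] := proj1 (lim_seq_eps _ _) L1 h0 Hh0. have [N2 HN2] := proj1 (lim_seq_eps _ _) L2 h0 Hh0.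
 set (k := max N1 N2). specialize (HN1 k ltac:(lia)). specialize (HN2 k ltac:(lia)). specialize (Hnear _ _ HN1 HN2).
 apply Rabs_lt_between in Hnear. have [_ [_ [_ [_ HE]]]] := Hq' (phi (psi k)). unfold energy in HE. lra.
Qed.

(** * Moving the starting time to zero *)

(** Constant beyond the walls of a well, the nonlinearity is bounded and defined
    everywhere, as following the flow backwards requires; trajectories that stay
    in the well do not notice. *)
Section Freeze.

Context {D f delta} (NL : nonlinearity D f delta).
Context {c bm bp A B mu} (W : well D f c bm bp A B mu) (bp_delta : delta <= bp) (bm_delta : bm <= - delta).

Let g := clamped f A B.

Lemma freeze_order : A < - delta /\ delta < B /\ 0 < delta.
Proof. have O := w_order W. have T := nl_delta NL. lra. Qed.

Lemma freeze_cont x : continuous g x.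
Proof. have O := freeze_order. apply unif_cont_continuous, (clamped_unif NL); try apply W. lra. Qed.

Lemma freeze_derive x : is_derive (primitive g) x (g x).
Proof.
 apply (is_derive_RInt g _ 0); [|apply freeze_cont]. exists (mkposreal 1 Rlt_0_1). intros y _.
 apply (RInt_correct (V := R_CompleteNormedModule)). apply ex_RInt_continuous. intros z _. apply freeze_cont.
Qed.

Lemma freeze_primitive x : A <= x <= B -> primitive g x = primitive f x.
Proof. intros Hx. have O := freeze_order. apply RInt_ext. intros y Hy. apply clamped_id. by_cases. Qed.

Lemma freeze_right x : B <= x -> primitive f B + f B * (x - B) <= primitive g x.
Proof.
 intros Hx. have O := freeze_order. rewrite <- freeze_primitive by lra. apply (deriv_ge_le _ g); auto.
 - intros y _. apply (is_derive_continuous _ _ _ (freeze_derive y)).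
 - split; [apply freeze_derive|]. unfold g, clamped, clamp. by_cases.
Qed.

Lemma freeze_left x : x <= A -> primitive f A - f A * (A - x) <= primitive g x.
Proof.
 intros Hx. have O := freeze_order. rewrite <- freeze_primitive by lra.
 have G : primitive g A <= primitive g x + f A * (A - x).
 { apply (deriv_le _ g); auto.
  - intros y _. apply (is_derive_continuous _ _ _ (freeze_derive y)).
  - split; [apply freeze_derive|]. unfold g, clamped, clamp. by_cases. }
 lra.
Qed.

Lemma freeze_walls : f A < 0 /\ 0 < f B.
Proof.
 have O := w_order W. split.
 - apply (w_fm W). lra.
 - apply (w_fp W). lra.
Qed.

Lemma freeze_nonlinearity : nonlinearity (fun _ => True) g delta.
Proof.
 have O := freeze_order. have [WA WB] := freeze_walls.
 have HD : forall x, A <= x <= B -> D x by (intros x; apply (D_between NL); apply W). constructor; auto.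
 - exists 1. split; [lra|auto].
 - intros x _. apply freeze_cont.
 - intros x _ Hx. destruct (nl_lip NL (clamp A B x)) as [L [e [He [HL H]]]].
  + apply HD, clamp_range. lra.
  + unfold clamp. by_cases.
  + exists L, e. repeat split; auto. intros y z Hy Hz. eapply Rle_trans; [apply H|].
   * eapply Rle_lt_trans; [apply clamp_lipschitz; lra|auto].
   * eapply Rle_lt_trans; [apply clamp_lipschitz; lra|auto].
   * apply Rmult_le_compat_l; auto. apply clamp_lipschitz; lra.
 - unfold g. rewrite clamped_id by lra. apply (nl_f0 NL).
 - intros x _. set (h := Rabs (primitive g x) + Rabs (primitive f A) + Rabs (primitive f B) + 1).
  have P1 := Rle_abs (primitive g x). have P2 := Rle_abs (- primitive f A). rewrite Rabs_Ropp in P2.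
  have P3 := Rle_abs (- primitive f B). rewrite Rabs_Ropp in P3. have Q1 := Rabs_pos (primitive g x).
  have Q2 := Rabs_pos (primitive f A). have Q3 := Rabs_pos (primitive f B). set (B' := B + Rabs x + h / f B).
  set (A' := A - Rabs x - h / - f A). have HB : 0 < h / f B by (apply Rdiv_lt_0_compat; unfold h; lra).
  have HA : 0 < h / - f A by (apply Rdiv_lt_0_compat; unfold h; lra). have Px := Rle_abs x. have Px2 := Rle_abs (- x).
  rewrite Rabs_Ropp in Px2. exists A', B'. do 2 (split; auto). split; [unfold A', B'; lra|]. split; [unfold A', B'; lra|].
  split.
  + have T := freeze_left A' ltac:(unfold A'). have E : - f A * (h / - f A) = h by (field; lra).
   assert (- f A * (h / - f A) <= - f A * (A - A')) by (apply Rmult_le_compat_l; unfold A'; lra). unfold h in *. lra.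
  + have T := freeze_right B' ltac:(unfold B'). have E : f B * (h / f B) = h by (field; lra).
   assert (f B * (h / f B) <= f B * (B' - B)) by (apply Rmult_le_compat_l; unfold B'; lra). unfold h in *. lra.
 - lra.
 - intros s _ Hs. assert (Rabs s < delta) by lra. apply Rabs_lt_between in H. rewrite freeze_primitive by lra.
  apply (nl_neg NL); auto. apply HD; lra.
 - have [l Hl] := nl_finite NL. exists l. intros s _ Hs E. unfold g, clamped in E. have [H1|H1] := Rlt_le_dec s A.
  + unfold clamp in E. by_cases.
  + have [H2|H2] := Rlt_le_dec B s.
   * unfold clamp in E. by_cases.
   * rewrite clamp_id in E by lra. auto.
Qed.

Lemma freeze_bound : exists M, 0 < M /\ forall x, Rabs (g x) <= M.
Proof.
 have O := freeze_order. destruct (f_bounded NL A B) as [M [HM H]]; try apply W; [lra|]. exists M. split; auto. intro x.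
 apply H, clamp_range. lra.
Qed.

Lemma rest_freeze n rho al u v : rest_sol n D f rho al u v -> (forall r, A <= u r <= B) ->
  rest_sol n (fun _ => True) g rho al u v.
Proof.
 intros [H1 H2 H3 H4 H5] Hin. constructor; auto. intros r Hr. have [O1 O2] := H5 r Hr. split; auto. unfold g.
 rewrite clamped_id; auto.
Qed.

Lemma rest_unfreeze n rho al u v : rest_sol n (fun _ => True) g rho al u v -> A < al < B ->
  rest_sol n D f rho al u v.
Proof.
 intros RS Hal. have Hin : forall r, A < u r < B.
 { apply (rest_confined (n := n) freeze_nonlinearity rho al u v); auto; rewrite !freeze_primitive by lra; rewrite ?(w_xm W),
   ?(w_xp W); apply (well_inside NL c bm bp A B); auto. }
 have [H1 H2 H3 H4 H5] := RS. constructor; auto.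
 - intro r. apply (D_between NL A B); try apply W. specialize (Hin r). lra.
 - intros r Hr. have [O1 O2] := H5 r Hr. split; auto. unfold g in O2. rewrite clamped_id in O2; auto. specialize (Hin r).
  lra.
Qed.

End Freeze.

Arguments rest_freeze {D f A B n rho al u v}.
Arguments rest_unfreeze {D f delta} NL {c bm bp A B mu} W bp_delta bm_delta {n rho al u v}.

Lemma uniform_limit (x : nat -> R -> R) (y : R -> R) (K a b : R) :
  (forall k s t, a <= s <= b -> a <= t <= b -> Rabs (x k t - x k s) <= K * Rabs (t - s)) -> 0 <= K ->
  (forall t, is_lim_seq (fun k => x k t) (y t)) ->
  forall e, 0 < e -> exists N, forall k t, (N <= k)%nat -> a <= t <= b -> Rabs (x k t - y t) < e.
Proof.
 intros HK HK0 Hlim e He. have Ky : forall s t, a <= s <= b -> a <= t <= b -> Rabs (y t - y s) <= K * Rabs (t - s).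
 { intros s t Hs Ht.
  apply (is_lim_seq_le (fun k => Rabs (x k t - x k s)) (fun _ => K * Rabs (t - s)) (Rabs (y t - y s)) (K * Rabs (t - s)));
   [auto| |apply is_lim_seq_const]. apply (is_lim_seq_abs _ (Finite (y t - y s))). apply is_lim_seq_minus'; auto. }
 apply NNPP; intro Hno.
 have Hbad : forall N, exists p : nat * R, (N <= fst p)%nat /\ a <= snd p <= b /\ e <= Rabs (x (fst p) (snd p) - y (snd p)).
 { intro N. apply NNPP; intro Hn. apply Hno. exists N. intros k t Hk Ht. apply Rnot_le_lt; intro Hle. apply Hn.
  exists (k, t). auto. }
 apply choice in Hbad. have [p Hp] := Hbad.
 destruct (bounded_subsequence (fun N => snd (p N)) (Rmax (Rabs a) (Rabs b))) as [phi [Hphi [l Hl]]].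
 { intro N. have [_ [H _]] := Hp N. by_cases. } have Hlab : a <= l <= b.
 { split.
  - apply (is_lim_seq_le (fun _ => a) (fun N => snd (p (phi N))) a l); auto; [intro; apply Hp|apply is_lim_seq_const].
  - apply (is_lim_seq_le (fun N => snd (p (phi N))) (fun _ => b) l b); auto; [intro; apply Hp|apply is_lim_seq_const]. }
 destruct (proj1 (lim_seq_eps _ _) Hl (e / 4 / (K + 1))) as [N1 HN1]; [positive|].
 destruct (proj1 (lim_seq_eps _ _) (Hlim l) (e / 4)) as [N2 HN2]; [lra|]. set (N := max N1 N2).
 specialize (HN1 N ltac:(lia)). have [P1 [P2 P3]] := Hp (phi N). set (k := fst (p (phi N))) in *.
 set (t := snd (p (phi N))) in *. specialize (HN2 k ltac:(assert (T := increasing_map_le phi Hphi N); lia)).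
 have Q : K * Rabs (t - l) <= e / 4.
 { apply Rle_trans with ((K + 1) * (e / 4 / (K + 1))); [|apply Req_le; field; lra]. apply Rmult_le_compat; try lra. by_cases. }
 have T1 := HK k l t Hlab P2. have T2 := Ky l t Hlab P2. by_cases.
Qed.

(** Derivatives leave equations in the carrier of a structure; [ring] and [lra]
    want them at type [R]. *)
Ltac real_eq := match goal with |- ?a = ?b => change (@eq R a b) end.

(** Read backwards in time, friction is bounded away from [0]; the Lipschitz
    bounds do not depend on the final time [z]. *)
Lemma backward_exists n g M c z z0 us vs : (1 <= n)%nat -> (forall x, Rabs (g x) <= M) -> unif_cont g ->
  0 < c -> c < z -> z <= z0 -> exists u v, u z = us /\ v z = vs /\
    (forall T s t, Rabs s <= T -> Rabs t <= T ->
       Rabs (u t - u s) <= slope_bound (INR n / c) M (Rabs vs) (z0 + T) * Rabs (t - s) /\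
       Rabs (v t - v s) <= slope_bound (INR n / c) M (Rabs vs) (z0 + T) * Rabs (t - s)) /\
    forall r, c < r < z -> radial n g u v r.
Proof.
 intros Hn HM Hg Hc Hz Hz0. have Hd : 0 <= INR n by positive. set (q := fun t => - (INR n / Rmax c (z - t))).
 have [HQ1 HQ2] := friction_cut (INR n) c (fun t => z - t) Hc Hd (continuous_backward z).
 destruct (ode_exists q g (INR n / c) M) with (a := us) (b := - vs) as [u [v [Hu0 [Hv0 [_ [HL Ho]]]]]]; auto.
 - intro t. unfold q. rewrite Rabs_Ropp. auto.
 - intro t. apply (continuous_opp (fun t => INR n / Rmax c (z - t))), HQ2.
 - rewrite Rabs_Ropp in HL. exists (fun r => u (z - r)), (fun r => - v (z - r)).
  have Dz : forall r, is_derive (fun r => z - r) r (-1).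
  { intro r. apply (is_derive_value _ _ (0 - 1)); [|lra].
   apply is_derive_diff; [apply (is_derive_const z)|apply (is_derive_id r)]. }
  split; [rewrite Rminus_diag; auto|].
  split; [rewrite Rminus_diag, Hv0; apply Ropp_involutive|]. split.
  + intros T s t Hs Ht. destruct (HL (z0 + T) (z - s) (z - t)) as [L1 L2]; [by_cases|by_cases|]. rewrite (Rabs_minus_sym t).
   by_cases.
  + intros r Hr. have [O1 O2] := Ho (z - r) by_lra. split.
   * apply (is_derive_value _ _ (-1 * v (z - r))); [|real_eq; ring]. apply (is_derive_comp u); auto.
   * apply (is_derive_value _ _ (- (-1 * (- q (z - r) * v (z - r) - g (u (z - r)))))).
    -- apply (is_derive_opp (fun r => v (z - r))). apply (is_derive_comp v); auto.
    -- unfold q. replace (z - (z - r)) with r by ring. by_cases.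
Qed.

(** A state reached from rest is also reached, slightly earlier, from a nearby
    rest point: follow the flow backwards from the state. *)
Lemma earlier_start_frozen n g delta M rho al u v z : (1 <= n)%nat -> nonlinearity (fun _ => True) g delta ->
  0 <= M -> (forall x, Rabs (g x) <= M) -> unif_cont g -> rest_sol n (fun _ => True) g rho al u v ->
  0 < rho -> rho < z -> al <> 0 -> g al <> 0 -> (forall r, rho <= r <= z -> ~ dead u v r) ->
  forall e, 0 < e -> exists z' rho' al' u' v', rho' < z' < z /\ 0 < rho' /\ Rabs (al' - al) < e /\
    rest_sol n (fun _ => True) g rho' al' u' v' /\ u' z' = u z /\ v' z' = v z.
Proof.
 intros Hn NL HM0 HM Hg RS Hrho Hz Hal Hgal Halive e He. have Hd : 0 <= INR n by positive. set (c := rho / 2).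
 set (zn := fun k : nat => z - (z - rho) / 2 * / INR (S k)). have Hinv : forall k, 0 < / INR (S k) <= 1.
 { split; [apply Rinv_0_lt_compat, lt_0_INR; lia|]. rewrite <- Rinv_1. apply Rinv_le_contravar; [lra|]. apply (le_INR 1).
  lia. }
 have Hzn : forall k, (rho + z) / 2 <= zn k < z. { intro k. unfold zn. destruct (Hinv k). nra. }
 set (KT := fun T => slope_bound (INR n / c) M (Rabs (v z)) (z + T)). set (K := KT z). have HKT : forall T, 0 <= KT T.
 { intro T. apply slope_bound_pos; auto; [apply Rdiv_le_0_compat; unfold c; lra|apply Rabs_pos]. }
 destruct (choice (fun k (p : (R -> R) * (R -> R)) => fst p (zn k) = u z /\ snd p (zn k) = v z /\ (forall T s t, Rabs s <= T
  -> Rabs t <= T -> Rabs (fst p t - fst p s) <= KT T * Rabs (t - s) /\ Rabs (snd p t - snd p s) <= KT T * Rabs (t - s)) /\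
  forall r, c < r < zn k -> radial n g (fst p) (snd p) r)) as [p Hp].
 { intro k. specialize (Hzn k). destruct (backward_exists n g M c (zn k) z (u z) (v z)) as [u' [v' H]]; auto.
  - positive.
  - unfold c; lra.
  - lra.
  - exists (u', v'). auto. }
 set (un := fun k => fst (p k)). set (vn := fun k => snd (p k)).
 have Ende : forall k, un k (zn k) = u z /\ vn k (zn k) = v z by (intro k; destruct (Hp k) as [? [? _]]; auto).
 have LipT : forall k T s t, Rabs s <= T -> Rabs t <= T -> Rabs (un k t - un k s) <= KT T * Rabs (t - s) /\ Rabs (vn k t - vn
  k s) <= KT T * Rabs (t - s) by (intro k; apply Hp).
 have Lip : forall k s t, 0 <= s <= z -> 0 <= t <= z -> Rabs (un k t - un k s) <= K * Rabs (t - s) /\ Rabs (vn k t - vn k s)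
  <= K * Rabs (t - s). { intros k s t Hs Ht. apply LipT; rewrite Rabs_right; lra. }
 have Hzn0 : forall k, 0 <= zn k <= z by (intro k; specialize (Hzn k); lra). have Lz : is_lim_seq zn z.
 { apply lim_seq_eps. intros x Hx. destruct (archimed_cor1 (x / (z - rho))) as [N [N1 N2]]; [apply Rdiv_lt_0_compat; lra|].
  exists N. intros k Hk. unfold zn. destruct (Hinv k).
  have I1 : / INR (S k) <= / INR N by (apply Rinv_le_contravar; [apply lt_0_INR|apply le_INR; lia]).
  have I2 : (z - rho) * / INR N < (z - rho) * (x / (z - rho)) by nra.
  replace ((z - rho) * (x / (z - rho))) with x in I2 by (field; lra). rewrite Rabs_left1; nra. }
 have HK : 0 <= K by apply HKT.
 destruct (ascoli_pair KT un vn (Rabs (u z) + Rabs (v z) + K * z) HKT LipT) as [phi [uu [vv [Pphi [Hu' [Hv' Hcc]]]]]].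
 { intro k. have [E1 E2] := Ende k. destruct (Lip k (zn k) 0 (Hzn0 k)) as [L1 L2]; [lra|].
  rewrite Rminus_0_l, Rabs_Ropp, (Rabs_right (zn k)) in L1, L2 by (specialize (Hzn0 k); lra).
  have B : K * zn k <= K * z by (apply Rmult_le_compat_l; auto; apply Hzn0). by_cases. }
 have Cuu : forall t, continuous uu t by apply Hcc. have Cvv : forall t, continuous vv t by apply Hcc.
 have Lzphi := subseq_lim _ _ phi Pphi Lz.
 have EndL : forall (x : nat -> R -> R) (y : R -> R) w, (forall k, Rabs (x k z - x k (zn k)) <= K * Rabs (z - zn k)) ->
  (forall t, is_lim_seq (fun k => x (phi k) t) (y t)) -> (forall k, x k (zn k) = w) -> y z = w.
 { intros x y w Hx Hy Hw. apply Rminus_diag_uniq. have G : Rabs (y z - w) <= K * Rabs (z - z).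
  { apply (is_lim_seq_le (fun k => Rabs (x (phi k) z - w)) (fun k => K * Rabs (z - zn (phi k))) (Rabs (y z - w)) (K * Rabs
    (z - z))).
   - intro k. rewrite <- (Hw (phi k)). auto.
   - apply (is_lim_seq_abs _ (Finite (y z - w))). apply is_lim_seq_minus'; [apply Hy|apply is_lim_seq_const].
   - apply is_lim_seq_mult'; [apply is_lim_seq_const|]. apply (is_lim_seq_abs _ (Finite (z - z))).
    apply is_lim_seq_minus'; [apply is_lim_seq_const|auto]. }
  by_cases. }
 have Euu : uu z = u z by (apply (EndL un uu); auto; intro k; [apply Lip; [apply Hzn0|lra]|apply Ende]).
 have Evv : vv z = v z by (apply (EndL vn vv); auto; intro k; [apply Lip; [apply Hzn0|lra]|apply Ende]).
 have Oc : forall r, c < r < z -> radial n g uu vv r.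
 { intros r Hr. have Hc0 : 0 < c by positive. destruct (proj1 (lim_seq_eps _ _) Lzphi ((z - r) / 2)) as [N HN]; [lra|].
  set (e0 := Rmin (r - c) (z - r) / 2).
  have He0 : 0 < e0 /\ e0 < r - c /\ 2 * e0 <= z - r by (unfold e0, Rmin; destruct Rle_dec; lra).
  apply (ode_limit _ g (fun k => un (phi k)) (fun k => vn (phi k)) uu vv r e0 K (Rabs (v z) + K * z) N); auto; try lra.
  - apply continuous_prod; [apply continuous_const|]. apply continuous_Rinv. lra.
  - intros k s Hk Hs. specialize (HN k Hk). apply Rabs_lt_between in HN. apply Rabs_lt_between in Hs.
   have [_ [P2 [_ P4]]] := Hp (phi k). split; [apply P4; lra|].
   destruct (Lip (phi k) (zn (phi k)) s (Hzn0 _)) as [_ L2]; [lra|]. have Z := Hzn0 (phi k).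
   rewrite (proj2 (Ende (phi k))) in L2. have B : K * Rabs (s - zn (phi k)) <= K * z.
   { apply Rmult_le_compat_l; auto. by_cases. } by_cases.
  - intros k s t _ Hs Ht. apply Rabs_lt_between in Hs, Ht. apply Lip; lra. }
 have TL : traj n (fun _ => True) g (3 * rho / 4) z uu vv. { split; auto. intros r Hr. apply Oc. unfold c; lra. }
 have Agree : forall r, rho <= r <= z -> u r = uu r /\ v r = vv r.
 { apply (traj_unique_backward (n := n) NL); try lra.
  - apply (rest_traj n _ g rho al); auto. lra.
  - apply (traj_sub n _ g (3 * rho / 4) z); auto; lra.
  - intros r Hr. apply Halive. lra. }
 have [R1 R2] := rs_rest RS rho (Rle_refl _). have [A1 A2] := Agree rho by_lra.
 rewrite R1 in A1. rewrite R2 in A2. have [_ O2] := Oc rho ltac:(unfold c; lra). rewrite <- A1, <- A2 in O2.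
 destruct (simple_zero vv rho (- (INR n / rho) * 0 - g al)) as [e1 [He1 Hsz]]; auto; [lra|].
 destruct (continuous_eps uu rho (Rmin (Rabs al) e / 2) (Cuu rho)) as [e2 [He2 Hnear]]. { by_cases. }
 set (x := Rmin (Rmin e1 e2) (Rmin (rho / 4) ((z - rho) / 2)) / 2).
 have Hx : 0 < x /\ x < e1 /\ x < e2 /\ x < rho / 4 /\ x < (z - rho) / 2. { unfold x. by_cases. }
 have V1 := Hsz (rho - x) ltac:(by_cases) by_lra. have V2 := Hsz (rho + x) ltac:(by_cases) by_lra.
 replace (- (INR n / rho) * 0 - g al) with (- g al) in * by ring.
 (* uniform closeness that keeps the signs of the speed and the solution alive *)
 have Al : exists m, 0 < m /\ forall r, rho - x <= r <= z -> m <= Rabs (uu r ^ 2 + vv r ^ 2).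
 { apply bounded_away; [lra|]. intros r Hr. split.
  - apply continuous_sum; apply continuous_square; auto.
  - intro E0. have Z1 : uu r = 0 by nra. have Z2 : vv r = 0 by nra. destruct (Rle_lt_dec rho r).
   + apply (Halive r by_lra). destruct (Agree r by_lra). by_cases.
   + specialize (Hnear r ltac:(by_cases)). by_cases. }
 have [m [Hm Hmr]] := Al.
 set (m1 := Rmin (Rmin (Rabs (vv (rho - x))) (Rabs (vv (rho + x)))) (Rmin (Rmin 1 (m / 4)) (e / 2))).
 have Vne1 : vv (rho - x) <> 0 by nra. have Vne2 : vv (rho + x) <> 0 by nra. have T1 := Rabs_pos_lt _ Vne1.
 have T2 := Rabs_pos_lt _ Vne2.
 have Hm1 : 0 < m1 /\ m1 <= Rabs (vv (rho - x)) /\ m1 <= Rabs (vv (rho + x)) /\ m1 <= 1 /\ m1 <= m / 4 /\ m1 <= e / 2.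
 { unfold m1, Rmin. repeat destruct Rle_dec; lra. }
 destruct (uniform_limit (fun k => un (phi k)) uu K (rho - x) z ltac:(intros; apply Lip; lra) HK Hu' m1) as [N1 HN1]; [lra|].
 destruct (uniform_limit (fun k => vn (phi k)) vv K (rho - x) z ltac:(intros; apply Lip; lra) HK Hv' m1) as [N2 HN2]; [lra|].
 set (k := max N1 N2). have U1 := fun r => HN1 k r ltac:(lia). have U2 := fun r => HN2 k r ltac:(lia).
 have Hzk := Hzn (phi k). have [Q1 [Q2 [Q3 Q4]]] := Hp (phi k). have Sgn : forall w y, Rabs (w - y) < Rabs y -> 0 < y * w.
 { intros w y Hy. unfold Rabs in Hy. repeat destruct Rcase_abs in Hy; nra. }
 have S1 := Sgn _ _ (Rlt_le_trans _ _ _ (U2 (rho - x) by_lra) (proj1 (proj2 Hm1))).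
 have S2 := Sgn _ _ (Rlt_le_trans _ _ _ (U2 (rho + x) by_lra) (proj1 (proj2 (proj2 Hm1)))).
 have Hzero : exists r0, rho - x <= r0 <= rho + x /\ vn (phi k) r0 = 0.
 { have Cvn : forall y, continuous (vn (phi k)) y by (apply (lipschitz_continuous KT); intros; apply LipT).
  have [Hp0|Hp0] := Rlt_le_dec 0 (g al).
  - have Q0 : 0 < g al * x by (apply Rmult_lt_0_compat; lra). apply ivt_decr; auto; [lra|]. split; nra.
  - have Q0 : 0 < - g al * x by (apply Rmult_lt_0_compat; lra). apply ivt; auto; [lra|]. split; nra. }
 have [r0 [Hr0 Er0]] := Hzero. set (al' := un (phi k) r0). have Hal' : Rabs (al' - al) < e.
 { have B1 := U1 r0 by_lra. have B2 := Hnear r0 ltac:(apply Rabs_def1). rewrite <- A1 in B2.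
  have T5 := Rmin_r (Rabs al) e. replace (al' - al) with ((al' - uu r0) + (uu r0 - al)) by ring.
  eapply Rle_lt_trans; [apply Rabs_triang|]. unfold al'. lra. }
 destruct (rest_exists Hn NL r0 al') as [u' [v' RS']]; try lra. have [B1 B2] := rs_rest RS' r0 (Rle_refl _).
 have Fin : forall r, r0 <= r <= zn (phi k) -> un (phi k) r = u' r /\ vn (phi k) r = v' r.
 { have Tk : traj n (fun _ => True) g r0 (zn (phi k)) (un (phi k)) (vn (phi k)).
  { split; [|intros r Hr; apply Q4; unfold c; lra]. split; auto.
   split; apply (lipschitz_continuous KT); intros; apply LipT; auto. }
  apply (traj_unique_forward (n := n) NL); auto; [lra| | |].
  - apply (rest_traj n _ g r0 al'); auto. lra.
  - lra.
  - intros r Hr [E5 E6]. have D1 := U1 r by_lra. have D2 := U2 r by_lra. rewrite E5 in D1. rewrite E6 in D2.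
   specialize (Hmr r by_lra). rewrite Rminus_0_l, Rabs_Ropp in D1, D2. have D3 : uu r ^ 2 <= m1.
   { rewrite <- pow2_abs. have T := Rabs_pos (uu r). nra. } have D4 : vv r ^ 2 <= m1.
   { rewrite <- pow2_abs. have T := Rabs_pos (vv r). nra. } have T5 := pow2_ge_0 (uu r). have T6 := pow2_ge_0 (vv r).
   rewrite Rabs_right in Hmr; lra. }
 exists (zn (phi k)), r0, al', u', v'. do 2 (split; [lra|]).
 have [<- <-] := Fin (zn (phi k)) by_lra. auto.
Qed.

Section Start.

Context {n D f delta} (n_pos : (1 <= n)%nat) (NL : nonlinearity D f delta).

Let F := primitive f.

Lemma earlier_start rho al u v z : rest_sol n D f rho al u v ->
  0 < rho -> rho < z -> 0 < al -> f al <> 0 -> (forall r, rho <= r <= z -> ~ dead u v r) ->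
  forall e, 0 < e -> exists z' rho' al' u' v', rho' < z' < z /\ 0 < rho' /\ Rabs (al' - al) < e /\
    rest_sol n D f rho' al' u' v' /\ u' z' = u z /\ v' z' = v z.
Proof.
 intros RS Hrho Hz Hal Hfal Halive e He. have HDal : D al. { have [<- _] := rs_rest RS rho (Rle_refl _). apply (rs_dom RS). }
 have D0 := nl_zero NL. have HD : forall x, 0 <= x <= al -> D x by (intros x; apply (D_between NL)).
 destruct (continuity_ab_maj F 0 al) as [m [Hm Hm2]]; try lra.
 { intros x Hx. apply continuous_continuity_pt, (F_cont NL), HD; auto. } have F0 : F 0 = 0 by apply F_zero.
 have Hc : 0 <= F m by (rewrite <- F0; apply Hm; lra).
 have [_ [y [_ [Hy [[_ Hy0] [[_ Hmy] [_ HFy]]]]]]] := nl_coercive NL m (HD m Hm2).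
 have [bm [bp [A [B [mu [W [WB [Wp Wm]]]]]]]] := well_exists D f delta (F m) y NL Hc Hy0 Hy HFy. have O := w_order W.
 have Hbp : al <= bp.
 { apply Rnot_lt_le; intro Hlt. set (x := Rmin al B).
  have Hx : bp < x /\ x <= al /\ x <= B by (unfold x, Rmin; destruct Rle_dec; lra). have G : F bp < F x.
  { apply (F_increasing NL); try (apply HD; lra); [lra|]. intros t Ht. apply (w_fp W). lra. } have T := w_bp W.
  specialize (Hm x by_lra). unfold F in *. lra. }
 have Hin : forall r, A < u r < B.
 { apply (rest_confined NL rho al u v A B RS); try apply W; try lra.
  - rewrite (w_xm W). apply (well_inside NL _ _ _ _ _ _ al W). lra.
  - rewrite (w_xp W). apply (well_inside NL _ _ _ _ _ _ al W). lra. }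
 have [M [HM HMb]] := freeze_bound NL W Wp Wm.
 destruct (earlier_start_frozen n (clamped f A B) delta M rho al u v z) with (e := Rmin e (Rmin (al - A) (B - al))) as [z'
  [rho' [al' [u' [v' [H1 [H2 [H3 [H4 [H5 H6]]]]]]]]]]; auto; try lra.
 - apply (freeze_nonlinearity NL W Wp Wm).
 - apply (clamped_unif NL); try apply W. lra.
 - apply (rest_freeze (D := D)); auto. intro r. specialize (Hin r). lra.
 - rewrite clamped_id; lra.
 - by_cases.
 - apply Rmin_Rgt_l in H3 as [H3 H7]. apply Rmin_Rgt_l in H7 as [H7 H8]. apply Rabs_lt_between in H7.
  apply Rabs_lt_between in H8. exists z', rho', al', u', v'. do 2 (split; auto). do 2 (split; auto).
  apply (rest_unfreeze NL W Wp Wm H4). lra.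
Qed.

(** For large starting times friction is small and the flow nearly preserves
    areas: going backwards from a small ball of states below energy [0], some
    orbit reaches high energies, and on its way down it has a rest point on the
    right, just above level [F p]. *)
Lemma late_start p q : 0 < p -> D q -> p < q -> F p < F q -> (forall x, 0 <= x <= p -> F x <= F p) ->
  exists rho al u v, rest_sol n D f rho al u v /\ p < al < q /\
    ((exists z, rho <= z /\ energy f u v z < 0 /\ Rabs (u z) < delta) \/ (exists z, rho <= z /\ dead u v z)).
Proof.
 intros Hp HDq Hpq HFpq Hmax. have F0 : F 0 = 0 by apply F_zero. set (c := F p) in *.
 have Hc : 0 <= c by (rewrite <- F0; apply Hmax; lra). have Hdel := nl_delta NL.
 have [bm [bp [A [B [mc [W [WB [Wp Wm]]]]]]]] := well_exists D f delta c q NL Hc by_lra HDq HFpq. have O := w_order W.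
 have Hmc := w_mu W. set (g := clamped f A B). have NLg := freeze_nonlinearity NL W Wp Wm.
 have [M [HM HMb]] := freeze_bound NL W Wp Wm. have [WfA WfB] := freeze_walls W.
 have HD : forall x, A <= x <= B -> D x by (intros x; apply (well_D NL _ _ _ _ _ _ x W)).
 have Hg : forall x, A <= x <= B -> primitive g x = primitive f x by (apply (freeze_primitive NL W)).
 have Hout : forall x, x <= A \/ B <= x -> c + mc <= primitive g x.
 { intros x [Hx|Hx].
  - have T := freeze_left NL W Wp Wm x Hx. fold g in T. rewrite (w_xm W) in T. nra.
  - have T := freeze_right NL W Wp Wm x Hx. fold g in T. rewrite (w_xp W) in T. nra. }
 destruct (continuity_ab_min F A B) as [mi [Hmi _]]; try lra.
 { intros x Hx. apply continuous_continuity_pt, (F_cont NL), HD; auto. } set (Mo := Rabs (F mi)).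
 have PMo : 0 <= Mo by positive. have Hlow : forall x, - Mo <= primitive g x.
 { intro x. case: (Rle_lt_dec A x) => H1; [case: (Rle_lt_dec x B) => H2|].
  - rewrite Hg by lra. specialize (Hmi x by_lra). have T := Rle_abs (- F mi). rewrite Rabs_Ropp in T. fold F. unfold Mo.
   lra.
  - specialize (Hout x by_lra). lra.
  - specialize (Hout x by_lra). lra. }
 have [R0 [tau [HR0 [Htau Hwin]]]] := window NL c bm bp A B mc W (n := n).
 have [Vb [HVb Hspeed]] := well_speed NL W. have Hd : 1 <= INR n by (apply (le_INR 1)).
 set (X := INR n * Vb ^ 2 * (3 * tau)). have HX : 0 <= X by positive. set (rho0 := R0 + 4 * X / mc).
 have Hrho0 : R0 <= rho0 by (unfold rho0; assert (0 <= 4 * X / mc) by (apply Rdiv_le_0_compat; lra); lra).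
 set (K := Rabs A + Rabs B + 1 + 2 * (c + mc + Mo)). have D2 : D (delta / 2) by (apply HD; lra).
 have F2 : F (delta / 2) < 0 by (apply (nl_neg NL); auto; rewrite Rabs_right; lra).
 destruct (energy_near NL (delta / 2) 0 (- F (delta / 2)) D2) as [h [Hh Hnear]]; [lra|]. set (e := Rmin h (delta / 2) / 2).
 have He : 0 < e /\ e < h /\ e < delta / 2. { unfold e. by_cases. }
 destruct (area_escape g M (INR n) rho0 K (delta / 2) 0 e) as [z [u [v [Hz [Hcont [Hode [Hu [Hv [r [Hr HK]]]]]]]]]]; auto;
  try lra. { apply (clamped_unif NL); try apply W. lra. } have Huz : 0 < u z < delta by by_cases.
 have HEz : energy f u v z < 0.
 { have T := Hnear (u z) (v z) by_lra by_lra. apply Rabs_lt_between in T. unfold energy. fold F in T |- *. lra. }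
 have Eg : forall t, A <= u t <= B -> energy g u v t = energy f u v t. { intros t Ht. unfold energy. rewrite Hg; auto. }
 have Hmono : forall a b, rho0 <= a -> a <= b -> b <= z -> energy g u v b <= energy g u v a.
 { intros a b Ha Hab Hb. apply (energy_decreasing (n := n) NLg); try lra.
  - split; auto. apply Hcont. lra.
  - intros t Ht. apply Hode. lra. }
 have Cg : forall t, rho0 <= t <= z -> continuous (energy g u v) t.
 { intros t Ht. apply (energy_cont NLg); auto; apply Hcont; auto. }
 (* the orbit has been above the walls *)
 have HEr : c + mc <= energy g u v r.
 { unfold energy. have Pv := pow2_ge_0 (v r). have PA := Rabs_pos A. have PB := Rabs_pos B. case: HK => HK.
  - have Hor : u r <= A \/ B <= u r. { have Q1 := Rle_abs (- A). unfold K in HK. by_cases. } specialize (Hout _ Hor). lra.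
  - specialize (Hlow (u r)). rewrite <- pow2_abs. unfold K in HK. nra. }
 destruct (ivt_decr (energy g u v) r z (c + 3 * mc / 4)) as [t1 [Ht1 Et1]]; try lra. { intros x Hx. apply Cg. lra. }
 { rewrite Eg by lra. lra. } have HI : forall t, t1 <= t <= z -> inwell f c A B mc u v t.
 { intros t Ht. have T := Hmono t1 t by_lra by_lra by_lra. have Hin : A < u t < B.
  { apply NNPP; intro Hn. have Q := F_le_E g u v t. specialize (Hout (u t) by_lra). lra. } split; auto.
  rewrite <- Eg by lra. lra. }
 have TR : forall a b, t1 <= a -> b <= z -> traj n D f a b u v.
 { split.
  - intros t Ht. have [I1 _] := HI t by_lra. split; [apply HD; lra|apply Hcont; lra].
  - intros t Ht. have [O1 O2] := Hode t by_lra. split; auto. have [I1 _] := HI t by_lra. unfold g in O2.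
   rewrite clamped_id in O2; auto. lra. }
 have Ef : energy f u v t1 = c + 3 * mc / 4.
 { destruct (HI t1 by_lra). rewrite <- Eg; auto. lra. }
 have HEn : forall t, t1 <= t <= z -> t <= t1 + 3 * tau -> c + mc / 2 <= energy f u v t.
 { intros t Ht Htt. have [TC TO] := TR t1 z by_lra by_lra.
  have G : energy f u v t1 + - (INR n * Vb ^ 2 / rho0) * (t - t1) <= energy f u v t.
  { apply (deriv_ge_le _ (fun x => - (INR n / x) * v x ^ 2)); try lra.
   - intros x Hx. apply (energy_cont NL); apply TC; lra.
   - split; [apply (energy_derive NL); [apply TC; lra|apply TO; lra]|]. have Q := Hspeed _ _ x (HI x by_lra).
    assert (v x ^ 2 <= Vb ^ 2) by (rewrite <- pow2_abs; apply pow_incr; split; [apply Rabs_pos|auto]).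
    assert (0 <= v x ^ 2) by apply pow2_ge_0. assert (INR n / x <= INR n / rho0).
    { apply Rmult_le_compat_l; [lra|]. apply Rinv_le_contravar; lra. }
    assert (INR n / x * v x ^ 2 <= INR n / rho0 * Vb ^ 2). { apply Rmult_le_compat; auto. apply Rdiv_le_0_compat; lra. }
    lra. }
  have G2 : INR n * Vb ^ 2 / rho0 * (t - t1) <= mc / 4.
  { apply (Rmult_le_reg_r rho0); [lra|].
   replace (INR n * Vb ^ 2 / rho0 * (t - t1) * rho0) with (INR n * Vb ^ 2 * (t - t1)) by (field; lra).
   apply Rle_trans with X; [unfold X; apply Rmult_le_compat_l; [|lra]; apply Rmult_le_pos; [lra|apply pow2_ge_0]|].
   unfold rho0. replace (mc / 4 * (R0 + 4 * X / mc)) with (mc / 4 * R0 + X) by (field; lra).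
   assert (0 <= mc / 4 * R0) by positive. lra. }
  lra. }
 have Hz3 : t1 + 3 * tau < z.
 { apply Rnot_le_lt; intro Hle. specialize (HEn z by_lra Hle). lra. }
 have Win : forall s, t1 <= s -> s + tau <= t1 + 3 * tau -> exists t, s < t <= s + tau /\ u t = 0.
 { intros s Hs1 Hs2. apply (Hwin s u v); [lra|apply TR; lra|]. intros t Ht. have [I1 I2] := HI t by_lra.
  specialize (HEn t by_lra by_lra). lra. }
 destruct (Win t1) as [s1 [S1 Z1]]; try lra.
 destruct (Win s1) as [s2 [S2 Z2]]; try lra. destruct (Win s2) as [s3 [S3 Z3]]; try lra.
 have Cu : forall x, s1 <= x <= s3 -> continuity_pt u x. { intros x Hx. apply continuous_continuity_pt, Hcont. lra. }
 have [m [Hm Hm2]] := continuity_ab_maj u s1 s3 by_lra Cu.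
 have Crit : forall x, s1 < x < s3 -> (forall y, s1 <= y <= s3 -> u y <= u x) -> v x = 0.
 { intros x Hx Hxm. have [O1 _] := Hode x by_lra. have pr : derivable_pt u x by (exists (v x); apply is_derive_Reals).
  rewrite <- (is_derive_unique _ _ _ O1), <- (Derive_Reals u x pr). apply (deriv_maximum u s1 s3); try lra.
  intros y Hy1 Hy2. apply Hxm. lra. }
 have Hum : 0 < u m.
 { apply Rnot_le_lt; intro Hle. have V2 : v s2 = 0. { apply Crit; [lra|]. intros y Hy. specialize (Hm y Hy). lra. }
  specialize (HEn s2 by_lra by_lra). unfold energy in HEn. rewrite Z2, V2 in HEn. fold F in HEn. lra. }
 have Hms : s1 < m < s3.
 { case: (Req_dec m s1) => [E1|]; [rewrite E1 in Hum; lra|].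
  case: (Req_dec m s3) => [E1|]; [rewrite E1 in Hum; lra|lra]. }
 have Vm : v m = 0 by auto.
 have Fm : c + mc / 2 <= F (u m).
 { specialize (HEn m by_lra by_lra). unfold energy in HEn. rewrite Vm in HEn. fold F in HEn. lra. }
 have [Im _] := HI m by_lra. destruct (rest_exists n_pos NL m (u m)) as [u' [v' RS]]; [lra|apply HD; lra|].
 exists m, (u m), u', v'. split; auto. split.
 { split; [|lra]. apply Rnot_le_lt; intro. specialize (Hmax (u m) by_lra). lra. }
 have [[r' [Hr' Hd']]|Hno] := classic (exists r, m <= r <= z /\ dead u' v' r).
 - right. exists r'. split; [lra|auto].
 - left. exists z. have [E1 E2] := rs_rest RS m (Rle_refl _).
  destruct (traj_unique_forward (n := n) NL m z u' v' u v) with (r := z) as [E3 E4]; try lra.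
  + apply (rest_traj n D f m (u m)); auto. lra.
  + apply TR; lra.
  + intros t Ht Hd'. apply Hno. exists t. split; [lra|auto].
  + unfold energy in *. rewrite E3, E4. by_cases.
Qed.

Section Arrival.

Context (bm bp xm xp mu : R) (W : well D f 0 bm bp xm xp mu) (bp_delta : delta <= bp) (bm_delta : bm <= - delta).
Context (U V : R -> R -> R) (Fam : forall al, D al -> al <> 0 -> normal_sol n D f al (U al) (V al)).
Variable I : R -> Prop.
Hypothesis OI : open_interval D I.
Hypothesis I_delta : forall al, I al -> delta <= al.
Hypothesis I_ends : forall S0, exists a b, I a /\ I b /\ forall al rho u v, I al -> al < a \/ b < al ->
  rest_sol n D f rho al u v -> forall r, r <= S0 -> mu <= energy f u v r.

(** By compactness there is an earliest time at which the state is reached from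
    rest in [I]: heights near the ends of [I] do not contribute, as they keep an
    energy above [mu]. Its start is at time [0], by [earlier_start]. *)
Lemma first_arrival us vs z0 rho0 al0 u0 v0 : rest_sol n D f rho0 al0 u0 v0 -> I al0 -> rho0 <= z0 ->
  u0 z0 = us -> v0 z0 = vs -> ~ I us -> ~ (us = 0 /\ vs = 0) -> vs ^ 2 / 2 + F us < mu ->
  exists z rho al u v, rest_sol n D f rho al u v /\ I al /\ rho <= z <= z0 /\ u z = us /\ v z = vs /\
    (rho = 0 \/ exists r, rho <= r < z /\ dead u v r).
Proof.
 intros RS0 HI0 Hrz Hu0 Hv0 HnI Hst HEs.
 set (Z := fun z => exists rho al u v, rest_sol n D f rho al u v /\ I al /\ rho <= z /\ u z = us /\ v z = vs).
 have Z0 : Z z0 by (exists rho0, al0, u0, v0; auto). have Zpos : forall z, Z z -> 0 <= z.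
 { intros z [rho [al [u [v [A1 [_ [A2 _]]]]]]]. have T := rs_rho A1. lra. }
 destruct (completeness (fun y => Z (- y))) as [L [L1 L2]]. { exists 0. intros y Hy. specialize (Zpos _ Hy). lra. }
 { exists (- z0). rewrite Ropp_involutive; auto. } have HL : forall z, Z z -> - L <= z.
 { intros z Hz. have T := L1 (- z). rewrite Ropp_involutive in T. specialize (T Hz). lra. } have HL0 : - L <= z0 by auto.
 have Hseq : forall k : nat, exists q : (R * (R * R)) * ((R -> R) * (R -> R)), let '((z, (rho, al)), (u, v)) := q in rest_sol
  n D f rho al u v /\ I al /\ rho <= z /\ u z = us /\ v z = vs /\ - L <= z <= z0 /\ z < - L + / INR (k + 1).
 { intro k. have Hk : 0 < / INR (k + 1) by (apply Rinv_0_lt_compat, lt_0_INR; lia).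
  have Hex : exists z, Z z /\ z < - L + / INR (k + 1).
  { apply NNPP; intro Hn. assert (L <= L - / INR (k + 1)); [|lra]. apply L2. intros y Hy. apply Rnot_lt_le; intro. apply Hn.
   exists (- y). abs_bounds. }
  have [z [Hz1 Hz2]] := Hex. have [Hle|Hlt] := Rle_lt_dec z z0.
  - have [rho [al [u [v [A1 [A2 [A3 [A4 A5]]]]]]]] := Hz1. exists ((z, (rho, al)), (u, v)). abs_bounds.
  - exists ((z0, (rho0, al0)), (u0, v0)). abs_bounds. }
 apply choice in Hseq. have [q Hq] := Hseq.
 set (zn := fun k => fst (fst (q k))). set (rhon := fun k => fst (snd (fst (q k)))).
 set (aln := fun k => snd (snd (fst (q k)))). set (un := fun k => fst (snd (q k))). set (vn := fun k => snd (snd (q k))).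
 have Hq' : forall k, rest_sol n D f (rhon k) (aln k) (un k) (vn k) /\ I (aln k) /\ rhon k <= zn k /\ un k (zn k) = us /\ vn
  k (zn k) = vs /\ - L <= zn k <= z0 /\ zn k < - L + / INR (k + 1).
 { intro k. specialize (Hq k). unfold zn, rhon, aln, un, vn. destruct (q k) as [[x1 [x2 x3]] [x4 x5]]. auto. }
 have [a [b [Ha [Hb Hab]]]] := I_ends z0. have Hal : forall k, a <= aln k <= b.
 { intro k. have [A1 [A2 [A3 [A4 [A5 [A6 _]]]]]] := Hq' k. apply NNPP; intro Hn.
  specialize (Hab (aln k) (rhon k) (un k) (vn k) A2 by_lra A1 (zn k) by_lra). unfold energy in Hab.
  rewrite A4, A5 in Hab. fold F in Hab. lra. }
 destruct (bounded_subsequence aln (Rabs a + Rabs b)) as [phi1 [P1 [al Lal]]].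
 { intro k. specialize (Hal k). by_cases. }
 destruct (bounded_subsequence (fun k => rhon (phi1 k)) z0) as [phi2 [P2 [rho Lrho]]].
 { intro k. have [A1 [_ [A3 [_ [_ [A6 _]]]]]] := Hq' (phi1 k). have T := rs_rho A1. by_cases. }
 set (phi := fun k => phi1 (phi2 k)). have P : increasing_map phi by exact (increasing_map_comp phi1 phi2 P1 P2).
 have Lal' : is_lim_seq (fun k => aln (phi k)) al by (apply (subseq_lim (fun k => aln (phi1 k))); auto).
 have Hal2 : a <= al <= b.
 { split.
  - apply (is_lim_seq_le (fun _ => a) (fun k => aln (phi k)) a al); auto; [intro; apply Hal|apply is_lim_seq_const].
  - apply (is_lim_seq_le (fun k => aln (phi k)) (fun _ => b) al b); auto; [intro; apply Hal|apply is_lim_seq_const]. }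
 have HIal : I al by (apply (oi_conv OI a b); auto). have [HDal Hal0] := oi_dom OI al HIal.
 destruct (rest_compact n_pos NL (fun k => rhon (phi k)) (fun k => aln (phi k)) (fun k => un (phi k)) (fun k => vn (phi k))
  rho al) as [psi [u [v [K [Hpsi [RS [L3 [L4 Lip]]]]]]]]; auto. { intro k. apply Hq'. }
 have Lz : is_lim_seq (fun k => zn (phi (psi k))) (- L).
 { apply (subseq_lim (fun k => zn (phi k))); auto. apply (subseq_lim zn); auto. apply lim_seq_eps. intros e He.
  have [N [N1 N2]] := archimed_cor1 e He. exists N. intros k Hk. have [_ [_ [_ [_ [_ [A6 A7]]]]]] := Hq' k.
  rewrite Rabs_right by lra.
  assert (/ INR (k + 1) <= / INR N) by (apply Rinv_le_contravar; [apply lt_0_INR; auto|apply le_INR; lia]). lra. }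
 have Lrho' : is_lim_seq (fun k => rhon (phi (psi k))) rho by (apply (subseq_lim (fun k => rhon (phi k))); auto).
 have Hrho : rho <= - L.
 { apply (is_lim_seq_le (fun k => rhon (phi (psi k))) (fun k => zn (phi (psi k))) rho (- L)); auto. intro k. apply Hq'. }
 have Hr0 := rs_rho RS.
 have Hend : forall (x : nat -> R -> R) (y : R -> R) w, (forall k T s t, Rabs s <= T -> Rabs t <= T -> Rabs (x (phi (psi k))
  t - x (phi (psi k)) s) <= K T * Rabs (t - s)) -> (forall t, is_lim_seq (fun k => x (phi (psi k)) t) (y t)) -> (forall k, x
  k (zn k) = w) -> y (- L) = w.
 { intros x y w Hx Hy Hw. apply Rminus_diag_uniq. apply NNPP; intro Hne. apply Rabs_pos_lt in Hne.
  set (KT := Rabs (K z0) + 1). have HKT : 0 < KT by (unfold KT; assert (T := Rabs_pos (K z0)); lra).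
  destruct (proj1 (lim_seq_eps _ _) (Hy (- L)) (Rabs (y (- L) - w) / 2)) as [N1 HN1]; [lra|].
  destruct (proj1 (lim_seq_eps _ _) Lz (Rabs (y (- L) - w) / 2 / KT)) as [N2 HN2]; [positive|]. set (k := max N1 N2).
  specialize (HN1 k ltac:(lia)). specialize (HN2 k ltac:(lia)). have [_ [_ [_ [_ [_ [A6 _]]]]]] := Hq' (phi (psi k)).
  specialize (Hx k z0 (- L) (zn (phi (psi k))) ltac:(by_cases) ltac:(by_cases)). rewrite Hw in Hx.
  assert (K z0 * Rabs (zn (phi (psi k)) - - L) <= Rabs (y (- L) - w) / 2).
  { apply Rle_trans with (KT * (Rabs (y (- L) - w) / 2 / KT)); [|apply Req_le; field; lra].
   have T := Rabs_pos (zn (phi (psi k)) - - L). have T2 := Rle_abs (K z0).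
   apply Rle_trans with (KT * Rabs (zn (phi (psi k)) - - L)); [apply Rmult_le_compat_r; unfold KT; lra|]. nra. }
  by_cases. }
 have Eu : u (- L) = us. { apply (Hend un u us); auto; [|intro k; apply (Hq' k)]. apply Lip; auto. } have Ev : v (- L) = vs.
 { apply (Hend vn v vs); auto; [|intro k; apply (Hq' k)]. apply Lip; auto. } exists (- L), rho, al, u, v.
 refine (conj RS (conj HIal (conj (conj Hrho HL0) (conj Eu (conj Ev _))))). case: (Req_dec rho 0) => [|Hrho0]; auto.
 right. apply NNPP; intro Hno. have [R1 R2] := rs_rest RS rho (Rle_refl _). have HrhoL : rho < - L.
 { case: (Req_dec rho (- L)) => [E1|]; [|lra]. congruence. } have Hfal : f al <> 0.
 { intro Hf.
  destruct (rest_unique NL rho al _ _ u v (- L) Hal0 (const_rest n D f rho al Hr0 HDal Hf) RS) with (r := - L) as [E1 _];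
   [|lra|].
  - by_cases.
  congruence. }
 have Hald := I_delta al HIal. have Hdel := nl_delta NL. have [e [He HIe]] := oi_open OI al HIal.
 destruct (earlier_start rho al u v (- L) RS by_lra HrhoL by_lra Hfal) with (e := e) as [z' [rho' [al' [u' [v' [B1
  [B2 [B3 [B4 [B5 B6]]]]]]]]]]; auto.
 { intros r Hr Hd. destruct (Req_dec r (- L)) as [->|]; [apply Hst; destruct Hd; split; congruence|]. apply Hno. exists r.
  split; [lra|auto]. }
 assert (- L <= z'); [|lra]. apply HL. exists rho', al', u', v'. rewrite Eu in B5. rewrite Ev in B6.
 refine (conj B4 (conj _ (conj _ (conj B5 B6)))); [auto|lra].
Qed.

Lemma normal_state al u v z : I al -> rest_sol n D f 0 al u v -> (forall r, r < z -> ~ dead u v r) ->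
  U al z = u z /\ V al z = v z.
Proof.
 intros HI RS Halive. have [HD Hne] := oi_dom OI al HI.
 destruct (rest_unique NL 0 al u v (U al) (V al) z Hne RS (ns_rest (Fam al HD Hne)) Halive z (Rle_refl _)); auto.
Qed.

Definition finite_state (al : R) : Prop := I al /\ trapped D f xm xp mu U V al /\ exists m, ~ has_zeros (U al) (V al) (S m).

(** With negative energy a solution cannot return to zero. *)
Lemma finite_negative al z : I al -> 0 <= z -> energy f (U al) (V al) z < 0 -> Rabs (U al z) < delta -> finite_state al.
Proof.
 intros HI Hz HE Hu. have [HD Hne] := oi_dom OI al HI. have NS := Fam al HD Hne. have O := w_order W. have Hmu := w_mu W.
 apply Rabs_lt_between in Hu. have F0 : primitive f 0 = 0 by apply F_zero. have Hd : ~ dead (U al) (V al) z.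
 { intros [E1 E2]. unfold energy in HE. rewrite E1, E2 in HE. lra. } split; auto. split.
 - repeat split; auto. exists z. repeat split; auto; lra.
 - destruct (finite_zeros n_pos al (U al) (V al) z NS Hne Hd) as [k Hk].
  + intros t Ht Hut. have T := rest_energy_decr (n := n) NL 0 al _ _ z t (ns_rest NS) by_lra. unfold energy at 1 in T.
   rewrite Hut in T. nra.
  + exists k. intro Hz2. apply Hk. apply (has_zeros_le _ _ k (S k)); auto.
Qed.

Lemma finite_near_zero C al z : (forall al u v S0 t1 t2, rest_sol n D f 0 al u v ->
    0 <= S0 <= t1 -> t1 < t2 -> S0 * energy f u v S0 < C -> Rabs (u S0) < delta / 3 ->
    u t1 = 0 -> u t2 = 0 -> v t2 <> 0 -> False) ->
  I al -> 0 <= z -> z * energy f (U al) (V al) z < C -> Rabs (U al z) < delta / 3 -> energy f (U al) (V al) z < mu ->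
  ~ dead (U al) (V al) z -> finite_state al.
Proof.
 intros HC HI Hz HE Hu HEmu Hd. have [HD Hne] := oi_dom OI al HI. have NS := Fam al HD Hne. have O := w_order W.
 have Hu' := Hu. apply Rabs_lt_between in Hu'. split; auto. split.
 - repeat split; auto. exists z. repeat split; auto; lra.
 - have Hex : exists S0, ~ dead (U al) (V al) S0 /\ forall t, S0 < t -> U al t = 0 -> V al t = 0.
  { have [[t1 [T1 [T2 T3]]]|Hno] := classic (exists t1, z <= t1 /\ U al t1 = 0 /\ V al t1 <> 0).
   - exists t1. split; [intros [_ E1]; auto|]. intros t Ht Hut. apply NNPP; intro Hv.
    apply (HC al _ _ z t1 t (ns_rest NS)); auto.
   - exists z. split; auto. intros t Ht Hut. apply NNPP; intro Hv. apply Hno. exists t. repeat split; lra. }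
  have [S0 [HS1 HS2]] := Hex. have [k Hk] := finite_zeros n_pos al (U al) (V al) S0 NS Hne HS1 HS2. exists k. intro Hz2.
  apply Hk. apply (has_zeros_le _ _ k (S k)); auto.
Qed.

(** Just before it dies the solution has little [r E] left. The earliest arrival
    at such a state starts at time [0] and has even less. *)
Lemma finite_from_dead rho al u v z : rest_sol n D f rho al u v -> I al -> rho <= z -> dead u v z ->
  exists al1, finite_state al1.
Proof.
 intros RS HI Hz Hd. have [HD Hne] := oi_dom OI al HI. have H0 := rs_rho RS. have F0 : primitive f 0 = 0 by apply F_zero.
 have Hdel := nl_delta NL. have Hmu := w_mu W.
 destruct (first_dead u v z) as [r0 [Hr0 [[D1 D2] Hbef]]]; auto; [apply (rs_cont RS)|lra|]. have Hr : rho < r0.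
 { apply Rnot_le_lt; intro Hle. have [E1 _] := rs_rest RS r0 Hle. lra. } have [C [HC HF]] := few_zeros n_pos NL.
 destruct (energy_near NL (u r0) (v r0) (Rmin mu (C / r0))) as [h [Hh Hnear]]. { apply (rs_dom RS). }
 { apply Rmin_glb_lt; auto. positive. }
 destruct (continuous_eps u r0 (Rmin h (delta / 3))) as [e1 [He1 H1]]; [apply (rs_cont RS)|by_cases|].
 destruct (continuous_eps v r0 h) as [e2 [He2 H2]]; [apply (rs_cont RS)|auto|].
 set (r1 := Rmax ((rho + r0) / 2) (r0 - Rmin e1 e2 / 2)). have He : 0 < Rmin e1 e2 by by_cases.
 have Hr1 : rho < r1 < r0 /\ r0 - Rmin e1 e2 / 2 <= r1 by (unfold r1, Rmax; destruct Rle_dec; lra).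
 have Hsm : forall r, r1 <= r <= r0 -> Rabs (u r) < delta / 3 /\ Rabs (u r - u r0) < h.
 { intros r Hrr. specialize (H1 r ltac:(by_cases)). by_cases. } have [Q1 Q2] := Hsm r1 by_lra.
 specialize (H2 r1 ltac:(by_cases)). specialize (Hnear _ _ Q2 H2). rewrite D1, D2 in Hnear.
 apply Rmin_Rgt_l in Hnear as [N1 N2]. apply Rabs_lt_between in N1. apply Rabs_lt_between in N2.
 change (v r1 ^ 2 / 2 + primitive f (u r1)) with (energy f u v r1) in *.
 have E0 : energy f u v r0 = 0 by (unfold energy; rewrite D1, D2, F0; lra).
 (* some energy is left before the solution dies *)
 have Epos : 0 < energy f u v r1.
 { have Hge := rest_energy_decr (n := n) NL rho al u v r1 r0 RS by_lra.
  case: (Req_dec (energy f u v r1) 0) => [E1|]; [|lra]. exfalso.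
  destruct (mean_value (energy f u v) (fun r => - (INR n / r) * v r ^ 2) r1 r0) as [c [C1 C2]]; try lra.
  - intros x _. apply (energy_cont NL); [apply (rs_dom RS)|apply (rs_cont RS)|apply (rs_cont RS)].
  - intros x Hx. apply (energy_derive NL); [apply (rs_dom RS)|apply (rs_ode RS); lra].
  - assert (0 < INR n / c) by (apply Rdiv_lt_0_compat; [apply lt_0_INR; auto|lra]). have Vc : v c = 0.
   { apply NNPP; intro Hv. assert (0 < v c ^ 2) by nra.
    assert (0 < INR n / c * v c ^ 2 * (r0 - r1)) by (apply Rmult_lt_0_compat; [apply Rmult_lt_0_compat; auto|lra]). lra. }
   have G1 := rest_energy_decr (n := n) NL rho al u v c r0 RS by_lra. rewrite E0 in G1. unfold energy in G1.
   rewrite Vc in G1. have [Q3 _] := Hsm c by_lra. have [E2|E2] := Req_dec (u c) 0.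
   + apply (Hbef c); [lra|]. by_cases.
   + have T := nl_neg NL (u c) (rs_dom RS c). by_cases. }
 have HEC : r1 * energy f u v r1 < C.
 { have T : energy f u v r1 < C / r0 by lra. apply (Rmult_lt_compat_l r0) in T; [|lra].
  replace (r0 * (C / r0)) with C in T by (field; lra). nra. }
 destruct (first_arrival (u r1) (v r1) r1 rho al u v) as [z' [rho' [al' [u' [v' [A1 [A2 [A3 [A4 [A5 A6]]]]]]]]]]; auto; try
  lra. { intro HIu. have T := I_delta _ HIu. by_cases. } { intro Hdd. apply (Hbef r1); [lra|]. auto. }
 { change (energy f u v r1 < mu). lra. } have E' : energy f u' v' z' = energy f u v r1 by (unfold energy; rewrite A4, A5).
 have Hnd : forall r, r < z' -> ~ dead u' v' r.
 { intros r Hrz [B1 B2]. have T := rest_energy_mono NL rho' al' u' v' r z' A1 by_lra. unfold energy at 2 in T.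
  rewrite B1, B2 in T. lra. }
 have Hrho' : rho' = 0.
 { case: A6 => [A6|[r [B1 B2]]]; auto. exfalso. apply (Hnd r); auto; lra. } subst rho'.
 have [B1 B2] := normal_state al' u' v' z' A2 A1 Hnd. exists al'. apply (finite_near_zero C al' z'); auto; try lra.
 - unfold energy. rewrite B1, B2. change (z' * energy f u' v' z' < C). nra.
 - by_cases.
 - unfold energy. rewrite B1, B2. change (energy f u' v' z' < mu). lra.
 - intros [B3 B4]. apply (Hbef r1); [lra|]. by_cases.
Qed.

(** A late start reaches a state of negative energy, or dies; the earliest arrival
    there starts at time [0], unless it dies on its way. *)
Lemma finite_start p q : 0 < p -> D q -> p < q -> F p < F q -> (forall x, 0 <= x <= p -> F x <= F p) ->
  (forall x, p < x < q -> I x) -> exists al1, finite_state al1.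
Proof.
 intros Hp HDq Hpq HFpq Hmax HIpq. assert (F0 : primitive f 0 = 0) by apply F_zero. assert (Hmu := w_mu W).
 destruct (late_start p q Hp HDq Hpq HFpq Hmax) as [rho [al [u [v [RS [Hal [[z [Z1 [Z2 Z3]]]|[z [Z1 Z2]]]]]]]]].
 2: { apply (finite_from_dead rho al u v z); auto. }
 destruct (first_arrival (u z) (v z) z rho al u v) as [z' [rho' [al' [u' [v' [A1 [A2 [A3 [A4 [A5 A6]]]]]]]]]]; auto.
 - intro HIu. assert (T := I_delta _ HIu). by_cases.
 - intros [E1 E2]. unfold energy in Z2. rewrite E1, E2, F0 in Z2. lra.
 - change (energy f u v z < mu). lra.
 - case: (classic (exists r, rho' <= r < z' /\ dead u' v' r)) => [[r [B1 B2]]|Hno].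
  + apply (finite_from_dead rho' al' u' v' r); auto; lra.
  + case: A6 => A6; [|contradiction]. subst rho'. destruct (oi_dom OI al' A2) as [HDa Hne].
   destruct (normal_state al' u' v' z' A2 A1) as [B1 B2].
   { intros r Hr Hdd. case: (Rle_lt_dec 0 r) => H.
    - apply Hno. exists r. auto.
    - case: Hdd => [E1 _]. destruct (rs_rest A1 r) as [E2 _]; [lra|]. lra. }
   exists al'.
   apply (finite_negative al' z'); auto; try lra.
   * unfold energy. rewrite B1, B2, A4, A5. auto.
   by_cases.
Qed.

End Arrival.

End Start.

Arguments finite_state : clear implicits.
Arguments finite_negative : clear implicits.
Arguments finite_start : clear implicits.

(** * The assumptions *)

Definition open_dom (gm gp : Rbar) (s : R) : Prop := Rbar_lt gm s /\ Rbar_lt s gp.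

Lemma Rbar_lt_le_real (gm : Rbar) (x y : R) : Rbar_lt gm x -> x <= y -> Rbar_lt gm y.
Proof. destruct gm; simpl; lra. Qed.

Lemma Rbar_le_lt_real (gp : Rbar) (x y : R) : Rbar_lt y gp -> x <= y -> Rbar_lt x gp.
Proof. destruct gp; simpl; lra. Qed.

Lemma open_dom_locally gm gp x : open_dom gm gp x -> exists e, 0 < e /\ forall y, Rabs (y - x) < e -> open_dom gm gp y.
Proof.
 intros [H1 H2]. have A : exists e, 0 < e /\ forall y, Rabs (y - x) < e -> Rbar_lt gm y.
 { destruct gm as [a| |]; simpl in *; [|lra|exists 1; split; [lra|auto]]. exists (x - a). split; [lra|]. by_cases. }
 have B : exists e, 0 < e /\ forall y, Rabs (y - x) < e -> Rbar_lt y gp.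
 { destruct gp as [a| |]; simpl in *; [|exists 1; split; [lra|auto]|lra]. exists (a - x). split; [lra|]. by_cases. }
 destruct A as [e1 [He1 A]]. destruct B as [e2 [He2 B]]. exists (Rmin e1 e2). split; [by_cases|]. intros y Hy.
 apply Rmin_Rgt_l in Hy as [Y1 Y2]. split; auto.
Qed.

Lemma from_above_point gm (P : R -> Prop) (t : R) : Rbar_lt gm t -> from_above gm P ->
  exists A : R, Rbar_lt gm A /\ A < t /\ forall x : R, Rbar_lt gm x -> x <= A -> P x.
Proof.
 intros Ht HP. destruct gm as [a| |]; simpl in *.
 - have [e He] := HP. have Hm : exists m, 0 < m /\ m <= pos e /\ m <= t - a.
  { exists (Rmin e (t - a)). split; [apply Rmin_glb_lt; [apply cond_pos|lra]|]. by_cases. } have [m [M0 [M1 M2]]] := Hm.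
  exists (a + m / 2). repeat split; try lra. intros x Hx1 Hx2. apply He; auto. change (Rabs (x - a) < e). by_cases.
 - lra.
 - have [M HM] := HP. exists (Rmin (M - 1) (t - 1)). have M1 := Rmin_l (M - 1) (t - 1). have M2 := Rmin_r (M - 1) (t - 1).
  do 2 (split; [lra|]). intros x _ Hx. apply HM; auto. lra.
Qed.

Lemma continuous_interior gm gp (f : R -> R) (x : R) : continuous_on (dom gm gp) f -> open_dom gm gp x -> continuous f x.
Proof.
 intros Hc Hx. have [e [He H]] := open_dom_locally gm gp x Hx.
 have Hd : dom gm gp x by (destruct Hx; split; [auto|apply Rbar_lt_le]). intros P HP. have T := Hc x Hd P HP.
 unfold filtermap in *. have Hloc : locally x (dom gm gp).
 { exists (mkposreal e He). intros y Hy. destruct (H y Hy). split; [auto|apply Rbar_lt_le; auto]. }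
 apply (filter_imp (fun y => dom gm gp y /\ (dom gm gp y -> P (f y)))); [tauto|]. apply filter_and; auto.
Qed.

Lemma make_nonlinearity gm gp (f : R -> R) (delta : R) : Rbar_lt gm 0 -> Rbar_lt 0 gp ->
  continuous_on (dom gm gp) f -> f 0 = 0 ->
  locally_lipschitz_on (fun s => dom gm gp s /\ s <> 0) f ->
  0 < delta -> (forall s, 0 < Rabs s < delta -> primitive f s < 0) -> cond_f4 gm gp f delta ->
  (forall x t : R, open_dom gm gp x -> Rbar_lt gm t -> exists A : R, Rbar_lt gm A /\ A < t /\ primitive f x < primitive f A) ->
  (forall x t : R, open_dom gm gp x -> Rbar_lt t gp -> exists B : R, t < B /\ Rbar_lt B gp /\ primitive f x < primitive f B) ->
  nonlinearity (open_dom gm gp) f delta.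
Proof.
 intros Hgm Hgp Hc Hf0 Hlip Hdel Hneg [[l Hl] _] HA HB. constructor; auto.
 - split; auto.
 - intros a b x [A1 A2] [B1 B2] Hx. split; [apply (Rbar_lt_le_real gm a)|apply (Rbar_le_lt_real gp x b)]; auto; lra.
 - apply open_dom_locally; auto.
 - intros x Hx. apply (continuous_interior gm gp); auto.
 - intros x Hx Hne. assert (Hd : dom gm gp x) by (destruct Hx; split; [auto|apply Rbar_lt_le; auto]).
  destruct (Hlip x (conj Hd Hne)) as [L [e [He H]]]. destruct (open_dom_locally gm gp x Hx) as [e2 [He2 H2]].
  assert (Hx0 := Rabs_pos_lt _ Hne). exists (Rmax L 0), (Rmin e (Rmin e2 (Rabs x))).
  split; [repeat apply Rmin_glb_lt; auto|]. split; [apply Rmax_r|].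
  assert (In : forall y, Rabs (y - x) < Rmin e (Rmin e2 (Rabs x)) -> (dom gm gp y /\ y <> 0) /\ Rabs (y - x) < e).
  { intros y Hy. apply Rmin_Rgt_l in Hy as [Y1 Y2]. apply Rmin_Rgt_l in Y2 as [Y2 Y3]. split; auto. split.
   - destruct (H2 y Y2). split; [auto|apply Rbar_lt_le; auto].
   by_cases. }
  intros y z Hy Hz. destruct (In y Hy) as [Y1 Y2]. destruct (In z Hz) as [Z1 Z2].
  eapply Rle_trans; [apply H; auto|]. apply Rmult_le_compat_r; [apply Rabs_pos|apply Rmax_l].
 - intros x Hx. destruct (HA x (Rmin x 0) Hx) as [A [A1 [A2 A3]]]. { destruct Hx. unfold Rmin. destruct Rle_dec; auto. }
  destruct (HB x (Rmax x 0) Hx) as [B [B1 [B2 B3]]]. { destruct Hx. unfold Rmax. destruct Rle_dec; auto. }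
  assert (M1 := Rmin_l x 0). assert (M2 := Rmin_r x 0). assert (M3 := Rmax_l x 0). assert (M4 := Rmax_r x 0). exists A, B.
  split; [split; auto; apply (Rbar_le_lt_real gp A 0); auto; lra|].
  split; [split; auto; apply (Rbar_lt_le_real gm 0); auto; lra|]. repeat split; auto; lra.
 - exists l. intros s [S1 S2] Hs Hf. apply Hl; auto. unfold Rabs in Hs.
  destruct Rcase_abs in Hs; [left|right]; split; auto; lra.
Qed.

(** What happens for initial values close to the upper end of the domain:
    whatever the starting time, the solution keeps its energy for long. *)
Definition upper_end n (gm gp : Rbar) f (mu : R) : Prop := forall (S0 q : R), Rbar_lt q gp -> exists q1 : R, q < q1 /\ Rbar_lt q1 gp /\
  forall al rho u v, q1 < al -> rest_sol n (open_dom gm gp) f rho al u v -> forall r, r <= S0 -> mu <= energy f u v r.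

Section FiniteEnd.

Variables (gm : Rbar) (gs : R) (f : R -> R).
Hypothesis gm_neg : Rbar_lt gm 0.
Hypothesis gs_pos : 0 < gs.
Hypothesis f_cont : continuous_on (dom gm gs) f.

Let fc x := f (clamp 0 gs x).

Lemma end_cont x : continuous fc x.
Proof.
 intros P HP. have Hd : forall y, dom gm gs (clamp 0 gs y).
 { intro y. destruct (clamp_range 0 gs y) as [C1 C2]; [lra|]. split; [apply (Rbar_lt_le_real gm 0); auto|auto]. }
 have T := f_cont (clamp 0 gs x) (Hd x) P HP. have [e He] := T. exists e. intros y Hy. apply He; auto.
 eapply Rle_lt_trans; [apply clamp_lipschitz; lra|auto].
Qed.

Lemma end_primitive s : 0 <= s <= gs -> primitive f s = RInt fc 0 s.
Proof. intros Hs. apply RInt_ext. intros x Hx. unfold fc. rewrite clamp_id; auto. by_cases. Qed.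

Lemma end_limit e : 0 < e -> exists h, 0 < h < gs /\ forall s, gs - h < s <= gs -> Rabs (primitive f s - primitive f gs) < e.
Proof.
 intros He. have Hd : is_derive (fun s => RInt fc 0 s) gs (fc gs).
 { apply (is_derive_RInt fc _ 0); [|apply end_cont]. exists (mkposreal 1 Rlt_0_1). intros y _.
  apply (RInt_correct (V := R_CompleteNormedModule)). apply ex_RInt_continuous. intros z _. apply end_cont. }
 have [h [Hh H]] := continuous_eps _ gs e (is_derive_continuous _ _ _ Hd) He. exists (Rmin h gs / 2).
 assert (0 < Rmin h gs) by by_cases. have M2 := Rmin_r h gs. split; [lra|]. intros s Hs. rewrite !end_primitive by lra.
 apply H. by_cases.
Qed.

End FiniteEnd.

Lemma A1_nonlinearity gm gs f : assumptionsA1 gm gs f ->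
  exists delta, nonlinearity (open_dom gm gs) f delta.
Proof.
 intros [[H1 [H2 [H3 [H4 [H5 H6]]]]] [delta [[D1 [D2 [D3 D4]]] [_ D6]]]]. exists delta. apply make_nonlinearity; auto.
 - intros x t [X1 X2] Ht. destruct (from_above_point gm (fun s => primitive f x < primitive f s) t Ht) as [A [A1 [A2 A3]]].
  { apply D3. apply locally_gt. auto. } exists A. repeat split; auto. apply A3; auto. lra.
 - intros x t [X1 X2] Ht. specialize (D4 x X1 X2). simpl in Ht.
  destruct (end_limit gm gs f H1 H2 H3 (primitive f gs - primitive f x)) as [h [Hh Hlim]]; [lra|].
  set (B := Rmax ((t + gs) / 2) (gs - h / 2)). have HB : t < B < gs /\ gs - h / 2 <= B. { unfold B. by_cases. } exists B.
  split; [lra|]. split; [simpl; lra|]. specialize (Hlim B by_lra). by_cases.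
Qed.

(** At a finite end [f] vanishes and is Lipschitz: nearby solutions stay nearby. *)
Lemma A1_upper_end n gm gs f mu : assumptionsA1 gm gs f -> mu < primitive f gs -> upper_end n gm gs f mu.
Proof.
 intros [[H1 [H2 [H3 [H4 [H5 H6]]]]] [delta [[D1 [D2 [D3 D4]]] _]]] Hmu S0 q Hq. simpl in Hq.
 destruct (end_limit gm gs f H1 H2 H3 (primitive f gs - mu)) as [h [Hh Hlim]]; [lra|].
 destruct (H6 gs) as [L [e [He HL]]]; [split; [split; [apply (Rbar_lt_le_real gm 0); auto; lra|simpl; lra]|lra]|].
 set (La := Rmax L 0). have HLa : 0 <= La by apply Rmax_r. have HLa2 : L <= La by apply Rmax_l.
 set (w0 := Rmin h (Rmin e gs) / 2).
 have Hw0 : 0 < w0 /\ w0 < h /\ w0 < e /\ w0 < gs by (unfold w0, Rmin; repeat destruct Rle_dec; lra).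
 set (X := exp ((1 + La) * Rabs S0)). have HX : 0 < X by positive. set (a := Rmin (w0 / 2) (Rmin (gs - q) (w0 ^ 2 / 2 / X))).
 have Hw2 : 0 < w0 ^ 2 / 2 / X. { apply Rdiv_lt_0_compat; auto. nra. }
 have Ha : 0 < a /\ a <= w0 / 2 /\ a <= gs - q /\ a <= w0 ^ 2 / 2 / X by (unfold a, Rmin; repeat destruct Rle_dec; lra).
 exists (gs - Rmin a 1 / 2). have Hm : 0 < Rmin a 1 by by_cases. have M1 := Rmin_l a 1. have M2 := Rmin_r a 1. split; [lra|].
 split; [simpl; lra|]. intros al rho u v Hal RS r Hr. have Hrho := rs_rho RS. have [R1 R2] := rs_rest RS rho (Rle_refl _).
 have Hlt : forall t, u t < gs by (intro t; destruct (rs_dom RS t) as [_ T]; exact T).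
 have Cu : forall t, continuous u t by (intro; apply (rs_cont RS)).
 have Cv : forall t, continuous v t by (intro; apply (rs_cont RS)). have Hal2 : gs - al < Rmin a 1 /\ al < gs.
 { specialize (Hlt rho). lra. }
 have Gron : forall t, rho <= t <= S0 -> (forall s, rho <= s < t -> gs - u s < w0) -> (gs - u t) ^ 2 < w0 ^ 2.
 { intros t Ht Hst. have G : (gs - u t) ^ 2 + v t ^ 2 <= ((gs - u rho) ^ 2 + v rho ^ 2) * exp ((1 + La) * (t - rho)).
  { apply (gronwall (fun s => (gs - u s) ^ 2 + v s ^ 2) (fun s => 2 * (gs - u s) * (0 - v s) + 2 * v s * (- (INR n / s) * v
    s - f (u s)))); try lra.
   - intros s _. apply continuous_sum; apply continuous_square; auto. apply continuous_diff; auto. apply continuous_const.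
   - intros s Hs. have [O1 O2] := rs_ode RS s by_lra. split.
    + apply is_derive_sum; [apply (is_derive_square (fun s => gs - u s))|apply is_derive_square; auto].
     apply is_derive_diff; auto. apply (is_derive_const gs).
    + specialize (Hst s by_lra). specialize (Hlt s). set (w := gs - u s) in *. have Hf : Rabs (f (u s)) <= La * w.
     { replace (f (u s)) with (f (u s) - f gs) by (rewrite H5; ring). eapply Rle_trans; [apply HL|].
      - split; [split; [apply (Rbar_lt_le_real gm 0); auto; unfold w in *; lra|simpl; lra]|unfold w in *; lra].
      - split; [split; [apply (Rbar_lt_le_real gm 0); auto; lra|simpl; lra]|lra].
      - rewrite Rabs_left; unfold w in *; lra.
      - by_cases.
      - rewrite Rabs_left by (unfold w in *; lra). replace (- (u s - gs)) with w by (unfold w; ring).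
       apply Rmult_le_compat_r; unfold w in *; lra. }
     have Hns : 0 <= INR n / s by (apply Rdiv_le_0_compat; [apply pos_INR|lra]).
     have P1 : 0 <= INR n / s * v s ^ 2 by nra. have P2 : - (2 * v s * f (u s)) <= La * (w ^ 2 + v s ^ 2).
     { have T := Rle_abs (- (2 * v s * f (u s))). rewrite Rabs_Ropp, Rabs_mult, Rabs_mult, Rabs_right in T by lra.
      have T2 : 2 * Rabs (v s) * Rabs (f (u s)) <= 2 * Rabs (v s) * (La * w).
      { apply Rmult_le_compat_l; auto. by_cases. } have T3 := pow2_ge_0 (Rabs (v s) - w). rewrite <- (pow2_abs (v s)).
      nra. }
     have P3 := pow2_ge_0 (w + v s). lra. }
  have E : exp ((1 + La) * (t - rho)) <= X.
  { unfold X. have T := Rle_abs S0. destruct (Req_dec (t - rho) (Rabs S0)) as [->|]; [lra|]. apply Rlt_le, exp_increasing.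
   nra. }
  have G2 : ((gs - al) ^ 2 + 0 ^ 2) * exp ((1 + La) * (t - rho)) <= (gs - al) * X.
  { apply Rmult_le_compat; try nra. apply Rlt_le, exp_pos. } have G3 : (gs - al) * X <= w0 ^ 2 / 2.
  { replace (w0 ^ 2 / 2) with (w0 ^ 2 / 2 / X * X) by (field; lra). nra. } nra. }
 have Stay : forall t, rho <= t <= S0 -> gs - u t < w0.
 { intros t Ht. apply Rnot_le_lt; intro Hle. destruct (first_hit (fun s => gs - u s) rho t w0) as [z [Z1 [Z2 Z3]]]; try lra.
  - intros x _. apply continuous_diff; auto. apply continuous_const.
  - specialize (Gron z by_lra). rewrite Z2 in Gron. enough (w0 ^ 2 < w0 ^ 2) by lra. auto. }
 have Hur : gs - u r < w0.
 { case: (Rle_lt_dec r rho) => [Hle|Hlt2]; [|apply Stay; lra]. have [-> _] := rs_rest RS r Hle. lra. }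
 eapply Rle_trans; [|apply F_le_E]. specialize (Hlt r). specialize (Hlim (u r) by_lra). by_cases.
Qed.

Lemma list_bound (l : list R) : exists X, forall s, In s l -> s <= X.
Proof.
 induction l as [|x l [X IH]]; [exists 0; intros s []|]. exists (Rmax x X). have M1 := Rmax_l x X. have M2 := Rmax_r x X.
 intros s [<-|Hs]; auto. specialize (IH s Hs). lra.
Qed.

Lemma lim_above f (L : Rbar) (K : R) : is_lim f p_infty L -> Rbar_lt K L -> exists X, forall x, X < x -> K < f x.
Proof. intros HL HK. have T := HL (fun y => Rbar_lt K y) (open_Rbar_gt' L K HK). auto. Qed.

Lemma lim_left gm f (L : Rbar) (K t : R) : filterlim f (from_above gm) (Rbar_locally L) -> Rbar_lt K L -> Rbar_lt gm t ->
  exists A : R, Rbar_lt gm A /\ A < t /\ forall x : R, Rbar_lt gm x -> x <= A -> K < f x.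
Proof.
 intros HL HK Ht. have T := HL (fun y => Rbar_lt K y) (open_Rbar_gt' L K HK). apply (from_above_point gm _ t Ht). auto.
Qed.

Lemma A2_nonlinearity N gm f : assumptionsA2 N gm f -> exists delta, nonlinearity (open_dom gm p_infty) f delta.
Proof.
 intros [[H1 [H2 [H3 H4]]] [[delta [[D1 [D2 [L [D3 [D4 D5]]]]] [_ D6]]] _]]. exists delta.
 apply make_nonlinearity; simpl; auto.
 - intros x t [X1 X2] Ht. have [A [A1 [A2 A3]]] := lim_left gm _ L (primitive f x) t D4 (D5 x X1) Ht. exists A.
  repeat split; auto. apply A3; auto. lra.
 - intros x t [X1 X2] _. have [X HX] := lim_above _ L (primitive f x) D3 (D5 x X1). exists (Rmax X t + 1).
  have M1 := Rmax_l X t. have M2 := Rmax_r X t. do 2 (split; [lra|]). apply HX. lra.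
Qed.

Section Pohozaev.

Context {n D f delta} (n_pos : (1 <= n)%nat) (NL : nonlinearity D f delta).

Let F := primitive f.
Let Q := Qfun (S n) f.

Definition pohozaev (u v : R -> R) (r : R) : R :=
  r ^ (n + 1) * energy f u v r + (INR n - 1) / 2 * (r ^ n * (u r * v r)).

(** Pohozaev's identity. *)
Lemma pohozaev_derive rho al u v r : rest_sol n D f rho al u v -> rho < r ->
  is_derive (pohozaev u v) r (r ^ n * (Q (u r) / 2)).
Proof.
 intros RS Hr. have H0 := rs_rho RS. have [O1 O2] := rs_ode RS r Hr.
 apply (is_derive_value _ _ ((INR (n + 1) * r ^ pred (n + 1) * energy f u v r + r ^ (n + 1) * (- (INR n / r) * v r ^ 2)) +
  (INR n - 1) / 2 * ((INR n * r ^ pred n) * (u r * v r) + r ^ n * (v r * v r + u r * (- (INR n / r) * v r - f (u r)))))).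
 - apply is_derive_sum.
  + apply is_derive_prod; [apply is_derive_Reals, derivable_pt_lim_pow|].
   apply (energy_derive NL); [apply (rs_dom RS)|split; auto].
  + apply is_derive_cmul.
   apply (is_derive_prod (fun r => r ^ n) (fun r => u r * v r)); [apply is_derive_Reals, derivable_pt_lim_pow|].
   apply is_derive_prod; auto.
 - real_eq. unfold Q, Qfun, energy. replace (n + 1)%nat with (S n) by lia. destruct n as [|m]; [lia|]. rewrite S_INR.
  simpl pow. field. lra.
Qed.

Lemma pohozaev_cont rho al u v r : rest_sol n D f rho al u v -> continuous (pohozaev u v) r.
Proof.
 intros RS. have [Cu Cv] := rs_cont RS r. have Cp : forall k, continuous (fun r => r ^ k) r.
 { intro k. apply (ex_derive_continuous (V := R_NormedModule)). auto_derive. auto. } apply continuous_sum.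
 - apply continuous_prod; auto. apply (energy_cont NL); auto. apply (rs_dom RS).
 - apply continuous_prod; [apply continuous_const|]. apply continuous_prod; auto. apply continuous_prod; auto.
Qed.

(** The first phase, down from [al] to [t0], produces a large Pohozaev energy. *)
Lemma pohozaev_gain rho al u v t0 M Qm z : rest_sol n D f rho al u v -> rho < z -> t0 < al -> u z = t0 -> 0 < M -> 0 <= Qm ->
  (forall s, rho <= s < z -> t0 < u s) -> (forall s, rho <= s -> u s <= al) ->
  (forall x, t0 <= x <= al -> 0 <= f x <= M /\ Qm <= Q x) -> 0 <= al ->
  2 * (al - t0) / M <= z ^ 2 /\ Qm / (2 * (INR n + 1)) * z ^ (n + 1) <= pohozaev u v z.
Proof.
 intros RS Hz Ht0 Huz HM HQm Hab Hle Hb Hal. have H0 := rs_rho RS. have Hd : 1 <= INR n by (apply (le_INR 1)).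
 have [R1 R2] := rs_rest RS rho (Rle_refl _). have Cu : forall x, continuous u x by (intro; apply (rs_cont RS)).
 have Cv : forall x, continuous v x by (intro; apply (rs_cont RS)).
 have Od : forall x, rho < x -> is_derive u x (v x) by (intros; apply (rs_ode RS)).
 have Pw : forall k x, is_derive (fun r => r ^ k) x (INR k * x ^ pred k) by (intros; apply is_derive_Reals,
  derivable_pt_lim_pow).
 have Cp : forall k x, continuous (fun r => r ^ k) x by (intros k x; apply (is_derive_continuous _ _ _ (Pw k x))).
 have Hin : forall s, rho <= s <= z -> t0 <= u s <= al.
 { split; [|apply Hle; lra]. destruct (Req_dec s z) as [->|]; [lra|]. apply Rlt_le, Hab; lra. }
 have Hpos : forall x k, 0 < x -> 0 < x ^ k by positive. have En : pred (n + 1) = n by lia.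
 have En2 : INR (n + 1) = INR n + 1 by (rewrite plus_INR; simpl). split.
 -
  (* the speed is at most [M r] *)
  have Hv : forall r, rho < r <= z -> - (M * r) <= v r.
  { intros r Hr. have Hphi : forall x, rho < x -> is_derive (fun x => x ^ n * v x) x (- (x ^ n * f (u x))).
   { intros x Hx. have [_ O2] := rs_ode RS x Hx.
    apply (is_derive_value _ _ (INR n * x ^ pred n * v x + x ^ n * (- (INR n / x) * v x - f (u x)))).
    - apply is_derive_prod; auto.
    - real_eq. destruct n as [|m]; [lia|]. simpl pow. field. lra. }
   have G : rho ^ n * v rho + M * rho ^ (n + 1) <= r ^ n * v r + M * r ^ (n + 1).
   { apply (nondecr_deriv (fun x => x ^ n * v x + M * x ^ (n + 1)) (fun x => - (x ^ n * f (u x)) + M * (INR (n + 1) * x ^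
     pred (n + 1)))); try lra.
    - intros x _. apply continuous_sum; [apply continuous_prod; auto|]. apply continuous_prod; auto.
     apply continuous_const.
    - split; [apply is_derive_sum; [apply Hphi; lra|apply is_derive_cmul; apply Pw]|]. rewrite En, En2.
     have [[_ F2] _] := Hb (u x) (Hin x by_lra). specialize (Hpos x n by_lra).
     assert (x ^ n * f (u x) <= x ^ n * M) by nra. assert (0 <= M * (INR n * x ^ n)) by positive. lra. }
   rewrite R2 in G.
   assert (0 <= M * rho ^ (n + 1)) by positive. have Pr := Hpos r n by_lra. apply (Rmult_le_reg_l (r ^ n)); auto.
   replace (r ^ (n + 1)) with (r ^ n * r) in G by (rewrite pow_add; ring). lra. }
  have G : u rho + M / 2 * rho ^ 2 <= u z + M / 2 * z ^ 2.
  { apply (nondecr_deriv (fun x => u x + M / 2 * x ^ 2) (fun x => v x + M / 2 * (INR 2 * x ^ pred 2))); try lra.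
   - intros x _. apply continuous_sum; auto. apply continuous_prod; auto. apply continuous_const.
   - split; [apply is_derive_sum; [apply Od; lra|apply is_derive_cmul; apply Pw]|]. specialize (Hv x by_lra). simpl.
    lra. }
  assert (0 <= M / 2 * rho ^ 2) by nra. apply (Rmult_le_reg_r M); auto.
  replace (2 * (al - t0) / M * M) with (2 * (al - t0)) by (field; lra). lra.
 - set (k := Qm / (2 * (INR n + 1))). have Ek : k * (INR n + 1) = Qm / 2 by (unfold k; field; lra).
  have G : pohozaev u v rho + - k * rho ^ (n + 1) <= pohozaev u v z + - k * z ^ (n + 1).
  { apply (nondecr_deriv (fun x => pohozaev u v x + - k * x ^ (n + 1)) (fun x => x ^ n * (Q (u x) / 2) + - k * (INR (n + 1)
    * x ^ pred (n + 1)))); try lra.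
   - intros x _. apply continuous_sum; [apply (pohozaev_cont rho al); auto|]. apply continuous_prod; auto.
    apply continuous_const.
   - split; [apply is_derive_sum; [apply (pohozaev_derive rho al); auto; lra|apply is_derive_cmul; apply Pw]|]. rewrite En.
    have [_ Q2] := Hb (u x) (Hin x by_lra). specialize (Hpos x n by_lra). nra. }
  have Hr : k * rho ^ (n + 1) <= pohozaev u v rho.
  { unfold pohozaev, energy. rewrite R1, R2. have [[F1 _] Q2] := Hb al by_lra. unfold Q, Qfun in Q2.
   rewrite S_INR in Q2. have T : 0 <= (INR n + 1 - 2) * al * f al by positive. assert (0 <= rho ^ (n + 1)) by positive.
   nra. }
  lra.
Qed.

(** [Q] is bounded from below, so the Pohozaev energy cannot fall faster than a
    power of [r]. *)
Lemma pohozaev_loss rho al u v CQ a b : rest_sol n D f rho al u v -> rho <= a <= b -> 0 <= CQ -> (forall x, D x -> - CQ <= Q x) ->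
  pohozaev u v a <= pohozaev u v b + CQ / 2 * b ^ (n + 1).
Proof.
 intros RS Hab HCQ HQ. have H0 := rs_rho RS.
 have Pw : forall k x, is_derive (fun r => r ^ k) x (INR k * x ^ pred k) by (intros; apply is_derive_Reals,
  derivable_pt_lim_pow). have G : pohozaev u v a + CQ / 2 * a ^ (n + 1) <= pohozaev u v b + CQ / 2 * b ^ (n + 1).
 { apply (nondecr_deriv (fun x => pohozaev u v x + CQ / 2 * x ^ (n + 1)) (fun x => x ^ n * (Q (u x) / 2) + CQ / 2 * (INR (n +
   1) * x ^ pred (n + 1)))); try lra.
  - intros x _. apply continuous_sum; [apply (pohozaev_cont rho al); auto|].
   apply continuous_prod; [apply continuous_const|]. apply (is_derive_continuous _ _ _ (Pw _ _)).
  - split; [apply is_derive_sum; [apply (pohozaev_derive rho al); auto; lra|apply is_derive_cmul; apply Pw]|].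
   replace (pred (n + 1)) with n by lia. rewrite plus_INR. simpl (INR 1). specialize (HQ (u x) (rs_dom RS x)).
   assert (0 < x ^ n) by positive. assert (0 <= (Q (u x) + CQ) * x ^ n) by nra.
   assert (0 <= CQ * (INR n * x ^ n)) by positive. lra. }
 assert (0 <= CQ / 2 * a ^ (n + 1)) by positive. lra.
Qed.

End Pohozaev.

Arguments pohozaev : clear implicits.

Lemma growth_bound N f theta : 0 < theta < 1 ->
  is_lim (fun s => real (Glb_Rbar (fun y => exists s1 s2 : R,
    theta * s <= s1 <= s /\ theta * s <= s2 <= s /\ y = Qfun N f s2 * Rpower (s / f s1) (INR N / 2)))) p_infty p_infty ->
  forall K, exists X, forall s s1 s2, X < s -> theta * s <= s1 <= s -> theta * s <= s2 <= s ->
    K < Qfun N f s2 * Rpower (s / f s1) (INR N / 2).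
Proof.
 intros Hth Hl K. have [X HX] := lim_above _ p_infty (Rmax K 0) Hl I. exists X. intros s s1 s2 Hs H1 H2.
 specialize (HX s Hs).
 match type of HX with _ < real (Glb_Rbar ?E) => assert (T := proj1 (Glb_Rbar_correct E)); set (g := Glb_Rbar E) in * end.
 specialize (T (Qfun N f s2 * Rpower (s / f s1) (INR N / 2)) ltac:(exists s1, s2; auto)). have M1 := Rmax_l K 0.
 have M2 := Rmax_r K 0. destruct g as [g| |]; simpl in *; lra.
Qed.

(** By [cond_f5] the Pohozaev energy gained in the fall from a great height
    exceeds all that can be lost up to time [S0], so that the energy at [S0] is
    large. *)
Lemma A2_upper_end n gm f mu x0 : (1 <= n)%nat -> assumptionsA2 (S n) gm f -> 0 <= mu -> open_dom gm p_infty x0 -> mu < primitive f x0 ->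
  upper_end n gm p_infty f mu.
Proof.
 intros Hn HA Hmu Hx0 Hmu2 Sin q _. have [delta NL] := A2_nonlinearity _ _ _ HA. set (D := open_dom gm p_infty) in *.
 set (F := primitive f) in *.
 have [[H1 [H2 [H3 H4]]] [[dl [[D1 [D2 [L [D3 [D4 D5]]]]] [_ D6]]] [[s0 [Q1 [Q2 Q3]]] [th [Hth Hgrow]]]]] := HA.
 have HmuL : Rbar_lt mu L. { apply (Rbar_lt_trans _ (F x0)); [auto|apply D5; apply Hx0]. }
 have HDp : forall x : R, 0 <= x -> D x by (intros x Hx; split; [apply (Rbar_lt_le_real gm 0)|simpl]).
 have Hd : 1 <= INR n by (apply (le_INR 1)). set (NN := INR n + 1). have ENN : INR (S n) = NN by (rewrite S_INR).
 (* f > 0 near infinity *)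
 have Hfp : exists X0, 1 <= X0 /\ forall x, X0 < x -> 0 < f x.
 { have [l Hl] := nl_finite NL. have [X HX] := list_bound l. set (X1 := Rmax X (Rmax delta 1)).
  have M1 := Rmax_l X (Rmax delta 1). have M2 := Rmax_r X (Rmax delta 1). have M4 := Rmax_r delta 1. fold X1 in M1, M2.
  have Hnz : forall x, X1 < x -> f x <> 0.
  { intros x Hx E. have T := HX x (Hl x (HDp x by_lra) ltac:(by_cases) E). lra. }
  have Cf : forall x, X1 < x -> continuous f x by (intros x Hx; apply (nl_cont NL), HDp; lra).
  have [Y HY] := lim_above _ L (F (X1 + 1)) D3 (D5 (X1 + 1) (proj1 (HDp (X1 + 1) by_lra))).
  set (B := Rmax Y (X1 + 1) + 1). have B1 := Rmax_l Y (X1 + 1). have B2 := Rmax_r Y (X1 + 1).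
  destruct (mean_value F f (X1 + 1) B) as [c [C1 C2]]; [unfold B; lra| | |]. { intros x Hx. apply (F_cont NL), HDp; lra. }
  { intros x Hx. apply (F_derive NL), HDp; lra. } have Hfc : 0 < f c.
  { specialize (HY B ltac:(unfold B; lra)). fold F in HY. nra. } exists X1. split; [lra|]. intros x Hx.
  apply Rnot_le_lt; intro Hle. destruct (Rle_lt_dec x c).
  - destruct (ivt f x c 0) as [z [Z1 Z2]]; [lra|intros; apply Cf; lra|lra|]. apply (Hnz z); lra.
  - destruct (ivt_decr f c x 0) as [z [Z1 Z2]]; [lra|intros; apply Cf; lra|lra|]. apply (Hnz z); lra. }
 case: Hfp => [X0 [HX0 Hfp]]. have [X2 HX2] := lim_above _ L mu D3 HmuL.
 have [A0 [A1 [A2 A3]]] := lim_left gm _ L mu 0 D4 HmuL H1. have Gr := growth_bound (S n) f th Hth Hgrow. rewrite ENN in Gr.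
 have RpPos : forall x y, 0 < Rpower x y by positive. have [X3 HX3] := Gr 0. set (Q := Qfun (S n) f) in *.
 set (XX := Rmax (Rmax X0 X2) X3). have HXX : X0 <= XX /\ X2 <= XX /\ X3 <= XX. { unfold XX. by_cases. }
 have HQX : forall s, XX < s -> 0 < Q s.
 { intros s Hs. have T := HX3 s s s by_lra ltac:(nra) ltac:(nra). specialize (RpPos (s / f s) (NN / 2)). nra. }
 have HD0 : forall x, s0 <= x -> D x by (intros x Hx; split; [apply (Rbar_lt_le_real gm s0)|simpl]).
 have Cid : forall x : R, continuous (fun t : R => t) x by easy. have CQf : forall x, s0 <= x -> continuous Q x.
 { intros x Hx. apply continuous_diff.
  - apply continuous_prod; [apply continuous_const|]. apply (F_cont NL), HD0; auto.
  - apply continuous_prod; [apply continuous_prod; [apply continuous_const|apply Cid]|]. apply (nl_cont NL), HD0; auto. }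
 have HQlow : exists CQ, 0 <= CQ /\ forall x, D x -> - CQ <= Q x.
 { destruct (continuity_ab_min Q s0 XX) as [m [Hm _]]; try lra. { intros x Hx. apply continuous_continuity_pt, CQf. lra. }
  exists (Rabs (Q m)). split; [positive|]. intros x [Hx _]. have T := Rle_abs (- Q m). rewrite Rabs_Ropp in T.
  have T2 := Rabs_pos (Q m). destruct (Rlt_le_dec x s0); [specialize (Q3 x Hx r); lra|].
  destruct (Rle_lt_dec x XX); [specialize (Hm x by_lra); lra|]. specialize (HQX x r0). lra. }
 case: HQlow => [CQ [HCQ HQlow]].
 (* the states of energy below mu are bounded *)
 have Low : forall x, D x -> F x < mu -> A0 < x < XX + 1.
 { intros x [Hx _] HF. split; apply Rnot_le_lt; intro.
  - have T := A3 x Hx H. fold F in T. lra.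
  - have T := HX2 x by_lra. fold F in T. lra. }
 set (S1 := Rmax Sin 1).
 have HS1 : Sin <= S1 /\ 1 <= S1 by (split; [apply Rmax_l|apply Rmax_r]).
 destruct (continuity_ab_min F A0 (XX + 1)) as [m [Hm _]]; try lra.
 { intros x Hx. apply continuous_continuity_pt, (F_cont NL). split; [apply (Rbar_lt_le_real gm A0); auto; lra|by_cases]. }
 set (V0 := 2 * (mu + Rabs (F m)) + 1). set (X5 := Rabs A0 + XX + 1). have PFm := Rabs_pos (F m). have PA := Rabs_pos A0.
 set (Bd := S1 ^ (n + 1) * mu + (INR n - 1) / 2 * (S1 ^ n * (X5 * V0)) + CQ / 2 * S1 ^ (n + 1)).
 set (cth := Rpower (2 * (1 - th)) (NN / 2)). have Hcth : 0 < cth by positive.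
 have [X6 HX6] := Gr (2 * NN / cth * (Rabs Bd + 1)). set (Y := Rmax (Rmax q X6) (XX + 1)).
 have HY : q <= Y /\ X6 <= Y /\ XX + 1 <= Y. { unfold Y. by_cases. } have HYth : Y < (Y + 1) / th.
 { apply (Rmult_lt_reg_r th); [lra|]. replace ((Y + 1) / th * th) with (Y + 1) by (field; lra). nra. } exists ((Y + 1) / th).
 repeat split; try lra. intros al rho u v Hal RS r Hr. apply Rnot_lt_le; intro Hlt. have Hrho := rs_rho RS.
 have [R1 R2] := rs_rest RS rho (Rle_refl _). have Hth2 : Y + 1 < th * al.
 { apply (Rmult_lt_compat_r th) in Hal; [|lra]. replace ((Y + 1) / th * th) with (Y + 1) in Hal by (field; lra). lra. }
 have Hal0 : th * al < al by nra. have Fmono : forall a b, X0 < a -> a < b -> F a < F b.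
 { intros a b Ha Hb. apply (F_increasing NL); try (apply HDp; lra); auto. intros; apply Hfp; lra. } have Hrr : rho < r.
 { apply Rnot_le_lt; intro Hle. rewrite (rest_energy_start rho al u v r RS Hle) in Hlt. have T := HX2 al by_lra. lra. }
 have HES : energy f u v S1 < mu. { eapply Rle_lt_trans; [apply (rest_energy_mono NL rho al u v r S1 RS); lra|auto]. }
 have HuS : A0 < u S1 < XX + 1. { apply Low; [apply (rs_dom RS)|]. eapply Rle_lt_trans; [apply (F_le_E f u v)|auto]. }
 destruct (first_hit (fun s => - u s) rho S1 (- (th * al))) as [z [Z1 [Z2 Z3]]]; try lra.
 { intros x _. apply (continuous_opp u). apply (rs_cont RS). } have Hule : forall s, rho <= s -> u s <= al.
 { intros s Hs. apply Rnot_lt_le; intro Hgt. have T := F_le_E f u v s. have T2 := rest_energy_mono NL rho al u v rho s RS Hs.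
  rewrite (rest_energy_start rho al u v rho RS) in T2 by lra. have T3 := Fmono al (u s) by_lra Hgt. unfold F in T3. lra. }
 destruct (continuity_ab_maj f (th * al) al) as [s1 [M1 M2]]; try lra.
 { intros x Hx. apply continuous_continuity_pt, (nl_cont NL), HDp; lra. }
 destruct (continuity_ab_min Q (th * al) al) as [s2 [M3 M4]]; try lra.
 { intros x Hx. apply continuous_continuity_pt, CQf; lra. } have Hf1 : 0 < f s1 by (apply Hfp; lra).
 have HQ2 : 0 < Q s2 by (apply HQX; lra).
 destruct (pohozaev_gain Hn NL rho al u v (th * al) (f s1) (Q s2) z RS) as [G1 G2]; auto; try lra.
 { intros s Hs. specialize (Z3 s Hs). lra. } { split; [split; [apply Rlt_le, Hfp; lra|apply M1; lra]|auto]. }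
 have Hz0 : 0 < z by lra. have G3 : cth * Rpower (al / f s1) (NN / 2) <= z ^ (n + 1).
 { have Hy : 0 < al / f s1 by positive. unfold cth. rewrite Rpower_mult_distr; try lra.
  replace (z ^ (n + 1)) with (Rpower (z ^ 2) (NN / 2)).
  - apply Rle_Rpower_l; [unfold NN; lra|]. split; [positive|]. lra.
  - rewrite <- (Rpower_pow 2 z Hz0), Rpower_mult, <- (Rpower_pow _ z Hz0). f_equal. rewrite plus_INR. unfold NN. simpl.
   field. }
 have G4 := HX6 al s1 s2 by_lra by_lra by_lra. have G5 : Rabs Bd + 1 < pohozaev n f u v z.
 { eapply Rlt_le_trans; [|apply G2]. apply Rlt_le_trans with (Q s2 / (2 * NN) * (cth * Rpower (al / f s1) (NN / 2))).
  - have HN2 : 0 < cth / (2 * NN) by (apply Rdiv_lt_0_compat; unfold NN; lra).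
   apply (Rmult_lt_compat_l (cth / (2 * NN))) in G4; auto.
   replace (cth / (2 * NN) * (2 * NN / cth * (Rabs Bd + 1))) with (Rabs Bd + 1) in G4 by (field; unfold NN; lra). lra.
  - apply Rmult_le_compat_l; auto. apply Rlt_le, Rdiv_lt_0_compat; unfold NN; lra. }
 have G6 := pohozaev_loss Hn NL rho al u v CQ z S1 RS by_lra HCQ HQlow.
 have G7 : pohozaev n f u v S1 <= S1 ^ (n + 1) * mu + (INR n - 1) / 2 * (S1 ^ n * (X5 * V0)).
 { unfold pohozaev. have Pn : 0 <= S1 ^ n by positive. have Pn1 : 0 <= S1 ^ (n + 1) by positive.
  have T1 : S1 ^ (n + 1) * energy f u v S1 <= S1 ^ (n + 1) * mu by (apply Rmult_le_compat_l; lra).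
  have Hv : Rabs (v S1) <= V0.
  { specialize (Hm (u S1) by_lra). unfold energy in HES. fold F in HES. have T := Rle_abs (- F m).
   rewrite Rabs_Ropp in T. assert (v S1 ^ 2 <= V0 ^ 2) by (unfold V0; nra). apply Rabs_le. split; unfold V0 in *; nra. }
  have Hux : Rabs (u S1) <= X5. { have T := Rle_abs (- A0). rewrite Rabs_Ropp in T. apply Rabs_le. unfold X5. lra. }
  have Huv : u S1 * v S1 <= X5 * V0.
  { have T := Rle_abs (u S1 * v S1). rewrite Rabs_mult in T.
   assert (Rabs (u S1) * Rabs (v S1) <= X5 * V0) by (apply Rmult_le_compat; auto; apply Rabs_pos). lra. }
  have T2 : (INR n - 1) / 2 * (S1 ^ n * (u S1 * v S1)) <= (INR n - 1) / 2 * (S1 ^ n * (X5 * V0)).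
  { apply Rmult_le_compat_l; [lra|]. apply Rmult_le_compat_l; auto. } lra. }
 have T := Rle_abs Bd. unfold Bd in *. lra.
Qed.

Lemma continuous_on_half (h : R -> R) : continuous_on (Rle 0) h <->
  forall r e, 0 <= r -> 0 < e -> exists d, 0 < d /\ forall y, 0 <= y -> Rabs (y - r) < d -> Rabs (h y - h r) < e.
Proof.
 split.
 - intros H r e Hr He. have T := H r Hr (ball (h r) (mkposreal e He)) (locally_ball _ _). have [d Hd] := T. exists d.
  split; [apply cond_pos|]. intros y Hy Hyr. apply (Hd y Hyr Hy).
 - intros H r Hr P [e He]. have [d [Hd H2]] := H r e Hr (cond_pos e). exists (mkposreal d Hd). intros y Hyr Hy. apply He.
  apply (H2 y Hy Hyr).
Qed.

(** By the mean value theorem, a derivative that extends continuously to the end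
    point is also the one-sided derivative there. *)
Lemma C1_halfline_intro (g h : R -> R) : (forall r, 0 <= r -> continuous g r) -> (forall r, 0 < r -> is_derive g r (h r)) ->
  continuous_on (Rle 0) h -> C1_halfline g h.
Proof.
 intros Hg Hd Hh. split; auto. intros r Hr. split; [exact (is_linear_scal_l _)|]. intros x Hx e. assert (x = r) as ->.
 { apply NNPP; intro Hne. have Hp : 0 < Rabs (r - x) by by_cases. have [d H2] := Hx _ (locally_ball x (mkposreal _ Hp)).
  specialize (H2 r (ball_center r d) Hr). apply (Rlt_irrefl (Rabs (r - x))). auto. }
 have [d [Hd0 H2]] := proj1 (continuous_on_half h) Hh r e Hr (cond_pos e). exists (mkposreal d Hd0). intros y Hyr Hy.
 change (Rabs (g y - g r - (y - r) * h r) <= e * Rabs (y - r)). change (Rabs (y - r) < d) in Hyr.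
 assert (exists c, 0 <= c /\ Rabs (c - r) < d /\ g y - g r = h c * (y - r)) as [c [C1 [C2 C3]]].
 { destruct (Rtotal_order y r) as [Hlt|[->|Hgt]].
  - destruct (mean_value g h y r Hlt) as [c [C1 C2]]; [intros; apply Hg; lra|intros; apply Hd; lra|]. exists c. by_cases.
  - exists r. lra.
  - destruct (mean_value g h r y Hgt) as [c [C1 C2]]; [intros; apply Hg; lra|intros; apply Hd; lra|]. exists c. by_cases. }
 rewrite C3. replace (h c * (y - r) - (y - r) * h r) with ((h c - h r) * (y - r)) by ring. rewrite Rabs_mult.
 apply Rmult_le_compat_r; [by_cases|]. apply Rlt_le, H2; auto.
Qed.

(** From [(r^n u')' = - r^n f(u)]: the value of [u''] at the origin. *)
Lemma normal_second_limit n D f delta al u v : (1 <= n)%nat -> nonlinearity D f delta -> D al -> normal_sol n D f al u v ->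
  forall e, 0 < e -> exists d, 0 < d /\ forall r, 0 < r < d -> Rabs (v r / r + f al / (INR n + 1)) < e.
Proof.
 intros Hn NL Hal NS e He. have HN : 1 <= INR n by (apply (le_INR 1)). have [E1 E2] := normal_start NS.
 destruct (continuous_eps (fun r => f (u r)) 0 e) as [d [Hd H]]; auto.
 { apply continuous_comp; [apply (normal_cont 0 NS)|]. apply (nl_cont NL). congruence. } exists d. split; auto. intros r Hr.
 destruct (mean_value (fun r => r ^ n * v r + f al / (INR n + 1) * r ^ S n) (fun r => r ^ n * (f al - f (u r))) 0 r) as [c
  [C1 C2]]; try lra.
 - intros x _. apply continuous_sum.
  + apply continuous_prod; [|apply (normal_cont x NS)]. apply (ex_derive_continuous (V := R_NormedModule)). auto_derive.
   auto.
  + apply (ex_derive_continuous (V := R_NormedModule)). auto_derive. auto.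
 - intros x Hx. destruct (normal_derive x NS) as [_ O2]; [lra|].
  apply (is_derive_value _ _ ((INR n * x ^ pred n * v x + x ^ n * (- (INR n / x) * v x - f (u x))) + f al / (INR n + 1) *
   (INR (S n) * x ^ pred (S n)))).
  + apply is_derive_sum; [|apply is_derive_cmul, is_derive_Reals, derivable_pt_lim_pow]. apply is_derive_prod; auto.
   apply is_derive_Reals, derivable_pt_lim_pow.
  + real_eq. rewrite S_INR. destruct n as [|m]; [lia|]. simpl pow. field. lra.
 - rewrite E2 in C2. have P : 0 < r ^ n by positive. have Pc : 0 <= c ^ n by positive.
  have Pcr : c ^ n <= r ^ n by (apply pow_incr; lra).
  replace (v r / r + f al / (INR n + 1)) with (c ^ n * (f al - f (u c)) / r ^ n).
  + unfold Rdiv. rewrite !Rabs_mult, Rabs_right, Rabs_inv, (Rabs_right (r ^ n)) by lra.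
   apply (Rmult_lt_reg_r (r ^ n)); auto. field_simplify; [|lra]. specialize (H c ltac:(by_cases)). rewrite E1 in H.
   rewrite <- Rabs_Ropp in H. replace (- (f (u c) - f al)) with (f al - f (u c)) in H by ring.
   apply Rle_lt_trans with (r ^ n * Rabs (f al - f (u c))); [apply Rmult_le_compat_r; [apply Rabs_pos|auto]|]. nra.
  + apply (Rmult_eq_reg_r (r ^ n * r)); [|apply Rgt_not_eq, Rmult_lt_0_compat; lra].
   replace (c ^ n * (f al - f (u c)) / r ^ n * (r ^ n * r)) with (c ^ n * (f al - f (u c)) * (r - 0)) by (field; lra).
   rewrite <- C2. simpl pow. field. lra.
Qed.

Lemma normal_is_solution n gm gp f delta al u v : (1 <= n)%nat -> nonlinearity (open_dom gm gp) f delta ->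
  open_dom gm gp al -> normal_sol n (open_dom gm gp) f al u v -> settles u -> is_solution (S n) gm gp f u.
Proof.
 intros Hn NL Hal NS Hset. assert (HN : 1 <= INR n) by (apply (le_INR 1); auto). destruct (normal_start NS) as [E1 E2].
 assert (Cu : forall r, continuous u r /\ continuous v r) by (intro; apply (normal_cont r NS)).
 assert (O : forall r, 0 < r -> is_derive u r (v r) /\ is_derive v r (- (INR n / r) * v r - f (u r))) by (intros; apply
  (normal_derive _ NS); auto). assert (Hdom : forall r, open_dom gm gp (u r)) by (apply (rs_dom (ns_rest NS))).
 assert (Cf : forall r, continuous (fun r => f (u r)) r).
 { intro r. apply continuous_comp; [apply Cu|]. apply (nl_cont NL); auto. }
 split; [intros r _; destruct (Hdom r); split; auto; apply Rbar_lt_le; auto|]. split.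
 - exists v, (fun r => if Rle_dec r 0 then - f al / (INR n + 1) else - (INR n / r) * v r - f (u r)).
  assert (Cv : continuous_on (Rle 0) v).
  { apply continuous_on_half. intros r e _ He. destruct (continuous_eps v r e (proj2 (Cu r)) He) as [d [Hd H]]. exists d.
   auto. }
  split; [|split; [|split]].
  + apply C1_halfline_intro; auto; [intros; apply Cu|intros r Hr; apply O; auto].
  + apply C1_halfline_intro; [intros; apply Cu| |].
   * intros r Hr. destruct Rle_dec; [lra|]. apply O; auto.
   * apply continuous_on_half. intros r e Hr He. destruct (Rle_lt_or_eq_dec 0 r Hr) as [Hp| <-].
    -- destruct (continuous_eps (fun r => - (INR n / r) * v r - f (u r)) r e) as [d [Hd H]]; auto.
      { apply continuous_diff; auto. apply continuous_prod; [|apply Cu].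
       apply (ex_derive_continuous (V := R_NormedModule)). auto_derive. lra. }
      exists (Rmin d r).
      split; [apply Rmin_glb_lt; auto|]. intros y Hy Hyr. assert (M1 := Rmin_l d r). assert (M2 := Rmin_r d r).
      apply Rabs_def2 in Hyr as Hy2. destruct (Rle_dec y 0); [lra|]. destruct (Rle_dec r 0); [lra|]. apply H. lra.
    -- destruct (normal_second_limit n _ f delta al u v Hn NL Hal NS (e / (2 * INR n))) as [d1 [Hd1 H1]]; [apply
       Rdiv_lt_0_compat; lra|]. destruct (continuous_eps (fun r => f (u r)) 0 (e / 2) (Cf 0)) as [d2 [Hd2 H2]]; [lra|].
      exists (Rmin d1 d2). split; [apply Rmin_glb_lt; auto|]. intros y Hy Hyr. assert (M1 := Rmin_l d1 d2).
      assert (M2 := Rmin_r d1 d2). destruct (Rle_dec 0 0); [|lra]. case: (Rle_dec y 0) => [Hle|Hgt]. { by_cases. }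
      rewrite Rabs_right in Hyr by lra. specialize (H1 y by_lra).
      specialize (H2 y ltac:(rewrite Rminus_0_r, Rabs_right; lra)). rewrite E1 in H2.
      replace (- (INR n / y) * v y - f (u y) - - f al / (INR n + 1)) with (- (INR n * (v y / y + f al / (INR n + 1))) -
       (f (u y) - f al)) by (field; lra). apply (Rmult_lt_compat_l (INR n)) in H1; [|lra].
      replace (INR n * (e / (2 * INR n))) with (e / 2) in H1 by (field; lra).
      rewrite <- (Rabs_right (INR n)) in H1 at 1 by lra. rewrite <- Rabs_mult in H1. by_cases.
  + intros r Hr. destruct (Rle_dec r 0); [lra|]. rewrite S_INR. lra.
  auto.
 - intros P [e He]. destruct (Hset e (cond_pos e)) as [X HX]. exists X. intros x Hx. apply He. change (Rabs (u x - 0) < e).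
  rewrite Rminus_0_r. apply HX. lra.
Qed.

(** ** Sign changes *)

Lemma zero_list u v k r : kth_zero u v k r -> exists l, NoDup l /\ length l = k /\
  forall x, In x l <-> 0 < x <= r /\ u x = 0 /\ v x <> 0.
Proof.
 revert r. induction k; intros r H.
 - simpl in H. exists nil. split; [constructor|]. split; auto. split; [intros []|lra].
 - have [s [H1 [H2 [H3 [H4 H5]]]]] := H. have [l [L1 [L2 L3]]] := IHk s H1. have T := kz_nonneg _ _ _ _ H1. exists (r :: l).
  split; [constructor; auto; intro Hin; apply L3 in Hin; lra|]. split; [simpl; auto|]. intro x. simpl. rewrite L3. split.
  + intros [<-|Hx]; [lra|]. lra.
  + destruct (Req_dec x r) as [->|Hne]; auto. right. destruct (Rle_lt_dec x s); [lra|]. destruct (H5 x); lra.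
Qed.

(** A zero with [u' = 0] is final for a normalized solution, so [u] vanishes
    identically on its right. *)
Lemma sign_change_zero n D f al u v r : normal_sol n D f al u v -> 0 < r ->
  (changes_sign_at u r <-> u r = 0 /\ v r <> 0).
Proof.
 intros NS Hr. have [Cu _] := normal_cont r NS. split.
 - intros H. have Hpt : forall P, at_left r P -> forall e, 0 < e -> exists y, Rabs (y - r) < e /\ P y.
  { intros P [d Hd] e He. set (h := Rmin d e). have M1 := Rmin_l d e. have M2 := Rmin_r d e.
   have M3 : 0 < h by (apply Rmin_glb_lt; auto; apply cond_pos). fold h in M1, M2.
   have Hy : Rabs (r - h / 2 - r) = h / 2 by by_cases. exists (r - h / 2). split; [lra|].
   apply Hd; [change (Rabs (r - h / 2 - r) < d); lra|lra]. }
  have Hpt2 : forall P, at_right r P -> forall e, 0 < e -> exists y, r < y /\ Rabs (y - r) < e /\ P y.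
  { intros P [d Hd] e He. set (h := Rmin d e). have M1 := Rmin_l d e. have M2 := Rmin_r d e.
   have M3 : 0 < h by (apply Rmin_glb_lt; auto; apply cond_pos). fold h in M1, M2.
   have Hy : Rabs (r + h / 2 - r) = h / 2 by by_cases. exists (r + h / 2). repeat split; try lra.
   apply Hd; [change (Rabs (r + h / 2 - r) < d); lra|lra]. }
  have Hu0 : u r = 0.
  { apply NNPP; intro Hne. destruct (continuous_eps u r (Rabs (u r)) Cu) as [e [He Hc]]; [by_cases|].
   case: H => [[H1 H2]|[H1 H2]]; destruct (Hpt _ H1 e He) as [y [Y1 Y2]]; destruct (Hpt2 _ H2 e He) as [z [Z0 [Z1 Z2]]];
    specialize (Hc y Y1) as Hy; specialize (Hc z Z1) as Hz; apply Rabs_def2 in Hy; apply Rabs_def2 in Hz; unfold Rabs in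
    Hy, Hz; destruct Rcase_abs; lra. }
  split; auto. intro Hv. have Hu : forall y, r < y -> u y = 0.
  { intros y Hy. apply (ns_dead NS r); [lra|by_cases]. }
  case: H => [[_ H2]|[_ H2]]; destruct (Hpt2 _ H2 1 Rlt_0_1) as [z [Z0 [_ Z2]]]; specialize (Hu z Z0); lra.
 - intros [Hu Hv]. have [O _] := normal_derive r NS Hr. have [e [He H]] := simple_zero u r (v r) O Hu Hv.
  have L : locally r (fun y => y <> r -> 0 < v r * (y - r) * u y). { exists (mkposreal e He). auto. }
  destruct (Rdichotomy _ _ Hv) as [Hneg|Hpos]; [right|left]; split; unfold at_left, at_right, within; (eapply filter_imp;
   [|exact L]); simpl; intros y Hy Hyr; specialize (Hy by_lra).
  + assert (0 < v r * (y - r)) by nra. nra.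
  + assert (v r * (y - r) < 0) by nra. nra.
  + assert (v r * (y - r) < 0) by nra. nra.
  + assert (0 < v r * (y - r)) by nra. nra.
Qed.

Lemma normal_sign_changes n D f al u v k : normal_sol n D f al u v -> al <> 0 ->
  has_zeros u v k -> ~ has_zeros u v (S k) -> exactly_sign_changes k u.
Proof.
 intros NS Hal [r Hr] Hno. have [l [L1 [L2 L3]]] := zero_list u v k r Hr. exists l. do 2 (split; auto). intro x. rewrite L3.
 split.
 - split; [lra|]. apply (sign_change_zero n D f al u v x NS); try lra.
 - intros [Hx H]. apply (sign_change_zero n D f al u v) in H; auto. do 2 (split; auto). apply Rnot_lt_le; intro Hlt.
  have [H1 H2] := H. have [r' [H3 _]] := kz_next al u v k r x NS Hal Hr Hlt H1 H2. apply Hno. exists r'. auto.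
Qed.

Definition next_max (D : R -> Prop) (f : R -> R) (a b : R) : Prop :=
  a < b /\ D b /\ local_max (primitive f) b /\ primitive f a < primitive f b /\
  forall c, a < c < b -> local_max (primitive f) c -> ~ primitive f a < primitive f c.

Definition bound_state (n : nat) (D : R -> Prop) (f : R -> R) (k : nat) (al : R) (u : R -> R) : Prop :=
  exists v, normal_sol n D f al u v /\ settles u /\ has_zeros u v k /\ ~ has_zeros u v (S k).

Section Chain.

Context {n D f delta} (n_pos : (1 <= n)%nat) (NL : nonlinearity D f delta).

Let F := primitive f.

Lemma primitive_0 : F 0 = 0.
Proof. exact (RInt_point 0 f). Qed.

Lemma larger_nearby x e : D x -> f x <> 0 -> 0 < e -> exists t, Rabs (t - x) < e /\ 0 < f x * (t - x) /\ F x < F t.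
Proof.
 intros Dx Hf He. have Hd : is_derive (fun t => F t + - F x) x (f x).
 { apply (is_derive_value _ _ (f x + 0)); [|lra].
  apply is_derive_sum; [apply (F_derive NL); auto|exact (is_derive_const _ x)]. }
 destruct (simple_zero _ x (f x) Hd) as [h [Hh H]]; try lra. set (k := Rmin h e / 2). have M1 := Rmin_l h e.
 have M2 := Rmin_r h e. have M3 : 0 < Rmin h e by by_cases.
 assert (exists t, Rabs (t - x) = k /\ 0 < f x * (t - x)) as [t [T1 T2]].
 { destruct (Rdichotomy _ _ Hf).
  - exists (x - k). replace (x - k - x) with (- k) by ring. rewrite Rabs_Ropp, Rabs_right by (unfold k; lra).
   assert (0 < k) by positive. nra.
  - exists (x + k). replace (x + k - x) with k by ring. rewrite Rabs_right by (unfold k; lra). split; auto. positive. }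
 exists t. split; [unfold k in T1; lra|]. assert (0 < f x * (t - x) * (F t + - F x)).
 { apply H; [unfold k in T1; lra|]. nra. } nra.
Qed.

Lemma local_max_critical b : D b -> local_max F b -> f b = 0.
Proof.
 intros Db [e He]. apply NNPP; intro Hf. have [t [T1 [_ T2]]] := larger_nearby b e Db Hf (cond_pos e). specialize (He t T1).
 lra.
Qed.

(** A point between higher than [F b] would yield a local maximum between [a] and
    [b] that is higher than [F a]. *)
Lemma next_max_dominates a b : D a -> next_max D f a b -> forall x, a <= x <= b -> F x <= F b.
Proof.
 intros Da [H1 [H2 [H3 [H4 H5]]]] x Hx.
 have Hc : forall x, a <= x <= b -> continuous F x by (intros; apply (F_cont NL), (nl_conv NL a b)).
 destruct (continuity_ab_maj F a b) as [c [C1 C2]]; [lra|intros; apply continuous_continuity_pt; auto|].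
 specialize (C1 x Hx) as Hxc. case: (Rle_lt_dec (F c) (F b)) => [|Hlt]; [lra|]. fold F in H4, H5.
 assert (a < c) by (apply Rnot_le_lt; intro; assert (c = a) by lra; subst c; lra).
 assert (c < b) by (apply Rnot_le_lt; intro; assert (c = b) by lra; subst c; lra). destruct (H5 c); try lra.
 apply (filter_imp (F := locally c) (fun y => a < y /\ y < b)); [intros y Hy; apply C1; lra|].
 apply filter_and; [apply locally_gt; auto|apply locally_lt; auto].
Qed.

Variables (g : nat -> R) (m : nat).
Hypothesis g0 : g O = 0.
Hypothesis g_next : forall i, (i < m)%nat -> next_max D f (g i) (g (S i)).

Lemma chain_facts i : (i <= m)%nat -> D (g i) /\ 0 <= g i /\ forall x, 0 <= x <= g i -> F x <= F (g i).
Proof.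
 induction i; intro Hi.
 - rewrite g0. split; [apply (nl_zero NL)|]. split; [lra|]. intros x Hx. replace x with 0 by lra. lra.
 - destruct IHi as [A1 [A2 A3]]; [lia|]. have T := g_next i ltac:(lia). have [B1 [B2 [B3 [B4 B5]]]] := T. split; auto.
  split; [lra|]. intros x Hx. destruct (Rle_lt_dec x (g i)).
  + specialize (A3 x by_lra). unfold F in *. lra.
  + apply (next_max_dominates (g i)); auto. lra.
Qed.

Lemma chain_positive i : (1 <= i <= m)%nat -> delta <= g i /\ 0 < g i /\ F (g 1%nat) <= F (g i) /\ 0 < F (g i) /\ f (g i) = 0.
Proof.
 intros Hi. destruct i as [|i]; [lia|]. have [A1 [A2 [A3 [A4 A5]]]] := g_next 0%nat ltac:(lia). rewrite g0 in A1, A4.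
 fold F in A4. rewrite primitive_0 in A4. have [B1 [B2 B3]] := chain_facts (S i) ltac:(lia).
 have Hmon : forall j, (1 <= j <= m)%nat -> g 1%nat <= g j /\ F (g 1%nat) <= F (g j).
 { induction j; intro Hj; [lia|]. destruct (Nat.eq_dec j 0) as [->|]; [lra|]. destruct IHj as [C1 C2]; [lia|].
  have [D1 [_ [_ [D4 _]]]] := g_next j ltac:(lia). fold F in D4. lra. }
 have [C1 C2] := Hmon (S i) Hi.
 repeat split; try lra.
 - have T := nl_neg NL (g (S i)) B1. rewrite Rabs_right in T by lra. fold F in T. lra.
 - apply local_max_critical; auto. apply g_next. lia.
Qed.

Context (bm bp xm xp mu : R) (W : well D f 0 bm bp xm xp mu) (bp_delta : delta <= bp) (bm_delta : bm <= - delta).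
Hypothesis m_pos : (1 <= m)%nat.
Hypothesis xp_le : xp <= g 1%nat.

Lemma well_below_chain i : (1 <= i <= m)%nat -> mu < F (g i).
Proof.
 intros Hi. have [_ [_ [H1 [_ _]]]] := chain_positive i Hi. have [_ [P1 [_ [_ P2]]]] := chain_positive 1 ltac:(lia).
 have [_ [_ P3]] := chain_facts 1 ltac:(lia). have [_ [O1 O2]] := w_order W. have Ex := w_xp W. fold F in Ex.
 have Fx := w_fp W xp by_lra.
 have Hlt : xp < g 1%nat by (apply Rnot_le_lt; intro; replace xp with (g 1%nat) in Fx by lra; lra).
 destruct (larger_nearby xp (g 1%nat - xp) (w_right W)) as [t [T1 [T2 T3]]]; try lra. apply Rabs_def2 in T1.
 assert (0 < t - xp) by nra. specialize (P3 t by_lra). lra.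
Qed.

Context (U V : R -> R -> R) (Fam : forall al, D al -> al <> 0 -> normal_sol n D f al (U al) (V al)).

Let good k al := bound_state n D f k al (U al).

Lemma sweep_states I sg al1 : open_interval D I -> Rabs sg = 1 -> finite_state D f xm xp mu U V I al1 -> high_end f mu U V I sg ->
  exists k0, forall k, (k0 <= k)%nat -> exists al, I al /\ 0 < sg * (al - al1) /\ good k al.
Proof.
 intros OI Hsg [H1 [H2 [k1 H3]]] HE. exists (S k1). intros k Hk.
 have [al [A1 [A2 A3]]] := sweep n_pos NL bm bp xm xp mu W bp_delta bm_delta U V Fam I sg al1 k1 OI Hsg H1 H2 H3 HE k
  ltac:(lia). exists al. repeat split; auto. exists (V al). destruct (oi_dom OI al A1). auto.
Qed.

Lemma first_interval : exists k0, forall k, (k0 <= k)%nat -> exists al, 0 < al < g 1%nat /\ good k al.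
Proof.
 destruct (chain_positive 1 ltac:(lia)) as [P0 [P1 [_ [_ P2]]]]. destruct (chain_facts 1 ltac:(lia)) as [P3 _].
 assert (P4 := well_below_chain 1 ltac:(lia)). assert (Hdel := nl_delta NL). set (I := fun x => 0 < x < g 1%nat).
 assert (ID : forall x, I x -> D x) by (intros x [X1 X2]; apply (nl_conv NL 0 (g 1%nat)); [apply (nl_zero NL)|auto|lra]).
 assert (OI : open_interval D I).
 { constructor; unfold I.
  - intros; lra.
  - intros x Hx. exists (Rmin x (g 1%nat - x)). split; [apply Rmin_glb_lt; lra|]. by_cases.
  split; auto; lra. }
 set (al1 := delta / 2). assert (I1 : I al1) by (unfold I, al1; lra).
 assert (FS : finite_state D f xm xp mu U V I al1).
 { destruct (normal_start (Fam al1 (ID _ I1) ltac:(unfold al1; lra))) as [E1 E2].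
  apply (finite_negative n D f delta n_pos NL bm bp xm xp mu W bp_delta bm_delta U V Fam I OI al1 0 I1 (Rle_refl _)).
  - unfold energy. rewrite E1, E2. assert (T := nl_neg NL al1 (ID _ I1)). rewrite Rabs_right in T by (unfold al1; lra).
   specialize (T ltac:(unfold al1; lra)). lra.
  - rewrite E1, Rabs_right; unfold al1; lra. }
 destruct (sweep_states I 1 al1 OI Rabs_R1 FS) as [k0 Hk0].
 - intro S0. destruct (critical_end n D f delta mu (g 1%nat) S0 n_pos NL P3 by_lra P2 P4) as [h [Hh H]].
  assert (M1 := Rmin_l h (g 1%nat)). assert (M2 := Rmin_r h (g 1%nat)). assert (M3 : 0 < Rmin h (g 1%nat)) by by_cases.
  exists (g 1%nat - Rmin h (g 1%nat) / 2). split; [unfold I; lra|]. intros al Hal Hal2. unfold I in Hal.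
  apply (H al 0 (U al) (V al)); [apply ID; auto|apply Rabs_def1; lra| |lra].
  apply (ns_rest (Fam al (ID al Hal) by_lra)).
 - exists k0. intros k Hk. destruct (Hk0 k Hk) as [al [A1 [_ A2]]]. exists al. auto.
Qed.

Lemma interval_two I p q : open_interval D I -> (forall al, I al -> delta <= al) ->
  (forall S0, exists a b, I a /\ I b /\ forall al rho u v, I al -> al < a \/ b < al ->
     rest_sol n D f rho al u v -> forall r, r <= S0 -> mu <= energy f u v r) ->
  0 < p -> D q -> p < q -> F p < F q -> (forall x, 0 <= x <= p -> F x <= F p) -> (forall x, p < x < q -> I x) ->
  exists k0, forall k, (k0 <= k)%nat -> exists x y, I x /\ I y /\ x < y /\ good k x /\ good k y.
Proof.
 intros OI Idel Iends Hp Dq Hpq HF HFp HI.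
 have [al1 FS] := finite_start n D f delta n_pos NL bm bp xm xp mu W bp_delta bm_delta U V Fam I OI Idel Iends p q Hp Dq Hpq
  HF HFp HI. have HR : forall al, I al -> rest_sol n D f 0 al (U al) (V al).
 { intros al Hal. have [X1 X2] := oi_dom OI al Hal. apply (ns_rest (Fam al X1 X2)). }
 destruct (sweep_states I 1 al1 OI Rabs_R1 FS) as [k1 Hk1].
 { intro S0. have [a [b [_ [Hb H]]]] := Iends S0. exists b. split; auto. intros al Hal Hal2. apply (H al 0); auto; try lra. }
 destruct (sweep_states I (-1) al1 OI) as [k2 Hk2]; auto; [by_cases| |].
 { intro S0. have [a [b [Ha [_ H]]]] := Iends S0. exists a. split; auto. intros al Hal Hal2. apply (H al 0); auto; try lra. }
 exists (max k1 k2). intros k Hk. have [y [Y1 [Y2 Y3]]] := Hk1 k ltac:(lia). have [x [X1 [X2 X3]]] := Hk2 k ltac:(lia).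
 exists x, y. repeat split; auto; lra.
Qed.

(** Both ends are critical points. *)
Lemma middle_interval i : (1 <= i)%nat -> (i < m)%nat ->
  exists k0, forall k, (k0 <= k)%nat -> exists x y, g i < x /\ x < y /\ y < g (S i) /\ good k x /\ good k y.
Proof.
 intros Hi1 Hi2. destruct (chain_positive i ltac:(lia)) as [P0 [P1 [_ [_ P2]]]].
 destruct (chain_facts i ltac:(lia)) as [P3 [_ P5]]. assert (P4 := well_below_chain i ltac:(lia)).
 destruct (chain_positive (S i) ltac:(lia)) as [_ [Q1 [_ [_ Q2]]]]. destruct (chain_facts (S i) ltac:(lia)) as [Q3 _].
 assert (Q4 := well_below_chain (S i) ltac:(lia)). destruct (g_next i Hi2) as [N1 [_ [_ [N2 _]]]].
 set (I := fun x => g i < x < g (S i)).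
 assert (ID : forall x, I x -> D x) by (intros x [X1 X2]; apply (nl_conv NL (g i) (g (S i))); auto; lra).
 assert (OI : open_interval D I).
 { constructor; unfold I.
  - intros; lra.
  - intros x Hx. exists (Rmin (x - g i) (g (S i) - x)). split; [apply Rmin_glb_lt; lra|]. by_cases.
  split; auto; lra. }
 destruct (interval_two I (g i) (g (S i)) OI) as [k0 Hk0]; auto.
 - unfold I. intros; lra.
 - intro S0. destruct (critical_end n D f delta mu (g i) S0 n_pos NL P3 by_lra P2 P4) as [h1 [Hh1 H1]].
  destruct (critical_end n D f delta mu (g (S i)) S0 n_pos NL Q3 by_lra Q2 Q4) as [h2 [Hh2 H2]].
  set (L := g (S i) - g i) in *. assert (M1 := Rmin_l h1 L). assert (M2 := Rmin_r h1 L).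
  assert (M3 : 0 < Rmin h1 L) by (apply Rmin_glb_lt; unfold L; lra). assert (M4 := Rmin_l h2 L). assert (M5 := Rmin_r h2 L).
  assert (M6 : 0 < Rmin h2 L) by by_cases. exists (g i + Rmin h1 L / 2), (g (S i) - Rmin h2 L / 2).
  split; [unfold I, L in *; lra|]. split; [unfold I, L in *; lra|]. intros al rho u v Hal [Ha|Hb] RS.
  + apply (H1 al rho u v); auto. apply Rabs_def1; unfold I in Hal; lra.
  + apply (H2 al rho u v); auto. apply Rabs_def1; unfold I in Hal; lra.
 - exists k0. intros k Hk. destruct (Hk0 k Hk) as [x [y [X1 [X2 X3]]]]. exists x, y. unfold I in *. intuition.
Qed.

(** The lower end is a critical point, the upper one is the end of the domain. *)
Lemma last_interval :
  (forall S0 q, D q -> exists q1, q < q1 /\ D q1 /\ forall al rho u v, q1 < al ->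
     rest_sol n D f rho al u v -> forall r, r <= S0 -> mu <= energy f u v r) ->
  exists k0, forall k, (k0 <= k)%nat -> exists x y, g m < x /\ x < y /\ D x /\ D y /\ good k x /\ good k y.
Proof.
 intros Hend. have [P0 [P1 [_ [_ P2]]]] := chain_positive m ltac:(lia). have [P3 [_ P5]] := chain_facts m ltac:(lia).
 have P4 := well_below_chain m ltac:(lia). set (p := g m) in *.
 have [A [q [_ [Dq [_ [[_ Hq] [_ HFq]]]]]]] := nl_coercive NL p P3. set (I := fun x => p < x /\ D x).
 have OI : open_interval D I.
 { constructor; unfold I.
  - intros a b x [A1 A2] [B1 B2] Hx. split; [lra|]. apply (nl_conv NL a b); auto.
  - intros x [Hx1 Hx2]. have [e [He H]] := nl_open NL x Hx2. exists (Rmin e (x - p)). split; [by_cases|].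
   have M1 := Rmin_l e (x - p). split; [by_cases|apply H; lra].
  abs_bounds. }
 destruct (interval_two I p q OI) as [k0 Hk0]; auto; try lra.
 - intros al [H1 _]. lra.
 - intro S0. have [h [Hh H]] := critical_end n D f delta mu p S0 n_pos NL P3 by_lra P2 P4.
  have [q1 [X1 [X2 X3]]] := Hend S0 p P3. have M2 := Rmin_r h (q1 - p). have M3 : 0 < Rmin h (q1 - p) by by_cases.
  exists (p + Rmin h (q1 - p) / 2), q1. split; [split; [lra|apply (nl_conv NL p q1); auto; lra]|]. repeat split; auto.
  intros al rho u v [Hal1 Hal2] [Ha|Hb] RS; [|apply (X3 al rho u v); auto]. apply (H al rho u v); auto. by_cases.
 - split; [lra|]. apply (nl_conv NL p q); auto; lra.
 - exists k0. intros k Hk. have [x [y [[X1 X2] [[X3 X4] [X5 [X6 X7]]]]]] := Hk0 k Hk. exists x, y. abs_bounds.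
Qed.

(** Intervals of heights are disjoint, so the states found in them are distinct. *)
Lemma states_below i : (1 <= i <= m)%nat -> exists k0, forall k, (k0 <= k)%nat ->
  exists l, NoDup l /\ length l = (2 * i - 1)%nat /\ forall x, In x l -> 0 < x < g i /\ good k x.
Proof.
 induction i as [|i IH]; intros Hi; [lia|]. have [->|Hne] := Nat.eq_dec i 0.
 - have [k0 Hk0] := first_interval. exists k0. intros k Hk. have [al [A1 A2]] := Hk0 k Hk. exists (al :: nil).
  split; [constructor; [intros []|constructor]|]. split; auto. intros x [<-|[]]; auto.
 - destruct IH as [k1 H1]; [lia|]. destruct (middle_interval i) as [k2 H2]; [lia|lia|]. exists (max k1 k2). intros k Hk.
  have [l [L1 [L2 L3]]] := H1 k ltac:(lia). have [x [y [X1 [X2 [X3 [X4 X5]]]]]] := H2 k ltac:(lia).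
  have [_ [G _]] := chain_facts i ltac:(lia). exists (x :: y :: l). split; [|split].
  + constructor; [intros [E|Hin]; [lra|apply L3 in Hin; lra]|]. constructor; auto. intro Hin. apply L3 in Hin. lra.
  + simpl. lia.
  + intros z [<-|[<-|Hz]]; [split; auto; lra|split; auto; lra|]. destruct (L3 z Hz). split; auto; lra.
Qed.

End Chain.

Arguments chain_facts : clear implicits.
Arguments chain_positive : clear implicits.
Arguments well_below_chain : clear implicits.
Arguments last_interval : clear implicits.
Arguments states_below : clear implicits.

(** One state below [g 1] and two in each further interval; the last interval
    needs control of the upper end of the domain. *)
Lemma chain_states n D f delta g m : (1 <= n)%nat -> nonlinearity D f delta -> g O = 0 -> (1 <= m)%nat ->
  (forall i, (i < m)%nat -> next_max D f (g i) (g (S i))) ->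
  (exists k0, forall k, (k0 <= k)%nat -> exists l, NoDup l /\ length l = (2 * m - 1)%nat /\
     forall x, In x l -> 0 < x /\ D x /\ exists u, bound_state n D f k x u) /\
  ((forall mu S0 q, 0 <= mu < primitive f (g m) -> D q -> exists q1, q < q1 /\ D q1 /\ forall al rho u v, q1 < al ->
     rest_sol n D f rho al u v -> forall r, r <= S0 -> mu <= energy f u v r) ->
   exists k0, forall k, (k0 <= k)%nat -> exists l, NoDup l /\ length l = (2 * m + 1)%nat /\
     forall x, In x l -> 0 < x /\ D x /\ exists u, bound_state n D f k x u).
Proof.
 intros Hn NL g0 Hm Hg. have [_ [P1 [_ [P2 _]]]] := chain_positive n D f delta Hn NL g m g0 Hg 1 ltac:(lia).
 have [P3 _] := chain_facts n D f delta Hn NL g m g0 Hg 1 ltac:(lia).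
 have [bm [bp [xm [xp [mu [W [W1 [W2 W3]]]]]]]] := well_exists D f delta 0 (g 1%nat) NL (Rle_refl _) P1 P3 P2.
 have HF : exists UV : R -> (R -> R) * (R -> R), forall al, D al -> al <> 0 -> normal_sol n D f al (fst (UV al)) (snd (UV
  al)).
 { apply (choice (fun al (p : (R -> R) * (R -> R)) => D al -> al <> 0 -> normal_sol n D f al (fst p) (snd p))). intro al.
  have [[X1 X2]|Hno] := classic (D al /\ al <> 0).
  - have [u [v H]] := normal_exists Hn NL al X1 X2. exists (u, v). auto.
  - exists (fun _ => 0, fun _ => 0). tauto. }
 have [UV Fam] := HF.
 have [k1 H1] := states_below n D f delta Hn NL g m g0 Hg bm bp xm xp mu W W2 W3 Hm W1 (fun al => fst (UV al)) (fun al => snd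
  (UV al)) Fam m ltac:(lia). have [G1 [G2 _]] := chain_facts n D f delta Hn NL g m g0 Hg m ltac:(lia).
 have HD : forall x, 0 < x < g m -> D x. { intros x Hx. apply (nl_conv NL 0 (g m)); auto; [apply (nl_zero NL)|lra]. } split.
 - exists k1. intros k Hk. have [l [L1 [L2 L3]]] := H1 k Hk. exists l. do 2 (split; auto). intros x Hx.
  have [X1 X2] := L3 x Hx. split; [lra|]. split; auto. eexists; exact X2.
 - intros Hend. have Hmu := well_below_chain n D f delta Hn NL g m g0 Hg bm bp xm xp mu W Hm W1 m ltac:(lia).
  have Hmu0 := w_mu W.
  destruct (last_interval n D f delta Hn NL g m g0 Hg bm bp xm xp mu W W2 W3 Hm W1 (fun al => fst (UV al)) (fun al => snd
   (UV al)) Fam) as [k2 H2]. { intros S0 q Dq. apply Hend; auto. lra. } exists (max k1 k2). intros k Hk.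
  have [l [L1 [L2 L3]]] := H1 k ltac:(lia). have [x [y [X1 [X2 [X3 [X4 [X5 X6]]]]]]] := H2 k ltac:(lia).
  exists (x :: y :: l). split; [|split].
  + constructor; [intros [E|Hin]; [lra|apply L3 in Hin; lra]|]. constructor; auto. intro Hin. apply L3 in Hin. lra.
  + simpl. lia.
  + intros z [<-|[<-|Hz]].
   * split; [lra|]. split; auto. eexists; exact X5.
   * split; [lra|]. split; auto. eexists; exact X6.
   * have [Z1 Z2] := L3 z Hz. split; [lra|]. split; auto. eexists; exact Z2.
Qed.

Lemma at_least_list (c : Z) (P : (R -> R) -> Prop) l : NoDup l -> (c <= Z.of_nat (length l))%Z ->
  (forall x, In x l -> exists u, u 0 = x /\ P u) -> at_least c P.
Proof.
 intros Hl Hc H. destruct (choice (fun x u => In x l -> u 0 = x /\ P u)) as [w Hw].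
 { intro x.
  case: (classic (In x l)) => Hin; [destruct (H x Hin) as [u Hu]; exists u; auto|exists (fun _ => 0); tauto]. }
 exists (fun i => w (nth i l 0)). split.
 - intros i Hi. apply Hw, nth_In. lia.
 - intros i j Hi Hj Hij. exists 0. split; [lra|].
  rewrite (proj1 (Hw (nth i l 0) ltac:(apply nth_In; lia))), (proj1 (Hw (nth j l 0) ltac:(apply nth_In; lia))). intro E.
  apply Hij. apply (proj1 (NoDup_nth l 0)); auto; lia.
Qed.

Lemma bound_state_solution n gm gp f delta k al u : (1 <= n)%nat -> nonlinearity (open_dom gm gp) f delta ->
  open_dom gm gp al -> al <> 0 -> bound_state n (open_dom gm gp) f k al u ->
  u 0 = al /\ is_solution (S n) gm gp f u /\ exactly_sign_changes k u.
Proof.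
 intros Hn NL Hal Hal0 [v [NS [H1 [H2 H3]]]]. split; [apply (normal_start NS)|]. split.
 - apply (normal_is_solution n gm gp f delta al u v); auto.
 - apply (normal_sign_changes n (open_dom gm gp) f al u v); auto.
Qed.

(** Negative heights are positive heights for the reflected nonlinearity. *)
Lemma bound_state_mirror n D f k al u : bound_state n (fun s => D (- s)) (mirror f) k al u ->
  bound_state n D f k (- al) (fun r => - u r).
Proof.
 intros [v [NS [H1 [H2 H3]]]]. exists (fun r => - v r). apply normal_sol_mirror in NS.
 replace (mirror (mirror f)) with f in NS by (apply functional_extensionality; intro s; unfold mirror; rewrite
  !Ropp_involutive; auto).
 replace (fun s => D (- - s)) with D in NS by (apply functional_extensionality; intro s; rewrite Ropp_involutive; auto).
 split; auto. split; [|rewrite <- !zeros_mirror; auto]. intros e He. have [S0 HS] := H1 e He. exists S0. intros t Ht.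
 rewrite Rabs_Ropp. auto.
Qed.

Lemma local_max_mirror D f delta s : nonlinearity D f delta -> D s ->
  (local_max (primitive f) s <-> local_max (primitive (mirror f)) (- s)).
Proof.
 intros NL Ds. have [e [He H]] := nl_open NL s Ds. have PM : forall x, D x -> primitive (mirror f) (- x) = primitive f x.
 { intros x Hx. rewrite (primitive_mirror NL); rewrite Ropp_involutive; auto. }
 have Hopp : forall x y, Rabs (- y - x) = Rabs (y - - x) by by_cases.
 split; intros [d Hd]; (assert (Hm : 0 < Rmin d e) by (apply Rmin_glb_lt; auto; apply cond_pos)); exists (mkposreal _ Hm);
  assert (M1 := Rmin_l d e); assert (M2 := Rmin_r d e); intros y Hy.
 - change (Rabs (y - - s) < Rmin d e) in Hy. rewrite <- Hopp in Hy.
  rewrite <- (Ropp_involutive y), !PM; auto; [|apply H; lra]. apply Hd. change (Rabs (- y - s) < d). lra.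
 - change (Rabs (y - s) < Rmin d e) in Hy. rewrite <- PM, <- PM by (auto; apply H; lra). apply Hd.
  change (Rabs (- y - - s) < d). by_cases.
Qed.

Lemma next_right_max gm gp f (a b : R) : Rbar_lt gm a -> next_right (primitive f) gp a b -> next_max (open_dom gm gp) f a b.
Proof. intros Ha [H1 [H2 H3]]. do 2 (split; auto). split; auto. apply (Rbar_lt_le_real gm a); auto. lra. Qed.

Lemma next_left_max gm gp f delta (a b : R) : nonlinearity (open_dom gm gp) f delta -> open_dom gm gp a ->
  next_left (primitive f) gm a b -> next_max (fun s => open_dom gm gp (- s)) (mirror f) (- a) (- b).
Proof.
 intros NL Da [H1 [H2 [H3 [H4 H5]]]].
 have Db : open_dom gm gp b by (split; auto; apply (Rbar_le_lt_real gp b a); [apply Da|lra]).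
 have PM : forall x, open_dom gm gp x -> primitive (mirror f) (- x) = primitive f x.
 { intros x Hx. rewrite (primitive_mirror NL); rewrite Ropp_involutive; auto. } split; auto.
 split; [rewrite Ropp_involutive; auto|]. split; [apply (local_max_mirror _ _ _ _ NL); auto|]. rewrite !PM; auto.
 split; auto. intros c Hc Hmax. have Dc : open_dom gm gp (- c) by (apply (nl_conv NL b a); auto; lra).
 rewrite <- (Ropp_involutive c) in Hmax |- *. rewrite PM; auto. apply H5; [lra|]. apply (local_max_mirror _ _ _ _ NL); auto.
Qed.

Lemma hypotheses_ends n gm gp f :
  (exists gs : R, gp = Finite gs /\ assumptionsA1 gm gs f) \/ (gp = p_infty /\ assumptionsA2 (S n) gm f) -> (1 <= n)%nat ->
  exists delta, nonlinearity (open_dom gm gp) f delta /\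
    forall p mu, open_dom gm gp p -> 0 <= mu < primitive f p -> upper_end n gm gp f mu.
Proof.
 intros [[gs [-> HA]]|[-> HA]] Hn.
 - have [delta NL] := A1_nonlinearity _ _ _ HA. exists delta. split; auto. intros p mu [P1 P2] Hmu. apply A1_upper_end; auto.
  have [_ [d [[_ [_ [_ Hlt]]] _]]] := HA. specialize (Hlt p P1 P2). lra.
 - have [delta NL] := A2_nonlinearity _ _ _ HA. exists delta. split; auto. intros p mu Dp Hmu.
  apply (A2_upper_end n gm f mu p); auto; lra.
Qed.

Theorem mainTheorem2 (N : nat) (hN : (2 <= N)%nat)
    (gm gp : Rbar) (f : R -> R)
    (hf : (exists gs : R, gp = Finite gs /\ assumptionsA1 gm gs f) \/
          (gp = p_infty /\ assumptionsA2 N gm f))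
    (gamma : Z -> R) (M Mbar : Z)
    (hgamma : gamma_points gm gp f gamma M Mbar) :
  exists k0 : nat, forall k : nat, (k0 <= k)%nat ->
    at_least (2 * M + 1)
      (fun u => is_solution N gm gp f u /\ 0 < u 0 /\ exactly_sign_changes k u) /\
    at_least (2 * Z.abs Mbar - 1)
      (fun u => is_solution N gm gp f u /\ u 0 < 0 /\ exactly_sign_changes k u).
Proof.
 destruct N as [|n]; [lia|]. have Hn : (1 <= n)%nat by lia. have [delta [NL Hend]] := hypotheses_ends n gm gp f hf Hn.
 have [G0 [GM [Gr [_ [GB [Gl _]]]]]] := hgamma. set (D := open_dom gm gp) in *. have D0 := nl_zero NL.
 have Pos : exists k1, forall k, (k1 <= k)%nat -> exists l, NoDup l /\ length l = (2 * Z.to_nat M + 1)%nat /\ forall x, In x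
  l -> 0 < x /\ D x /\ exists u, bound_state n D f k x u.
 { have Hnext : forall i, (i < Z.to_nat M)%nat -> Rbar_lt gm (gamma (Z.of_nat i)) /\ next_max D f (gamma (Z.of_nat i)) (gamma
   (Z.of_nat (S i))).
  { induction i; intro Hi.
   - have X : Rbar_lt gm (gamma (Z.of_nat 0)) by (simpl; rewrite G0; apply D0). split; auto. apply next_right_max; auto.
    apply Gr. lia.
   - destruct IHi as [_ X]; [lia|]. destruct X as [_ [[X _] _]]. split; auto. apply next_right_max; auto.
    replace (Z.of_nat (S (S i))) with (Z.of_nat (S i) + 1)%Z by lia. apply Gr. lia. }
  have [_ H] := chain_states n D f delta (fun i => gamma (Z.of_nat i)) (Z.to_nat M) Hn NL G0 ltac:(lia) (fun i Hi => proj2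
   (Hnext i Hi)). apply H. intros mu S0 q Hmu [Hq1 Hq2].
  destruct (Hend (gamma (Z.of_nat (Z.to_nat M))) mu) with (S0 := S0) (q := q) as [q1 [X1 [X2 X3]]]; auto.
  - have [_ [_ [X _]]] := Hnext (pred (Z.to_nat M)) ltac:(lia).
   replace (S (pred (Z.to_nat M))) with (Z.to_nat M) in X by lia. auto.
  - exists q1. repeat split; auto. apply (Rbar_lt_le_real gm q); auto. lra. }
 have Neg : (1 <= Z.to_nat (- Mbar))%nat -> exists k2, forall k, (k2 <= k)%nat -> exists l, NoDup l /\ length l = (2 *
  Z.to_nat (- Mbar) - 1)%nat /\ forall x, In x l -> 0 < x /\ D (- x) /\ exists u, bound_state n (fun s => D (- s)) (mirror
  f) k x u.
 { intro HM.
  have Hnext : forall i, (i < Z.to_nat (- Mbar))%nat -> D (gamma (- Z.of_nat i)%Z) /\ next_max (fun s => D (- s)) (mirror f)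
   (- gamma (- Z.of_nat i)%Z) (- gamma (- Z.of_nat (S i))%Z).
  { induction i; intro Hi.
   - have X : D (gamma (- Z.of_nat 0)%Z) by (simpl; rewrite G0). split; auto. apply (next_left_max gm gp f delta); auto.
    apply Gl. lia.
   - destruct IHi as [_ X]; [lia|]. destruct X as [_ [X _]]. rewrite Ropp_involutive in X. split; auto.
    apply (next_left_max gm gp f delta); auto. replace (- Z.of_nat (S (S i)))%Z with (- Z.of_nat (S i) - 1)%Z by lia.
    apply Gl. lia. }
  have [H _] := chain_states n (fun s => D (- s)) (mirror f) delta (fun i => - gamma (- Z.of_nat i)%Z) (Z.to_nat (- Mbar))
   Hn (nonlinearity_mirror NL) ltac:(simpl; rewrite G0; ring) HM (fun i Hi => proj2 (Hnext i Hi)). auto. }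
 have [k1 H1] := Pos.
 assert (exists k2, (1 <= Z.to_nat (- Mbar))%nat -> forall k, (k2 <= k)%nat -> exists l, NoDup l /\ length l = (2 * Z.to_nat
  (- Mbar) - 1)%nat /\ forall x, In x l -> 0 < x /\ D (- x) /\ exists u, bound_state n (fun s => D (- s)) (mirror f) k x u)
  as [k2 H2].
 { destruct (le_lt_dec 1 (Z.to_nat (- Mbar))) as [Hle|Hlt]; [|exists 0%nat; lia]. have [k2 H2] := Neg Hle. exists k2. auto. }
 exists (max k1 k2). split.
 - have [l [L1 [L2 L3]]] := H1 k ltac:(lia). apply (at_least_list _ _ l L1); [lia|]. intros x Hx.
  have [X1 [X2 [u X3]]] := L3 x Hx. have [E [X4 X5]] := bound_state_solution n gm gp f delta k x u Hn NL X2 by_lra X3.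
  exists u. abs_bounds.
 - have [Hle|Hlt] := le_lt_dec 1 (Z.to_nat (- Mbar)).
  + have [l [L1 [L2 L3]]] := H2 Hle k ltac:(lia). apply (at_least_list _ _ (map Ropp l)).
   * apply FinFun.Injective_map_NoDup; auto. intros x y E. lra.
   * rewrite length_map. lia.
   * intros y Hy. apply in_map_iff in Hy. have [x [<- Hx]] := Hy. have [X1 [X2 [u X3]]] := L3 x Hx.
    apply bound_state_mirror in X3.
    have [E [X4 X5]] := bound_state_solution n gm gp f delta k (- x) (fun r => - u r) Hn NL X2 by_lra X3.
    exists (fun r => - u r). abs_bounds.
  + apply (at_least_list _ _ nil); [constructor|cbn [length]; lia|intros x []].
Qed.
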